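(* Let $\mathfrak{e}\subset\mathbb{R}$ be a regular and compact Parreau--Widom set, $x_*$ a point in $\overline{\mathbb{R}}\setminus\mathfrak{e}$, and $w$ an upper semi-continuous weight on $\mathfrak{e}$. Then $$(a)\ \inf_{n\ge1} W_n(\mathfrak{e},w,x_* )>0\quad\Longleftrightarrow\quad (b)\ \int\log w(z)\,d\rho_{\mathfrak{e}}(z)>-\infty .$$ Moreover, if either $(a)$ or $(b)$ holds, then also $\sup_{n\ge1} W_n(\mathfrak{e},w,x_* )<\infty$.
   Context: $\overline{\mathbb{R}}=\mathbb{R}\cup\{\infty\}$. A weight on an infinite compact set $\mathfrak{e}$ is an upper semi-continuous function $w:\mathfrak{e}\to[0,\infty)$ that is positive at infinitely many points of $\mathfrak{e}$. $\|\cdot\|_{\mathfrak{e}}$ is the sup norm over $\mathfrak{e}$, $\mathrm{C}(\mathfrak{e})$ is logarithmic capacity, $\rho_{\mathfrak{e}}$ is the equilibrium measure of $\mathfrak{e}$, and $g_{\mathfrak{e}}(z,z_0)$ is the Green function of $\overline{\mathbb{C}}\setminus\mathfrak{e}$ with logarithmic pole at $z_0$. Widom factors ($n\ge1$): for finite $x_*$, $$W_n(\mathfrak{e},w,x_* )=e^{n g_{\mathfrak{e}}(x_*,\infty)}\min\{\|wP\|_{\mathfrak{e}}: P \text{ a polynomial},\ \deg P\le n,\ P(x_* )=1\},$$ and for $x_*=\infty$, $$W_n(\mathfrak{e},w,\infty)=\mathrm{C}(\mathfrak{e})^{-n}\min\{\|wP\|_{\mathfrak{e}}: P \text{ monic of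 degree } n\}.$$ $\mathfrak{e}$ is regular if it is regular for potential theory (every point of $\mathfrak{e}$ that is a boundary point of $\overline{\mathbb{C}}\setminus\mathfrak{e}$ is regular for the Dirichlet problem on $\overline{\mathbb{C}}\setminus\mathfrak{e}$). The gaps of $\mathfrak{e}$ are the connected components of $\overline{\mathbb{R}}\setminus\mathfrak{e}$. A compact regular set $\mathfrak{e}\subset\mathbb{R}$ is a Parreau--Widom set if $PW(\mathfrak{e},x_* ):=\sum_\ell g_{\mathfrak{e}}(\zeta_\ell,x_* )<\infty$, where $\{\zeta_\ell\}$ are the critical points of $x\mapsto g_{\mathfrak{e}}(x,x_* )$ in the gaps of $\mathfrak{e}$, i.e. the points with $\partial_x g_{\mathfrak{e}}(\zeta_\ell,x_* )=0$, where the derivative at $\infty$ is $\partial_xg_{\mathfrak{e}}(\infty,x_* )=\lim_{x\to\infty}x[g_{\mathfrak{e}}(x,x_* )-g_{\mathfrak{e}}(\infty,x_* )]$. This condition is independent of the choice of $x_*\in\overline{\mathbb{R}}\setminus\mathfrak{e}$. *)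

(* Defs.v *)
From HB Require Import structures.
From mathcomp Require Import all_boot all_order all_algebra.
From mathcomp Require Import complex.
From mathcomp Require Import all_classical all_reals all_analysis.

Set Implicit Arguments.
Unset Strict Implicit.
Unset Printing Implicit Defensive.

Import Order.TTheory GRing.Theory Num.Theory.
Import numFieldNormedType.Exports.

Local Open Scope classical_set_scope.
Local Open Scope ring_scope.

(** The complex plane is [R * R], the point [(x, y)] standing for x + iy: this
    type carries the topology and the real normed space structure needed for
    potential theory.  Its library norm is the sup norm, so the Euclidean
    modulus is introduced separately.  Only the coefficients of polynomials
    live in the field [R[i]]. *)
Notation plane R := (R * R)%type.

(** The extended real line and the Riemann sphere; [None] is infinity. *)
Notation extline R := (one_point_compactification R).
Notation sphere R := (one_point_compactification (plane R)).

Section Plane.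
Context {R : realType}.
Implicit Types (U E : set (plane R)) (z : plane R).

Definition modulus z : R := Num.sqrt (z.1 ^+ 2 + z.2 ^+ 2).

Definition circle_point z (r t : R) : plane R :=
  (z.1 + r * cos t, z.2 + r * sin t).

(** The chart z |-> 1/z at infinity. *)
Definition sphere_inv z : sphere R :=
  if z == 0 then None
  else Some (z.1 / modulus z ^+ 2, - z.2 / modulus z ^+ 2).

Definition sphere_of_extline (x : extline R) : sphere R :=
  omap (fun t : R => (t, 0)) x.

Definition plane_of_line (e : set R) : set (plane R) :=
  [set (t, 0) | t in e].

Definition upper_semicontinuous_on (T : topologicalType) (A : set T)
    (u : T -> \bar R) : Prop :=
  forall x, A x -> forall a : R, (u x < a%:E)%E ->
    \forall y \near within A (nbhs x), (u y < a%:E)%E.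

Definition C2_on U (h : plane R -> R) : Prop :=
  forall z, U z -> forall v v' : plane R,
    [/\ derivable h z v, derivable ('D_v h) z v' &
        {for z, continuous ('D_v' ('D_v h))}].

Definition laplacian (h : plane R -> R) z : R :=
  'D_(1, 0) ('D_(1, 0) h) z + 'D_(0, 1) ('D_(0, 1) h) z.

Definition harmonic_on U (h : plane R -> R) : Prop :=
  C2_on U h /\ forall z, U z -> laplacian h z = 0.

(** The function identically equal to -oo is allowed. *)
Definition subharmonic_on U (u : plane R -> \bar R) : Prop :=
  [/\ forall z, U z -> (u z < +oo)%E,
      upper_semicontinuous_on U u &
      forall z, U z -> exists2 r0 : R, 0 < r0 &
        forall r : R, 0 < r -> r < r0 ->
          (u z <= ((2 * pi)^-1)%:E *
             \int[lebesgue_measure]_(t in `[0%R, (2 * pi)%R])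
                u (circle_point z r t))%E].

(** On the sphere, both notions are read in the charts z and 1/z. *)
Definition sphere_harmonic_on (U : set (sphere R)) (h : sphere R -> R) : Prop :=
  harmonic_on [set z | U (Some z)] (fun z => h (Some z)) /\
  harmonic_on [set z | U (sphere_inv z)] (fun z => h (sphere_inv z)).

Definition sphere_subharmonic_on (U : set (sphere R))
    (u : sphere R -> \bar R) : Prop :=
  subharmonic_on [set z | U (Some z)] (fun z => u (Some z)) /\
  subharmonic_on [set z | U (sphere_inv z)] (fun z => u (sphere_inv z)).

(** The domain of the Dirichlet problem is the complement in the sphere of a
    compact plane set [E]. *)
Definition sphere_compl E : set (sphere R) := ~` (Some @` E).

Definition outer_boundary E : set (plane R) := E `&` closure (~` E).

(** The second clause says that the limsup of [u] at [zeta] is at most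
    [phi zeta]. *)
Definition perron_family E (phi : plane R -> R) : set (sphere R -> \bar R) :=
  [set u | sphere_subharmonic_on (sphere_compl E) u /\
    forall zeta, outer_boundary E zeta -> forall a : R, phi zeta < a ->
      \forall z \near within (~` E) (nbhs zeta), (u (Some z) < a%:E)%E].

Definition perron_solution E (phi : plane R -> R) (z : sphere R) : \bar R :=
  ereal_sup [set u z | u in perron_family E phi].

Definition regular_point E (zeta : plane R) : Prop :=
  forall phi : plane R -> R, {within outer_boundary E, continuous phi} ->
    (fun z : plane R => perron_solution E phi (Some z))
      @ within (~` E) (nbhs zeta) --> (phi zeta)%:E.

Definition regular_set E : Prop :=
  forall zeta, outer_boundary E zeta -> regular_point E zeta.

Definition log_pole (z0 : sphere R) (g : sphere R -> R) : Prop :=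
  match z0 with
  | Some a => exists M : R, \forall z \near (a : plane R)^',
                `|g (Some z) + ln (modulus (z - a))| <= M
  | None => exists M : R, \forall z \near (0 : plane R)^',
                `|g (sphere_inv z) + ln (modulus z)| <= M
  end.

(** Green function of the complement of [E] with pole [z0], for a regular
    [E], so that the boundary value 0 is attained at every boundary point.  It
    is extended by 0 to [E]; its value at the pole is infinite, hence
    meaningless here, and is set to 0. *)
Definition is_green E (z0 : sphere R) (g : sphere R -> R) : Prop :=
  [/\ sphere_harmonic_on (sphere_compl E `\ z0) g,
      log_pole z0 g,
      forall zeta, outer_boundary E zeta ->
        (fun z : plane R => g (Some z)) @ within (~` E) (nbhs zeta) --> (0 : R),
      forall z, E z -> g (Some z) = 0 &
      g z0 = 0].

Definition green E (z0 : sphere R) : sphere R -> R :=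
  xget (fun=> 0) [set g | is_green E z0 g].

End Plane.

Section Line.
Context {R : realType}.
Implicit Types (e : set R) (xs : extline R) (w : R -> R).

(** Logarithmic energy; [- lne 0 = +oo]. *)
Definition energy (mu : probability R R) : \bar R :=
  (\int[mu]_x \int[mu]_y - lne `|x - y|%:E)%E.

Definition probabilities_on e : set (probability R R) :=
  [set mu | mu e = 1%E].

Definition robin_constant e : \bar R :=
  ereal_inf [set energy mu | mu in probabilities_on e].

Definition capacity e : R := fine (expeR (- robin_constant e)).

(** Unique when the capacity of the compact set [e] is positive, in
    particular when [e] is nonempty and regular. *)
Definition equilibrium_measure e : probability R R :=
  xget (\d_(0 : R) : probability R R)
    [set mu | probabilities_on e mu /\ energy mu = robin_constant e].

Definition weight e w : Prop :=
  [/\ upper_semicontinuous_on e (EFin \o w),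
      forall x, e x -> 0 <= w x &
      infinite_set [set x | e x /\ 0 < w x]].

Definition green_line e (x0 x : extline R) : R :=
  green (plane_of_line e) (sphere_of_extline x0) (sphere_of_extline x).

Definition cmodulus (z : R[i]) : R := ComplexField.Normc.normc z.

Definition weighted_norm e w (P : {poly R[i]}) : R :=
  sup [set w x * cmodulus P.[x%:C%C] | x in e].

(** The infima are attained. *)
Definition widom_factor e w xs (n : nat) : R :=
  match xs with
  | Some x =>
      expR (n%:R * green_line e None (Some x)) *
      inf [set weighted_norm e w P | P in
            [set P : {poly R[i]} | (size P <= n.+1)%N /\ P.[x%:C%C] = 1]]
  | None =>
      capacity e ^- n *
      inf [set weighted_norm e w P | P in
            [set P : {poly R[i]} | P \is monic /\ size P = n.+1]]
  end.

Definition extline_compl e : set (extline R) := ~` (Some @` e).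

Definition gaps e : set (set (extline R)) :=
  [set connected_component (extline_compl e) x | x in extline_compl e].

Definition critical_point e xs (zeta : extline R) : Prop :=
  match zeta with
  | Some x => is_derive x 1 (fun t : R => green_line e xs (Some t)) 0
  | None =>
      let q (t : R) :=
        t * (green_line e xs (Some t) - green_line e xs None) in
      q t @[t --> +oo] --> (0 : R) /\ q t @[t --> -oo] --> (0 : R)
  end.

Definition gap_critical_points e xs : set (extline R) :=
  [set zeta | (exists2 G, gaps e G & G zeta) /\
              zeta <> xs /\ critical_point e xs zeta].

Definition PW e xs : \bar R :=
  \esum_(zeta in gap_critical_points e xs) (green_line e xs zeta)%:E.

Definition parreau_widom e xs : Prop :=
  [/\ compact e, regular_set (plane_of_line e) & (PW e xs < +oo)%E].

End Line.

(* Main.v *)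
Require Import Defs.
From HB Require Import structures.
From mathcomp Require Import all_boot all_order all_algebra.
From mathcomp Require Import complex.
From mathcomp Require Import all_classical all_reals all_analysis.
From mathcomp Require Import measurable_realfun ring lra zify.

Set Implicit Arguments.
Unset Strict Implicit.
Unset Printing Implicit Defensive.

Import Order.TTheory GRing.Theory Num.Theory.
Import numFieldNormedType.Exports.

Local Open Scope classical_set_scope.
Local Open Scope ring_scope.

(* For a finite pole q put s = 1 / (t - q) (and s = t for q = oo); this maps e onto a compact set Kq q e. Fekete points of
Kq q e have, along an ultrafilter, a limit law mu with V + pot >= 0, vanishing at the points of e by regularity; V + pot is
the Green function with pole q, and for q = oo the law mu is the equilibrium measure.
Lower bound: integrate ln (w |P|) against mu; every linear factor of P contributes at least - g(q, oo).
Upper bound: let E be a polynomial with 0 < E <= 1 / w on e. The polynomial deviating least from 0 for the weight 1 / E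
alternates on nodes of e, and Lagrange interpolation bounds the logarithm of its norm by the sum of the Green function at
points interlacing with nodes of e. A gap contains at most one of them, so the sum is at most PW. The integral of ln E can
be made large if that of ln w is -oo; this last condition does not depend on q, the laws mu being mutually comparable. *)

Implicit Type R : realType.
Local Notation prob R := (probability R R).
Local Notation pline := plane_of_line.
Local Notation leb := lebesgue_measure.
Local Notation intR mu K f := (mu.-integrable K (EFin \o f)).

(** Regularity is given through Perron solutions, so what must be produced is a boundary function
    whose Perron solution stays below a negative constant near the pole and tends to 0 at the given
    point of [e]. Continuous data that vanish at that point and are negative at an end of [e] do
    this for a pole just outside that end; a comparison with logarithmic sums over Fekete points
    carries it to every other pole. The same comparison bounds the Fekete energies, so positive
    capacity is deduced and not assumed. [equilibrium_measure e] is merely some minimizer of the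
    energy, a priori not the limit law. Their potentials are shown to agree off the real line by
    summing over N-th roots, and the boundary behaviour is inherited. The comparison of the laws of
    two poles rests on such sums over small circles centred on [e], where they measure the mass near
    the centre. For a finite pole, a polynomial in t becomes one in s only after multiplication by a
    power of s, which must be even to stay positive; odd degrees are reduced to the preceding even
    one. *)

(** * Fekete points *)

(** For a duplicate-free [s] this is the square of the absolute Vandermonde determinant. The
    condition [y != x] compares values, so coincident entries are skipped and the product is always
    positive; hence the explicit [uniq] hypotheses below. *)
Definition vdm {R} (s : seq R) : R := \prod_(x <- s) \prod_(y <- s | y != x) `|x - y|.

Lemma vdm_perm {R} (s t : seq R) : perm_eq s t -> vdm s = vdm t.
Proof.
move=> st; rewrite /vdm (perm_big _ st)/=; apply: eq_bigr => x _.
exact: perm_big.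
Qed.

Lemma prod_neq_notin {R} x s (F : R -> R) : x \notin s -> \prod_(y <- s | y != x) F y = \prod_(y <- s) F y.
Proof.
move=> xs; rewrite big_seq_cond [RHS]big_seq; apply: eq_bigl => y.
apply: andb_idr => ys; apply/negP => /eqP yx.
by rewrite -yx ys in xs.
Qed.

Lemma vdm_cons {R} x (s : seq R) : x \notin s -> vdm (x :: s) = vdm s * (\prod_(y <- s) `|x - y|) ^+ 2.
Proof.
move=> xs; rewrite /vdm big_cons big_cons eqxx/= prod_neq_notin//.
have -> : \prod_(y <- s) \prod_(z <- x :: s | z != y) `|y - z| =
  \prod_(y <- s) (`|x - y| * \prod_(z <- s | z != y) `|y - z|).
 apply: eq_big_seq => y ys; rewrite big_cons distrC ifT//.
 by apply/eqP => xy; rewrite xy ys in xs.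
by rewrite big_split/= mulrA -expr2 mulrC.
Qed.

Lemma vdm_gt0 {R} (s : seq R) : 0 < vdm s.
Proof.
rewrite /vdm; apply: prodr_gt0 => x _; apply: prodr_gt0 => y yx.
by rewrite normr_gt0 subr_eq0 eq_sym.
Qed.

Lemma continuous_prod {T : topologicalType} {R} (I : Type) (r : seq I) (P : pred I) (f : I -> T -> R) :
 (forall i, continuous (f i)) -> continuous (fun x => \prod_(i <- r | P i) f i x).
Proof.
move=> cf x; elim: r => [|i r ih].
 by under eq_fun do rewrite big_nil; exact: cvg_cst.
under eq_fun do rewrite big_cons.
by case: (P i) => //; apply: cvgM => //; exact: cf.
Qed.

Lemma infinite_uniq_seq {R} K (n : nat) : infinite_set K ->
 exists s : seq R, [/\ size s = n, uniq s & forall x, x \in s -> K x].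
Proof.
move=> /(infinite_set_fset n)[B BK nB].
exists (take n (finmap.enum_fset B)); split.
- by rewrite size_takel.
- by rewrite take_uniq// finmap.fset_uniq.
- by move=> x /mem_take xB; apply: BK.
Qed.

Lemma vdm_codom {R} (n : nat) (v : 'rV[R]_n) : injective (fun i => v ord0 i) -> vdm [seq v ord0 i | i <- enum 'I_n] =
 \prod_(i < n) \prod_(j < n | j != i) `|v ord0 i - v ord0 j|.
Proof.
move=> vi; rewrite /vdm big_map big_enum/=; apply: eq_bigr => i _.
rewrite big_map big_enum_cond/=; apply: eq_bigl => j.
by rewrite (inj_eq vi).
Qed.

Lemma fekete_exists {R} K (n : nat) : compact K -> infinite_set K ->
 exists s : seq R, [/\ size s = n, uniq s, forall x, x \in s -> K x &
  forall t, size t = n -> uniq t -> (forall x, x \in t -> K x) -> vdm t <= vdm s].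
Proof.
move=> cK iK.
(* Pairs are indexed by position here, so a coincidence gives 0: [f] is continuous on the compact
   set of vectors with entries in [K], and a maximizer, where [f] is positive, has distinct
   entries. *)
pose f (v : 'rV[R]_n) := \prod_(i < n) \prod_(j < n | j != i) `|v ord0 i - v ord0 j|.
have tov t : size t = n -> uniq t -> exists v : 'rV[R]_n, injective (fun i => v ord0 i) /\
   [seq v ord0 i | i <- enum 'I_n] = t.
 move=> tn ut; exists (\row_i nth 0 t i); split.
  move=> i j /=; rewrite !mxE => /eqP.
  by rewrite nth_uniq ?tn// => /eqP/val_inj.
 apply: (@eq_from_nth _ 0); first by rewrite size_map size_enum_ord tn.
 move=> i; rewrite size_map size_enum_ord => ni.
 rewrite (nth_map (Ordinal ni)) ?size_enum_ord// mxE.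
 by rewrite nth_enum_ord.
have [s0 [s0n us0 s0K]] := infinite_uniq_seq n iK.
have [v0 [v0i v0s]] := tov _ s0n us0.
pose A := [set v : 'rV[R]_n | forall i, K (v ord0 i)].
have v0A : A v0.
 by move=> i; apply: s0K; rewrite -v0s map_f ?mem_enum.
have [||v vA vmax] := @EVT_max_rV R n f A _ (rV_compact (fun _ => cK)).
- by exists v0.
- apply: continuous_subspaceT; apply: continuous_prod => i.
 apply: continuous_prod => j w.
 apply: (@continuous_comp _ _ _ (fun v : 'rV[R]_n => v ord0 i - v ord0 j) Num.norm); last exact: norm_continuous.
 by apply: continuousB; exact: coord_continuous.
have fv0 : 0 < f v.
 apply: (@lt_le_trans _ _ (f v0)); last by apply: vmax; exact: mem_set.
 by rewrite /f -vdm_codom// vdm_gt0.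
have vi : injective (fun i => v ord0 i).
 move=> i j /= vij; apply/eqP; apply/negPn/negP => ij.
 move: fv0; rewrite /f (bigD1 i)//= (bigD1 j) 1?eq_sym//=.
 by rewrite vij subrr normr0 !mul0r ltxx.
exists [seq v ord0 i | i <- enum 'I_n]; split.
- by rewrite size_map size_enum_ord.
- by rewrite (map_inj_uniq vi) enum_uniq.
- by move=> x /mapP[i _ ->]; exact: (set_mem vA).
- move=> t tn ut tK; have [u [ui ut']] := tov t tn ut; rewrite -{1}ut'.
 rewrite !vdm_codom//; apply: vmax; apply: mem_set => i.
 by apply: tK; rewrite -ut' map_f ?mem_enum.
Qed.

Lemma fekete_exchange {R} (K : set R) s : uniq s -> (forall x, x \in s -> K x) ->
 (forall t, size t = size s -> uniq t -> (forall x, x \in t -> K x) -> vdm t <= vdm s) ->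
 forall x z, x \in s -> K z -> \prod_(y <- s | y != x) `|z - y| <= \prod_(y <- s | y != x) `|x - y|.
Proof.
move=> us sK smax x z xs Kz.
have sx := perm_to_rem xs.
rewrite !(perm_big _ sx)/= !big_cons eqxx/=.
have xr : x \notin rem x s by rewrite mem_rem_uniq// inE eqxx.
rewrite !prod_neq_notin//.
have [zr|zr] := boolP (z \in rem x s).
 by rewrite (big_rem z)//= subrr normr0 mul0r prodr_ge0.
have : vdm (z :: rem x s) <= vdm (x :: rem x s).
 rewrite -(vdm_perm sx); apply: smax => /=.
 - by rewrite size_rem// prednK//; case: (s) xs.
 - by rewrite zr rem_uniq.
 - by move=> t; rewrite inE => /predU1P[->//|/mem_rem/sK].
rewrite !vdm_cons// ler_pM2l ?vdm_gt0// ler_pXn2r//= nnegrE; exact: prodr_ge0.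
Qed.

(** Multiply the exchange inequality over all x in [s]: each distance |z - y| then occurs
    [(size s).-1] times. In terms of [delta] below, the average of ln |z - y| plus [delta s] is at
    most 0 on [K], which makes this sum a comparison function for the Dirichlet problem. *)
Lemma fekete_pot {R} (K : set R) s : uniq s -> (forall x, x \in s -> K x) ->
 (forall t, size t = size s -> uniq t -> (forall x, x \in t -> K x) -> vdm t <= vdm s) ->
 forall z, K z -> (\prod_(y <- s) `|z - y|) ^+ (size s).-1 <= vdm s.
Proof.
move=> us sK smax z Kz.
have -> : (\prod_(y <- s) `|z - y|) ^+ (size s).-1 = \prod_(x <- s) \prod_(y <- s | y != x) `|z - y|.
 rewrite (exchange_big_dep predT)//= -prodrXl; apply: eq_big_seq => y ys.
 rewrite (eq_bigl (fun x => x != y)) => [|x]; last by rewrite eq_sym.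
 rewrite big_const_seq iter_mulr_1; congr (_ ^+ _).
 by have /= := count_predC (pred1 y) s; rewrite count_uniq_mem// ys add1n => <-.
rewrite /vdm big_seq [leRHS]big_seq; apply: ler_prod => x xs.
rewrite prodr_ge0//=; exact: (fekete_exchange us sK smax).
Qed.

(** * Weak limits of counting measures through quantile functions *)

Lemma norm_bounded_on {R} {T : Type} (g : T -> R) (A : set T) B :
 (forall s, A s -> `|g s| <= B) -> [bounded g x | x in A].
Proof.
move=> gB; exists B; split; first exact: num_real.
move=> x Bx y Ay; exact: le_trans (gB y Ay) (ltW Bx).
Qed.

Lemma ultra_cvg {R} (F : set_system nat) (UF : UltraFilter F) A (a : nat -> R) :
 compact A -> (forall n, A (a n)) -> exists2 l, A l & a @ F --> l.
Proof.
move=> cA Aa.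
have [|p [Ap cp]] := cA (a @ F) _.
 exact: (filterS (fun n _ => Aa n) filterT).
exists p => // B pB.
have [//|nB] := in_ultra_setVsetC (a @^-1` B) UF.
by have [x [nBx Bx]] := cp (~` B) B nB pB.
Qed.

Lemma riemann_cells {R} (g : R -> R) (N k : nat) (c d : nat -> R)
  (B : R) : (0 < N)%N -> measurable_fun setT g -> (forall s, `|g s| <= B) ->
 (forall i s, (i < k)%N -> i%:R / N%:R <= s -> s < i.+1%:R / N%:R -> `|g s - c i| <= d i) ->
 `|\int[leb]_(s in `[0, k%:R / N%:R[%classic) g s
   - (\sum_(i < k) c i) / N%:R| <= (\sum_(i < k) d i) / N%:R.
Proof.
move=> N0 mg gB.
have ig (u v : R) : intR leb (`[u, v[%classic : set R) g.
 apply: measurable_bounded_integrable => //.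
 - by rewrite /= lebesgue_measure_itv/=; case: ifP => // _; rewrite -EFinB ltry.
 - exact: measurable_funTS.
 - by apply: (@norm_bounded_on _ _ _ _ B) => s _.
have N0' : (0 : R) < N%:R by rewrite ltr0n.
elim: k => [|k ih] gcd.
 rewrite mul0r set_itv_ge ?bnd_simp ?ltxx//.
 by rewrite Rintegral_set0 !big_ord0 mul0r subrr normr0.
have kk : (k%:R / N%:R : R) <= k.+1%:R / N%:R.
 by rewrite ler_pM2r ?invr_gt0// ler_nat.
have -> : (`[0, k.+1%:R / N%:R[%classic : set R) =
  `[0, k%:R / N%:R[%classic `|` `[k%:R / N%:R, k.+1%:R / N%:R[%classic.
 apply/seteqP; split => x /=; rewrite !in_itv/=.
 - by case: (ltP x (k%:R / N%:R)) => xk /andP[-> ->]; [left|right].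
 - case=> /andP[x1 x2]; apply/andP; split => //.
  + exact: lt_le_trans x2 kk.
  + by apply: le_trans x1; rewrite divr_ge0// ler0n.
rewrite Rintegral_setU//; last 2 first.
- apply: measurable_bounded_integrable => //.
 + exact: measurableU.
 + apply: le_lt_trans (measureU2 _ _ _) _ => //.
  rewrite /= !lebesgue_measure_itv/=.
  by do 2![case: ifP => _]; rewrite -?EFinB ?adde0 ?add0e ?ltry// -EFinD ltry.
 + exact: measurable_funTS.
 + by apply: (@norm_bounded_on _ _ _ _ B) => s _.
- apply/disj_setPS => x /= [] ; rewrite !in_itv/= => /andP[_ x1] /andP[x2 _].
 by move: x1; rewrite ltNge x2.
rewrite !big_ord_recr/= !mulrDl opprD addrACA.
apply: le_trans (ler_normD _ _) _; apply: lerD.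
 by apply: ih => i s ik; apply: gcd; exact: ltnW.
have mI : leb (`[k%:R / N%:R, k.+1%:R / N%:R[%classic : set R) = (N%:R^-1)%:E.
 rewrite lebesgue_measure_itv/= lte_fin ltr_pM2r ?invr_gt0// ltr_nat ltnSn.
 by rewrite -EFinB -mulrBl -natrB ?subSnn ?mul1r.
have cI (r : R) : \int[leb]_(s in (`[k%:R / N%:R, k.+1%:R / N%:R[%classic : set R)) r = r / N%:R.
 by rewrite Rintegral_cst//; congr (_ * _); rewrite [X in fine X]mI.
have iI (r : R) : intR leb (`[k%:R / N%:R, k.+1%:R / N%:R[%classic : set R) (fun=> r).
 apply: measurable_bounded_integrable => //; first by have := ltry (N%:R^-1 : R); rewrite -mI.
 by apply: (@norm_bounded_on _ _ _ _ `|r|) => s _.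
rewrite -cI -RintegralB//.
apply: le_trans (le_normr_Rintegral _ _) _ => //.
 exact: (integrableB _ (ig _ _) (iI (c k))).
rewrite -cI; apply: le_Rintegral => //.
 apply: integrable_norm => //.
 exact: (integrableB _ (ig _ _) (iI (c k))).
move=> s /=; rewrite in_itv/= => /andP[s1 s2]; exact: gcd.
Qed.

(** The error on a cell is at most L times the increment of [q], and the increments of a monotone
    function telescope. The bound depends on [q] only through [B]; this uniformity lets a limit of
    quantile functions be taken under the integral. *)
Lemma riemann_mono {R} (q f : R -> R) (N : nat) B L A :
 (0 < N)%N -> {homo q : x y / x <= y} -> (forall s, - B <= q s <= B) ->
 (forall x y, `|f x - f y| <= L * `|x - y|) -> (forall x, 0 <= f x <= A) -> measurable_fun setT f -> 0 <= L ->
 `|\int[leb]_(s in `[0, 1[%classic) f (q s)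
   - (\sum_(i < N) f (q (i%:R / N%:R))) / N%:R| <= L * (2 * B) / N%:R.
Proof.
move=> N0 qm qB fL fA mf L0.
have N0' : (0 : R) < N%:R by rewrite ltr0n.
have mq : measurable_fun setT q by exact: measurable_realfun.nondecreasing_measurable.
have q01 : \sum_(i < N) (L * (q (i.+1%:R / N%:R) - q (i%:R / N%:R))) <= L * (2 * B).
 rewrite -big_distrr/=; apply: ler_wpM2l => //.
 rewrite -(big_mkord predT (fun i => q (i.+1%:R / N%:R) - q (i%:R / N%:R))).
 rewrite telescope_sumr//.
 have /andP[_ q1] := qB (N%:R / N%:R).
 have /andP[q2 _] := qB (0%:R / N%:R).
 lra.
have mfq : measurable_fun setT (f \o q) by exact: measurableT_comp.
have H : `|\int[leb]_(s in `[0, N%:R / N%:R[%classic) (f \o q) s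
   - (\sum_(i < N) f (q (i%:R / N%:R))) / N%:R| <=
  (\sum_(i < N) (L * (q (i.+1%:R / N%:R) - q (i%:R / N%:R)))) / N%:R.
 apply: (@riemann_cells _ _ _ _ (fun i => f (q (i%:R / N%:R)))
  (fun i => L * (q (i.+1%:R / N%:R) - q (i%:R / N%:R))) A) => //.
  by move=> s /=; have /andP[f0 f1] := fA (q s); rewrite ger0_norm.
 move=> i s iN s1 s2 /=; apply: le_trans (fL _ _) _; apply: ler_wpM2l => //.
 by rewrite ger0_norm ?subr_ge0 ?qm// lerB// qm// ltW.
rewrite divff ?gt_eqF// in H; apply: le_trans H _.
by rewrite ler_pM2r ?invr_gt0.
Qed.

Lemma floor_cell {R} (n i : nat) (s : R) : (0 < n)%N ->
 i%:R / n%:R <= s -> s < i.+1%:R / n%:R -> Num.truncn (s * n%:R) = i.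
Proof.
move=> n0 s1 s2; have n0' : (0 : R) < n%:R by rewrite ltr0n.
by apply: truncn_def; rewrite -ler_pdivrMr// s1/= -ltr_pdivlMr.
Qed.

Definition avg {R} (X : seq R) (f : R -> R) : R := (\sum_(x <- X) f x) / (size X)%:R.

(** Quantile function of the counting measure of a sorted [X]. The [minn] keeps the index in range
    for s >= 1, so that for nonempty [X] the function is monotone with values in [X] on the whole
    line. *)
Definition quant {R} (X : seq R) (s : R) : R := nth 0 X (minn (Num.truncn (s * (size X)%:R)) (size X).-1).

Lemma quant_in {R} (X : seq R) s : (0 < size X)%N -> quant X s \in X.
Proof.
by move=> X0; rewrite mem_nth// (leq_ltn_trans (geq_minr _ _))// prednK.
Qed.

Lemma quant_mono {R} (X : seq R) : (0 < size X)%N -> sorted <=%R X -> {homo quant X : x y / x <= y}.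
Proof.
move=> X0 sX x y xy; rewrite /quant.
apply: (sorted_leq_nth le_trans le_refl 0 sX); rewrite ?inE.
- by rewrite (leq_ltn_trans (geq_minr _ _))// prednK.
- by rewrite (leq_ltn_trans (geq_minr _ _))// prednK.
- rewrite leq_min geq_minr andbT (leq_trans (geq_minl _ _))//.
 by apply: le_truncn; rewrite ler_wpM2r// ler0n.
Qed.

Lemma quant_avg {R} X (f : R -> R) A : (0 < size X)%N -> sorted <=%R X -> measurable_fun setT f ->
 (forall x, 0 <= f x <= A) -> \int[leb]_(s in `[0, 1[%classic) f (quant X s) = avg X f.
Proof.
move=> X0 sX mf fA.
have mq : measurable_fun setT (quant X).
 by apply: measurable_realfun.nondecreasing_measurable => //; exact: quant_mono.
have H : `|\int[leb]_(s in `[0, (size X)%:R / (size X)%:R[%classic) (f \o quant X) s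
   - (\sum_(i < size X) f (nth 0 X i)) / (size X)%:R| <= (\sum_(i < size X) 0) / (size X)%:R.
 apply: (@riemann_cells _ _ _ _ (fun i => f (nth 0 X i)) (fun i => 0) A) => //.
 - exact: measurableT_comp.
 - by move=> s /=; have /andP[f0 f1] := fA (quant X s); rewrite ger0_norm.
 - move=> i s iX s1 s2 /=; rewrite /quant (floor_cell X0 s1 s2).
  by rewrite (minn_idPl _) ?subrr ?normr0// -ltnS prednK.
move: H; rewrite big1_eq mul0r normr_le0 subr_eq0 divff ?pnatr_eq0 -?lt0n// => /eqP ->.
by rewrite /avg (big_nth 0) big_mkord.
Qed.

Lemma quantile_law {R} Q : measurable_fun setT Q -> exists mu : prob R,
  (forall K, measurable K -> (forall s, K (Q s)) -> mu K = 1%E) /\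
  (forall f : R -> \bar R, measurable_fun setT f -> (forall x, (0 <= f x)%E) ->
   (\int[mu]_x f x = \int[leb]_(s in `[0%R, 1%R[) f (Q s))%E).
Proof.
move=> mQ.
pose P : probability (measurableTypeR R) R := uniform_prob (@ltr01 R).
pose q : {mfun measurableTypeR R >-> R} := @mfun_Sub _ _ (measurableTypeR R) R Q (mem_set mQ).
exists (distribution P q : prob R); split.
 move=> K mK KQ; rewrite /distribution/= /pushforward/=.
 rewrite (_ : _ @^-1` _ = setT) ?probability_setT//.
 by apply/seteqP; split => // s _; exact: KQ.
move=> f mf f0; rewrite ge0_integral_distribution//.
have mfQ : measurable_fun (setT : set (measurableTypeR R)) (f \o Q).
 exact: measurableT_comp.
rewrite (integral_uniform (@ltr01 R) mfQ); last by move=> x; exact: f0.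
rewrite subr0 invr1 mul1e; apply/esym; apply: integral_itv_bndo_bndc.
exact: measurable_funTS.
Qed.

Lemma integral_ge0_bounded {R} (f : R -> R) A : measurable_fun setT f -> (forall x, 0 <= f x <= A) ->
 (\int[leb]_(s in `[0%R, 1%R[) (f s)%:E)%E = (\int[leb]_(s in `[0%R, 1%R[%classic) f s)%:E.
Proof.
move=> mf fA; rewrite /Rintegral fineK//; apply: integrable_fin_num => //.
apply: measurable_bounded_integrable => //.
- by rewrite /= lebesgue_measure_itv/= lte_fin ltr01 -EFinB ltry.
- exact: measurable_funTS.
- by apply: (@norm_bounded_on _ _ _ _ A) => s _; have /andP[f0 f1] := fA s; rewrite ger0_norm.
Qed.

Definition lip {R} (L : R) (f : R -> R) := forall x y, `|f x - f y| <= L * `|x - y|.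

Lemma lip_continuous {R} L (f : R -> R) : 0 <= L -> lip L f -> continuous f.
Proof.
move=> L0 fL x; apply/cvgrPdist_le => e e0.
have L1 : 0 < L + 1 by rewrite ltr_wpDl.
apply/nbhs_ballP; exists (e / (L + 1)) => /=; first exact: divr_gt0.
move=> y /= xy; apply: le_trans (fL x y) _.
apply: (@le_trans _ _ ((L + 1) * `|x - y|)); first by rewrite ler_wpM2r// lerDl.
by rewrite mulrC -ler_pdivlMr// ltW.
Qed.

Lemma lip_measurable {R} L (f : R -> R) : 0 <= L -> lip L f -> measurable_fun setT f.
Proof. by move=> L0 fL; apply: continuous_measurable_fun; exact: lip_continuous fL. Qed.

Definition dint {R} (h : R -> R -> R) (q : R -> R) : R := \int[leb]_(s in `[0, 1[%classic)
  \int[leb]_(t in `[0, 1[%classic) h (q s) (q t).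

Lemma itv01_integral_bounds {R} (f g : R -> R) A : measurable_fun setT f -> (forall x, 0 <= f x <= A) ->
 measurable_fun setT g -> (forall x, 0 <= g x <= A) -> forall c : R, (forall x, `|f x - g x| <= c) ->
 `|\int[leb]_(t in `[0, 1[%classic) f t - \int[leb]_(t in `[0, 1[%classic) g t| <= c.
Proof.
move=> mf fA mg gA c fg.
have m1 : leb (`[0, 1[%classic : set R) = 1%E.
 by rewrite lebesgue_measure_itv/= lte_fin ltr01 -EFinB subr0.
have ib (k : R -> R) (B : R) : measurable_fun setT k -> (forall x, `|k x| <= B) ->
  intR leb (`[0, 1[%classic : set R) k.
 move=> mk kB; apply: measurable_bounded_integrable => //.
 - by have := ltry (1 : R); rewrite -m1.
 - exact: measurable_funTS.
 - by apply: (@norm_bounded_on _ _ _ _ B) => s _.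
have iF : intR leb (`[0, 1[%classic : set R) f.
 by apply: (ib f A) => // x; have /andP[f0 f1] := fA x; rewrite ger0_norm.
have iG : intR leb (`[0, 1[%classic : set R) g.
 by apply: (ib g A) => // x; have /andP[f0 f1] := gA x; rewrite ger0_norm.
rewrite -RintegralB//.
apply: le_trans (le_normr_Rintegral _ _) _ => //; first exact: (integrableB _ iF iG).
have -> : c = \int[leb]_(t in (`[0, 1[%classic : set R)) c.
 by rewrite Rintegral_cst//; rewrite [X in fine X]m1 mulr1.
apply: le_Rintegral => //.
- by apply: integrable_norm; exact: (integrableB _ iF iG).
- by apply: (ib _ `|c|) => //; exact: measurable_cst.
Qed.

Lemma itv01_integral_range {R} (f : R -> R) A : measurable_fun setT f -> (forall x, 0 <= f x <= A) ->
 0 <= \int[leb]_(t in `[0, 1[%classic) f t <= A.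
Proof.
move=> mf fA; apply/andP; split.
 by apply: Rintegral_ge0 => x _; have /andP[] := fA x.
have A0 : 0 <= A by have /andP[a b] := fA 0; exact: le_trans b.
have := @itv01_integral_bounds R f (fun=> 0) A mf fA _ _ A.
rewrite Rintegral_cst// mul0r subr0 => H.
apply: le_trans (ler_norm _) _; apply: H.
- exact: measurable_cst.
- by move=> x; rewrite lexx.
- by move=> x; have /andP[a b] := fA x; rewrite subr0 ger0_norm.
Qed.

Lemma dint_riemann {R} q h (N : nat) (B L A : R) :
 (0 < N)%N -> {homo q : x y / x <= y} -> (forall s, - B <= q s <= B) -> 0 <= L ->
 (forall x, lip L (h x)) -> (forall y, lip L (h ^~ y)) -> (forall x y, 0 <= h x y <= A) ->
 `|dint h q - (\sum_(i < N) (\sum_(j < N) h (q (i%:R / N%:R)) (q (j%:R / N%:R))) / N%:R) / N%:R|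
  <= L * (2 * B) / N%:R + L * (2 * B) / N%:R.
Proof.
move=> N0 qm qB L0 h1 h2 hA; have N0' : (0 : R) < N%:R by rewrite ltr0n.
have mq : measurable_fun setT q by exact: measurable_realfun.nondecreasing_measurable.
have mh x : measurable_fun setT (h x) by exact: lip_measurable (h1 x).
pose H x := \int[leb]_(t in `[0, 1[%classic) h x (q t).
have mhq x : measurable_fun setT (fun t => h x (q t)) by exact: measurableT_comp.
have LH : lip L H.
 move=> x y; apply: (@itv01_integral_bounds _ _ _ A) => // t; exact: h2.
have HA x : 0 <= H x <= A by exact: itv01_integral_range.
have := riemann_mono N0 qm qB LH HA (lip_measurable L0 LH) L0.
rewrite -/(dint h q) => D1.
have D2 : `|(\sum_(i < N) H (q (i%:R / N%:R))) / N%:R -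
  (\sum_(i < N) (\sum_(j < N) h (q (i%:R / N%:R)) (q (j%:R / N%:R))) / N%:R) / N%:R| <= L * (2 * B) / N%:R.
 rewrite -mulrBl -sumrB normrM [X in _ * X]ger0_norm ?invr_ge0 ?ler0n//.
 rewrite ler_pdivrMr//; apply: le_trans (ler_norm_sum _ _ _) _.
 apply: (@le_trans _ _ (\sum_(i < N) (L * (2 * B) / N%:R))).
  by apply: ler_sum => i _; exact: (riemann_mono N0 qm qB (h1 _) (hA _)).
 by rewrite sumr_const card_ord -[X in X <= _]mulr_natr.
apply: le_trans (lerD D1 D2); apply: le_trans (ler_normD _ _).
by rewrite addrA subrK.
Qed.

Lemma quant_davg {R} X h (A L : R) : (0 < size X)%N -> sorted <=%R X -> 0 <= L ->
 (forall x, lip L (h x)) -> (forall y, lip L (h ^~ y)) -> (forall x y, 0 <= h x y <= A) ->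
 dint h (quant X) = avg X (fun x => avg X (h x)).
Proof.
move=> X0 sX L0 h1 h2 hA; rewrite /dint.
have mh x : measurable_fun setT (h x) by exact: lip_measurable (h1 x).
have mh2 y : measurable_fun setT (h ^~ y) by exact: lip_measurable (h2 y).
under eq_Rintegral do rewrite (quant_avg X0 sX (mh _) (hA _)).
apply: (@quant_avg _ _ _ A) => // [|x].
 rewrite /avg; apply: measurable_funM => //; exact: measurable_sum.
rewrite /avg divr_ge0 ?ler0n ?sumr_ge0//= => [|y _]; last by have /andP[] := hA x y.
rewrite ler_pdivrMr ?ltr0n//.
apply: (@le_trans _ _ (\sum_(y <- X) A)).
 by apply: ler_sum => y _; have /andP[] := hA x y.
by rewrite big_const_seq iter_addr_0 count_predT mulr_natr.
Qed.

Lemma limit_quantile {R} K X (F : set_system nat) : UltraFilter F -> compact K ->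
 (forall n, (0 < size (X n))%N) -> (forall n, sorted <=%R (X n)) -> (forall n x, x \in X n -> K x) ->
 exists Q : R -> R, [/\ {homo Q : x y / x <= y}, forall s, K (Q s) & forall s, quant (X n) s @[n --> F] --> Q s].
Proof.
move=> UF cK X0 sX XK.
have H s : exists l, K l /\ quant (X n) s @[n --> F] --> l.
 have [l Kl ql] := @ultra_cvg R F UF K (fun n => quant (X n) s) cK (fun n => XK _ _ (quant_in s (X0 n))).
 by exists l.
have [Q HQ] := choice H; exists Q; split.
- move=> x y xy.
 apply: (ler_cvg_to (proj2 (HQ x)) (proj2 (HQ y))).
 by apply: nearW => n; exact: quant_mono.
- by move=> s; case: (HQ s).
- by move=> s; case: (HQ s).
Qed.

Lemma compact_bound {R} K : compact K -> exists2 B : R, 0 < B & forall x, K x -> - B <= x <= B.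
Proof.
move=> /compact_bounded[M [_ KM]]; exists (`|M| + 1); first by rewrite ltr_wpDl.
move=> x Kx; rewrite -ler_norml; apply: (KM (`|M| + 1)) => //.
by rewrite ltr_pwDr// ler_norm.
Qed.

Lemma approx_cvg {R} (F : set_system nat) C a l : ProperFilter F ->
 (forall N : nat, (0 < N)%N -> exists r l', [/\ forall n, `|a n - r n| <= C / N%:R,
   `|l - l'| <= C / N%:R & r @ F --> (l' : R)]) -> a @ F --> l.
Proof.
move=> PF H; apply/cvgrPdist_lt => e e0.
pose N := (Num.truncn (3 * `|C| / e)).+1.
have CN : C / N%:R < e / 3.
 apply: le_lt_trans (_ : `|C| / N%:R < _).
  by rewrite ler_pM2r ?invr_gt0 ?ltr0n// ler_norm.
 have := truncnS_gt (3 * `|C| / e); rewrite -/N ltr_pdivrMr// => H1.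
 rewrite ltr_pdivrMr ?ltr0n//; lra.
have [r [l' [ar ll' rl]]] := H N isT.
have e3 : 0 < e / 3 by rewrite divr_gt0.
move/cvgrPdist_lt: rl => /(_ _ e3); apply: filterS => n rn.
rewrite (_ : l - a n = (l - l') + (l' - r n) - (a n - r n)); last by ring.
apply: le_lt_trans (ler_normB _ _) _.
apply: le_lt_trans (lerD (ler_normD _ _) (le_refl _)) _.
move: (ar n) ll' rn CN; lra.
Qed.

Lemma cvg_fin_sum {R} (T : Type) (F : set_system T) (N : nat) a (l : nat -> R) : ProperFilter F ->
 (forall i, (i < N)%N -> a i @ F --> l i) -> (fun n => \sum_(i < N) a i n) @ F --> \sum_(i < N) l i.
Proof.
move=> PF; elim: N => [|N ih] H.
 by under eq_fun do rewrite big_ord0; rewrite big_ord0; exact: cvg_cst.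
under eq_fun do rewrite big_ord_recr/=.
rewrite big_ord_recr/=; apply: cvgD; last exact: H.
by apply: ih => i iN; apply: H; exact: ltnW.
Qed.

(** Quantile functions are monotone with values in [K], so they converge pointwise along the
    ultrafilter to a monotone function, whose law is [mu]. Riemann sums involve only finitely many
    quantiles, and their error is uniform in n. The clause on double averages serves the energy. *)
Lemma limit_law {R} K X (F : set_system nat) : UltraFilter F -> compact K ->
 (forall n, (0 < size (X n))%N) -> (forall n, sorted <=%R (X n)) -> (forall n x, x \in X n -> K x) ->
 exists mu : prob R, [/\ mu K = 1%E, forall (f : R -> R) (L A : R), 0 <= L -> lip L f -> (forall x, 0 <= f x <= A) ->
   exists2 l : R, (\int[mu]_x (f x)%:E)%E = l%:E & avg (X n) f @[n --> F] --> l &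
  forall (h : R -> R -> R) (L A : R), 0 <= L -> (forall x, lip L (h x)) -> (forall y, lip L (h ^~ y)) ->
   (forall x y, 0 <= h x y <= A) -> exists2 l : R, (\int[mu]_x \int[mu]_y (h x y)%:E)%E = l%:E &
    avg (X n) (fun x => avg (X n) (h x)) @[n --> F] --> l].
Proof.
move=> UF cK X0 sX XK.
have [B B0 KB] := compact_bound cK.
have [Q [Qm QK Qcvg]] := limit_quantile UF cK X0 sX XK.
have mQ : measurable_fun setT Q by exact: measurable_realfun.nondecreasing_measurable.
have [mu [muK muf]] := quantile_law mQ.
have QB s : - B <= Q s <= B by exact: KB.
have qB n s : - B <= quant (X n) s <= B by apply/KB/XK/quant_in.
have muE (f : R -> R) (A : R) : measurable_fun setT f -> (forall x, 0 <= f x <= A) -> (\int[mu]_x (f x)%:E)%E =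
  (\int[leb]_(s in `[0, 1[%classic) f (Q s))%:E.
 move=> mf fA; rewrite muf.
 + apply: (@integral_ge0_bounded _ (f \o Q) A) => // [|x]; last exact: fA.
  exact: measurableT_comp.
 + exact: measurableT_comp.
 + by move=> x; rewrite lee_fin; have /andP[] := fA x.
exists mu; split.
- by apply: muK => //; apply: closed_measurable; exact: compact_closed.
- move=> f L A L0 fL fA; have mf := lip_measurable L0 fL.
 exists (\int[leb]_(s in `[0, 1[%classic) f (Q s)).
  exact: muE fA.
 apply: (@approx_cvg _ _ (L * (2 * B))) => // N N0.
 exists (fun n => (\sum_(i < N) f (quant (X n) (i%:R / N%:R))) / N%:R).
 exists ((\sum_(i < N) f (Q (i%:R / N%:R))) / N%:R); split.
 + move=> n; rewrite -(quant_avg (X0 n) (sX n) mf fA).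
  by apply: (riemann_mono N0 _ _ fL fA) => //; exact: quant_mono.
 + exact: (riemann_mono N0 _ _ fL fA).
 + apply: cvgMl.
  apply: (@cvg_fin_sum _ _ F N (fun i n => f (quant (X n) (i%:R / N%:R))) (fun i => f (Q (i%:R / N%:R)))) => i _.
  apply: cvg_comp (Qcvg _) _; exact: (lip_continuous L0 fL).
- move=> h L A L0 h1 h2 hA.
 have mh x : measurable_fun setT (h x) by exact: lip_measurable (h1 x).
 exists (dint h Q).
  under eq_integral do rewrite (muE _ _ (mh _) (hA _)).
  apply: (muE _ A).
  + apply: (@lip_measurable _ L) => // x y.
   by apply: (@itv01_integral_bounds _ _ _ A) => // [||t];
    [exact: measurableT_comp|exact: measurableT_comp|exact: h2].
  + by move=> x; apply: itv01_integral_range => //; exact: measurableT_comp.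
 apply: (@approx_cvg _ _ (L * (2 * B) + L * (2 * B))) => // N N0.
 exists (fun n => (\sum_(i < N) (\sum_(j < N)
  h (quant (X n) (i%:R / N%:R)) (quant (X n) (j%:R / N%:R))) / N%:R) / N%:R).
 exists ((\sum_(i < N) (\sum_(j < N) h (Q (i%:R / N%:R)) (Q (j%:R / N%:R))) / N%:R) / N%:R); split.
 + move=> n; rewrite -(quant_davg (X0 n) (sX n) L0 h1 h2 hA) mulrDl.
  by apply: (dint_riemann N0 _ _ L0 h1 h2 hA) => //; exact: quant_mono.
 + by rewrite mulrDl; exact: (dint_riemann N0 _ _ L0 h1 h2 hA).
 + apply: cvgMl; apply: (@cvg_fin_sum _ _ F N (fun i n => (\sum_(j < N)
   h (quant (X n) (i%:R / N%:R)) (quant (X n) (j%:R / N%:R))) / N%:R)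
   (fun i => (\sum_(j < N) h (Q (i%:R / N%:R)) (Q (j%:R / N%:R))) / N%:R)) => i _.
  apply: cvgMl; apply: (@cvg_fin_sum _ _ F N (fun j n => h (quant (X n) (i%:R / N%:R)) (quant (X n) (j%:R / N%:R)))
   (fun j => h (Q (i%:R / N%:R)) (Q (j%:R / N%:R)))) => j _.
  have P1 := Qcvg (i%:R / N%:R); have P2 := Qcvg (j%:R / N%:R).
  apply/cvgrPdist_lt => e e0; pose e' := e / (2 * (L + 1)).
  have L1 : 0 < L + 1 by rewrite ltr_wpDl.
  have e'0 : 0 < e' by rewrite divr_gt0// mulr_gt0.
  move/cvgrPdist_lt: P1 => /(_ _ e'0) P1; move/cvgrPdist_lt: P2 => /(_ _ e'0) P2.
  apply: filterS2 P1 P2 => n P1 P2.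
  rewrite (_ : _ - _ = (h (Q (i%:R / N%:R)) (Q (j%:R / N%:R)) - h (quant (X n) (i%:R / N%:R)) (Q (j%:R / N%:R))) +
   (h (quant (X n) (i%:R / N%:R)) (Q (j%:R / N%:R)) -
   h (quant (X n) (i%:R / N%:R)) (quant (X n) (j%:R / N%:R)))); last by ring.
  apply: le_lt_trans (ler_normD _ _) _.
  apply: le_lt_trans (lerD (h2 _ _ _) (h1 _ _ _)) _.
  have ee : e = (L + 1) * e' + (L + 1) * e'.
   by rewrite /e'; field; rewrite gt_eqF.
  rewrite ee; apply: ler_ltD.
   by apply: ler_pM => //; rewrite ?lerDl// ltW.
  apply: (@le_lt_trans _ _ (L * e')); first by apply: ler_wpM2l => //; exact: ltW.
  by rewrite ltr_pM2r// ltrDl.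
Qed.

(** * The truncated logarithmic kernel and the energy *)

(** The kernel -ln |x - y| is shifted by [C] and cut off at 0 so that Tonelli and monotone
    convergence apply; when [C] bounds the logarithm of the diameter of [K], the cut changes nothing
    on [K]. [kM] moreover replaces distances below exp(-M) by exp(-M), which makes it Lipschitz and
    bounded; it increases to [kk]. *)
Definition kM {R} (C : R) (M : nat) (x y : R) : R := Num.max 0 (C - ln (Num.max `|x - y| (expR (- M%:R)))).

Definition kk {R} (C : R) (x y : R) : \bar R := if x == y then +oo%E else (Num.max 0 (C - ln `|x - y|))%:E.

Lemma ln_lip {R} (d u v : R) : 0 < d -> d <= u -> d <= v -> `|ln u - ln v| <= d^-1 * `|u - v|.
Proof.
move=> d0.
suff H (a b : R) : d <= a -> a <= b -> ln b - ln a <= d^-1 * (b - a).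
 move=> du dv; have u0 := lt_le_trans d0 du; have v0 := lt_le_trans d0 dv.
 case: (leP u v) => [uv|/ltW uv].
  rewrite distrC [`|u - v|]distrC.
  by rewrite [`|v - u|]ger0_norm ?subr_ge0// ger0_norm ?subr_ge0 ?ler_ln ?posrE//; exact: H.
 by rewrite [`|u - v|]ger0_norm ?subr_ge0// ger0_norm ?subr_ge0 ?ler_ln ?posrE//; exact: H.
move=> da ab; have a0 : 0 < a by exact: lt_le_trans da.
have b0 : 0 < b by exact: lt_le_trans ab.
rewrite -ln_div ?posrE//.
have := @le_ln1Dx R (b / a - 1); rewrite (addrC 1) subrK => H.
have ba : 1 <= b / a by rewrite ler_pdivlMr// mul1r.
apply: le_trans (H _) _; first lra.
rewrite -[X in _ / _ - X](@divff _ a) ?gt_eqF// -mulrBl mulrC.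
by apply: ler_wpM2r; rewrite ?subr_ge0// lef_pV2// posrE.
Qed.

Lemma max_lip {R} (c u v : R) : `|Num.max c u - Num.max c v| <= `|u - v|.
Proof.
rewrite ler_norml; have := ler_norm (u - v); have := ler_norm (v - u).
rewrite (distrC v); case: (leP c u) => cu; case: (leP c v) => cv; lra.
Qed.

Lemma kM_lip {R} (C : R) M x : lip (expR M%:R) (kM C M x).
Proof.
move=> y z; rewrite /kM; apply: le_trans (max_lip _ _ _) _.
rewrite opprB addrC addrA subrK.
have e0 : 0 < expR (- M%:R) :> R by exact: expR_gt0.
apply: le_trans (ln_lip e0 _ _) _; rewrite ?le_max ?lexx ?orbT//.
rewrite expRN invrK; apply: ler_wpM2l; first exact: expR_ge0.
rewrite ![Num.max `|_| _]maxC; apply: le_trans (max_lip _ _ _) _.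
apply: le_trans (ler_dist_dist _ _) _.
have -> : x - z - (x - y) = y - z by ring.
by [].
Qed.

Lemma kMC {R} (C : R) M x y : kM C M x y = kM C M y x.
Proof. by rewrite /kM distrC. Qed.

Lemma kM_lip2 {R} (C : R) M y : lip (expR M%:R) (kM C M ^~ y).
Proof. by move=> x z; rewrite !(kMC C M _ y); exact: kM_lip. Qed.

Lemma kM_bound {R} (C : R) M x y : 0 <= kM C M x y <= `|C| + M%:R.
Proof.
rewrite /kM le_max lexx/= ge_max addr_ge0//= lerD ?ler_norm//.
have e0 : 0 < expR (- M%:R) :> R by exact: expR_gt0.
have : ln (expR (- M%:R)) <= ln (Num.max `|x - y| (expR (- M%:R))).
 by rewrite ler_ln ?posrE// ?lt_max ?e0 ?orbT// le_max lexx orbT.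
by rewrite expRK; lra.
Qed.

Lemma kM_meas {R} (C : R) M x : measurable_fun setT (kM C M x).
Proof.
apply: (@lip_measurable _ (expR M%:R)); first exact: expR_ge0.
exact: kM_lip.
Qed.

Lemma kM_mono {R} (C : R) M N x y : (M <= N)%N -> kM C M x y <= kM C N x y.
Proof.
move=> MN; rewrite /kM ge_max le_max lexx/= le_max; apply/orP; right.
rewrite lerB// ler_ln ?posrE ?lt_max ?expR_gt0 ?orbT//.
rewrite ge_max !le_max lexx/= ler_expR lerN2 ler_nat MN.
by rewrite orbT.
Qed.

Lemma kM_eq {R} (C : R) M x y : expR (- M%:R) <= `|x - y| -> kM C M x y = Num.max 0 (C - ln `|x - y|).
Proof. by move=> H; rewrite /kM; case: (leP `|x - y| _) => // H'; rewrite (le_anti (introT andP (conj H H'))). Qed.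

Lemma kM_le_kk {R} (C : R) M x y : ((kM C M x y)%:E <= kk C x y)%E.
Proof.
rewrite /kk; case: eqP => [_|/eqP xy]; first exact: leey.
rewrite lee_fin /kM ge_max le_max lexx/= le_max; apply/orP; right.
rewrite lerB// ler_ln ?posrE ?lt_max ?expR_gt0 ?orbT ?normr_gt0 ?subr_eq0//.
by rewrite le_max lexx.
Qed.

Lemma kk_ge0 {R} (C : R) x y : (0 <= kk C x y)%E.
Proof. by rewrite /kk; case: ifP => // _; rewrite lee_fin le_max lexx. Qed.

Lemma kkC {R} (C : R) x y : kk C x y = kk C y x.
Proof. by rewrite /kk eq_sym distrC. Qed.

Lemma kM_cvg {R} (C : R) x y : (kM C M x y)%:E @[M --> \oo] --> kk C x y.
Proof.
rewrite /kk; case: eqP => [->|/eqP xy].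
 apply/cvgeyPge => A; near=> M; rewrite lee_fin /kM subrr normr0.
 rewrite (max_idPr (expR_ge0 _)) expRK opprK le_max; apply/orP; right.
 rewrite -lerBlDl; near: M; exact: nbhs_infty_ger.
apply: cvg_near_cst; near=> M; rewrite kM_eq//.
rewrite -[leRHS]lnK ?posrE ?normr_gt0 ?subr_eq0// ler_expR lerNl.
near: M; exact: nbhs_infty_ger.
Unshelve. all: by end_near. Qed.

Lemma kk_meas {R} (C : R) x : measurable_fun setT (kk C x).
Proof.
apply: (emeasurable_fun_cvg (fun M y => (kM C M x y)%:E)) => [M|y _].
 apply/measurable_EFinP; exact: kM_meas.
exact: kM_cvg.
Qed.

Definition Uk {R} (C : R) (mu : prob R) (x : R) : \bar R := (\int[mu]_y kk C x y)%E.
Definition UM {R} (C : R) (mu : prob R) M (x : R) : \bar R := (\int[mu]_y (kM C M x y)%:E)%E.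

Lemma Uk_ge0 {R} (C : R) mu x : (0 <= Uk C mu x)%E.
Proof. by apply: integral_ge0 => y _; exact: kk_ge0. Qed.

Lemma UM_cvg {R} (C : R) mu x : UM C mu M x @[M --> \oo] --> Uk C mu x.
Proof.
rewrite /Uk (_ : (\int[mu]_y kk C x y = \int[mu]_y (limn (fun M => (kM C M x y)%:E)))%E).
 apply: cvg_monotone_convergence => //.
 - move=> M; apply/measurable_EFinP; exact: kM_meas.
 - by move=> M y _; rewrite lee_fin; have /andP[] := kM_bound C M x y.
 - by move=> y _ M N MN; rewrite lee_fin; exact: kM_mono.
by apply: eq_integral => y _; apply/esym/cvg_lim => //; exact: kM_cvg.
Qed.

Lemma UM_le {R} (C : R) mu M x : (UM C mu M x <= Uk C mu x)%E.
Proof.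
apply: ge0_le_integral => //.
- by move=> y _; rewrite lee_fin; have /andP[] := kM_bound C M x y.
- apply/measurable_EFinP; exact: kM_meas.
- exact: kk_meas.
- by move=> y _; exact: kM_le_kk.
Qed.

Lemma bounded_integrableT {R} (mu : prob R) (f : R -> R) A :
 measurable_fun setT f -> (forall x, 0 <= f x <= A) -> intR mu setT f.
Proof.
move=> mf fA; apply: measurable_bounded_integrable => //.
 by rewrite [ltLHS]probability_setT ltry.
by apply: (@norm_bounded_on _ _ _ _ A) => s _; have /andP[f0 f1] := fA s; rewrite ger0_norm.
Qed.

Lemma UM_fin {R} (C : R) mu M x : UM C mu M x \is a fin_num.
Proof.
apply: integrable_fin_num => //; apply: (@bounded_integrableT _ _ _ (`|C| + M%:R)).
 exact: kM_meas.
by move=> y; exact: kM_bound.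
Qed.

Lemma UM_lip {R} (C : R) mu M : lip (expR M%:R) (fun x => fine (UM C mu M x)).
Proof.
move=> x y.
have ii z : intR mu setT (kM C M z).
 apply: (@bounded_integrableT _ _ _ (`|C| + M%:R)).
  exact: kM_meas.
 by move=> t; exact: kM_bound.
have -> : fine (UM C mu M x) - fine (UM C mu M y) = \int[mu]_t (kM C M x t - kM C M y t) by rewrite RintegralB.
apply: le_trans (le_normr_Rintegral _ _) _ => //; first exact: (integrableB _ (ii x) (ii y)).
have -> : expR M%:R * `|x - y| = \int[mu]_t (expR M%:R * `|x - y|).
 by rewrite Rintegral_cst//; rewrite [X in fine X]probability_setT mulr1.
apply: le_Rintegral => //.
- by apply: integrable_norm; exact: (integrableB _ (ii x) (ii y)).
- apply: (@bounded_integrableT _ _ _ (expR M%:R * `|x - y|)) => [|z].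
  exact: measurable_cst.
 by rewrite lexx mulr_ge0 ?expR_ge0.
- by move=> t _; exact: kM_lip2.
Qed.

Lemma Uk_meas {R} (C : R) mu : measurable_fun setT (Uk C mu).
Proof.
apply: (emeasurable_fun_cvg (fun M x => UM C mu M x)) => [M|x _]; last exact: UM_cvg.
rewrite (_ : UM C mu M = EFin \o (fun x => fine (UM C mu M x))).
 apply/measurable_EFinP; apply: (@lip_measurable _ (expR M%:R)); first exact: expR_ge0.
 exact: UM_lip.
by apply/funext => x /=; rewrite fineK// UM_fin.
Qed.

(** [Uk] is an increasing limit of the continuous functions [UM], hence lower semicontinuous. *)
Lemma Uk_lsc {R} C mu (V : R) : closed [set x | (Uk C mu x <= V%:E)%E].
Proof.
rewrite -openC openE => x /= /negP; rewrite -ltNge => Vx.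
have [M VM] : exists M, (V%:E < UM C mu M x)%E.
 apply/not_existsP => H; move: Vx; rewrite ltNge => /negP; apply.
 rewrite -(cvg_lim (@ereal_hausdorff R) (@UM_cvg _ C mu x)); apply: lime_le.
  by apply/cvg_ex; exists (Uk C mu x); exact: UM_cvg.
 by apply: nearW => M; rewrite leNgt; apply/negP; exact: H.
have cM : continuous (fun x => fine (UM C mu M x)).
 by apply: (@lip_continuous _ (expR M%:R)); [exact: expR_ge0|exact: UM_lip].
rewrite -(fineK (UM_fin _ _ _ _)) lte_fin in VM.
have := cM x; move/cvgrPdist_lt => /(_ (fine (UM C mu M x) - V)).
rewrite subr_gt0 => /(_ VM); apply: filterS => y /= Hy; apply/negP.
rewrite -ltNge; apply: lt_le_trans (UM_le _ _ M _).
rewrite -(fineK (UM_fin _ _ _ _)) lte_fin.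
have := ler_norm (fine (UM C mu M x) - fine (UM C mu M y)); lra.
Qed.

Lemma measurable_lneEFin {R} : measurable_fun setT (fun r : R => lne r%:E).
Proof.
rewrite (_ : (fun r : R => lne r%:E) = fun r => if r <= 0 then -oo%E else (ln r)%:E); last first.
 by apply/funext => r; rewrite /lne; case: ifP.
apply: measurable_fun_if => //.
- exact: measurable_fun_ler.
- by apply: measurable_funTS; apply/measurable_EFinP; exact: measurable_ln.
Qed.

Lemma prob_compl0 {R} (mu : prob R) K : measurable K -> mu K = 1%E -> mu (~` K) = 0%E.
Proof. by move=> mK muK; rewrite probability_setC// muK subee. Qed.

Lemma prob_ge0_integral {R} (mu : prob R) K f : measurable K -> mu K = 1%E -> measurable_fun setT f ->
 (forall x, (0 <= f x)%E) -> (\int[mu]_x f x = \int[mu]_(x in K) f x)%E.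
Proof.
move=> mK muK mf f0.
rewrite (@ge0_negligible_integral _ _ _ mu setT (~` K))//.
- by rewrite setTD setCK.
- exact: measurableC.
- exact: prob_compl0.
Qed.

Lemma prob_integral_shift {R} (mu : prob R) K f g C : measurable K -> mu K = 1%E -> 0 <= C ->
 measurable_fun setT f -> measurable_fun setT g ->
 (forall x, (0 <= g x)%E) -> (forall x, K x -> g x = (f x + C%:E)%E) -> (\int[mu]_x f x = \int[mu]_x g x - C%:E)%E.
Proof.
move=> mK muK C0 mf mg g0 gf.
rewrite integralE.
rewrite (@prob_ge0_integral _ _ K _ mK muK (measurable_funepos mf))//.
rewrite (@prob_ge0_integral _ _ K _ mK muK (measurable_funeneg mf))//.
rewrite (@prob_ge0_integral _ _ K _ mK muK mg)//.
have mfp : measurable_fun K (f^\+%E) by exact/measurable_funTS/measurable_funepos.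
have mfn : measurable_fun K (f^\-%E) by exact/measurable_funTS/measurable_funeneg.
have muKC : (\int[mu]_(x in K) C%:E = C%:E)%E.
 by rewrite integral_cst// [X in (_ * X)%E]muK mule1.
have fnC x : K x -> (f^\- x <= C%:E)%E.
 move=> Kx; rewrite funenegE ge_max lee_fin C0 andbT leeNl -EFinN.
 by have := g0 x; rewrite gf//; case: (f x) => [r| |]//=; rewrite ?leey// !lee_fin; lra.
have Ifn : (\int[mu]_(x in K) f^\- x <= C%:E)%E.
 by rewrite -muKC; apply: ge0_le_integral.
have Ifnf : (\int[mu]_(x in K) f^\- x)%E \is a fin_num.
 rewrite ge0_fin_numE; first exact: le_lt_trans Ifn (ltry _).
 exact: integral_ge0.
have E : (\int[mu]_(x in K) g x + \int[mu]_(x in K) f^\- x = \int[mu]_(x in K) f^\+ x + C%:E)%E.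
 rewrite -muKC -!ge0_integralD//; last exact: measurable_funTS.
 apply: eq_integral => x; rewrite inE => Kx; rewrite gf//.
 have : (0 <= f x + C%:E)%E by rewrite -gf.
 rewrite funeposE funenegE; case: (f x) => [r| |]//.
  rewrite -!EFinN -!EFin_max -!EFinD => _; congr EFin.
  by case: (leP r 0) => ?; case: (leP (- r) 0) => ?; lra.
 by move=> _; rewrite /= (max_idPr (leNye _)) (max_idPl (leey _)) adde0.
have -> : (\int[mu]_(x in K) g x = \int[mu]_(x in K) f^\+ x + C%:E - \int[mu]_(x in K) f^\- x)%E by rewrite -E addeK.
by rewrite addeAC addeK.
Qed.

Definition diam_le {R} (K : set R) (C : R) := 0 <= C /\ forall x y, K x -> K y -> `|x - y| <= expR C.

Lemma kk_lne {R} K (C x y : R) : diam_le K C -> K x -> K y -> kk C x y = (- lne `|x - y|%:E + C%:E)%E.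
Proof.
move=> [C0 KC] Kx Ky; rewrite /kk; case: eqP => [->|/eqP xy].
 by rewrite subrr normr0 le0_lneNy.
have xy0 : 0 < `|x - y| by rewrite normr_gt0 subr_eq0.
have h : 0 <= C - ln `|x - y|.
 by rewrite subr_ge0 -[leRHS](expRK C) ler_ln ?posrE ?expR_gt0// KC.
by rewrite (max_idPr h) lne_EFin// -EFinN -EFinD addrC.
Qed.

Lemma mlne2 {R} : measurable_fun setT (fun z : R * R => - lne `|z.1 - z.2|%:E)%E.
Proof.
apply: measurableT_comp => //.
apply: (measurableT_comp (@measurable_lneEFin R)).
by apply: measurableT_comp => //; exact: measurable_funB.
Qed.

Lemma energy_Uk {R} (mu : prob R) K C : measurable K -> mu K = 1%E -> diam_le K C ->
 energy mu = (\int[mu]_x Uk C mu x - C%:E)%E.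
Proof.
move=> mK muK KC; have C0 := KC.1.
have mx x : measurable_fun setT (fun y : R => - lne `|x - y|%:E)%E.
 exact: (measurableT_comp mlne2 (pair1_measurable x)).
rewrite /energy; apply: (@prob_integral_shift _ _ K) => //.
- apply: (eq_measurable_fun (fun x => \int[mu]_y ((fun z : R * R => - lne `|z.1 - z.2|%:E) ^\+ (x, y)) -
   \int[mu]_y ((fun z : R * R => - lne `|z.1 - z.2|%:E) ^\- (x, y)))%E).
  move=> x _ /=; rewrite [in RHS]integralE; congr (_ - _)%E.
   by apply: eq_integral => y _; rewrite !funeposE.
  by apply: eq_integral => y _; rewrite !funenegE.
 apply: emeasurable_funB.
 + apply: (measurable_fun_fubini_tonelli_F (m2 := mu)) => //.
  exact: measurable_funepos mlne2.
 + apply: (measurable_fun_fubini_tonelli_F (m2 := mu)) => //.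
  exact: measurable_funeneg mlne2.
- exact: Uk_meas.
- exact: Uk_ge0.
- move=> x Kx.
 rewrite (@prob_integral_shift _ mu K _ (kk C x) C)//.
 + by rewrite -/(Uk C mu x) subeK.
 + exact: kk_meas.
 + exact: kk_ge0.
 + by move=> y Ky; exact: kk_lne KC Kx Ky.
Qed.

Lemma prods_gt0 {R} s (F : R -> R) : (forall y, y \in s -> 0 < F y) -> 0 < \prod_(y <- s) F y.
Proof. by move=> F0; rewrite big_seq; exact: prodr_gt0. Qed.

Lemma ln_prods {R} s (F : R -> R) :
 (forall y, y \in s -> 0 < F y) -> ln (\prod_(y <- s) F y) = \sum_(y <- s) ln (F y).
Proof.
elim: s => [|x s ih] F0; first by rewrite !big_nil ln1.
rewrite !big_cons lnM ?posrE ?F0 ?mem_head//.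
 by rewrite ih// => y ys; apply: F0; rewrite inE ys orbT.
by apply: prods_gt0 => y ys; apply: F0; rewrite inE ys orbT.
Qed.

(** Discrete energy, every pair of positions counted twice. A repeated entry gives +oo, so a lower
    bound valid for tuples of distinct points holds for all tuples of [K] and can be integrated
    without excluding the diagonal. *)
Fixpoint ek {R} (C : R) (s : seq R) : \bar R :=
 if s is x :: s' then (ek C s' + 2%:E * \sum_(y <- s') kk C x y)%E else 0%E.

Lemma ek_ge0 {R} (C : R) s : (0 <= ek C s)%E.
Proof.
elim: s => //= x s ih; apply: adde_ge0 => //; apply: mule_ge0 => //.
by apply: sume_ge0 => y _; exact: kk_ge0.
Qed.

Lemma ek_nuniq {R} (C : R) s : ~~ uniq s -> ek C s = +oo%E.
Proof.
elim: s => //= x s ih; rewrite negb_and negbK => /orP[xs|/ih ->]; last first.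
 rewrite addye// gt_eqF// (lt_le_trans (ltNyr 0))//; apply: mule_ge0 => //.
 by apply: sume_ge0 => y _; exact: kk_ge0.
have -> : (\sum_(y <- s) kk C x y = +oo)%E.
 rewrite (big_rem x)//= {1}/kk eqxx addye// gt_eqF// (lt_le_trans (ltNyr 0))//.
 by apply: sume_ge0 => y _; exact: kk_ge0.
by rewrite gt0_muley ?lte_fin// addey// gt_eqF// (lt_le_trans (ltNyr 0))// ek_ge0.
Qed.

Lemma ek_uniq {R} K (C : R) s : diam_le K C -> uniq s -> (forall x, x \in s -> K x) ->
 ek C s = ((size s * (size s).-1)%:R * C - ln (vdm s))%:E.
Proof.
move=> KC; elim: s => [|x s ih] /=.
 by move=> _ _; rewrite mul0n mul0r /vdm big_nil ln1 subr0.
move=> /andP[xs us] sK; rewrite ih//; last by move=> y ys; apply: sK; rewrite inE ys orbT.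
have xy0 y : y \in s -> 0 < `|x - y|.
 by move=> ys; rewrite normr_gt0 subr_eq0; apply/eqP => xy; rewrite xy ys in xs.
have p0 := prods_gt0 xy0.
rewrite vdm_cons// lnM ?posrE ?vdm_gt0 ?exprn_gt0//.
have -> : (\sum_(y <- s) kk C x y = (\sum_(y <- s) (C - ln `|x - y|))%:E)%E.
 rewrite -sumEFin; apply: eq_big_seq => y ys.
 rewrite (kk_lne KC) ?lne_EFin ?xy0//.
 - by rewrite -EFinN -EFinD addrC.
 - by apply: sK; rewrite mem_head.
 - by apply: sK; rewrite inE ys orbT.
rewrite -EFinM -EFinD; congr EFin.
rewrite lnXn// (ln_prods xy0).
have -> : \sum_(y <- s) (C - ln `|x - y|) = C * (size s)%:R - \sum_(y <- s) ln `|x - y|.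
 by rewrite sumrB big_const_seq iter_addr_0 count_predT mulr_natr.
have -> : ((size s).+1 * size s = size s * (size s).-1 + 2 * size s)%N.
 by case: (size s) => // n /=; lia.
rewrite [in RHS]natrD [in RHS](natrM _ 2); ring.
Qed.

(** Integrate the discrete energy of n independent points with law [nu]: each of the n (n - 1)
    ordered pairs contributes the energy of [nu]. *)
Lemma energy_lb {R} (nu : prob R) K C c (n : nat) : measurable K -> nu K = 1%E ->
 (forall s, size s = n -> (forall x, x \in s -> K x) -> (c%:E <= ek C s)%E) ->
 (c%:E <= (n * n.-1)%:R%:E * \int[nu]_x Uk C nu x)%E.
Proof.
move=> mK nuK H; set I := (\int[nu]_x _)%E.
have I0 : (0 <= I)%E by apply: integral_ge0 => x _; exact: Uk_ge0.
(* [s] holds the points still fixed and m counts those already integrated out; the three terms are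
   the pairs inside [s], the mixed pairs and the pairs of integrated points. *)
suff G m s : (size s + m)%N = n -> (forall x, x \in s -> K x) ->
  (c%:E <= ek C s + (2 * m)%:R%:E * \sum_(y <- s) Uk C nu y + (m * m.-1)%:R%:E * I)%E.
 have := G n [::] erefl; rewrite big_nil/= mule0 !add0e; apply.
 by move=> x; rewrite in_nil.
elim: m s => [|m ih] s sn sK.
 rewrite muln0 mul0n !mul0e !adde0; apply: H => //.
 by rewrite addn0 in sn.
have nuKc (r : \bar R) : (0 <= r)%E -> (\int[nu]_(x in K) r = r)%E.
 by move=> r0; rewrite integral_cst// [X in (_ * X)%E]nuK mule1.
have U0 x : (0 <= Uk C nu x)%E by exact: Uk_ge0.
have S0 : (0 <= \sum_(y <- s) Uk C nu y)%E by apply: sume_ge0.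
have mkk : measurable_fun K (fun x => \sum_(y <- s) kk C x y)%E.
 apply: emeasurable_sum => y; apply: measurable_funTS.
 by under eq_fun do rewrite kkC; exact: kk_meas.
pose T := (ek C s + (2 * m)%:R%:E * \sum_(y <- s) Uk C nu y + (m * m.-1)%:R%:E * I)%E.
have T0 : (0 <= T)%E by rewrite !adde_ge0 ?mule_ge0 ?ek_ge0.
have ck : (c%:E <= \int[nu]_(x in K) ((2%:E * \sum_(y <- s) kk C x y) + ((2 * m)%:R%:E * Uk C nu x + T)))%E.
 rewrite -[leLHS]mule1 -nuK -integral_cst//.
 apply: (@le_trans _ _ (\int[nu]_(x in K) (maxe c%:E 0))%E).
  rewrite !integral_cst// [X in (_ * X)%E]nuK [X in (_ <= _ * X)%E]nuK !mule1 le_max lexx//.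
 apply: ge0_le_integral => //.
 - by move=> x _; rewrite le_max lexx orbT.
 - apply: emeasurable_funD; first exact: measurable_funeM.
  apply: emeasurable_funD => //; apply: measurable_funeM; apply: measurable_funTS; exact: Uk_meas.
 - move=> x Kx; rewrite ge_max; apply/andP; split; last first.
   apply: adde_ge0; last by apply: adde_ge0 => //; exact: mule_ge0.
   by apply: mule_ge0 => //; apply: sume_ge0 => y _; exact: kk_ge0.
  have := ih (x :: s); rewrite /= addSnnS => /(_ sn) /(_ _)/le_trans; apply.
   by move=> y; rewrite inE => /predU1P[->|/sK].
  rewrite big_cons ge0_muleDr// /T.
  rewrite (addeC (ek C s)) -!addeA; apply: leeD => //.
  by rewrite addeCA.
apply: le_trans ck _.
rewrite ge0_integralD//; last 4 first.
- by move=> x _; apply: mule_ge0 => //; apply: sume_ge0 => y _; exact: kk_ge0.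
- exact: measurable_funeM.
- by move=> x _; apply: adde_ge0 => //; exact: mule_ge0.
- apply: emeasurable_funD => //; apply: measurable_funeM; apply: measurable_funTS; exact: Uk_meas.
rewrite ge0_integralD//; last 2 first.
- by move=> x _; rewrite mule_ge0.
- by apply: measurable_funeM; apply: measurable_funTS; exact: Uk_meas.
rewrite nuKc// ge0_integralZl//; last by move=> x _; apply: sume_ge0 => y _; exact: kk_ge0.
rewrite ge0_integralZl//; last by apply: measurable_funTS; exact: Uk_meas.
have h1 : (\int[nu]_(x in K) \sum_(y <- s) kk C x y <= \sum_(y <- s) Uk C nu y)%E.
 rewrite ge0_integral_sum//.
 + apply: lee_sum => y _; rewrite /Uk.
  under eq_integral do rewrite kkC.
  by rewrite -prob_ge0_integral//; [exact: kk_meas|move=> x; exact: kk_ge0].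
 + move=> y; apply: measurable_funTS.
  by under eq_fun do rewrite kkC; exact: kk_meas.
 + by move=> y x _; exact: kk_ge0.
have h2 : (\int[nu]_(x in K) Uk C nu x = I)%E.
 by rewrite -prob_ge0_integral//; exact: Uk_meas.
rewrite h2.
apply: le_trans (leeD (lee_wpmul2l _ h1) (le_refl _)) _; first by rewrite lee_fin.
rewrite /T; set S := (\sum_(y <- s) _)%E.
have -> : ((2 * m.+1)%:R%:E * S = 2%:E * S + (2 * m)%:R%:E * S)%E.
 rewrite -ge0_muleDl; [|by rewrite lee_fin|by rewrite lee_fin ler0n].
 by rewrite -EFinD; congr (_%:E * _)%E; rewrite mulnS natrD.
have -> : ((m.+1 * m)%:R%:E * I = (2 * m)%:R%:E * I + (m * m.-1)%:R%:E * I)%E.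
 rewrite -ge0_muleDl; [|by rewrite lee_fin ler0n|by rewrite lee_fin ler0n].
 rewrite -EFinD -natrD.
 by congr (_%:R%:E * _)%E; case: (m) => // k /=; lia.
rewrite -!addeA (addeCA ((2 * m)%:R%:E * I)%E (ek C s)) (addeCA (2%:E * S)%E (ek C s)).
by rewrite (addeCA ((2 * m)%:R%:E * I)%E ((2 * m)%:R%:E * S)%E).
Qed.

(** For distinct points, the mean of -ln |x - y| over the ordered pairs; for Fekete points its limit
    will be the Robin constant. *)
Definition delta {R} (s : seq R) : R :=
 - ln (vdm s) / (size s * (size s).-1)%:R.

Definition fekete {R} (K : set R) (s : seq R) := [/\ uniq s, forall x, x \in s -> K x &
  forall t, size t = size s -> uniq t -> (forall x, x \in t -> K x) -> vdm t <= vdm s].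

(** Fekete points have the least discrete energy among all tuples of [K] of their size, so averaging
    bounds the energy of every law on [K] from below. *)
Lemma fekete_energy {R} (nu : prob R) K C s :
 measurable K -> nu K = 1%E -> diam_le K C -> (1 < size s)%N -> fekete K s ->
 ((delta s + C)%:E <= \int[nu]_x Uk C nu x)%E.
Proof.
move=> mK nuK KC s1 [us sK smax].
have nn0 : (0 : R) < (size s * (size s).-1)%:R.
 by rewrite ltr0n muln_gt0 (ltn_trans _ s1)//= -ltnS prednK// (ltn_trans _ s1).
have := @energy_lb R nu K C ((size s * (size s).-1)%:R * C - ln (vdm s)) (size s) mK nuK.
have H t : size t = size s -> (forall x, x \in t -> K x) ->
  (((size s * (size s).-1)%:R * C - ln (vdm s))%:E <= ek C t)%E.
 move=> ts tK; have [ut|ut] := boolP (uniq t); last by rewrite ek_nuniq// leey.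
 rewrite (ek_uniq KC)// ts lee_fin lerB// ler_ln ?posrE ?vdm_gt0//.
 exact: smax.
move=> /(_ H) {}H; rewrite -(@lee_pmul2l _ (size s * (size s).-1)%:R%:E)//.
apply: le_trans H; rewrite -EFinM lee_fin /delta mulrDr mulrC divfK ?gt_eqF//.
by rewrite addrC.
Qed.

Lemma ln_vdm {R} (s : seq R) : ln (vdm s) = \sum_(x <- s) \sum_(y <- s | y != x) ln `|x - y|.
Proof.
have pos x : 0 < \prod_(y <- s | y != x) `|x - y|.
 by apply: prodr_gt0 => y yx; rewrite normr_gt0 subr_eq0 eq_sym.
rewrite /vdm ln_prods//; apply: eq_bigr => x _.
rewrite -big_filter ln_prods ?big_filter// => y.
by rewrite mem_filter normr_gt0 subr_eq0 eq_sym => /andP[].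
Qed.

(** Compared with [delta s], the double average of the truncated kernel also contains the diagonal,
    whose terms are at most |C| + M each; for fixed M this excess is of order 1 / [size s]. *)
Lemma avg_kM_fekete {R} K C M (s : seq R) : diam_le K C -> (1 < size s)%N -> uniq s -> (forall x, x \in s -> K x) ->
 avg s (fun x => avg s (kM C M x)) <= delta s + C + (`|C| + M%:R - delta s - C) / (size s)%:R.
Proof.
move=> KC s1 us sK; set n := size s.
have n0 : (0 : R) < n%:R by rewrite ltr0n (ltn_trans _ s1).
have n1 : (0 : R) < (n * n.-1)%:R.
 by rewrite ltr0n muln_gt0 (ltn_trans _ s1)//= -ltnS prednK// (ltn_trans _ s1).
have H : \sum_(x <- s) \sum_(y <- s) kM C M x y <= n%:R * (`|C| + M%:R) + ((n * n.-1)%:R * C - ln (vdm s)).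
 have H1 x : x \in s -> \sum_(y <- s) kM C M x y <=
   (`|C| + M%:R) + (n.-1%:R * C - \sum_(y <- s | y != x) ln `|x - y|).
  move=> xs; rewrite (bigD1_seq x)//=; apply: lerD.
   by have /andP[] := kM_bound C M x x.
  have -> : n.-1%:R * C - \sum_(y <- s | y != x) ln `|x - y| = \sum_(y <- s | y != x) (C - ln `|x - y|).
   rewrite sumrB big_const_seq iter_addr_0 mulr_natl; congr (_ *+ _ - _).
   by have := count_predC (pred1 x) s; rewrite count_uniq_mem// xs add1n /n => <-.
  rewrite big_seq_cond [leRHS]big_seq_cond; apply: ler_sum => y /andP[ys yx].
  rewrite -lee_fin; apply: le_trans (kM_le_kk C M x y) _.
  rewrite (kk_lne KC (sK _ xs) (sK _ ys)) lne_EFin; last first.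
   by rewrite normr_gt0 subr_eq0 eq_sym.
  by rewrite -EFinN -EFinD addrC.
 rewrite big_seq; apply: le_trans (ler_sum _ H1) _; rewrite -big_seq big_split/= sumrB.
 rewrite !big_const_seq !iter_addr_0 count_predT -/n -ln_vdm.
 by rewrite -[X in X + _]mulr_natl -[X in _ + (X - _)]mulr_natl mulrA -natrM.
have -> : avg s (fun x => avg s (kM C M x)) = (\sum_(x <- s) \sum_(y <- s) kM C M x y) / (n%:R * n%:R).
 by rewrite /avg -/n -mulr_suml -mulrA invfM.
rewrite ler_pdivrMr ?mulr_gt0//; apply: le_trans H _.
have lnE : ln (vdm s) = - (delta s * (n * n.-1)%:R).
 by rewrite /delta -/n mulrVK ?opprK// unitfE gt_eqF.
rewrite lnE natrM.
have -> : (n.-1%:R : R) = n%:R - 1 by rewrite -subn1 natrB// (ltn_trans _ s1).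
rewrite le_eqVlt; apply/orP; left; apply/eqP; field.
by rewrite gt_eqF.
Qed.

(** * Frostman's inequality by variation of the energy *)

Lemma integral_mrestr {R} (mu : prob R) A (mA : measurable A) f : measurable_fun setT f -> (forall x, (0 <= f x)%E) ->
 (\int[mrestr mu mA]_x f x = \int[mu]_(x in A) f x)%E.
Proof.
move=> mf f0; rewrite (@ge0_negligible_integral _ _ _ _ setT (~` A))//.
- rewrite setTD setCK; apply: eq_measure_integral => B mB BA.
 by change (mu (B `&` A) = mu B); rewrite (setIidl BA).
- exact: measurableC.
- by change (mu (~` A `&` A) = 0%E); rewrite setICl measure0.
Qed.

(** The law is the normalization of [rho] plus t times its restriction to [A]. *)
Lemma perturb {R} (rho : prob R) A t : measurable A -> 0 <= t -> exists nu : prob R,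
  (forall K, measurable K -> rho K = 1%E -> nu K = 1%E) /\
  (forall f : R -> \bar R, measurable_fun setT f -> (forall x, (0 <= f x)%E) ->
   ((1 + t * fine (rho A))%:E * \int[nu]_x f x = \int[rho]_x f x + t%:E * \int[rho]_(x in A) f x)%E).
Proof.
move=> mA t0; have a0 : 0 <= fine (rho A) by rewrite fine_ge0.
pose m := measure_add rho (mscale (NngNum t0) (mrestr rho mA)).
have rA : rho A = (fine (rho A))%:E by rewrite fineK// fin_num_measure.
have mE B : m B = (rho B + t%:E * rho (B `&` A))%E by rewrite /m measure_addE.
have mT : m setT = (1 + t * fine (rho A))%:E.
 by rewrite mE probability_setT setTI rA.
have p0 : 0 < 1 + t * fine (rho A) by rewrite ltr_pwDl// mulr_ge0.
pose nu : prob R := mnormalize m rho.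
have nuE B : nu B = ((1 + t * fine (rho A))^-1%:E * m B)%E.
 have -> : nu B = (if (m setT == 0%E) || (m setT == +oo%E) then rho B else m B * ((fine (m setT))^-1)%:E)%E.
  transitivity ((if (m setT == 0%E) || (m setT == +oo%E) then (fun U => rho U)
   else (fun U => (m U * ((fine (m setT))^-1)%:E)%E)) B); first by [].
  by case: ifP.
 rewrite mT ifF 1?muleC//.
 by apply/negbTE; rewrite negb_or/= andbT eqe gt_eqF.
have mf_int f : measurable_fun setT f -> (forall x, (0 <= f x)%E) -> (\int[m]_x f x =
   \int[rho]_x f x + t%:E * \int[rho]_(x in A) f x)%E.
 move=> mf f0; rewrite ge0_integral_measure_add//; congr (_ + _)%E.
 by rewrite ge0_integral_mscale//= integral_mrestr.
exists nu; split => [K mK rK|f mf f0].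
 rewrite nuE mE rK.
 rewrite (_ : rho (K `&` A) = rho A).
  rewrite rA; set a := fine (rho A) in p0 *.
  transitivity (((1 + t * a)^-1 * (1 + t * a))%:E) => //.
  by rewrite mulVf// gt_eqF.
 have := @measureD _ _ _ rho A K mA mK; rewrite setDE => H.
 have HK : rho (A `&` ~` K) = 0%E.
  apply/eqP; rewrite -measure_le0 -(prob_compl0 mK rK).
  by apply: le_measure; rewrite ?inE//; [exact: measurableI (measurableC _)|exact: measurableC].
 rewrite setIC -[in RHS](setIT A) -(setUv K) setIUr measureU//.
 - by rewrite [X in (_ + X)%E]HK adde0.
 - exact: measurableI.
 - by apply: measurableI => //; exact: measurableC.
 - by rewrite setIACA setICr setI0.
rewrite -mf_int//.
have k0 : 0 <= (1 + t * fine (rho A))^-1 by rewrite invr_ge0 ltW.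
rewrite (@eq_measure_integral _ _ _ _ (mscale (NngNum k0) m)); last first.
 by move=> B mB _; exact: nuE.
rewrite ge0_integral_mscale//= muleA -EFinM divff ?mul1e// gt_eqF//.
Qed.

Lemma kk_meas2 {R} C : measurable_fun setT (fun z : R * R => kk C z.1 z.2).
Proof.
apply: (emeasurable_fun_cvg (fun M (z : R * R) => (kM C M z.1 z.2)%:E)) => [M|y _].
 apply/measurable_EFinP; rewrite /kM; apply: measurable_maxr => //.
 apply: measurable_funB => //; apply: measurableT_comp; first exact: measurable_ln.
 apply: measurable_maxr => //; apply: measurableT_comp => //.
 exact: measurable_funB.
exact: kM_cvg.
Qed.

Lemma UkA_swap {R} (rho : prob R) C A : measurable A ->
 (\int[rho]_x \int[rho]_(y in A) kk C x y = \int[rho]_(x in A) Uk C rho x)%E.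
Proof.
move=> mA.
have H x : (\int[rho]_(y in A) kk C x y = \int[rho]_y (kk C x y * (\1_A y)%:E))%E.
 rewrite integral_mkcond; apply: eq_integral => y _; rewrite patchE indicE.
 by case: (y \in A); rewrite ?mule1 ?mule0.
under eq_integral do rewrite H.
rewrite (@fubini_tonelli _ _ _ _ _ rho rho (fun z => kk C z.1 z.2 * (\1_A z.2)%:E)%E)/=.
- rewrite [RHS]integral_mkcond; apply: eq_integral => y _; rewrite patchE.
 have -> : (\int[rho]_x (kk C x y * (\1_A y)%:E) = Uk C rho y * (\1_A y)%:E)%E.
  rewrite -ge0_integralZr//; [|exact: kk_meas|by move=> x _; exact: kk_ge0].
  by apply: eq_integral => x _; rewrite kkC.
 by rewrite indicE; case: (y \in A); rewrite ?mule1 ?mule0.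
- apply: emeasurable_funM; first exact: kk_meas2.
 apply/measurable_EFinP; apply: measurableT_comp => //.
- by move=> z; apply: mule_ge0 => //; exact: kk_ge0.
Qed.

(** Minimality is tested against the perturbed law of [perturb]: the coefficient of t in the energy
    gives the inequality as t tends to 0, the term in t^2 being at most t^2 W. *)
Lemma frostman_variation {R} (rho : prob R) K A C W : measurable K -> rho K = 1%E -> measurable A ->
 (\int[rho]_x Uk C rho x = W%:E)%E -> (forall nu : prob R, nu K = 1%E -> (W%:E <= \int[nu]_x Uk C nu x)%E) ->
 (W%:E * rho A <= \int[rho]_(x in A) Uk C rho x)%E.
Proof.
move=> mK rK mA rW min.
have mU : measurable_fun setT (Uk C rho) by exact: Uk_meas.
have U0 x : (0 <= Uk C rho x)%E by exact: Uk_ge0.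
set J := (\int[rho]_(x in A) _)%E.
have JW : (J <= W%:E)%E by rewrite -rW; apply: ge0_subset_integral.
have J0 : (0 <= J)%E by exact: integral_ge0.
have Jf : J \is a fin_num by rewrite ge0_fin_numE// (le_lt_trans JW)// ltry.
have rA : rho A = (fine (rho A))%:E by rewrite fineK// fin_num_measure.
set a := fine (rho A) in rA *.
have a0 : 0 <= a by rewrite fine_ge0.
pose UA x := (\int[rho]_(y in A) kk C x y)%E.
have UAU x : (UA x <= Uk C rho x)%E.
 by apply: ge0_subset_integral => //; [exact: kk_meas|move=> y _; exact: kk_ge0].
have mUA : measurable_fun setT UA.
 have -> : UA = (fun x => \int[rho]_y (kk C x y * (\1_A y)%:E))%E.
  apply/funext => x; rewrite /UA integral_mkcond; apply: eq_integral => y _.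
  by rewrite patchE indicE; case: (y \in A); rewrite ?mule1 ?mule0.
 apply: (measurable_fun_fubini_tonelli_F (m2 := rho) (fun z => kk C z.1 z.2 * (\1_A z.2)%:E)%E).
  apply: emeasurable_funM; first exact: kk_meas2.
  by apply/measurable_EFinP; apply: measurableT_comp.
 by move=> z; apply: mule_ge0; [exact: kk_ge0|rewrite lee_fin].
have UA0 x : (0 <= UA x)%E by apply: integral_ge0 => y _; exact: kk_ge0.
have key (t : R) : 0 < t -> W * (1 + t * a) ^+ 2 <= W + 2 * t * fine J + t ^+ 2 * W.
 move=> t0; have [nu [nuK nuf]] := perturb rho mA (ltW t0).
 have nK := nuK _ mK rK; have := min nu nK => Wnu.
 have p0 : 0 < 1 + t * a by rewrite ltr_pwDl// mulr_ge0// ltW.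
 have E1 x : ((1 + t * a)%:E * Uk C nu x = Uk C rho x + t%:E * UA x)%E.
  by apply: nuf; [exact: kk_meas|exact: kk_ge0].
 have E2 : ((1 + t * a)%:E * ((1 + t * a)%:E * \int[nu]_x Uk C nu x) =
   W%:E + t%:E * J + t%:E * (J + t%:E * \int[rho]_(x in A) UA x))%E.
  rewrite nuf; [|exact: Uk_meas|exact: Uk_ge0].
  have t0' : (0 <= t%:E)%E by rewrite lee_fin ltW.
  rewrite ge0_muleDr//; last 2 first.
  + by apply: integral_ge0 => x _; exact: Uk_ge0.
  + by apply: mule_ge0 => //; apply: integral_ge0 => x _; exact: Uk_ge0.
  have HD B : measurable B -> ((1 + t * a)%:E * \int[rho]_(x in B) Uk C nu x =
    \int[rho]_(x in B) Uk C rho x + t%:E * \int[rho]_(x in B) UA x)%E.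
   move=> mB; rewrite -ge0_integralZl_EFin//;
    do ?[by move=> x _; exact: Uk_ge0|exact: ltW|by apply: measurable_funTS; exact: Uk_meas].
   under eq_integral do rewrite E1.
   rewrite ge0_integralD//;
    do ?[exact: measurable_funTS|by move=> x _; exact: mule_ge0|by apply: measurable_funeM; exact: measurable_funTS].
   by rewrite ge0_integralZl//; exact: measurable_funTS.
  rewrite HD// rW (@UkA_swap _ rho C A mA) -/J.
  by rewrite muleCA HD.
 have E3 : (\int[rho]_(x in A) UA x <= W%:E)%E.
  by apply: le_trans JW; apply: ge0_le_integral => //; exact: measurable_funTS.
 have E30 : (0 <= \int[rho]_(x in A) UA x)%E by exact: integral_ge0.
 have E4 : (\int[rho]_(x in A) UA x)%E \is a fin_num by rewrite ge0_fin_numE// (le_lt_trans E3)// ltry.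
 have := lee_wpmul2l (ltW (_ : (0 < ((1 + t * a) * (1 + t * a))%:E)%E)) Wnu.
 rewrite lte_fin mulr_gt0// => /(_ isT).
 rewrite [in X in (_ <= X)%E]EFinM -muleA E2.
 have [k kE] : exists k : R, (\int[rho]_(x in A) UA x)%E = k%:E.
  by exists (fine (\int[rho]_(x in A) UA x)%E); rewrite fineK.
 have [j jE] : exists j : R, J = j%:E by exists (fine J); rewrite fineK.
 rewrite kE lee_fin in E3; rewrite kE jE /= => H.
 have {}H : (1 + t * a) * (1 + t * a) * W <= W + t * j + t * (j + t * k).
  by rewrite -lee_fin; exact: H.
 have : t * t * k <= t * t * W by apply: ler_wpM2l => //; rewrite mulr_ge0// ltW.
 by move: H; rewrite !expr2; lra.
rewrite rA -(fineK Jf) -EFinM lee_fin.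
have W0 : 0 <= W by rewrite -lee_fin -rW; exact: integral_ge0.
apply/ler_addgt0Pr => e e0.
pose t := e / (W + 1).
have t0 : 0 < t by rewrite divr_gt0// ltr_wpDl.
have tW : t * (W + 1) = e by rewrite /t divfK// gt_eqF// ltr_wpDl.
have t0' := ltW t0.
have T2 : 0 <= t * t by exact: mulr_ge0.
have T1 : 0 <= t * t * (a * a * W) by rewrite mulr_ge0// mulr_ge0// mulr_ge0.
have T3 : 0 <= t * t * W by rewrite mulr_ge0.
have k := key t t0; rewrite !expr2 in k; rewrite -(ler_pM2l t0) -tW; lra.
Qed.

(** Let A be the closed set where the potential is at most W. The variation on A and the total W
    leave at most W times the mass of the complement for the integral over the complement, where the
    potential exceeds W: the complement is null. *)
Lemma frostman_ae {R} (rho : prob R) K C W : measurable K -> rho K = 1%E -> (\int[rho]_x Uk C rho x = W%:E)%E ->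
 (forall nu : prob R, nu K = 1%E -> (W%:E <= \int[nu]_x Uk C nu x)%E) -> rho [set x | (Uk C rho x <= W%:E)%E] = 1%E.
Proof.
move=> mK rK rW min; set A := [set x | _].
have mU : measurable_fun setT (Uk C rho) by exact: Uk_meas.
have mA : measurable A by apply: closed_measurable; exact: Uk_lsc.
have U0 x : (0 <= Uk C rho x)%E by exact: Uk_ge0.
have JA := frostman_variation mK rK mA rW min.
have mcA : measurable (~` A) by exact: measurableC.
have fA B : measurable B -> rho B = (fine (rho B))%:E by move=> mB; rewrite fineK// fin_num_measure.
have tot : (\int[rho]_(x in A) Uk C rho x + \int[rho]_(x in ~` A) Uk C rho x = W%:E)%E.
 rewrite -rW -ge0_integral_setU//.
 - by rewrite setUv.
 - by rewrite setUv.
 - by apply/disj_setPS => x [].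
have JcA : (\int[rho]_(x in ~` A) Uk C rho x <= W%:E * rho (~` A))%E.
 rewrite probability_setC// fA//.
 have h : (\int[rho]_(x in ~` A) Uk C rho x = W%:E - \int[rho]_(x in A) Uk C rho x)%E.
  rewrite -tot addeAC subee ?add0e// ge0_fin_numE; last exact: integral_ge0.
  apply: le_lt_trans (ltry W); rewrite -tot leeDl//; exact: integral_ge0.
 rewrite h -EFinB; rewrite fA// in JA.
 apply: le_trans (leeB (le_refl _) JA) _.
 by rewrite -!EFinM -EFinB lee_fin; lra.
have null : rho (~` A) = 0%E.
 pose f x := (Uk C rho x - W%:E)%E.
 have f0 x : (~` A) x -> (0 < f x)%E.
  by move=> /negP; rewrite -ltNge => h; rewrite /f sube_gt0.
 have mf : measurable_fun (~` A) f.
  by apply: emeasurable_funB => //; exact: measurable_funTS.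
 have If : (\int[rho]_(x in ~` A) f x = 0)%E.
  apply/eqP; rewrite eq_le; apply/andP; split; last by apply: integral_ge0 => x /f0/ltW.
  have : (\int[rho]_(x in ~` A) f x + \int[rho]_(x in ~` A) W%:E = \int[rho]_(x in ~` A) Uk C rho x)%E.
   rewrite -ge0_integralD//.
   + by apply: eq_integral => x _; rewrite /f subeK.
   + by move=> x /f0/ltW.
   + by move=> x _; rewrite -rW; exact: integral_ge0.
  have [r rE] : exists r : R, rho (~` A) = r%:E by eexists; exact: fA.
  rewrite integral_cst// [X in (_ * X)%E]rE -EFinM => h; move: JcA; rewrite -h rE -EFinM.
  by rewrite -[leRHS]add0e leeD2rE.
 have : ae_eq rho (~` A) f (cst 0%E).
  apply/ae_eq_integral_abs => //.
  rewrite -[RHS]If; apply: eq_integral => x; rewrite inE => /f0 fx.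
  by rewrite gee0_abs// ltW.
 case=> N [mN N0 NA]; apply/eqP; rewrite -measure_le0 -N0.
 apply: le_measure; rewrite ?inE//; apply: subset_trans NA => x Ax /=.
 by move=> /(_ Ax) fx; have := f0 x Ax; rewrite fx ltxx.
have := prob_compl0 mcA; rewrite setCK => _.
have := probability_setC rho mA; rewrite null fA// => /eqP.
by rewrite eq_sym -EFinB eqe subr_eq0 => /eqP <-.
Qed.

(** * Fekete points converge to an energy minimizer *)

Lemma diam_le_exists {R} (K : set R) : compact K -> exists C, diam_le K C.
Proof.
move=> cK; have [B B0 KB] := compact_bound cK.
exists (2 * B); split; first by rewrite mulr_ge0// ltW.
move=> x y Kx Ky; apply: (@le_trans _ _ (2 * B)).
 by have /andP[] := KB x Kx; have /andP[] := KB y Ky; rewrite ler_norml; lra.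
by apply: le_trans (expR_ge1Dx _); rewrite lerDr.
Qed.

Lemma delta_ge {R} K C (s : seq R) : diam_le K C ->
 (1 < size s)%N -> uniq s -> (forall x, x \in s -> K x) -> - C <= delta s.
Proof.
move=> KC s1 us sK; have nn0 : (0 : R) < (size s * (size s).-1)%:R.
 by rewrite ltr0n muln_gt0 (ltn_trans _ s1)//= -ltnS prednK// (ltn_trans _ s1).
rewrite /delta ler_pdivlMr//.
by have := ek_ge0 C s; rewrite (ek_uniq KC)// lee_fin; lra.
Qed.

Lemma min_Uk {R} K C V (mu : prob R) : measurable K -> diam_le K C -> mu K = 1%E -> energy mu = V%:E ->
 robin_constant K = V%:E -> (\int[mu]_x Uk C mu x)%E = (V + C)%:E /\
 (forall nu : prob R, nu K = 1%E -> ((V + C)%:E <= \int[nu]_x Uk C nu x)%E).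
Proof.
move=> mK KC muK EV RV.
have H (nu : prob R) : nu K = 1%E -> (\int[nu]_x Uk C nu x = energy nu + C%:E)%E.
 by move=> nuK; rewrite (energy_Uk mK nuK KC) subeK.
split; first by rewrite H// EV.
move=> nu nuK; rewrite H// EFinD leeD2r// -RV.
by apply: ereal_inf_lbound; exists nu.
Qed.

(** The energy of the limit law is at most V: let n tend to infinity at fixed truncation M, then M.
    Every law on [K] has energy at least [delta (X n)] for each n. The bound [B] on [delta] is what
    makes V finite. *)
Lemma fekete_limit {R} K X (F : set_system nat) B : UltraFilter F -> (\oo `<=` F) -> compact K ->
 (forall n, fekete K (X n)) -> (forall n, size (X n) = n.+2) ->
 (forall n, sorted <=%R (X n)) -> (forall n, delta (X n) <= B) ->
 exists (mu : prob R) (V : R), [/\ mu K = 1%E, energy mu = V%:E,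
  robin_constant K = V%:E, delta (X n) @[n --> F] --> V &
  forall (f : R -> R) (L A : R), 0 <= L -> lip L f -> (forall x, 0 <= f x <= A) ->
   exists2 l : R, (\int[mu]_x (f x)%:E)%E = l%:E & avg (X n) f @[n --> F] --> l].
Proof.
move=> UF ooF cK fX sX oX dB.
have mK := compact_measurable cK.
have [C KC] := diam_le_exists cK.
have XK n x : x \in X n -> K x by case: (fX n) => _ + _; apply.
have s1 n : (1 < size (X n))%N by rewrite sX.
have [mu [muK mu1 mu2]] := limit_law UF cK (fun n => ltnW (s1 n)) oX XK.
have dC n : - C <= delta (X n).
 by apply: (delta_ge KC (s1 n)); [case: (fX n)|exact: XK].
have dI n : `[- C, B]%classic (delta (X n)) by rewrite /= in_itv/= dC dB.
have [V _ dV] := ultra_cvg UF (@segment_compact _ (- C) B) dI.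
have inv0 : (n.+2%:R^-1 : R) @[n --> F] --> (0 : R).
 apply: cvg_trans (_ : (n.+2%:R^-1 : R) @[n --> \oo] --> _).
  by apply: cvg_app ooF.
 apply/cvgrPdist_lt => e e0; near=> n.
 rewrite sub0r normrN ger0_norm// invf_plt ?posrE//.
 apply: (@lt_trans _ _ n%:R); last by rewrite ltr_nat.
 by near: n; exact: nbhs_infty_gtr.
have IM M : (\int[mu]_x UM C mu M x <= (V + C)%:E)%E.
 have [l lE lcvg] := mu2 (kM C M) (expR M%:R) (`|C| + M%:R) (expR_ge0 _) (kM_lip C M) (kM_lip2 C M) (kM_bound C M).
 rewrite lE lee_fin.
 have up : delta (X n) + C + (`|C| + M%:R - delta (X n) - C) * n.+2%:R^-1 @[n --> F]
   --> V + C + (`|C| + M%:R - V - C) * 0.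
  apply: cvgD; first by apply: cvgD => //; exact: cvg_cst.
  apply: cvgM => //; apply: cvgB; last exact: cvg_cst.
  by apply: cvgB => //; exact: cvg_cst.
 rewrite mulr0 addr0 in up; apply: (ler_cvg_to lcvg up).
 apply: nearW => n; have [un _ _] := fX n.
 by have := @avg_kM_fekete R K C M (X n) KC (s1 n) un (XK n); rewrite sX.
have IU : (\int[mu]_x Uk C mu x <= (V + C)%:E)%E.
 have -> : (\int[mu]_x Uk C mu x = \int[mu]_x limn (fun M => UM C mu M x))%E.
  by apply: eq_integral => x _; apply/esym/cvg_lim => //; exact: UM_cvg.
 have cv : (\int[mu]_x UM C mu M x)%E @[M --> \oo] --> (\int[mu]_x limn (fun M => UM C mu M x))%E.
  apply: cvg_monotone_convergence => //.
  - move=> M; rewrite (_ : UM C mu M = EFin \o (fun x => fine (UM C mu M x))).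
    apply/measurable_EFinP; apply: (@lip_measurable _ (expR M%:R)); first exact: expR_ge0.
    exact: UM_lip.
   by apply/funext => x /=; rewrite fineK// UM_fin.
  - by move=> M x _; apply: integral_ge0 => y _; rewrite lee_fin; have /andP[] := kM_bound C M x y.
  - move=> x _ M N MN; apply: ge0_le_integral => //.
   + by move=> y _; rewrite lee_fin; have /andP[] := kM_bound C M x y.
   + by apply/measurable_EFinP; exact: kM_meas.
   + by apply/measurable_EFinP; exact: kM_meas.
   + by move=> y _; rewrite lee_fin; exact: kM_mono.
 rewrite -(cvg_lim (@ereal_hausdorff R) cv); apply: lime_le; last exact: nearW.
 by apply/cvg_ex; eexists; exact: cv.
have lb (nu : prob R) : nu K = 1%E -> ((V + C)%:E <= \int[nu]_x Uk C nu x)%E.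
 move=> nuK; case E : (\int[nu]_x Uk C nu x)%E => [r| |]; last 2 first.
 - by rewrite leey.
 - have : (0 <= \int[nu]_x Uk C nu x)%E by apply: integral_ge0 => x _; exact: Uk_ge0.
  by rewrite E.
 rewrite lee_fin; have h : delta (X n) + C @[n --> F] --> V + C.
  by apply: cvgD => //; exact: cvg_cst.
 have h' : (fun=> r) @ F --> r by exact: cvg_cst.
 apply: (ler_cvg_to h h'); apply: nearW => n /=.
 by rewrite -lee_fin -E; exact: (fekete_energy mK nuK KC (s1 n) (fX n)).
have EmuV : energy mu = V%:E.
 have -> : energy mu = (\int[mu]_x Uk C mu x - C%:E)%E by exact: energy_Uk KC.
 have -> : (\int[mu]_x Uk C mu x = (V + C)%:E)%E by apply/eqP; rewrite eq_le IU lb.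
 by rewrite -EFinB addrK.
exists mu, V; split => //.
apply/eqP; rewrite eq_le; apply/andP; split.
 by apply: ereal_inf_lbound; exists mu.
apply/ereal_infP => _ [nu nuK <-].
have -> : energy nu = (\int[nu]_x Uk C nu x - C%:E)%E by exact: energy_Uk KC.
by rewrite leeBrDr// -EFinD lb.
Unshelve. all: by end_near. Qed.

(** * Logarithmic potentials of minimizers *)

(** Logarithm of the distance from z to the real point t. As [ln 0 = 0], the value at z = (t, 0) is
    0 and not -oo; laws without atoms do not see the difference. *)
Definition lg {R} (z : plane R) (t : R) : R := ln ((z.1 - t) ^+ 2 + z.2 ^+ 2) / 2.

(** No minus sign: this is the opposite of the usual potential, so Frostman's inequality bounds it
    below by -V. *)
Definition pot {R} (e : set R) (mu : prob R) (z : plane R) : R := \int[mu]_(t in e) lg z t.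

Lemma lg_real {R} (x t : R) : lg (x, 0) t = ln `|x - t|.
Proof.
rewrite /lg/= expr0n/= addr0 -real_normK ?num_real//.
have [->|xt] := eqVneq x t; first by rewrite subrr normr0 expr0n/= ln0// mul0r.
by rewrite lnXn ?normr_gt0 ?subr_eq0// mulr2n; lra.
Qed.

Lemma ln_concave {R} (l u v : R) : 0 <= l <= 1 -> 0 < u -> 0 < v ->
 l * ln u + (1 - l) * ln v <= ln (l * u + (1 - l) * v).
Proof.
move=> /andP[l0 l1] u0 v0; set w := l * u + (1 - l) * v.
have w0 : 0 < w.
 rewrite /w; have [->|ln0] := eqVneq l 0; first by rewrite mul0r add0r subr0 mul1r.
 apply: ltr_pwDl; first by rewrite mulr_gt0// lt_neqAle eq_sym ln0.
 by rewrite mulr_ge0 ?subr_ge0// ltW.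
have tl a : 0 < a -> ln a <= ln w + (a - w) / w.
 move=> a0; rewrite -lerBlDl -ln_div ?posrE//.
 have := @le_ln1Dx R (a / w - 1); rewrite (addrC 1) subrK mulrBl divff ?gt_eqF//; apply.
 by rewrite ltrBrDr addNr divr_gt0.
have h1 := ler_wpM2l l0 (tl u u0).
have l1' : 0 <= 1 - l by rewrite subr_ge0.
have h2 := ler_wpM2l l1' (tl v v0).
apply: le_trans (lerD h1 h2) _.
rewrite le_eqVlt; apply/orP; left; apply/eqP.
have -> : l * (ln w + (u - w) / w) + (1 - l) * (ln w + (v - w) / w) =
  ln w + (l * u + (1 - l) * v - w) / w by field; rewrite gt_eqF.
by rewrite /w subrr mul0r addr0.
Qed.

Lemma setDDsub {T : Type} (K G : set T) : G `<=` K -> K `\` (K `\` G) = G.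
Proof.
move=> GK; apply/seteqP; split => x /=.
 by move=> [Kx] H; apply: contrapT => Gx; apply: H.
by move=> Gx; split; [exact: GK|case].
Qed.

Lemma Rint_restrict {R} (mu : prob R) K G f : measurable K -> measurable G -> G `<=` K -> mu (K `\` G) = 0%E ->
 intR mu K f -> \int[mu]_(x in K) f x = \int[mu]_(x in G) f x.
Proof.
move=> mK mG GK m0 fi; rewrite /Rintegral; congr fine.
rewrite (negligible_integral _ _ fi m0) ?setDDsub//; exact: measurableD.
Qed.

Lemma ae_le_Rint {R} (mu : prob R) K G f g : measurable K -> measurable G -> G `<=` K -> mu (K `\` G) = 0%E ->
 intR mu K f -> intR mu K g -> (forall x, G x -> f x <= g x) -> \int[mu]_(x in K) f x <= \int[mu]_(x in K) g x.
Proof.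
move=> mK mG GK m0 fi gi fg.
rewrite (Rint_restrict mK mG GK m0 fi) (Rint_restrict mK mG GK m0 gi).
by apply: le_Rintegral => //; exact: (integrableS mK mG GK).
Qed.

Lemma ae_integrable {R} (mu : prob R) K G (f g : R -> R) :
 measurable K -> measurable G -> G `<=` K -> mu (K `\` G) = 0%E -> measurable_fun K f -> intR mu K g ->
 (forall x, G x -> `|f x| <= g x) -> intR mu K f.
Proof.
move=> mK mG GK m0 mf gi fg.
have mKG : measurable (K `\` G) by exact: measurableD.
apply/(negligible_integrable mKG mK _ m0); first exact/measurable_EFinP.
rewrite setDDsub//; apply: (@le_integrable _ _ _ mu G mG _ (EFin \o g)) => //.
- by apply/measurable_EFinP; apply: measurable_funS mf.
- by move=> x Gx /=; rewrite lee_fin (le_trans (fg x Gx))// ler_norm.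
- exact: (integrableS mK mG GK).
Qed.

Lemma lg_meas {R} (z : plane R) : measurable_fun setT (lg z).
Proof.
rewrite /lg; apply: measurable_funM => //.
apply: measurableT_comp; first exact: measurable_ln.
apply: measurable_funD => //; apply: measurable_funX.
exact: measurable_funB.
Qed.

Lemma bounded_integrable {R} (mu : prob R) K (f : R -> R) B :
 measurable K -> measurable_fun setT f -> (forall x, K x -> `|f x| <= B) -> intR mu K f.
Proof.
move=> mK mf fB; apply: measurable_bounded_integrable => //.
- by apply: (@le_lt_trans _ _ 1%E); rewrite ?ltry// probability_le1.
- exact: measurable_funTS.
- exact: norm_bounded_on fB.
Qed.
Arguments bounded_integrable {R mu K f} B.

Lemma cst_integrable {R} (mu : prob R) K (c : R) : measurable K -> intR mu K (fun=> c).
Proof. by move=> mK; apply: (bounded_integrable `|c|). Qed.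

Lemma Rint_prob_cst {R} (mu : prob R) K r : measurable K -> mu K = 1%E -> \int[mu]_(x in K) r = r.
Proof. by move=> mK muK; rewrite Rintegral_cst//; rewrite [X in fine X]muK mulr1. Qed.

Lemma lg_le_lg0 {R} z (t : R) : z.1 != t -> lg (z.1, 0) t <= lg z t.
Proof.
move=> zt; rewrite /lg /= ler_pM2r ?invr_gt0// expr0n/= addr0.
have p : 0 < (z.1 - t) ^+ 2 by rewrite exprn_even_gt0//= subr_eq0.
rewrite ler_ln ?posrE//; first by rewrite lerDl sqr_ge0.
by rewrite ltr_wpDr// sqr_ge0.
Qed.

Lemma lg_ub {R} z (B : R) : 0 < B -> exists M, forall t, - B <= t <= B -> lg z t <= M.
Proof.
move=> B0; exists ((`|z.1| + B) ^+ 2 + z.2 ^+ 2 ).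
move=> t tB; rewrite /lg ler_pdivrMr//.
set u := (z.1 - t) ^+ 2 + z.2 ^+ 2.
have uu : u <= (`|z.1| + B) ^+ 2 + z.2 ^+ 2.
 have h : `|z.1 - t| <= `|z.1| + B.
  by apply: le_trans (ler_normB _ _) _; rewrite lerD2l ler_norml.
 rewrite lerD2r -[leLHS]real_normK ?num_real//.
 by rewrite lerXn2r// nnegrE addr_ge0// ltW.
have u0 : 0 <= u by rewrite addr_ge0 ?sqr_ge0.
have : ln u <= u.
 have [->|un] := eqVneq u 0; first by rewrite ln0.
 by rewrite ltW// ln_sublinear// lt_neqAle eq_sym un.
lra.
Qed.

(** What later arguments retain of a minimizer. The last field is Frostman's inequality at every
    point of the plane, not only almost everywhere. *)
Record pot_ok {R} (K : set R) (mu : prob R) (V : R) : Prop := PotOk { pot_mass : mu K = 1%E;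
 pot_atom : forall t, mu [set t] = 0%E; pot_int : forall z : plane R, intR mu K (lg z);
 pot_ge : forall z : plane R, - V <= pot K mu z }.

(** On the real line the maximum principle for potentials is elementary. Take the points a, b of [B]
    next to x = z.1 on either side, with x = l a + (1 - l) b: no point of [B] lies strictly between
    them, so |x - t| is the same combination of |a - t| and |b - t|, and concavity of ln bounds ln
    |x - t| from below. Beyond the ends of [B] the nearest point alone serves, and leaving the axis
    only increases the distance. *)
Lemma frostman_dominated {R} K B (mu : prob R) V : compact K -> closed B -> B `<=` K -> mu B = 1%E -> measurable K ->
 (forall t, B t -> mu [set t] = 0%E) -> (forall t, B t -> intR mu K (lg (t, 0))) ->
 (forall t, B t -> - V <= pot K mu (t, 0)) -> pot_ok K mu V.
Proof.
move=> cK cB BK muB mK Bat Bint Bge.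
have mB : measurable B by exact: closed_measurable.
have muK : mu K = 1%E.
 apply/eqP; rewrite eq_le probability_le1//= -muB; apply: le_measure; rewrite ?inE//.
have cpB : compact B by apply: subclosed_compact cK BK.
have [M M0 KM] := compact_bound cK.
have at0 t : mu [set t] = 0%E.
 have [/Bat//|Bt] := pselect (B t).
 apply/eqP; rewrite -measure_le0 -(prob_compl0 mB muB).
 by apply: le_measure; rewrite ?inE//; [exact: measurableC|move=> x ->].
have Bne : exists t, B t.
 apply/not_existsP => H; move: muB; rewrite (_ : B = set0) ?measure0.
  by move/eqP; rewrite eq_sym onee_eq0.
 by apply/seteqP; split => // x /H.
have dom (z : plane R) : exists a b l, [/\ B a, B b, 0 <= l <= 1 & forall t, B t -> t != a -> t != b -> t != z.1 ->
   l * lg (a, 0) t + (1 - l) * lg (b, 0) t <= lg z t].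
 pose x := z.1.
 have left : (exists2 a, B a & a <= x) -> exists2 a, B a /\ a <= x & forall t, B t -> t <= x -> t <= a.
  move=> [a0 Ba0 a0x].
  have [|||a aB amax] := @compact_EVT_max R R id (B `&` [set t | t <= x]) _ _ _.
  - by exists a0.
  - by apply: compact_closedI => //; exact: closed_le.
  - by apply: continuous_subspaceT => t; exact: cvg_id.
  - exists a; first by move: aB; rewrite inE => -[].
   by move=> t Bt tx; apply: amax; rewrite inE.
 have right : (exists2 a, B a & x <= a) -> exists2 a, B a /\ x <= a & forall t, B t -> x <= t -> a <= t.
  move=> [a0 Ba0 a0x].
  have [|||a aB amax] := @compact_EVT_max R R -%R (B `&` [set t | x <= t]) _ _ _.
  - by exists a0.
  - by apply: compact_closedI => //; exact: closed_ge.
  - by apply: continuous_subspaceT => t; exact: opp_continuous.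
  - exists a; first by move: aB; rewrite inE => -[].
   by move=> t Bt tx; rewrite -lerN2; apply: amax; rewrite inE.
 have main a b l : 0 <= l <= 1 -> (forall t, B t -> t != a -> t != b -> t != x ->
   l * lg (a, 0) t + (1 - l) * lg (b, 0) t <= lg (x, 0) t) -> (forall t, B t -> t != a -> t != b -> t != z.1 ->
   l * lg (a, 0) t + (1 - l) * lg (b, 0) t <= lg z t).
  move=> l01 H t Bt ta tb tz; apply: le_trans (H t Bt ta tb tz) _.
  by apply: lg_le_lg0; rewrite eq_sym.
 have [/left [a [Ba ax] amax]|nl] := pselect (exists2 a, B a & a <= x); last first.
  have [b0 Bb0] := Bne.
  have xb0 : x <= b0 by rewrite leNgt; apply/negP => /ltW b0x; apply: nl; exists b0.
  have /right [b [Bb xb] bmin] : exists2 a, B a & x <= a by exists b0.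
  exists b, b, 1; split => //; first by rewrite lexx ler01.
  apply: main => [|t Bt tb _ tx]; first by rewrite lexx ler01.
  have xt : x <= t by rewrite leNgt; apply/negP => /ltW tx'; apply: nl; exists t.
  have bt := bmin t Bt xt.
  rewrite subrr mul0r addr0 mul1r !lg_real ler_ln ?posrE ?normr_gt0 ?subr_eq0 1?eq_sym//.
  by rewrite !ler0_norm ?subr_le0//; lra.
 have [/right [b [Bb xb] bmin]|nr] := pselect (exists2 a, B a & x <= a); last first.
  exists a, a, 1; split => //; first by rewrite lexx ler01.
  apply: main => [|t Bt ta _ tx]; first by rewrite lexx ler01.
  have xt : t <= x by rewrite leNgt; apply/negP => /ltW tx'; apply: nr; exists t.
  have bt := amax t Bt xt.
  rewrite subrr mul0r addr0 mul1r !lg_real ler_ln ?posrE ?normr_gt0 ?subr_eq0 1?eq_sym//.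
  by rewrite !ger0_norm ?subr_ge0//; lra.
 have [ab|ab] := eqVneq a b.
  have ax' : a = x by apply/eqP; rewrite eq_le ax ab xb.
  exists a, a, 1; split => //; first by rewrite lexx ler01.
  apply: main => [|t Bt ta _ tx]; first by rewrite lexx ler01.
  by rewrite subrr mul0r addr0 mul1r ax'.
 have ba : 0 < b - a by rewrite subr_gt0 lt_neqAle ab (le_trans ax xb).
 pose l := (b - x) / (b - a).
 have l01 : 0 <= l <= 1.
  rewrite /l divr_ge0 ?subr_ge0 ?(ltW ba)//= ?ler_pdivrMr ?mul1r ?lerB//.
  by rewrite (le_trans ax).
 have xE : l * a + (1 - l) * b = x by rewrite /l; field; rewrite gt_eqF.
 exists a, b, l; split => //; apply: main => // t Bt ta tb tx.
 rewrite !lg_real.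
 have [tx'|xt'] := leP t x.
  have tlea := amax t Bt tx'.
  rewrite !ger0_norm ?subr_ge0//; [|exact: le_trans tlea (le_trans ax xb)].
  have a0 : 0 < a - t by rewrite subr_gt0 lt_neqAle ta.
  have b0 : 0 < b - t by rewrite subr_gt0 lt_neqAle tb (le_trans tlea (le_trans ax xb)).
  have := ln_concave l01 a0 b0.
  by rewrite (_ : l * (a - t) + (1 - l) * (b - t) = x - t)// -xE; ring.
 have tleb := bmin t Bt (ltW xt').
 rewrite !ler0_norm ?subr_le0//; [|exact: ltW|exact: le_trans ax (le_trans xb tleb)].
 have a0 : 0 < - (a - t) by rewrite opprB subr_gt0 (le_lt_trans ax).
 have b0 : 0 < - (b - t) by rewrite opprB subr_gt0 lt_neqAle eq_sym tb.
 have := ln_concave l01 a0 b0.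
 by rewrite (_ : l * - (a - t) + (1 - l) * - (b - t) = - (x - t))// -xE; ring.
have dom' (z : plane R) : intR mu K (lg z) /\ - V <= pot K mu z.
 have [a [b [l [Ba Bb l01 H]]]] := dom z.
 pose G := B `\` ([set a] `|` [set b] `|` [set z.1]).
 have mS : measurable ([set a] `|` [set b] `|` [set z.1]).
  by apply: measurableU => //; exact: measurableU.
 have mG : measurable G by exact: measurableD.
 have GK : G `<=` K by move=> t [/BK].
 have KG0 : mu (K `\` G) = 0%E.
  apply/eqP; rewrite -measure_le0.
  apply: (@le_trans _ _ (mu (~` B `|` ([set a] `|` [set b] `|` [set z.1])))).
   apply: le_measure; rewrite ?inE; [exact: measurableD|by apply: measurableU => //; exact: measurableC|].
   move=> t [Kt] nG; have [Bt|Bt] := pselect (B t); last by left.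
   by right; apply: contrapT => nt; apply: nG.
  apply: le_trans (measureU2 _ _ _) _ => //; first exact: measurableC.
  rewrite [X in (X + _)%E](prob_compl0 mB muB) add0e.
  apply: le_trans (measureU2 _ _ _) _ => //; first exact: measurableU.
  rewrite [X in (_ + X)%E]at0 adde0.
  by apply: le_trans (measureU2 _ _ _) _ => //; rewrite [X in (X + _)%E]at0 [X in (_ + X)%E]at0 adde0.
 pose f t := l * lg (a, 0) t + (1 - l) * lg (b, 0) t.
 have fi : intR mu K f.
  have i1 := integrableZl mK l (Bint a Ba); have i2 := integrableZl mK (1 - l) (Bint b Bb).
  exact: (integrableD mK i1 i2).
 have [N HN] := lg_ub z M0.
 have lgi : intR mu K (lg z).
  have gi : intR mu K (fun t => `|f t| + `|N|).
   have j1 := integrable_norm fi.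
   have j2 : intR mu K (fun=> `|N|).
    by apply: (bounded_integrable `|N|) => // x _; rewrite normr_id.
   exact: (integrableD mK j1 j2).
  apply: (ae_integrable mK mG GK KG0 _ gi).
   exact: measurable_funTS (lg_meas z).
  move=> t [Bt /= /not_orP[/not_orP[ta tb] tz]].
  have h1 : f t <= lg z t by apply: H => //; apply/eqP.
  have h2 : lg z t <= N by apply/HN/KM/BK.
  have := ler_norm N; have := ler_norm (- f t); rewrite normrN.
  have := normr_ge0 N; have := normr_ge0 (f t).
  by rewrite ler_norml => ? ? ? ?; apply/andP; split; lra.
 split => //.
 apply: (@le_trans _ _ (\int[mu]_(t in K) f t)).
  have i1 := integrableZl mK l (Bint a Ba); have i2 := integrableZl mK (1 - l) (Bint b Bb).
  rewrite /f RintegralD// !RintegralZl//; try exact: Bint.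
  have /andP[l0 l1] := l01; have pa := Bge a Ba; have pb := Bge b Bb.
  rewrite /pot in pa pb.
  have q1 := ler_wpM2l l0 pa; have l1' : 0 <= 1 - l by rewrite subr_ge0.
  have q2 := ler_wpM2l l1' pb; lra.
 apply: (ae_le_Rint mK mG GK KG0 fi lgi) => t [Bt /= /not_orP[/not_orP[ta tb] tz]].
 by apply: H => //; apply/eqP.
by split => // z; case: (dom' z).
Qed.

(** [frostman_dominated] is applied to the part of [K] where [Uk] is at most V + C. An atom there
    would make [Uk] infinite, since [kk] is +oo on the diagonal. *)
Lemma frostman_pot {R} K (mu : prob R) V : compact K -> mu K = 1%E -> energy mu = V%:E -> robin_constant K = V%:E ->
 pot_ok K mu V.
Proof.
move=> cK muK EV RV.
have mK := compact_measurable cK.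
have [C KC] := diam_le_exists cK.
have [W1 W2] := min_Uk mK KC muK EV RV.
pose A := [set x | (Uk C mu x <= (V + C)%:E)%E].
have cA : closed A by exact: Uk_lsc.
have mA : measurable A by exact: closed_measurable.
have muA : mu A = 1%E by exact: (frostman_ae mK muK W1 W2).
have cAK : closed (K `&` A) by apply: closedI => //; exact: compact_closed.
have muKA : mu (K `&` A) = 1%E.
 apply/eqP; rewrite eq_le probability_le1/=; last exact: measurableI.
 rewrite -[X in (_ <= X)%E](@adde0 R) -(prob_compl0 mA muA) -muK.
 rewrite (_ : K = (K `&` A) `|` (K `&` ~` A)); last by rewrite -setIUr setUv setIT.
 have mcA : measurable (~` A) by exact: measurableC.
 have mKcA : measurable (K `&` ~` A) by exact: measurableI.
 apply: le_trans (measureU2 _ _ _) _ => //; first exact: measurableI.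
 rewrite -setIUr setUv setIT leeD2l//.
 by apply: le_measure; rewrite ?inE//; move=> x [].
have kkf x : A x -> mu.-integrable setT (kk C x).
 move=> Ax; apply/integrableP; split; first exact: kk_meas.
 under eq_integral do rewrite gee0_abs ?kk_ge0//.
 exact: le_lt_trans Ax (ltry _).
have at0 x : A x -> mu [set x] = 0%E.
 move=> Ax; apply/eqP; rewrite -measure_le0 leNgt; apply/negP => p0.
 have : (\int[mu]_(y in [set x]) kk C x y <= Uk C mu x)%E.
  by apply: ge0_subset_integral => //; [exact: kk_meas|move=> y _; exact: kk_ge0].
 have -> : (\int[mu]_(y in [set x]) kk C x y = \int[mu]_(y in [set x]) +oo)%E.
  by apply: eq_integral => y; rewrite inE => ->; rewrite /kk eqxx.
 rewrite integral_cst// gt0_mulye// => h.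
 by have := le_trans h Ax; rewrite leye_eq.
have mlg x : measurable_fun K (lg (x, 0)) by apply: measurable_funTS; exact: lg_meas.
have kkE x t : K x -> K t -> t != x -> kk C x t = (C - lg (x, 0) t)%:E.
 move=> Kx Kt tx; rewrite (kk_lne KC Kx Kt) lg_real lne_EFin.
  by rewrite -EFinN -EFinD addrC.
 by rewrite normr_gt0 subr_eq0 eq_sym.
have KG x : A x -> [/\ measurable (K `\ x), K `\ x `<=` K & mu (K `\` (K `\ x)) = 0%E].
 move=> Ax; split; [exact: measurableD|by move=> t []|].
 apply/eqP; rewrite -measure_le0 -(at0 x Ax); apply: le_measure; rewrite ?inE//.
  by apply: measurableD => //; exact: measurableD.
 by move=> t [Kt] nt; apply: contrapT => tx; apply: nt.
have int x : K x -> A x -> intR mu K (lg (x, 0)).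
 move=> Kx Ax; have [mG GK G0] := KG x Ax.
 apply: (ae_integrable mK mG GK G0 (mlg x) (g := fun t => `|C| + fine (kk C x t))).
  have j1 : intR mu K (fun=> `|C|).
   by apply: (bounded_integrable `|C|) => // t _; rewrite normr_id.
  have j2 : intR mu K (fun t => fine (kk C x t)).
   apply: (negligible_integrable _ _ _ G0).2 => //.
   - exact: measurableD.
   - apply/measurable_EFinP; apply: measurableT_comp => //.
    by apply: measurable_funTS; exact: kk_meas.
   - rewrite (setDDsub GK).
    apply: (eq_integrable mG (kk C x)).
     by move=> t; rewrite inE => -[Kt /eqP tx]; rewrite /= kkE.
    exact: (integrableS measurableT mG (@subsetT _ _) (kkf x Ax)).
  exact: (integrableD mK j1 j2).
 move=> t [Kt /eqP tx]; rewrite (kkE _ _ Kx Kt tx)/=.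
 have : (0 <= kk C x t)%E by exact: kk_ge0.
 rewrite (kkE _ _ Kx Kt tx) lee_fin => h.
 have := ler_norm C; have C0 := KC.1; rewrite (ger0_norm C0) ler_norml => _.
 by apply/andP; split; lra.
apply: (@frostman_dominated _ _ (K `&` A)) => //.
- by move=> t [_ /at0].
- by move=> t [Kt At]; exact: int.
- move=> t [Kt At]; have [mG GK G0] := KG t At.
 have i1 := int t Kt At.
 have h : (\int[mu]_(s in K `\ t) (C - lg (t, 0) s)%:E <= (V + C)%:E)%E.
  apply: le_trans At; rewrite /Uk.
  apply: (@le_trans _ _ (\int[mu]_(s in K `\ t) kk C t s)%E).
   apply: ge0_le_integral => //.
   + by move=> s [Ks /eqP st]; rewrite -kkE//; exact: kk_ge0.
   + apply/measurable_EFinP; apply: measurable_funB => //.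
    by apply: measurable_funTS; exact: lg_meas.
   + by apply: measurable_funTS; exact: kk_meas.
   + by move=> s [Ks /eqP st]; rewrite -kkE.
  by apply: ge0_subset_integral => //; [exact: kk_meas|move=> s _; exact: kk_ge0].
 have mu1 : mu (K `\ t) = 1%E.
  apply/eqP; rewrite eq_le probability_le1//=.
  have h2 : (mu (K `\ t `|` [set t]) <= mu (K `\ t) + mu [set t])%E by exact: measureU2.
  rewrite [X in (_ <= _ + X)%E](at0 t At) adde0 in h2.
  apply: le_trans h2; rewrite -muK.
  apply: le_measure; rewrite ?inE//; first exact: measurableU.
  by move=> s Ks; have [->|/eqP st] := eqVneq s t; [right|left].
 have i2 := integrableS mK mG GK i1.
 have ic : intR mu (K `\ t) (fun=> C).
  by exact: cst_integrable.
 have i3 := integrableB mG ic i2.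
 have h' : \int[mu]_(s in K `\ t) (C - lg (t, 0) s) <= V + C.
  by rewrite -lee_fin fineK//; exact: integrable_fin_num i3.
 rewrite RintegralB// Rint_prob_cst// in h'.
 by rewrite /pot (Rint_restrict mK mG GK G0 i1); lra.
Qed.

(** * Maximum principles by four-point differences *)

Lemma compact_usc_max {d} {O : orderType d} {T : topologicalType} (C : set T) (f : T -> O) : compact C -> C !=set0 ->
 (forall p q, C p -> C q -> (f p < f q)%O -> \forall z \near p, C z -> (f z < f q)%O) ->
 exists2 p, C p & forall z, C z -> (f z <= f p)%O.
Proof.
move=> cC [c0 Cc0] usc.
pose B q := [set z | C z /\ (f q <= f z)%O].
pose F := filter_from C B.
have FF : ProperFilter F.
 apply: filter_from_proper; last by move=> q Cq; exists q; split.
 apply: filter_from_filter; first by exists c0.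
 move=> p q Cp Cq; case: (leP (f p) (f q)) => pq.
  exists q => // z [Cz qz]; split; split => //; exact: le_trans qz.
 by exists p => // z [Cz pz]; split; split => //; apply: le_trans pz; rewrite ltW.
have FC : F C by exists c0 => // z [].
have [p [Cp clp]] := cC F FF FC.
exists p => // q Cq; rewrite leNgt; apply/negP => pq.
have Fq : F (B q) by exists q.
have [z [[Cz qz] H]] := clp _ _ Fq (usc p q Cp Cq pq).
by have := H Cz; rewrite ltNge qz.
Qed.

Definition sqn {R} (z : plane R) : R := z.1 ^+ 2 + z.2 ^+ 2.

Definition rot {R} (h : plane R) : plane R := (- h.2, h.1).

(** [rot] is multiplication by i, so the four points are z + h, z - h, z + ih and z - ih; the
    difference with 4 g(z) plays the part of the Laplacian. *)
Definition sum4 {R} (g : plane R -> R) (z h : plane R) : R := g (z + h) + g (z - h) + g (z + rot h) + g (z - rot h).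

Lemma sqn_ge0 {R} (z : plane R) : 0 <= sqn z.
Proof. by rewrite addr_ge0 ?sqr_ge0. Qed.

(** A positive value of f in D, with nonpositive upper limits at the boundary, forces f + eta |z|^2
    to attain its maximum in D; the quadratic term supplies the strictness that the maximum
    principles exploit. *)
Lemma max_quadratic {R} D f B z1 : (forall z, D z -> `|z.1| <= B /\ `|z.2| <= B) ->
 (forall z, D z -> (f z < +oo)%E) ->
 (forall z, D z -> forall a : R, (f z < a%:E)%E -> \forall y \near z, D y -> (f y < a%:E)%E) ->
 (forall z, ~ D z -> forall eps : R, 0 < eps -> \forall y \near z, D y -> (f y < eps%:E)%E) ->
 D z1 -> (0 < f z1)%E -> exists p eta, [/\ D p, 0 < eta, (-oo < f p)%E &
  forall z, D z -> (f z + (eta * sqn z)%:E <= f p + (eta * sqn p)%:E)%E].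
Proof.
move=> DB foo usc bd D1 f1.
have [r fr] : exists r : R, f z1 = r%:E.
 by case: (f z1) (foo _ D1) f1 => [r| |]//; exists r.
have r0 : 0 < r by rewrite fr lte_fin in f1.
have B0 : 0 <= B by have [] := DB _ D1; move=> /(le_trans (normr_ge0 _)).
have sqB z : D z -> sqn z <= 2 * B ^+ 2.
 move=> /DB [a b]; rewrite /sqn mulr2n mulrDl mul1r; apply: lerD.
  by rewrite -real_normK ?num_real// lerXn2r// nnegrE.
 by rewrite -real_normK ?num_real// lerXn2r// nnegrE.
(* On D one has |z|^2 <= 2 B^2, so eta |z|^2 <= r / 2: points with f < r / 4 stay below the value
   reached at z1, and only the compact set [C] matters. *)
pose eta := r / (4 * (B ^+ 2 + 1)).
have B1 : 0 < B ^+ 2 + 1 by rewrite ltr_wpDl// sqr_ge0.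
have eta0 : 0 < eta by rewrite divr_gt0// mulr_gt0.
have etaB z : D z -> eta * sqn z <= r / 2.
 move=> /sqB h; apply: le_trans (ler_wpM2l (ltW eta0) h) _.
 rewrite /eta mulrAC ler_pdivrMr ?mulr_gt0//.
 have := sqr_ge0 B => hB; nra.
pose C := [set z | D z /\ ((r / 4)%:E <= f z)%E].
have CC : compact C.
 apply: (@subclosed_compact _ _ (`[- B, B] `*` `[- B, B])).
 - rewrite -openC openE => p /= nCp; rewrite /interior.
  have [Dp|nDp] := pselect (D p).
   have fp : (f p < (r / 4)%:E)%E by rewrite ltNge; apply/negP => h; apply: nCp.
   apply: filterS (usc p Dp _ fp) => z h [Dz]; rewrite leNgt => /negP; apply; exact: h.
  have r4 : 0 < r / 4 by rewrite divr_gt0.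
  apply: filterS (bd p nDp _ r4) => z h [Dz]; rewrite leNgt => /negP; apply; exact: h.
 - by apply: compact_setX; exact: segment_compact.
 - by move=> z [/DB[a b] _]; split; rewrite /= in_itv/= -ler_norml.
have C1 : C z1.
 split => //; rewrite fr lee_fin ler_pdivrMr//; lra.
pose g z := (f z + (eta * sqn z)%:E)%E.
have cq : continuous (fun z : plane R => eta * sqn z).
 move=> z; apply: cvgM; first exact: cvg_cst.
 by apply: cvgD; apply: cvgM; (exact: cvg_fst || exact: cvg_snd).
have [|p [Dp fp] pmax] := compact_usc_max CC (f := g) (ex_intro _ _ C1).
 move=> p q [Dp p4] [Dq q4] pq.
 have [a fpE] : exists a : R, f p = a%:E.
  by case: (f p) (foo _ Dp) p4 => [a| |]//; exists a.
 have [b fqE] : exists b : R, f q = b%:E.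
  by case: (f q) (foo _ Dq) q4 => [b| |]//; exists b.
 move: pq; rewrite /g fpE fqE -!EFinD lte_fin => pq.
 set s := b + _ in pq *; set dd := s - (a + eta * sqn p).
 have dd0 : 0 < dd by rewrite subr_gt0.
 have fpa : (f p < (a + dd / 2)%:E)%E by rewrite fpE lte_fin ltrDl divr_gt0.
 have n2 : \forall z \near p, eta * sqn z < eta * sqn p + dd / 2.
  have /cvgrPdist_lt/(_ _ (divr_gt0 dd0 (ltr0Sn R 1))) := cq p.
  apply: filterS => z; rewrite ltr_norml => /andP[h _]; move: h; lra.
 apply: filterS2 (usc p Dp _ fpa) n2 => z h1 h2 [Dz z4].
 have := h1 Dz; case: (f z) (foo _ Dz) z4 => [c| |]// _ _.
 rewrite lte_fin -EFinD lte_fin => h3.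
 rewrite (_ : s = a + eta * sqn p + dd); last by rewrite /dd addrC subrK.
 lra.
exists p, eta; split => //; first by apply: lt_le_trans fp; rewrite ltNyr.
move=> z Dz; have [zC|zC] := pselect (C z); first exact: pmax.
apply: le_trans (pmax _ C1).
have : (f z < (r / 4)%:E)%E by rewrite ltNge; apply/negP => h; apply: zC.
case: (f z) (foo _ Dz) => [c| |]// _; last by rewrite addNye leNye.
rewrite /g fr lte_fin -!EFinD lee_fin => h; have := etaB _ Dz; have := mulr_ge0 (ltW eta0) (sqn_ge0 z1).
lra.
Qed.

(** Nonnegative Laplacian as an o(s^2) lower bound for the four-point difference along the axes. *)
Definition sub4 {R} (f : plane R -> R) (z : plane R) : Prop := forall eps : R, 0 < eps -> exists2 r : R, 0 < r &
  forall s, 0 < s -> s < r -> - (eps * s ^+ 2) <= sum4 f z (s, 0) - 4 * f z.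

Lemma near_axes {R} D (z : plane R) : (\forall y \near z, D y) ->
 exists2 r : R, 0 < r & forall h : plane R, sqn h < r ^+ 2 -> D (z + h).
Proof.
move=> [[A B] /= [/nbhs_ballP[a a0 aA] /nbhs_ballP[b b0 bB]] AB].
exists (Num.min a b); first by rewrite lt_min a0 b0.
move=> h hr; apply: AB; split => /=.
 apply: aA; rewrite /ball/= opprD addrA subrr add0r normrN.
 have := lt_le_trans hr (_ : Num.min a b ^+ 2 <= a ^+ 2); rewrite /sqn => hh.
 rewrite -(@ltr_pXn2r _ 2) ?nnegrE ?(ltW a0)// real_normK ?num_real//.
 apply: le_lt_trans (hh _); first by rewrite lerDl sqr_ge0.
 by rewrite lerXn2r ?nnegrE ?le_min ?(ltW a0) ?(ltW b0)// ge_min lexx.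
apply: bB; rewrite /ball/= opprD addrA subrr add0r normrN.
have := lt_le_trans hr (_ : Num.min a b ^+ 2 <= b ^+ 2); rewrite /sqn => hh.
rewrite -(@ltr_pXn2r _ 2) ?nnegrE ?(ltW b0)// real_normK ?num_real//.
apply: le_lt_trans (hh _); first by rewrite lerDr sqr_ge0.
by rewrite lerXn2r ?nnegrE ?le_min ?(ltW a0) ?(ltW b0)// ge_min lexx orbT.
Qed.

Lemma sum4_sqn {R} (z h : plane R) : sum4 sqn z h = 4 * sqn z + 4 * sqn h.
Proof. by rewrite /sum4 /sqn /rot /=; ring. Qed.

Lemma sqn_rot {R} (h : plane R) : sqn (rot h) = sqn h.
Proof. by rewrite /sqn /rot/= sqrrN addrC. Qed.

Lemma sqnN {R} (h : plane R) : sqn (- h) = sqn h.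
Proof. by rewrite /sqn/= !sqrrN. Qed.

(** At a maximum of f + eta |z|^2 the four-point difference of this sum is nonpositive, yet the
    quadratic part contributes exactly 4 eta s^2 while [sub4] lets f lose at most eta s^2. *)
Lemma max_principle {R} D f B : (forall z, D z -> `|z.1| <= B /\ `|z.2| <= B) ->
 (forall z, D z -> \forall y \near z, D y) -> (forall z, D z -> {for z, continuous f}) ->
 (forall z, D z -> sub4 f z) ->
 (forall z, ~ D z -> forall eps : R, 0 < eps -> \forall y \near z, D y -> f y < eps) -> forall z, D z -> f z <= 0.
Proof.
move=> DB Do fc fs bd z1 D1; rewrite leNgt; apply/negP => f1.
have [||||p [eta [Dp eta0 _ pmax]]] := @max_quadratic R D (EFin \o f) B z1 DB _ _ _ D1.
- by move=> z _; exact: ltry.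
- move=> z Dz a /=; rewrite lte_fin => za.
 have /cvgrPdist_lt/(_ (a - f z)) := fc z Dz; rewrite subr_gt0 => /(_ za).
 apply: filterS => y; rewrite ltr_norml => /andP[h _] _; rewrite lte_fin; lra.
- by move=> z nD eps e0; apply: filterS (bd z nD eps e0) => y h /h; rewrite lte_fin.
- by rewrite lte_fin.
have [r1 r10 H1] := fs p Dp _ eta0.
have [r2 r20 H2] := near_axes (Do p Dp).
pose s := Num.min r1 r2 / 2.
have m0 : 0 < Num.min r1 r2 by rewrite lt_min r10 r20.
have s0 : 0 < s by rewrite divr_gt0.
have sm : s < Num.min r1 r2 by rewrite /s ltr_pdivrMr// mulr2n; lra.
move: sm; rewrite lt_min => /andP[s1 s2].
have hs := H1 s s0 s1.
have sq (h : plane R) : sqn h = s ^+ 2 -> f (p + h) + eta * sqn (p + h) <= f p + eta * sqn p.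
 move=> hh; rewrite -lee_fin; apply: pmax; apply: H2; rewrite hh.
 by rewrite ltrXn2r// ?ltW.
have hE : sqn ((s, 0) : plane R) = s ^+ 2 by rewrite /sqn/= expr0n/= addr0.
have e1 := sq _ hE.
have e2 := sq (- (s, 0)); rewrite sqnN in e2; have {}e2 := e2 hE.
have e3 := sq (rot (s, 0)); rewrite sqn_rot in e3; have {}e3 := e3 hE.
have e4 := sq (- rot (s, 0)); rewrite sqnN sqn_rot in e4; have {}e4 := e4 hE.
have := sum4_sqn p (s, 0); rewrite hE /sum4 => q4.
rewrite /sum4 in hs.
have pos : 0 < eta * s ^+ 2 by rewrite mulr_gt0// exprn_gt0.
have q5 : eta * sqn (p + (s, 0)) + eta * sqn (p - (s, 0)) + eta * sqn (p + rot (s, 0)) +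
  eta * sqn (p - rot (s, 0)) = 4 * (eta * sqn p) + 4 * (eta * s ^+ 2).
 by rewrite -!mulrDr q4; ring.
lra.
Qed.

Lemma line_derive {R} (f : plane R -> R) z v t : derivable f (z + t *: v) v ->
 is_derive t 1 (fun t : R => f (z + t *: v)) ('D_v f (z + t *: v)).
Proof.
move=> fv.
have E : (fun h : R => h^-1 *: (f (z + (h *: 1 + t) *: v) - f (z + t *: v))) =
     (fun h : R => h^-1 *: (f (h *: v + (z + t *: v)) - f (z + t *: v))).
 apply/funext => h; congr (_ *: (f _ - _)).
 by rewrite scalerDl /GRing.scale/= mulr1 addrCA addrA.
split; first by rewrite /derivable; under eq_fun do rewrite /=; rewrite E.
by rewrite /derive; under eq_fun do rewrite /=; rewrite E.
Qed.

Lemma mvt_pm {R} g g' (s c eps : R) : (forall t : R, `|t| <= `|s| -> is_derive t 1 g (g' t) /\ `|g' t - c| <= eps) ->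
 `|g s - g 0 - c * s| <= eps * `|s|.
Proof.
move=> H.
have cont a b : `|a| <= `|s| -> `|b| <= `|s| -> {within `[a, b], continuous g}.
 move=> sa sb; apply: derivable_within_continuous => t; rewrite in_itv/= => /andP[at_ tb].
 have [] := H t; last by move=> [? ?].
 move: sa sb; rewrite !ler_norml => /andP[a1 a2] /andP[b1 b2].
 by rewrite (le_trans a1 at_) (le_trans tb b2).
have [->|s0] := eqVneq s 0; first by rewrite subrr mulr0 subr0 normr0 mulr0.
case: (ltgtP s 0) s0 => // sn _.
- have hs t : t \in `]s, 0[ -> `|t| <= `|s|.
  by rewrite in_itv/= => /andP[st t0]; rewrite !ltr0_norm// lerN2 ltW.
 have [||t ts E] := @MVT R g g' s 0 sn.
 + by move=> t /hs /H[].
 + by apply: cont; rewrite ?lexx// normr0.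
 have [_ hb] := H t (hs t ts).
 rewrite (_ : g s - g 0 - c * s = (g' t - c) * s) ?normrM ?ler_wpM2r//.
 by move: E; rewrite sub0r => E; rewrite -(opprB (g 0)) E; ring.
- have hs t : t \in `]0, s[ -> `|t| <= `|s|.
  by rewrite in_itv/= => /andP[st t0]; rewrite !gtr0_norm// ltW.
 have [||t ts E] := @MVT R g g' 0 s sn.
 + by move=> t /hs /H[].
 + by apply: cont; rewrite ?lexx// normr0.
 have [_ hb] := H t (hs t ts).
 rewrite (_ : g s - g 0 - c * s = (g' t - c) * s) ?normrM ?ler_wpM2r//.
 by rewrite E subr0; ring.
Qed.

Lemma mvt_line {R} f (z v : plane R) (s c eps : R) : (forall t : R, `|t| <= `|s| -> derivable f (z + t *: v) v /\
   `|'D_v f (z + t *: v) - c| <= eps) -> `|f (z + s *: v) - f z - c * s| <= eps * `|s|.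
Proof.
move=> H.
have := @mvt_pm R (fun t => f (z + t *: v)) (fun t => 'D_v f (z + t *: v)) s c eps.
have -> : f (z + 0 *: v) = f z by congr f; rewrite scale0r addr0.
by apply => t /H [h1 h2]; split; [exact: line_derive|exact: h2].
Qed.

Lemma plane_ext {R} (z w : plane R) : z.1 = w.1 -> z.2 = w.2 -> z = w.
Proof. by case: z w => [a b] [c d] /= -> ->. Qed.

Lemma near_sqn {R} (z : plane R) r : 0 < r -> \forall y \near z, sqn (y - z) < r ^+ 2.
Proof.
move=> r0; have r2 : 0 < r / 2 by rewrite divr_gt0.
exists (ball z.1 (r / 2), ball z.2 (r / 2)) => /=.
 by split; exact: nbhsx_ballx.
move=> [a b] /= []; rewrite /ball/= !(distrC _ a) !(distrC _ b) => ha hb.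
rewrite /sqn/= -[in X in X + _]real_normK ?num_real// -[in X in _ + X]real_normK ?num_real//.
have h1 : `|a - z.1| ^+ 2 < (r / 2) ^+ 2 by rewrite ltrXn2r// nnegrE ?ltW.
have h2 : `|b - z.2| ^+ 2 < (r / 2) ^+ 2 by rewrite ltrXn2r// nnegrE ?ltW.
have : (r / 2) ^+ 2 = r ^+ 2 / 4 by field.
have : 0 < r ^+ 2 by rewrite exprn_gt0.
lra.
Qed.

Lemma near_line {R} P (z v : plane R) :
 (\forall y \near z, P y) -> exists2 r : R, 0 < r & forall t : R, `|t| < r -> P (z + t *: v).
Proof.
move=> /near_axes [r r0 H].
exists (r / (Num.sqrt (sqn v) + 1)); first by rewrite divr_gt0.
move=> t tr; apply: H.
rewrite (_ : sqn (t *: v) = (`|t| * Num.sqrt (sqn v)) ^+ 2); last first.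
 rewrite exprMn real_normK ?num_real// sqr_sqrtr ?sqn_ge0//.
 by rewrite /sqn /=; rewrite /GRing.scale/=; ring.
rewrite ltrXn2r// ?nnegrE ?mulr_ge0 ?sqrtr_ge0 ?(ltW r0)//.
move: tr; rewrite ltr_pdivlMr// => tr; apply: le_lt_trans tr.
by rewrite ler_wpM2l// lerDl.
Qed.

Lemma partial_bounded {R} (f : plane R -> R) z M : (\forall y \near z, [/\ derivable f y (1, 0), derivable f y (0, 1),
   `|'D_(1, 0) f y| <= M & `|'D_(0, 1) f y| <= M]) ->
 exists2 r : R, 0 < r & forall h, sqn h < r ^+ 2 -> `|f (z + h) - f z| <= M * (`|h.1| + `|h.2|).
Proof.
move=> /near_axes[r r0 H]; exists r => // h hr.
pose y := z + (h.1, 0).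
have yE : z + h = y + h.2 *: ((0, 1) : plane R).
 by apply: plane_ext; rewrite /y /= /GRing.scale/= ?mulr0 ?mulr1 ?addr0.
have a1 : `|f y - f z| <= M * `|h.1|.
 have := @mvt_line R f z (1, 0) h.1 0 M.
 rewrite mul0r subr0 (_ : z + h.1 *: ((1, 0) : plane R) = y); first apply.
  move=> t th; rewrite subr0.
  suff /H[d1 _ d2 _] : sqn (t *: ((1, 0) : plane R)) < r ^+ 2 by split.
  apply: le_lt_trans hr; rewrite /sqn/= /GRing.scale/= mulr1 mulr0 expr0n/= addr0.
  rewrite -[leLHS]real_normK ?num_real// ler_wpDr ?sqr_ge0//.
  by rewrite -[leRHS]real_normK ?num_real// lerXn2r// nnegrE.
 by apply: plane_ext; rewrite /y /= /GRing.scale/= ?mulr0 ?mulr1 ?addr0.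
have a2 : `|f (z + h) - f y| <= M * `|h.2|.
 have := @mvt_line R f y (0, 1) h.2 0 M.
 rewrite mul0r subr0 -yE; apply => t th; rewrite subr0.
 rewrite (_ : y + t *: ((0, 1) : plane R) = z + (h.1, t)); last first.
  by apply: plane_ext; rewrite /y /= /GRing.scale/= ?mulr0 ?mulr1 ?addr0.
 suff /H[_ d1 _ d2] : sqn ((h.1, t) : plane R) < r ^+ 2 by split.
 apply: le_lt_trans hr; rewrite /sqn/= lerD2l.
 rewrite -[leLHS]real_normK ?num_real//.
 by rewrite -[leRHS]real_normK ?num_real// lerXn2r// nnegrE.
rewrite (_ : _ - _ = (f (z + h) - f y) + (f y - f z)); last by ring.
by apply: le_trans (ler_normD _ _) _; rewrite mulrDr addrC lerD.
Qed.

Lemma partial_continuous {R} (f : plane R -> R) z M :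
 (\forall y \near z, [/\ derivable f y (1, 0), derivable f y (0, 1),
   `|'D_(1, 0) f y| <= M & `|'D_(0, 1) f y| <= M]) -> {for z, continuous f}.
Proof.
move=> /partial_bounded[r r0 H].
have M0 : 0 <= M.
 have r20 : 0 < r / 2 by rewrite divr_gt0.
 have := H (r / 2, 0); rewrite /= normr0 addr0 (gtr0_norm r20) => h.
 have : 0 <= M * (r / 2).
  apply: le_trans (h _); first exact: normr_ge0.
  by rewrite /sqn/= expr0n/= addr0 ltrXn2r// ?ltW// ltr_pdivrMr// mulr2n; lra.
 by rewrite pmulr_lge0.
apply/cvgrPdist_lt => eps e0.
pose d := Num.min r (eps / (2 * M + 1)).
have M1 : 0 < 2 * M + 1 by rewrite ltr_wpDl// mulr_ge0.
have d0 : 0 < d by rewrite lt_min r0 !divr_gt0.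
apply: filterS (near_sqn z d0) => y hy.
have dr : d <= r by rewrite ge_min lexx.
have de : d <= eps / (2 * M + 1) by rewrite ge_min lexx orbT.
have hr : sqn (y - z) < r ^+ 2 by apply: lt_le_trans hy _; rewrite lerXn2r// nnegrE ltW.
have := H _ hr; rewrite distrC (addrC z) subrK => h; apply: le_lt_trans h _.
have h1 : `|(y - z).1| <= d.
 rewrite -(@ler_pXn2r _ 2) ?nnegrE ?(ltW d0)// real_normK ?num_real//.
 by apply: le_trans (ltW hy); rewrite /sqn lerDl sqr_ge0.
have h2 : `|(y - z).2| <= d.
 rewrite -(@ler_pXn2r _ 2) ?nnegrE ?(ltW d0)// real_normK ?num_real//.
 by apply: le_trans (ltW hy); rewrite /sqn lerDr sqr_ge0.
apply: le_lt_trans (ler_wpM2l M0 (lerD h1 h2)) _.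
have : d * (2 * M + 1) <= eps by rewrite -ler_pdivlMr.
have := mulr_ge0 M0 (ltW d0); nra.
Qed.

Lemma near_norm_lt {R} {T : topologicalType} (g : T -> R) (z : T) M :
 {for z, continuous g} -> `|g z| < M -> \forall y \near z, `|g y| < M.
Proof.
move=> /cvgrPdist_lt/(_ (M - `|g z|)); rewrite subr_gt0 => H /H; apply: filterS => y.
have := ler_normD (g z) (g y - g z); rewrite addrC subrK distrC; lra.
Qed.

Lemma dist_bound {R} (a b c : R) : `|a - b| <= c -> `|a| <= `|b| + c.
Proof. have := ler_normD b (a - b); rewrite addrC subrK; lra. Qed.

(** [C2_on] speaks of directional derivatives of f, so continuity of f itself has to be recovered:
    bounded second derivatives bound the first ones near z, and these bound the increments of f. *)
Lemma C2_continuous {R} U f (z : plane R) : (\forall y \near z, U y) -> C2_on U f -> {for z, continuous f}.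
Proof.
move=> Uz C2.
have Uz0 : U z by exact: nbhs_singleton.
have bnd v : exists M : R, \forall y \near z, `|'D_v f y| <= M.
 have [d1 _ c1] := C2 z Uz0 v (1, 0); have [_ _ c2] := C2 z Uz0 v (0, 1).
 pose M := `|'D_(1, 0) ('D_v f) z| + `|'D_(0, 1) ('D_v f) z| + 1.
 have M1 : `|'D_(1, 0) ('D_v f) z| < M by rewrite /M -addrA ltrDl ltr_wpDl.
 have M2 : `|'D_(0, 1) ('D_v f) z| < M by rewrite /M addrAC ltrDr ltr_wpDl.
 have n1 := near_norm_lt c1 M1; have n2 := near_norm_lt c2 M2.
 have [|r r0 H] := @partial_bounded R ('D_v f) z M.
  apply: filterS3 Uz n1 n2 => y Uy y1 y2.
  have [_ a _] := C2 y Uy v (1, 0); have [_ b _] := C2 y Uy v (0, 1).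
  exact: (And4 a b (ltW y1) (ltW y2)).
 exists (`|'D_v f z| + M * (r + r)).
 apply: filterS (near_sqn z r0) => y hy.
 have := H _ hy; rewrite (addrC z) subrK => h.
 have M0 : 0 <= M by apply: le_trans (ltW M1); exact: normr_ge0.
 have h1 : `|(y - z).1| <= r.
  rewrite -(@ler_pXn2r _ 2) ?nnegrE ?(ltW r0)// real_normK ?num_real//.
  by apply: le_trans (ltW hy); rewrite /sqn lerDl sqr_ge0.
 have h2 : `|(y - z).2| <= r.
  rewrite -(@ler_pXn2r _ 2) ?nnegrE ?(ltW r0)// real_normK ?num_real//.
  by apply: le_trans (ltW hy); rewrite /sqn lerDr sqr_ge0.
 have h3 := ler_wpM2l M0 (lerD h1 h2).
 exact: (dist_bound (le_trans h h3)).
have [M1 n1] := bnd (1, 0); have [M2 n2] := bnd (0, 1).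
apply: (@partial_continuous _ _ _ (Num.max M1 M2)).
apply: filterS3 Uz n1 n2 => y Uy y1 y2.
have [a _ _] := C2 y Uy (1, 0) 0; have [b _ _] := C2 y Uy (0, 1) 0.
have h1 : `|'D_(1, 0) f y| <= Num.max M1 M2 by rewrite le_max y1.
have h2 : `|'D_(0, 1) f y| <= Num.max M1 M2 by rewrite le_max y2 orbT.
exact: (And4 a b h1 h2).
Qed.

Definition har4 {R} (f : plane R -> R) (z : plane R) : Prop := forall eps : R, 0 < eps -> exists2 r : R, 0 < r &
  forall s : R, 0 < s -> s < r -> `|sum4 f z (s, 0) - 4 * f z| <= eps * s ^+ 2.

Lemma har4_sub4 {R} f (z : plane R) : har4 f z -> sub4 f z.
Proof.
move=> H eps /H[r r0 h]; exists r => // s s0 sr.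
by have := h s s0 sr; rewrite ler_norml => /andP[].
Qed.

Lemma mul_half_le {R} (a e : R) : 0 <= a -> 0 < e -> a * (e / (2 * (a + 1))) <= e / 2.
Proof.
move=> a0 e0; have a1 : 0 < a + 1 by rewrite ltr_wpDl.
rewrite (_ : a * _ = (e / 2) * (a / (a + 1))); last by field; rewrite gt_eqF.
rewrite ger_pMr ?divr_gt0// ler_pdivrMr// mul1r; lra.
Qed.

Lemma har4_lin {R} f g z (a b c : R) : har4 f z -> har4 g z -> har4 (fun y => a * f y + b * g y + c) z.
Proof.
move=> Hf Hg eps e0.
have a1 : 0 < 2 * (`|a| + 1) by rewrite mulr_gt0// ltr_wpDl.
have b1 : 0 < 2 * (`|b| + 1) by rewrite mulr_gt0// ltr_wpDl.
have [r r0 h] := Hf _ (divr_gt0 e0 a1).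
have [r' r'0 h'] := Hg _ (divr_gt0 e0 b1).
exists (Num.min r r'); first by rewrite lt_min r0.
move=> s s0; rewrite lt_min => /andP[/(h s s0) {}h /(h' s s0) {}h'].
rewrite (_ : _ - _ = a * (sum4 f z (s, 0) - 4 * f z) + b * (sum4 g z (s, 0) - 4 * g z)); last first.
 by rewrite /sum4; ring.
apply: le_trans (ler_normD _ _) _; rewrite !normrM.
have k1 := ler_wpM2l (normr_ge0 a) h; have k2 := ler_wpM2l (normr_ge0 b) h'.
apply: le_trans (lerD k1 k2) _.
rewrite (mulrA `|a|) (mulrA `|b|) -mulrDl ler_wpM2r ?sqr_ge0//.
have l1 := mul_half_le (normr_ge0 a) e0; have l2 := mul_half_le (normr_ge0 b) e0.
lra.
Qed.

(** Second-order expansion when f' is only differentiable at 0: the mean value theorem is applied to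
    f(t) + f(-t) - L t^2. *)
Lemma second_difference {R} f g r1 L : 0 < r1 -> (forall t : R, `|t| < r1 -> is_derive t 1 f (g t)) ->
 (forall eps : R, 0 < eps -> exists2 r : R, 0 < r & forall t : R, `|t| < r -> `|g t - g 0 - L * t| <= eps * `|t|) ->
 forall eps : R, 0 < eps -> exists2 r : R, 0 < r & forall s : R, 0 < s -> s < r ->
  `|f s + f (- s) - 2 * f 0 - L * s ^+ 2| <= eps * s ^+ 2.
Proof.
move=> r10 H1 d2 eps e0.
have e40 : 0 < eps / 2 by rewrite divr_gt0.
have [r2 r20 H2] := d2 _ e40.
exists (Num.min r1 r2); first by rewrite lt_min r10.
move=> s s0; rewrite lt_min => /andP[sr1 sr2].
have := @mvt_pm R (fun t => f t + f (- t) - L * t ^+ 2) (fun t => g t - g (- t) - 2 * L * t) s 0 (eps * s).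
rewrite mul0r subr0 oppr0 expr0n/= mulr0 subr0.
rewrite (gtr0_norm s0) -mulrA -expr2 => h.
rewrite (_ : _ - _ - _ = f s + f (- s) - L * s ^+ 2 - (f 0 + f 0)); last by ring.
apply: h => t ts; split.
 have i1 := H1 t (le_lt_trans ts sr1).
 have i2 : is_derive (- t) 1 f (g (- t)) by apply: H1; rewrite normrN (le_lt_trans ts).
 have i4 : is_derive t 1 (fun t : R => L * t ^+ 2) (2 * L * t).
  apply: is_derive_eq; rewrite /GRing.scale/= !mulr1; ring.
 apply: is_derive_eq; ring.
have a1 := H2 t (le_lt_trans ts sr2).
have := H2 (- t); rewrite normrN => /(_ (le_lt_trans ts sr2)) a2.
rewrite addr0 (_ : _ - _ = (g t - g 0 - L * t) - (g (- t) - g 0 - L * - t)); last by ring.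
apply: le_trans (ler_normB _ _) _; apply: le_trans (lerD a1 a2) _.
have tS := ler_wpM2l (ltW e40) ts; lra.
Qed.

Lemma derive_linear_approx {R} (f : plane R -> R) z v :
 derivable f z v -> forall eps : R, 0 < eps -> exists2 r : R, 0 < r & forall t : R, `|t| < r ->
  `|f (z + t *: v) - f z - 'D_v f z * t| <= eps * `|t|.
Proof.
set L := 'D_v f z.
move=> d2 eps e0.
have : (fun h : R => h^-1 *: (f (h *: v + z) - f z)) @ 0^' --> L by exact: d2.
move=> /cvgrPdist_lt/(_ _ e0)/nbhs_ballP[r r0 H]; exists r => // t tr.
have [->|t0] := eqVneq t 0.
 by rewrite scale0r addr0 subrr mulr0 subrr normr0 mulr0.
have := H t; rewrite /ball/= sub0r normrN => /(_ tr t0) /ltW.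
rewrite -(@ler_pM2r _ `|t|) ?normr_gt0// -normrM mulrBl distrC.
by rewrite /GRing.scale/= mulrAC mulVf// mul1r (addrC (t *: v)).
Qed.

Lemma line_second_difference {R} (f : plane R -> R) z v :
 (\forall y \near z, derivable f y v) -> derivable ('D_v f) z v ->
 forall eps : R, 0 < eps -> exists2 r : R, 0 < r & forall s : R, 0 < s -> s < r ->
  `|f (z + s *: v) + f (z - s *: v) - 2 * f z - 'D_v ('D_v f) z * s ^+ 2| <= eps * s ^+ 2.
Proof.
move=> /(near_line v) [r1 r10 H1] d2 eps e0.
have z0 : z + 0 *: v = z by apply: plane_ext; rewrite /= /GRing.scale/= mul0r addr0.
pose phi (t : R) := f (z + t *: v); pose psi (t : R) := 'D_v f (z + t *: v).
have phi0 : phi 0 = f z by rewrite /phi z0.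
have psi0 : psi 0 = 'D_v f z by rewrite /psi z0.
have h1 (t : R) : `|t| < r1 -> is_derive t 1 phi (psi t).
 by move=> /H1; exact: line_derive.
have h2 (eps' : R) : 0 < eps' -> exists2 r : R, 0 < r & forall t : R, `|t| < r ->
  `|psi t - psi 0 - 'D_v ('D_v f) z * t| <= eps' * `|t|.
 by move=> /(derive_linear_approx d2)[r r0 H]; exists r => // t tr; rewrite psi0; exact: H.
have [r r0 H] := second_difference r10 h1 h2 e0.
exists r => // s s0 sr; have := H s s0 sr.
by rewrite phi0 {2}/phi scaleNr.
Qed.

Lemma add_second_differences {R} (A B C D F p q s eps : R) : `|A + B - 2 * F - p * s ^+ 2| <= eps / 2 * s ^+ 2 ->
 `|C + D - 2 * F - q * s ^+ 2| <= eps / 2 * s ^+ 2 -> p + q = 0 -> `|A + B + C + D - 4 * F| <= eps * s ^+ 2.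
Proof.
move=> H H' pq.
rewrite (_ : _ - _ = (A + B - 2 * F - p * s ^+ 2) + (C + D - 2 * F - q * s ^+ 2)); last first.
 by rewrite (_ : q = - p); [ring|lra].
apply: le_trans (ler_normD _ _) _; apply: le_trans (lerD H H') _; lra.
Qed.

Lemma harmonic_har4 {R} U f (z : plane R) : (\forall y \near z, U y) -> harmonic_on U f -> har4 f z.
Proof.
move=> Uz [C2 lap] eps e0.
have Uz0 : U z by exact: nbhs_singleton.
have n v : \forall y \near z, derivable f y v.
 by apply: filterS Uz => y Uy; have [] := C2 y Uy v v.
have d v : derivable ('D_v f) z v by have [] := C2 z Uz0 v v.
have e20 : 0 < eps / 2 by rewrite divr_gt0.
have [r r0 H] := line_second_difference (n (1, 0)) (d (1, 0)) e20.
have [r' r'0 H'] := line_second_difference (n (0, 1)) (d (0, 1)) e20.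
exists (Num.min r r'); first by rewrite lt_min r0.
move=> s s0; rewrite lt_min => /andP[/(H s s0) {}H /(H' s s0) {}H'].
have E1 : s *: ((1, 0) : plane R) = (s, 0).
 by apply: plane_ext; rewrite /= /GRing.scale/= ?mulr0 ?mulr1.
have E2 : s *: ((0, 1) : plane R) = rot (s, 0).
 by apply: plane_ext; rewrite /= /GRing.scale/= ?mulr0 ?mulr1 ?oppr0.
have := lap z Uz0; rewrite /laplacian.
rewrite E1 in H; rewrite E2 in H'; rewrite /sum4.
exact: add_second_differences H H'.
Qed.

(** * Harmonicity of integrals of logarithmic kernels *)

Definition jcont {R} (K : set R) (k : plane R -> R -> R) (z : plane R) : Prop :=
 forall t, K t -> {for (z, t), continuous (fun p : plane R * R => k p.1 p.2)}.

Lemma jcont_uniform {R} K k z : compact K -> jcont K k z -> forall eps : R, 0 < eps ->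
 \forall y \near z, forall t, K t -> `|k y t - k z t| < eps.
Proof.
move=> /compact_near_coveringP cK jc eps e0.
apply: (cK (plane R) (nbhs z) (fun y t => `|k y t - k z t| < eps)) => t Kt.
have e20 : 0 < eps / 2 by rewrite divr_gt0.
have /cvgrPdist_lt/(_ _ e20) [[A B] /= [Az Bt] AB] := jc t Kt.
exists (B, A) => //= -[t' y] /= [Bt' Ay].
have h1 := AB (y, t') (conj Ay Bt'); have h2 := AB (z, t') (conj (nbhs_singleton Az) Bt').
rewrite /= in h1 h2.
rewrite (_ : k y t' - k z t' = (k z t - k z t') - (k z t - k y t')); last by ring.
apply: le_lt_trans (ler_normB _ _) _; lra.
Qed.

Lemma continuous_on_bounded {R} K (f : R -> R) :
 compact K -> (forall t, K t -> {for t, continuous f}) -> exists M, forall t, K t -> `|f t| <= M.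
Proof.
move=> cK fc.
have [[t0 K0]|K0] := pselect (K !=set0); last by exists 0 => t Kt; case: K0; exists t.
have [||p Kp pmax] := @compact_usc_max _ R R K (fun t => `|f t|) cK; first by exists t0.
 move=> p q Kp Kq pq.
 have := @near_norm_lt R R f p _ (fc p Kp) pq.
 by apply: filterS => z h _.
by exists `|f p| => t /pmax.
Qed.

Lemma continuous_on_measurable {R} K (f : R -> R) :
 measurable K -> (forall t, K t -> {for t, continuous f}) -> measurable_fun K f.
Proof.
move=> mK fc; apply: subspace_continuous_measurable_fun => //.
apply/subspace_continuousP => t Kt.
by apply: cvg_trans (fc t Kt); apply: cvg_app; exact: cvg_within.
Qed.

Lemma continuous_on_integrable {R} (mu : prob R) K f :
 compact K -> (forall t, K t -> {for t, continuous f}) -> intR mu K f.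
Proof.
move=> cK fc; have mK := compact_measurable cK.
have [M HM] := continuous_on_bounded cK fc.
apply: measurable_bounded_integrable => //.
- by apply: (@le_lt_trans _ _ 1%E); rewrite ?ltry// probability_le1.
- exact: continuous_on_measurable.
- exact: norm_bounded_on HM.
Qed.

Lemma jcont_section {R} K k (z : plane R) : jcont K k z -> forall t, K t -> {for t, continuous (k z)}.
Proof.
move=> jc t Kt.
apply: (@continuous_comp _ _ _ (fun s => (z, s)) (fun p : plane R * R => k p.1 p.2)); last exact: jc.
by move=> A [[U V] /= [Uz Vt] UV]; apply: filterS Vt => s Vs; apply: UV; split => //; exact: nbhs_singleton.
Qed.

Lemma Rint_diff_le {R} (mu : prob R) K f eps : measurable K -> mu K = 1%E -> intR mu K f ->
 (forall t, K t -> `|f t| <= eps) -> `|\int[mu]_(t in K) f t| <= eps.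
Proof.
move=> mK muK fi H.
apply: le_trans (le_normr_Rintegral mK fi) _.
rewrite -[leRHS](Rint_prob_cst eps mK muK); apply: le_Rintegral => //.
- exact: integrable_norm fi.
- by apply: (bounded_integrable `|eps|) => // x _.
Qed.

Lemma jcont_integral {R} (mu : prob R) K k z : compact K -> mu K = 1%E -> (\forall y \near z, jcont K k y) ->
 {for z, continuous (fun y => \int[mu]_(t in K) k y t)}.
Proof.
move=> cK muK jc; have mK := compact_measurable cK.
apply/cvgrPdist_lt => eps e0.
have e20 : 0 < eps / 2 by rewrite divr_gt0.
have jz : jcont K k z by exact: nbhs_singleton.
apply: filterS2 jc (jcont_uniform cK jz e20) => y jy h.
have i1 := continuous_on_integrable mu cK (jcont_section jz).
have i2 := continuous_on_integrable mu cK (jcont_section jy).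
rewrite -RintegralB//; apply: (@le_lt_trans _ _ (eps / 2)); last lra.
apply: Rint_diff_le => //; first exact: (integrableB mK i1 i2).
by move=> t Kt; rewrite distrC; apply: ltW; exact: h.
Qed.

(** Along z + s v the mean value theorem bounds the error of each difference quotient, uniformly in
    t because the derivative kernel is uniformly close to its value at z. *)
Lemma jcont_derive {R} (mu : prob R) K k k' z v :
 compact K -> mu K = 1%E -> (\forall y \near z, jcont K k y) -> (\forall y \near z, jcont K k' y) ->
 (\forall y \near z, forall t, K t -> is_derive y v (k^~ t) (k' y t)) ->
 is_derive z v (fun y => \int[mu]_(t in K) k y t) (\int[mu]_(t in K) k' z t).
Proof.
move=> cK muK jk jk' dk; have mK := compact_measurable cK.
have jz : jcont K k z by exact: nbhs_singleton.
have jz' : jcont K k' z by exact: nbhs_singleton.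
have i1 := continuous_on_integrable mu cK (jcont_section jz).
have i3 := continuous_on_integrable mu cK (jcont_section jz').
have C : (fun h : R => h^-1 *: (\int[mu]_(t in K) k (h *: v + z) t - \int[mu]_(t in K) k z t)) @ 0^'
  --> (\int[mu]_(t in K) k' z t : R).
 apply/cvgrPdist_lt => eps e0.
 have e20 : 0 < eps / 2 by rewrite divr_gt0.
 have [r r0 H] := near_line v (filterI jk (filterI dk (jcont_uniform cK jz' e20))).
 apply/nbhs_ballP; exists r => // s; rewrite /ball/= sub0r normrN => sr s0.
 rewrite (addrC (s *: v)).
 have [js _] := H s sr.
 have i2 := continuous_on_integrable mu cK (jcont_section js).
 have E : \int[mu]_(t in K) k (z + s *: v) t - \int[mu]_(t in K) k z t -
   \int[mu]_(t in K) k' z t * s = \int[mu]_(t in K) (k (z + s *: v) t - k z t - s * k' z t).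
  have i4 := integrableB mK i2 i1; have i5 := integrableZl mK s i3.
  by rewrite RintegralB// RintegralB// RintegralZl// (mulrC s).
 have B : `|\int[mu]_(t in K) (k (z + s *: v) t - k z t - s * k' z t)| <= eps / 2 * `|s|.
  apply: Rint_diff_le => //.
   have i4 := integrableB mK i2 i1; have i5 := integrableZl mK s i3.
   exact: (integrableB mK i4 i5).
  move=> t Kt; rewrite (mulrC s).
  have := @mvt_line R (k^~ t) z v s (k' z t) (eps / 2); apply => s' ss'.
  have [_ [dt ut]] := H s' (le_lt_trans ss' sr).
  have [d1 d2] := dt t Kt; split; first exact: d1.
  by rewrite d2; apply: ltW; exact: ut.
 rewrite -E in B; move: B.
 move: (\int[mu]_(t in K) k (z + s *: v) t) (\int[mu]_(t in K) k z t) (\int[mu]_(t in K) k' z t).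
 move=> a b c B; rewrite /GRing.scale/=.
 have sp : 0 < `|s| by rewrite normr_gt0.
 rewrite (_ : c - s^-1 * (a - b) = - ((a - b - c * s) / s)); last by field.
 rewrite normrN normrM normfV ltr_pdivrMr//; apply: le_lt_trans B _.
 by rewrite ltr_pM2r//; lra.
split; first by apply/cvg_ex; exists (\int[mu]_(t in K) k' z t); exact: C.
by rewrite /derive; apply/cvg_lim => //; exact: C.
Qed.

Lemma line_is_derive {R} f (z v : plane R) (d : R) :
 is_derive (0 : R) (1 : R) (fun s : R => f (z + s *: v)) d -> is_derive z v f d.
Proof.
have E : (fun h : R => h^-1 *: (f (z + (h *: 1 + 0) *: v) - f (z + 0 *: v))) =
     (fun h : R => h^-1 *: (f (h *: v + z) - f z)).
 apply/funext => h; congr (_ *: (f _ - f _)).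
  by rewrite addr0 /GRing.scale/= mulr1 addrC.
 by apply: plane_ext; rewrite /= /GRing.scale/= mul0r addr0.
move=> [d1 d2]; split; first by move: d1; rewrite /derivable; under eq_fun do rewrite /=; rewrite E.
by move: d2; rewrite /derive; under eq_fun do rewrite /=; rewrite E.
Qed.

(** |a z - b|^2 for the complex number z and real a, b. A Moebius change of variable turns distances
    into quotients of such moduli, so this single family covers both charts of the sphere and both
    kinds of pole. [lgk] is ln |a z - b|; [lgk1] and [lgk2] are its directional derivatives. *)
Definition nk {R} (a b : R) (z : plane R) : R := (a * z.1 - b) ^+ 2 + (a * z.2) ^+ 2.

Definition lgk {R} (a b : R) (z : plane R) : R := ln (nk a b z) / 2.

Definition lgk1 {R} (a b : R) (v z : plane R) : R := a * ((a * z.1 - b) * v.1 + a * z.2 * v.2) / nk a b z.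

Definition lgk2 {R} (a b : R) (v v' z : plane R) : R := a ^+ 2 * (v.1 * v'.1 + v.2 * v'.2) / nk a b z -
 2 * a ^+ 2 * ((a * z.1 - b) * v.1 + a * z.2 * v.2) * ((a * z.1 - b) * v'.1 + a * z.2 * v'.2) / nk a b z ^+ 2.

Lemma nk_ge0 {R} a b (z : plane R) : 0 <= nk a b z.
Proof. by rewrite addr_ge0 ?sqr_ge0. Qed.

Lemma lgk_derive {R} a b (v z : plane R) : nk a b z != 0 -> is_derive z v (lgk a b) (lgk1 a b v z).
Proof.
move=> n0; apply: line_is_derive.
pose N (s : R) := (a * (z.1 + s * v.1) - b) ^+ 2 + (a * (z.2 + s * v.2)) ^+ 2.
have N0 : N 0 = nk a b z by rewrite /N !mul0r !addr0.
have Npos : 0 < N 0 by rewrite N0 lt_neqAle eq_sym n0 nk_ge0.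
have dN : is_derive (0 : R) (1 : R) N (2 * a * ((a * z.1 - b) * v.1 + a * z.2 * v.2)).
 by apply: is_derive_eq; rewrite /GRing.scale/= !mul0r !addr0; ring.
have dL : is_derive (0 : R) (1 : R) (fun s : R => ln (N s)) ((N 0)^-1 * (2 * a * ((a * z.1 - b) * v.1 + a * z.2 * v.2))).
 have := is_derive1_comp (is_derive1_ln Npos) dN; exact.
rewrite (_ : (fun s : R => lgk a b (z + s *: v)) = (fun s => ln (N s)) * cst (2^-1)); last first.
 by apply/funext => s.
apply: is_derive_eq; rewrite N0 /lgk1 /GRing.scale/= mulr0 add0r.
by field.
Qed.

Lemma lgk1_derive {R} a b (v v' z : plane R) : nk a b z != 0 -> is_derive z v' (lgk1 a b v) (lgk2 a b v v' z).
Proof.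
move=> n0; apply: line_is_derive.
pose N (s : R) := (a * (z.1 + s * v'.1) - b) ^+ 2 + (a * (z.2 + s * v'.2)) ^+ 2.
pose M (s : R) := a * ((a * (z.1 + s * v'.1) - b) * v.1 + a * (z.2 + s * v'.2) * v.2).
have N0 : N 0 = nk a b z by rewrite /N !mul0r !addr0.
have Nn : N 0 != 0 by rewrite N0.
have dN : is_derive (0 : R) (1 : R) N (2 * a * ((a * z.1 - b) * v'.1 + a * z.2 * v'.2)).
 by apply: is_derive_eq; rewrite /GRing.scale/= !mul0r !addr0; ring.
have dM : is_derive (0 : R) (1 : R) M (a ^+ 2 * (v.1 * v'.1 + v.2 * v'.2)).
 by apply: is_derive_eq; rewrite /GRing.scale/= !mul0r !addr0; ring.
have dV := is_deriveV Nn dN.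
have dP := is_deriveM dM dV.
rewrite (_ : (fun s : R => lgk1 a b v (z + s *: v')) = M * (fun s => (N s)^-1)); last first.
 by apply/funext => s.
apply: (is_derive_eq dP).
by rewrite /GRing.scale/= N0 /M /lgk2 !mul0r !addr0; field.
Qed.

Section kernel_continuity.
Context {R} (a b : R -> R) (z : plane R) (t : R).
Hypotheses (ca : {for t, continuous a}) (cb : {for t, continuous b}).
Hypothesis n0 : nk (a t) (b t) z != 0.
Let p0 : plane R * R := (z, t).
Local Notation cont f := {for p0, continuous (f : plane R * R -> R)}.

Let cA : cont (fun p => a p.2).
Proof. by apply: continuous_comp; [exact: cvg_snd|exact: ca]. Qed.
Let cB : cont (fun p => b p.2).
Proof. by apply: continuous_comp; [exact: cvg_snd|exact: cb]. Qed.
Let cx : cont (fun p => p.1.1).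
Proof. by apply: continuous_comp; [exact: cvg_fst|exact: cvg_fst]. Qed.
Let cy : cont (fun p => p.1.2).
Proof. by apply: continuous_comp; [exact: cvg_fst|exact: cvg_snd]. Qed.
Let cP : cont (fun p => a p.2 * p.1.1 - b p.2).
Proof. by apply: cvgB; [apply: cvgM; [exact: cA|exact: cx]|exact: cB]. Qed.
Let cQ : cont (fun p => a p.2 * p.1.2).
Proof. by apply: cvgM; [exact: cA|exact: cy]. Qed.
Let cN : cont (fun p => nk (a p.2) (b p.2) p.1).
Proof. by apply: cvgD; apply: cvgM; (exact: cP || exact: cQ). Qed.
Let cS v : cont (fun p => (a p.2 * p.1.1 - b p.2) * v.1 + a p.2 * p.1.2 * v.2).
Proof. by apply: cvgD; apply: cvgM; (exact: cP || exact: cQ || exact: cvg_cst). Qed.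

Lemma lgk_jcont : cont (fun p => lgk (a p.2) (b p.2) p.1).
Proof.
apply: cvgM; last exact: cvg_cst.
apply: (@continuous_comp _ _ _ (fun p : plane R * R => nk (a p.2) (b p.2) p.1) (@ln R)) => //.
by apply: continuous_ln; rewrite lt_neqAle eq_sym n0 nk_ge0.
Qed.

Lemma lgk1_jcont v : cont (fun p => lgk1 (a p.2) (b p.2) v p.1).
Proof.
apply: cvgM; first by apply: cvgM; [exact: cA|exact: cS].
by apply: cvgV => //; exact: cN.
Qed.

Lemma lgk2_jcont v v' : cont (fun p => lgk2 (a p.2) (b p.2) v v' p.1).
Proof.
have cA2 : cont (fun p => a p.2 ^+ 2) by apply: cvgM; exact: cA.
have cNV : cont (fun p => (nk (a p.2) (b p.2) p.1)^-1).
 by apply: cvgV => //; exact: cN.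
apply: cvgB.
 by apply: cvgM; [apply: cvgM; [exact: cA2|exact: cvg_cst]|exact: cNV].
apply: cvgM; first by apply: cvgM; [apply: cvgM; [apply: cvgM; [exact: cvg_cst|exact: cA2]|exact: cS]|exact: cS].
apply: cvgV; first by rewrite expf_neq0.
by apply: cvgM; exact: cN.
Qed.
End kernel_continuity.

Lemma continuous_for_comb {R} {T : topologicalType} (p : T) f g (V c : R) :
 {for p, continuous f} -> {for p, continuous g} -> {for p, continuous (fun x => V + f x - c * g x)}.
Proof.
move=> cf cg; apply: cvgB; first by apply: cvgD; [exact: cvg_cst|exact: cf].
by apply: cvgM; [exact: cvg_cst|exact: cg].
Qed.

Lemma continuous_for_comb0 {R} {T : topologicalType} (p : T) f g (c : R) :
 {for p, continuous f} -> {for p, continuous g} -> {for p, continuous (fun x => f x - c * g x)}.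
Proof.
move=> cf cg; apply: cvgB; first exact: cf.
by apply: cvgM; [exact: cvg_cst|exact: cg].
Qed.

Lemma continuous_sqn_shift {R} (q : R) (z : plane R) : {for z, continuous (fun y : plane R => sqn (y.1 - q, y.2))}.
Proof. by apply: cvgD; apply: cvgM; (exact: cvg_snd || (apply: cvgB; [exact: cvg_fst|exact: cvg_cst])). Qed.

Section kernel_harmonic.
Context {R} (mu : prob R) (K : set R) (a b : R -> R) (V c a0 b0 : R).
Context (U : set (plane R)) (F : plane R -> R).
Hypotheses (cK : compact K) (muK : mu K = 1%E) (ca : continuous a) (cb : continuous b).
Hypothesis Uo : forall z, U z -> \forall y \near z, U y.
Hypothesis nU : forall z t, U z -> K t -> nk (a t) (b t) z != 0.
Hypothesis nU0 : forall z, U z -> nk a0 b0 z != 0.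
Hypothesis FE : forall z, U z -> F z = \int[mu]_(t in K) (V + lgk (a t) (b t) z - c * lgk a0 b0 z).

Let k0 z t := V + lgk (a t) (b t) z - c * lgk a0 b0 z.
Let k1 v z t := lgk1 (a t) (b t) v z - c * lgk1 a0 b0 v z.
Let k2 v v' z t := lgk2 (a t) (b t) v v' z - c * lgk2 a0 b0 v v' z.

Let j0 z : U z -> jcont K k0 z.
Proof.
move=> Uz t Kt.
have h1 := lgk_jcont (@ca t) (@cb t) (nU Uz Kt).
have h2 := @lgk_jcont R (fun=> a0) (fun=> b0) z t (@cst_continuous _ _ a0 t) (@cst_continuous _ _ b0 t) (nU0 Uz).
exact: (@continuous_for_comb _ _ _ _ _ V c h1 h2).

Qed.

Let j1 v z : U z -> jcont K (k1 v) z.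
Proof.
move=> Uz t Kt.
have h1 := lgk1_jcont (@ca t) (@cb t) (nU Uz Kt).
have h2 := @lgk1_jcont R (fun=> a0) (fun=> b0) z t (@cst_continuous _ _ a0 t) (@cst_continuous _ _ b0 t) (nU0 Uz).
exact: (@continuous_for_comb0 _ _ _ _ _ c (h1 v) (h2 v)).
Qed.

Let j2 v v' z : U z -> jcont K (k2 v v') z.
Proof.
move=> Uz t Kt.
have h1 := lgk2_jcont (@ca t) (@cb t) (nU Uz Kt).
have h2 := @lgk2_jcont R (fun=> a0) (fun=> b0) z t (@cst_continuous _ _ a0 t) (@cst_continuous _ _ b0 t) (nU0 Uz).
exact: (@continuous_for_comb0 _ _ _ _ _ c (h1 v v') (h2 v v')).
Qed.

Let d0 v z t : U z -> K t -> is_derive z v (k0^~ t) (k1 v z t).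
Proof.
move=> Uz Kt.
have h1 := lgk_derive v (nU Uz Kt); have h2 := lgk_derive v (nU0 Uz).
have h3 := is_deriveZ c h2; have h4 := is_deriveB h1 h3.
have h5 := is_deriveD (is_derive_cst V z v) h4.
rewrite add0r in h5.
rewrite (_ : k0^~ t = cst V + (lgk (a t) (b t) - c *: lgk a0 b0)); first exact: h5.
by apply/funext => y; rewrite /k0 /= addrA.
Qed.

Let d1 v v' z t : U z -> K t -> is_derive z v' ((k1 v)^~ t) (k2 v v' z t).
Proof.
move=> Uz Kt.
have h1 := lgk1_derive v v' (nU Uz Kt); have h2 := lgk1_derive v v' (nU0 Uz).
have h3 := is_deriveZ c h2.
exact: (is_deriveB h1 h3).
Qed.

Let F1 v z := \int[mu]_(t in K) k1 v z t.
Let F2 v v' z := \int[mu]_(t in K) k2 v v' z t.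

Let near_U (P : set (plane R)) z : (forall y, U y -> P y) -> U z -> \forall y \near z, P y.
Proof. by move=> H /Uo; apply: filterS. Qed.

Let D1 v z : U z -> is_derive z v F (F1 v z).
Proof.
move=> Uz.
have [h1 h2] : is_derive z v (fun y => \int[mu]_(t in K) k0 y t) (F1 v z).
 apply: jcont_derive => //; apply: near_U Uz => y Uy; [exact: j0|exact: j1|].
 by move=> t Kt; exact: d0.
have E : \forall y \near z, (fun y => \int[mu]_(t in K) k0 y t) y = F y.
 by apply: near_U Uz => y Uy; rewrite FE.
split; first exact: near_eq_derivable E h1.
by rewrite -(near_eq_derive v E).
Qed.

Let D2 v v' z : U z -> is_derive z v' ('D_v F) (F2 v v' z).
Proof.
move=> Uz.
have [h1 h2] : is_derive z v' (F1 v) (F2 v v' z).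
 apply: jcont_derive => //; apply: near_U Uz => y Uy; [exact: j1|exact: j2|].
 by move=> t Kt; exact: d1.
have E : \forall y \near z, F1 v y = 'D_v F y.
 by apply: near_U Uz => y Uy; have [_ ->] := D1 v Uy.
split; first exact: near_eq_derivable E h1.
by rewrite -(near_eq_derive v' E).
Qed.

(** Two derivations pass under the integral by joint continuity of the kernels, and ln |a z - b| is
    harmonic where a z - b does not vanish. *)
Lemma kernel_harmonic : harmonic_on U F.
Proof.
split=> [z Uz v v'|z Uz].
 split; [by have [] := D1 v Uz|by have [] := D2 v v' Uz|].
 have E : \forall y \near z, F2 v v' y = 'D_v' ('D_v F) y.
  by apply: near_U Uz => y Uy; have [_ ->] := D2 v v' Uy.
 have C : {for z, continuous (F2 v v')}.
  by apply: jcont_integral => //; apply: near_U Uz => y Uy; exact: j2.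
 move=> W WE; rewrite /= in WE.
 have := C W; rewrite (nbhs_singleton E) => /(_ WE) h.
 by apply: filterS2 E h => y /= <-.
rewrite /laplacian.
have [_ ->] := D2 (1, 0) (1, 0) Uz; have [_ ->] := D2 (0, 1) (0, 1) Uz.
have mK : measurable K by exact: compact_measurable.
have i1 := continuous_on_integrable mu cK (jcont_section (@j2 (1, 0) (1, 0) z Uz)).
have i2 := continuous_on_integrable mu cK (jcont_section (@j2 (0, 1) (0, 1) z Uz)).
rewrite /F2 -RintegralD //.
rewrite (_ : \int[mu]_(t in K) _ = \int[mu]_(t in K) 0).
 by rewrite Rint_prob_cst.
have lap0 (p q : R) : nk p q z != 0 -> lgk2 p q (1, 0) (1, 0) z + lgk2 p q (0, 1) (0, 1) z = 0.
 by move=> n0; rewrite /lgk2/=; move: n0; rewrite /nk => n0; field.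
apply: eq_Rintegral => t /set_mem Kt; rewrite /k2.
have := lap0 _ _ (nU Uz Kt); have := lap0 _ _ (nU0 Uz).
move: (lgk2 a0 _ _ _ _) (lgk2 a0 _ _ _ _) (lgk2 (a t) _ _ _ _) (lgk2 (a t) _ _ _ _).
by move=> p q r s h1 h2; rewrite (_ : q = - p); [rewrite (_ : s = - r); [ring|lra]|lra].
Qed.
End kernel_harmonic.

(** * The maximum principle for subharmonic functions *)

(** Arbitrary integrands are allowed, so that a subharmonic function on a circle can be compared
    with a continuous one without discussing its measurability. *)
Lemma le_integral_pointwise {d} {T : measurableType d} {R} (mu : measure T R) (D : set T) f g :
 (forall x, D x -> (f x <= g x)%E) -> (\int[mu]_(x in D) f x <= \int[mu]_(x in D) g x)%E.
Proof.
suff ge0 (f1 f2 : T -> \bar R) : (forall x, D x -> (0 <= f1 x)%E) -> (forall x, D x -> (f1 x <= f2 x)%E) ->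
  (\int[mu]_(x in D) f1 x <= \int[mu]_(x in D) f2 x)%E.
 move=> fg; rewrite integralE [leRHS]integralE; apply: leeB.
  apply: ge0 => x Dx; first exact: funepos_ge0.
  by apply: (@funepos_le _ _ D f g); rewrite ?inE// => y /set_mem; exact: fg.
 apply: ge0 => x Dx; first exact: funeneg_ge0.
 by apply: (@funeneg_le _ _ D f g); rewrite ?inE// => y /set_mem; exact: fg.
move=> f10 f12; rewrite !ge0_integralE//; last first.
 by move=> x Dx; exact: le_trans (f10 _ Dx) (f12 _ Dx).
apply/ereal_supP => _ [h hf <-]; apply: ereal_sup_ubound; exists h => //.
move=> x; apply: le_trans (hf x) _; rewrite /patch; case: ifPn => // /set_mem; exact: f12.
Qed.

Lemma mvt_upper {R} (H H' : R -> R) b B : 0 < b ->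
 (forall t : R, 0 <= t -> t <= b -> is_derive t 1 H (H' t)) -> (forall t, H' t <= B) -> H b - H 0 <= B * b.
Proof.
move=> b0 dH HB.
have [||t ti E] := @MVT R H H' 0 b b0.
- by move=> t; rewrite in_itv/= => /andP[t0 t1]; apply: dH; exact: ltW.
- apply: derivable_within_continuous => t; rewrite in_itv/= => /andP[t0 t1].
 by have [] := dH t t0 t1.
by rewrite E subr0 ler_wpM2r// ltW.
Qed.

Lemma antiderivative {R} th a u : a < u -> (forall t, {for t, continuous th}) ->
 exists F : R -> R, (forall x : R, a < x -> x < u -> is_derive x 1 F (th x)).
Proof.
move=> au cth.
have i : leb.-integrable `[a, u] (EFin \o th).
 apply: continuous_compact_integrable; first exact: segment_compact.
 by apply: continuous_subspaceT => t; exact: cth.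
exists (fun x : R => \int[leb]_(t in `[a, x]) th t) => x x1 xu.
have [d1 d2] := continuous_FTC1_closed xu i x1 (@cth x).
by split; [exact: d1|rewrite -derive1E; exact: d2].
Qed.

Lemma integral_antiderivative {R} th F a u b c : a < b -> b < c -> c < u -> (forall t, {for t, continuous th}) ->
 (forall x : R, a < x -> x < u -> is_derive x 1 F (th x)) ->
 (\int[leb]_(t in `[b, c]) (th t)%:E = (F c - F b)%:E)%E.
Proof.
move=> ab bc cu cth dF.
have cF (x : R) : a < x -> x < u -> {for x, continuous F}.
 by move=> x1 xu; have [d _] := dF x x1 xu; apply: differentiable_continuous; exact/derivable1_diffP.
rewrite (@continuous_FTC2 R th F) ?EFinB//.
- by apply: continuous_subspaceT => t; exact: cth.
- split.
 + move=> x; rewrite in_itv/= => /andP[x0 xp].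
  by have [] := dF x (lt_trans ab x0) (lt_trans xp cu).
 + by apply: cvg_at_right_filter; apply: cF => //; exact: lt_trans bc cu.
 + by apply: cvg_at_left_filter; apply: cF => //; exact: lt_trans ab bc.
- move=> x; rewrite in_itv/= => /andP[x0 xp].
 by have [_ <-] := dF x (lt_trans ab x0) (lt_trans xp cu); rewrite derive1E.
Qed.

Lemma is_derive_shift {R} F (c t d : R) : is_derive (t + c) 1 F d -> is_derive t 1 (fun t : R => F (t + c)) d.
Proof.
move=> dF.
have i1 : is_derive t 1 (fun t : R => t + c) 1 by apply: is_derive_eq; rewrite addr0.
have := @is_derive1_comp R F (fun t => t + c) t d 1 dF i1; rewrite mulr1; exact.
Qed.

(** The circle is folded onto a quarter of it: with F an antiderivative of [th], the function F(t) +
    F(t + pi/2) + F(t + pi) + F(t + 3 pi/2) has derivative at most [B], and its increment over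
    [0, pi/2] is F(2 pi) - F(0). *)
Lemma four_point_integral {R} (th : R -> R) B : (forall t, {for t, continuous th}) ->
 (forall t, th t + th (t + pi / 2) + th (t + pi) + th (t + (pi + pi / 2)) <= B) ->
 (\int[leb]_(t in `[0%R, (2 * pi)%R]) (th t)%:E <= (B * (pi / 2))%:E)%E.
Proof.
move=> cth HB.
have p0 : 0 < pi :> R := pi_gt0 R.
have p2 : 0 < pi / 2 :> R by rewrite divr_gt0.
have [au m1 pu] : [/\ -1 < 4 * pi :> R, -1 < 0 :> R & 2 * pi < 4 * pi :> R] by split; lra.
have [F dF] := antiderivative au cth.
rewrite (integral_antiderivative m1 _ pu cth dF) ?mulr_gt0// lee_fin.
pose H' (t : R) := th t + th (t + pi / 2) + th (t + pi) + th (t + (pi + pi / 2)).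
have := @mvt_upper R (fun t => F t + F (t + pi / 2) + F (t + pi) + F (t + (pi + pi / 2))) H' (pi / 2) B p2.
have e1 : pi / 2 + pi / 2 = pi :> R by lra.
have e2 : pi / 2 + pi = pi + pi / 2 :> R by rewrite addrC.
have e3 : pi / 2 + (pi + pi / 2) = 2 * pi :> R by lra.
rewrite !add0r e1 e2 e3.
rewrite (_ : _ + _ + _ + F (2 * pi) - _ = F (2 * pi) - F 0); last first.
 by move: (F (pi / 2)) (F pi) (F (pi + pi / 2)) (F (2 * pi)) (F 0) => A1 A2 A3 A4 A5; ring.
apply => // t t0 t1.
have sh c : -1 < t + c -> t + c < 4 * pi -> is_derive t 1 (fun t : R => F (t + c)) (th (t + c)).
 by move=> h1 h2; apply: is_derive_shift; exact: dF.
have a1 : is_derive t 1 F (th t) by apply: dF; lra.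
have a2 := sh (pi / 2); have a3 := sh pi; have a4 := sh (pi + pi / 2).
have {}a2 : is_derive t 1 (fun t : R => F (t + pi / 2)) (th (t + pi / 2)) by apply: a2; lra.
have {}a3 : is_derive t 1 (fun t : R => F (t + pi)) (th (t + pi)) by apply: a3; lra.
have {}a4 : is_derive t 1 (fun t : R => F (t + (pi + pi / 2))) (th (t + (pi + pi / 2))).
 by apply: a4; lra.
exact: (is_deriveD (is_deriveD (is_deriveD a1 a2) a3) a4).
Qed.

Lemma circle_rot {R} z (r t : R) : let h := (r * cos t, r * sin t) in
 [/\ circle_point z r t = z + h, circle_point z r (t + pi / 2) = z + rot h,
  circle_point z r (t + pi) = z - h & circle_point z r (t + (pi + pi / 2)) = z - rot h].
Proof.
have cpi (s : R) : cos (s + pi) = - cos s by rewrite cosDpi.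
have spi (s : R) : sin (s + pi) = - sin s by rewrite sinDpi.
have c4 (s : R) : cos (s + (pi + pi / 2)) = sin s by rewrite addrA cosDpihalf spi opprK.
have s4 (s : R) : sin (s + (pi + pi / 2)) = - cos s by rewrite addrA sinDpihalf cpi.
by split; apply: plane_ext; rewrite /circle_point /rot /= ?sinDpihalf ?cosDpihalf ?cpi ?spi ?c4 ?s4;
 rewrite ?mulrN ?opprK.
Qed.

Lemma lteDfin {R} u (g a : R) : (u + g%:E < a%:E)%E = (u < (a - g)%:E)%E.
Proof. by rewrite EFinB lteBrDr. Qed.

Lemma leeDfin {R} u (g a : R) : (u + g%:E <= a%:E)%E = (u <= (a - g)%:E)%E.
Proof. by rewrite EFinB leeBrDr. Qed.

Lemma lte_between {R} u a : (u < a%:E)%E -> exists2 b : R, (u < b%:E)%E & b < a.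
Proof.
case: u => [c| |]//; last by move=> _; exists (a - 1); [exact: ltNyr|lra].
by rewrite lte_fin => ca; exists ((c + a) / 2); rewrite ?lte_fin; lra.
Qed.

Lemma continuous_for_pair {R} {T : topologicalType} f g (t : T) : {for t, continuous f} -> {for t, continuous g} ->
 {for t, continuous (fun x => (f x, g x) : plane R)}.
Proof.
move=> cf cg A [[U V] /= [Uf Vg] UV].
have h1 : \forall s \near t, U (f s) by exact: cf.
have h2 : \forall s \near t, V (g s) by exact: cg.
change (nbhs t (fun s => A (f s, g s))).
apply: (@filterS _ _ (nbhs_filter t) _ _ _ (@filterI _ _ (nbhs_filter t) _ _ h1 h2)) => s [Us Vs].
by apply: UV; split.
Qed.

Lemma continuous_sqn {R} : continuous (@sqn R).
Proof. by move=> z; apply: cvgD; apply: cvgM; (exact: cvg_fst || exact: cvg_snd). Qed.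

(** At a maximum p of u + g + eta |z|^2, u is bounded on small circles by a continuous function
    whose mean, computed by four-point sums, is at most u(p) + C r^4 / 4 - eta r^2. For small r this
    contradicts the submean inequality; the order-four error for g is what leaves eta r^2
    dominant. *)
Lemma subharmonic_max_principle {R} D U u g B : (forall z, D z -> `|z.1| <= B /\ `|z.2| <= B) ->
 (forall z, D z -> \forall y \near z, D y) -> D `<=` U -> (forall z, D z -> {for z, continuous g}) ->
 (forall z, D z -> exists C r : R, 0 < r /\
  forall h, sqn h < r ^+ 2 -> - (C * sqn h ^+ 2) <= sum4 g z h - 4 * g z) -> subharmonic_on U u ->
 (forall z, ~ D z -> forall eps : R, 0 < eps -> \forall y \near z, D y -> (u y + (g y)%:E < eps%:E)%E) ->
 forall z, D z -> (u z + (g z)%:E <= 0)%E.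
Proof.
move=> DB Do DU gc g4 [uoo usc um] bd z1 D1; rewrite leNgt; apply/negP => f1.
have [||p [eta [Dp eta0 fp pmax]]] := @max_quadratic R D (fun z => u z + (g z)%:E)%E B z1 DB _ _ bd D1 f1.
- by move=> z Dz; rewrite lte_add_pinfty ?ltry//; exact: uoo (DU _ Dz).
- move=> z Dz a za; rewrite lteDfin in za.
 have [b ub gb] := lte_between za.
 have n1 : \forall y \near z, U y -> (u y < b%:E)%E := usc z (DU _ Dz) b ub.
 have n2 : \forall y \near z, g y < g z + (a - g z - b).
  have /cvgrPdist_lt/(_ (a - g z - b)) := gc z Dz; rewrite subr_gt0 => /(_ gb).
  apply: filterS => y; rewrite ltr_norml => /andP[h _]; lra.
 apply: filterS2 n1 n2 => y h1 h2 Dy; rewrite lteDfin.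
 by apply: lt_le_trans (h1 (DU _ Dy)) _; rewrite lee_fin; lra.
have [v uv] : exists v : R, u p = v%:E.
 by move: fp (uoo p (DU _ Dp)); case: (u p) => [c| |]//; exists c.
pose M := v + g p + eta * sqn p.
have {}pmax z : D z -> (u z <= (M - g z - eta * sqn z)%:E)%E.
 move=> Dz; have := pmax _ Dz; rewrite uv -addeA -EFinD leeDfin => h.
 by apply: le_trans h _; rewrite lee_fin /M; lra.
have [C [r1 [r10 H4]]] := g4 p Dp.
have [r2 r20 H2] := near_axes (Do p Dp).
have [r3 r30 H3] := um p (DU _ Dp).
have [r [r0 rr1 rr2 rr3 rC]] : exists r : R, [/\ 0 < r, r < r1, r < r2, r < r3 & C * r ^+ 2 < 4 * eta].
 pose c := Num.min (Num.min r1 r2) (Num.min r3 (Num.min 1 (eta / (`|C| + 1)))).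
 have c0 : 0 < c by rewrite !lt_min r10 r20 r30 ltr01 divr_gt0.
 have c2 : c / 2 < c by rewrite ltr_pdivrMr// mulr2n; lra.
 have := c2; rewrite {2}/c !lt_min => /andP[/andP[h1 h2] /andP[h3 /andP[h4 h5]]].
 have c20 : 0 < c / 2 by rewrite divr_gt0.
 exists (c / 2); split => //.
 have h6 : (c / 2) ^+ 2 <= c / 2 by rewrite expr2 ger_pMr// ltW.
 apply: (@le_lt_trans _ _ (`|C| * (c / 2))).
  apply: (@le_trans _ _ (`|C| * (c / 2) ^+ 2)); last by rewrite ler_wpM2l.
  by rewrite ler_wpM2r ?sqr_ge0// ler_norm.
 have : (c / 2) * (`|C| + 1) < eta by rewrite -ltr_pdivlMr.
 nra.
pose th (t : R) := M - g (circle_point p r t) - eta * sqn (circle_point p r t).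
have sqh (t : R) : sqn (r * cos t, r * sin t) = r ^+ 2.
 by rewrite /sqn/= !exprMn -mulrDr cos2Dsin2 mulr1.
have Dc (t : R) : D (circle_point p r t).
 have [-> _ _ _] := circle_rot p r t; apply: H2; rewrite sqh ltrXn2r// ?ltW//.
have ccp (t : R) : {for t, continuous (circle_point p r)}.
 apply: continuous_for_pair.
  by apply: cvgD; [exact: cvg_cst|apply: cvgM; [exact: cvg_cst|exact: continuous_cos]].
 by apply: cvgD; [exact: cvg_cst|apply: cvgM; [exact: cvg_cst|exact: continuous_sin]].
have cth (t : R) : {for t, continuous th}.
 apply: cvgB; first apply: cvgB.
 - exact: cvg_cst.
 - exact: (@continuous_comp _ _ _ _ g t (@ccp t) (gc _ (Dc t))).
 - apply: cvgM; first exact: cvg_cst.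
  exact: (@continuous_comp _ _ _ _ sqn t (@ccp t) (@continuous_sqn _ _)).
have bth (t : R) : th t + th (t + pi / 2) + th (t + pi) + th (t + (pi + pi / 2)) <=
  4 * v + C * r ^+ 4 - 4 * eta * r ^+ 2.
 rewrite /th; have [-> -> -> ->] := circle_rot p r t.
 have rr : r ^+ 2 < r1 ^+ 2 by rewrite ltrXn2r// ltW.
 set h := (_, _); have := H4 h; rewrite sqh => /(_ rr).
 have := sum4_sqn p h; rewrite sqh /sum4 -exprM => q4 hs.
 have q5 : eta * sqn (p + h) + eta * sqn (p - h) + eta * sqn (p + rot h) +
  eta * sqn (p - rot h) = 4 * (eta * sqn p) + 4 * (eta * r ^+ 2).
  by rewrite -!mulrDr q4; ring.
 rewrite /M; lra.
have := H3 r r0 rr3; rewrite uv.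
have h1 := four_point_integral cth bth.
have h2 : (\int[leb]_(t in `[0%R, (2 * pi)%R]) u (circle_point p r t) <=
  \int[leb]_(t in `[0%R, (2 * pi)%R]) (th t)%:E)%E.
 by apply: le_integral_pointwise => t _; exact: pmax.
have p0 : 0 < pi :> R := pi_gt0 R.
have h3 := le_trans h2 h1 => h4.
have pp : (0 <= ((2 * pi)^-1)%:E :> \bar R)%E by rewrite lee_fin invr_ge0 mulr_ge0 ?ltW.
have := le_trans h4 (lee_wpmul2l pp h3); rewrite -EFinM lee_fin.
have quarter (P a : R) : P != 0 -> (2 * P)^-1 * (a * (P / 2)) = a / 4.
 by move=> P0; field.
rewrite quarter ?gt_eqF//.
have -> : 4 * v + C * r ^+ 4 - 4 * eta * r ^+ 2 = 4 * v + (C * r ^+ 2 - 4 * eta) * r ^+ 2 by ring.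
have : (C * r ^+ 2 - 4 * eta) * r ^+ 2 < 0.
 by rewrite nmulr_rlt0 ?exprn_gt0// subr_lt0.
lra.
Qed.

(** * Potentials as limits of averages, and their positivity off [K] *)

Definition rho {R} (z : plane R) (t : R) : R := Num.sqrt ((z.1 - t) ^+ 2 + z.2 ^+ 2).

Lemma rho_ge0 {R} z (t : R) : 0 <= rho z t.
Proof. exact: sqrtr_ge0. Qed.

Lemma rho_sqr {R} z (t : R) : rho z t ^+ 2 = (z.1 - t) ^+ 2 + z.2 ^+ 2.
Proof. by rewrite sqr_sqrtr// addr_ge0 ?sqr_ge0. Qed.

Lemma lg_rho {R} z (t : R) : lg z t = ln (rho z t).
Proof.
rewrite /lg -rho_sqr; have := rho_ge0 z t; rewrite le_eqVlt => /orP[/eqP <-|r0].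
 by rewrite expr0n/= ln0// mul0r.
by rewrite lnXn// mulr2n; lra.
Qed.

Lemma rho_ge_abs {R} z (t : R) : `|z.1 - t| <= rho z t.
Proof.
by rewrite -(@ler_pXn2r _ 2) ?nnegrE ?rho_ge0// real_normK ?num_real// rho_sqr lerDl sqr_ge0.
Qed.

Lemma rho_lip {R} z (t t' : R) : `|rho z t - rho z t'| <= `|t - t'|.
Proof.
have := rho_ge0 z t; have := rho_ge0 z t' => a0 b0.
have [s0|s0] := eqVneq (rho z t + rho z t') 0.
 have -> : rho z t = 0 by lra.
 have -> : rho z t' = 0 by lra.
 by rewrite subrr normr0.
have sp : 0 < rho z t + rho z t' by rewrite lt_neqAle eq_sym s0 addr_ge0.
rewrite -(ler_pM2r sp) -[X in `|_| * X](gtr0_norm sp) -normrM.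
rewrite (_ : (_ - _) * _ = (t' - t) * ((z.1 - t) + (z.1 - t'))); last first.
 by rewrite -subr_sqr !rho_sqr; ring.
rewrite normrM (distrC t') ler_wpM2l//.
by apply: le_trans (ler_normD _ _) _; apply: lerD; exact: rho_ge_abs.
Qed.

Lemma rho_le {R} z (t : R) : rho z t <= `|z.1 - t| + `|z.2|.
Proof.
have h1 : `|z.1 - t| ^+ 2 = (z.1 - t) ^+ 2 by rewrite real_normK ?num_real.
have h2 : `|z.2| ^+ 2 = z.2 ^+ 2 by rewrite real_normK ?num_real.
rewrite -(@ler_pXn2r _ 2) ?nnegrE ?rho_ge0 ?addr_ge0// [leRHS]sqrrD rho_sqr h1 h2.
by rewrite addrAC lerDl mulrn_wge0// mulr_ge0.
Qed.

Lemma eq_avg {R} s (f g : R -> R) : (forall x, x \in s -> f x = g x) -> avg s f = avg s g.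
Proof. by move=> fg; rewrite /avg; congr (_ / _); exact: eq_big_seq. Qed.

Lemma avgD {R} s (f g : R -> R) : avg s (fun x => f x + g x) = avg s f + avg s g.
Proof. by rewrite /avg big_split/= mulrDl. Qed.

Lemma avg_cst {R} s (c : R) : (0 < size s)%N -> avg s (fun=> c) = c.
Proof.
move=> s0; rewrite /avg big_const_seq count_predT iter_addr_0 -(mulr_natr c) mulfK//.
by rewrite pnatr_eq0 -lt0n.
Qed.

Lemma avg_addc {R} s f (c : R) : (0 < size s)%N -> avg s (fun x => f x + c) = avg s f + c.
Proof. by move=> s0; rewrite avgD avg_cst. Qed.

Lemma le_avg {R} s (f g : R -> R) : (forall x, x \in s -> f x <= g x) -> avg s f <= avg s g.
Proof.
move=> fg; rewrite /avg ler_wpM2r ?invr_ge0// big_seq [leRHS]big_seq.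
by apply: ler_sum.
Qed.

Lemma avg_lg_cvg {R} K X (F : set_system nat) (mu : prob R) z d : ProperFilter F -> compact K -> mu K = 1%E ->
 (forall n, size (X n) = n.+2) -> (forall n x, x \in X n -> K x) ->
 (forall (f : R -> R) (L A : R), 0 <= L -> lip L f -> (forall x, 0 <= f x <= A) ->
   exists2 l : R, (\int[mu]_x (f x)%:E)%E = l%:E & avg (X n) f @[n --> F] --> l) ->
 0 < d -> (forall t, K t -> d <= rho z t) -> avg (X n) (lg z) @[n --> F] --> pot K mu z.
Proof.
move=> PF cK muK sX XK H d0 dz.
have mK := compact_measurable cK.
have [B B0 KB] := compact_bound cK.
pose D := Num.max d (`|z.1| + B + `|z.2|).
have dD : d <= D by rewrite le_max lexx.
have zD t : K t -> rho z t <= D.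
 move=> Kt; rewrite le_max; apply/orP; right; apply: le_trans (rho_le _ _) _.
 rewrite lerD2r; apply: le_trans (ler_normB _ _) _; rewrite lerD2l ler_norml; exact: KB.
pose A := ln D - ln d.
have A0 : 0 <= A by rewrite subr_ge0 ler_ln ?posrE// (lt_le_trans d0).
(* On [K] this is lg z - ln d; the two cut-offs make it Lipschitz and bounded on the whole line, as
   the convergence hypothesis demands. *)
pose f t := - Num.max (- A) (- (ln (Num.max d (rho z t)) - ln d)).
have g0 t : 0 <= ln (Num.max d (rho z t)) - ln d.
 by rewrite subr_ge0 ler_ln ?posrE ?lt_max ?d0// le_max lexx.
have fE t : K t -> f t = lg z t - ln d.
 move=> Kt; have m1 := dz t Kt; have m2 := zD t Kt.
 rewrite /f (max_idPr m1) lg_rho (max_idPr _) ?opprK// lerN2 lerD2r ler_ln ?posrE//.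
  exact: lt_le_trans m1.
 exact: lt_le_trans dD.
have fb t : 0 <= f t <= A.
 rewrite /f lerNr oppr0 ge_max !oppr_le0 A0 g0/= lerNl.
 by rewrite le_max lexx.
have fl : lip d^-1 f.
 move=> x y; rewrite /f opprK addrC; apply: le_trans (max_lip _ _ _) _.
 rewrite opprK addrC (_ : _ - _ - _ = ln (Num.max d (rho z x)) - ln (Num.max d (rho z y))); last by ring.
 apply: le_trans (ln_lip d0 _ _) _; rewrite ?le_max ?lexx//.
 rewrite ler_wpM2l ?invr_ge0 ?(ltW d0)//.
 exact: le_trans (max_lip _ _ _) (rho_lip _ _ _).
have id0 : 0 <= d^-1 by rewrite invr_ge0 ltW.
have [l lE lc] := H f d^-1 A id0 fl fb.
have mf : measurable_fun setT f by exact: lip_measurable fl.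
have fi : intR mu setT f by exact: bounded_integrableT mf fb.
have muc : mu (setT `\` K) = 0%E by rewrite setTD; exact: prob_compl0.
have fK : \int[mu]_(t in K) f t = l.
 rewrite -(Rint_restrict measurableT mK (@subsetT _ K) muc fi).
 by rewrite /Rintegral lE.
have fiK : intR mu K f by exact: integrableS fi.
have potE : pot K mu z = l + ln d.
 rewrite /pot (_ : \int[mu]_(t in K) lg z t = \int[mu]_(t in K) (f t + ln d)).
  rewrite RintegralD// ?Rint_prob_cst ?fK//.
  by exact: cst_integrable.
 by apply: eq_Rintegral => t /set_mem Kt; rewrite fE// subrK.
rewrite potE.
have -> : (fun n => avg (X n) (lg z)) = (fun n => avg (X n) f + ln d).
 apply/funext => n; rewrite -avg_addc ?sX//; apply: eq_avg => t /XK Kt.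
 by rewrite fE// subrK.
by apply: cvgD => //; exact: cvg_cst.
Qed.

Lemma pot_lower {R} K mu V f z (a : R) : compact K -> pot_ok K mu V -> intR mu K f ->
 (forall t, K t -> t != a -> f t <= lg z t) -> \int[mu]_(t in K) f t <= pot K mu z.
Proof.
move=> cK [muK at0 int ge] fi fl.
have mK := compact_measurable cK.
have mG : measurable (K `\ a) by exact: measurableD.
have GK : K `\ a `<=` K by move=> t [].
have G0 : mu (K `\` (K `\ a)) = 0%E.
 apply/eqP; rewrite -measure_le0 -(at0 a); apply: le_measure; rewrite ?inE//.
  by apply: measurableD => //; exact: measurableD.
 by move=> t [Kt] nt; apply: contrapT => ta; apply: nt.
apply: (ae_le_Rint mK mG GK G0 fi (int z)) => t [Kt /eqP ta]; exact: fl.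
Qed.

Lemma ln_midpoint {R} (p1 p2 a r M : R) : p1 * p2 = (a - r) ^+ 2 -> 0 <= p1 -> 0 <= p2 -> 0 <= r -> r < a -> a <= M ->
 2^-1 * (ln p1 / 2 + ln p2 / 2) + r / M / 2 <= ln a / 2.
Proof.
move=> e p10 p20 r0 ra aM.
have a0 : 0 < a by exact: le_lt_trans ra.
have ar : 0 < a - r by rewrite subr_gt0.
have ar2 : 0 < (a - r) ^+ 2 by rewrite exprn_gt0.
have q1 : 0 < p1.
 by rewrite lt_neqAle p10 andbT eq_sym; apply: contraTneq ar2 => h; rewrite -e h mul0r ltxx.
have q2 : 0 < p2.
 by rewrite lt_neqAle p20 andbT eq_sym; apply: contraTneq ar2 => h; rewrite -e h mulr0 ltxx.
have l1 : ln p1 + ln p2 = 2 * ln (a - r) by rewrite -lnM ?posrE// e lnXn// mulr2n; lra.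
have ra1 : r / a < 1 by rewrite ltr_pdivrMr// mul1r.
have l2 : ln (a - r) = ln a + ln (1 + - (r / a)).
 rewrite -lnM ?posrE ?subr_gt0//; congr ln; field; exact: lt0r_neq0.
have := @le_ln1Dx R (- (r / a)); rewrite ltrN2 => /(_ ra1) l3.
have l4 : r / M <= r / a by rewrite ler_wpM2l// lef_pV2 ?posrE// (lt_le_trans a0).
lra.
Qed.

(** A quantitative form of V + pot > 0 at distance d from [K]. If |z.2| >= d / 2, compare with the
    point below z on the axis; otherwise x = z.1 keeps distance d / 2 from [K], and strict concavity
    of ln between x - r and x + r provides the gain. *)
Lemma pot_pos {R} (K : set R) (mu : prob R) (V d b : R) : compact K -> pot_ok K mu V -> 0 < d ->
 exists2 c : R, 0 < c & forall z : plane R, `|z.1| <= b -> (forall t, K t -> d <= rho z t) -> c <= V + pot K mu z.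
Proof.
move=> cK pK d0; have [muK at0 int ge] := pK.
have mK := compact_measurable cK.
have [B B0 KB] := compact_bound cK.
pose M := `|b| + B.
have M0 : 0 < M by rewrite ltr_wpDl.
pose c1 := ln (1 + (d / 2) ^+ 2 / M ^+ 2) / 2.
have c10 : 0 < c1.
 by rewrite divr_gt0// ln_gt0// ltrDl divr_gt0 ?exprn_gt0// divr_gt0.
pose r := d / 4; have r0 : 0 < r by rewrite divr_gt0.
pose c2 := r ^+ 2 / M ^+ 2 / 2.
have c20 : 0 < c2 by rewrite divr_gt0// divr_gt0 ?exprn_gt0.
have ci (c : R) : intR mu K (fun=> c) by exact: cst_integrable.
exists (Num.min c1 c2); first by rewrite lt_min c10.
move=> [x y] /= xb dz.
have zM t : K t -> (x - t) ^+ 2 <= M ^+ 2.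
 move=> Kt; rewrite -real_normK ?num_real// lerXn2r ?nnegrE ?(ltW M0)//.
 apply: le_trans (ler_normB _ _) _; apply: lerD; first exact: le_trans xb (ler_norm _).
 by rewrite ler_norml; exact: KB.
have [yd|yd] := lerP (d / 2) `|y|.
 have h : \int[mu]_(t in K) (lg (x, 0) t + c1) <= pot K mu (x, y).
  apply: (@pot_lower _ _ _ V _ _ x) => //; first exact: (integrableD mK (int (x, 0)) (ci c1)).
  move=> t Kt tx; rewrite /lg/= expr0n/= addr0 /c1 -mulrDl ler_pM2r ?invr_gt0//.
  have p : 0 < (x - t) ^+ 2 by rewrite exprn_even_gt0//= subr_eq0 eq_sym.
  have q : 0 < 1 + (d / 2) ^+ 2 / M ^+ 2.
   by rewrite ltr_pwDl// divr_ge0 ?sqr_ge0.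
  have m := zM t Kt; have dp : 0 < d / 2 by rewrite divr_gt0.
  set D := (d / 2) ^+ 2 / M ^+ 2 in q *.
  have DM : M ^+ 2 * D = (d / 2) ^+ 2 by rewrite mulrC divfK ?gt_eqF ?exprn_gt0.
  have D0 : 0 <= D by rewrite divr_ge0 ?sqr_ge0.
  have y2 : (d / 2) ^+ 2 <= y ^+ 2.
   by rewrite -[leRHS]real_normK ?num_real// lerXn2r// nnegrE ltW.
  have y0 := sqr_ge0 y.
  move: p m; move: ((x - t) ^+ 2) => a p m.
  have h1 := ler_wpM2r D0 m.
  have h2 : 0 < a * (1 + D) by rewrite mulr_gt0.
  have h3 : 0 < a + y ^+ 2 by exact: ltr_wpDr.
  rewrite -lnM ?posrE//.
  by rewrite ler_ln ?posrE//; rewrite mulrDr mulr1; lra.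
 rewrite RintegralD// in h.
 rewrite Rint_prob_cst// in h.
 rewrite ge_min; apply/orP; left.
 have := ge (x, 0); rewrite /pot in h *; lra.
have dx t : K t -> (d / 2) ^+ 2 <= (x - t) ^+ 2.
 move=> Kt; have := dz t Kt; rewrite -(@ler_pXn2r _ 2) ?nnegrE ?rho_ge0 ?(ltW d0)//.
 rewrite rho_sqr/= => h.
 have : y ^+ 2 <= (d / 2) ^+ 2.
  by rewrite -real_normK ?num_real// lerXn2r// ?nnegrE ltW// divr_gt0.
 have : 0 < d ^+ 2 by rewrite exprn_gt0.
 have : (d / 2) ^+ 2 = d ^+ 2 / 4 by field.
 lra.
have h : \int[mu]_(t in K) (2^-1 * (lg (x - r, 0) t + lg (x + r, 0) t) + c2) <= pot K mu (x, y).
 apply: (@pot_lower _ _ _ V _ _ x) => //.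
  have i1 := integrableD mK (int (x - r, 0)) (int (x + r, 0)).
  exact: (integrableD mK (integrableZl mK (2^-1) i1) (ci c2)).
 move=> t Kt tx; have xt : ((x, y) : plane R).1 != t by rewrite eq_sym.
 apply: le_trans (lg_le_lg0 xt).
 have rd : r ^+ 2 = (d / 2) ^+ 2 / 4 by rewrite /r; field.
 have dp : 0 < (d / 2) ^+ 2 by rewrite exprn_gt0// divr_gt0.
 have p := dx t Kt.
 rewrite /lg/= expr0n/= !addr0.
 apply: ln_midpoint => //; first by ring.
 - exact: sqr_ge0.
 - exact: sqr_ge0.
 - exact: sqr_ge0.
 - by rewrite rd; lra.
 - exact: zM.
have i0 := integrableD mK (int (x - r, 0)) (int (x + r, 0)).
have i1 := integrableZl mK (2^-1) i0.
rewrite RintegralD// Rint_prob_cst// RintegralZl// RintegralD// in h.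
rewrite ge_min; apply/orP; right.
have := ge (x - r, 0); have := ge (x + r, 0); rewrite /pot in h *; lra.
Qed.

(** * Coordinates that send the pole to infinity *)

Definition ginv {R} (z : plane R) : plane R := (z.1 / sqn z, - z.2 / sqn z).

(** [ginv] is complex inversion, so this is 1 / (z - q) for a finite pole; [lcoord] is its trace on
    the real axis. *)
Definition coord {R} (q : option R) (z : plane R) : plane R := if q is Some q then ginv (z.1 - q, z.2) else z.

Definition lcoord {R} (q : option R) (t : R) : R := if q is Some q then (t - q)^-1 else t.

Definition Kq {R} (q : option R) (e : set R) : set R := [set lcoord q t | t in e].

Definition off_pole {R} (q : option R) (z : plane R) : Prop := if q is Some q then z <> (q, 0) else True.

Definition pole_out {R} (q : option R) (e : set R) : Prop := if q is Some q then ~ e q else True.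

(** Coefficients of |coord q z - s| = |ka z - kb| / |ka0 z - kb0|: for a finite pole the numerator
    is |s (z - q) - 1| and the denominator |z - q|. For q = oo the denominator is 1, and [kc] = 0
    removes its logarithm. *)
Definition ka {R} (q : option R) (s : R) : R := if q is Some _ then s else 1.
Definition kb {R} (q : option R) (s : R) : R := if q is Some q then 1 + s * q else s.
Definition kc {R} (q : option R) : R := if q is Some _ then 1 else 0.
Definition ka0 {R} (q : option R) : R := if q is Some _ then 1 else 0.
Definition kb0 {R} (q : option R) : R := if q is Some q then q else 1.

Lemma sqn_eq0 {R} (z : plane R) : sqn z = 0 -> z = 0.
Proof.
move=> h; have := sqr_ge0 z.1; have := sqr_ge0 z.2; rewrite /sqn in h => h1 h2.
by apply: plane_ext => /=; apply/eqP; rewrite -sqrf_eq0; apply/eqP; lra.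
Qed.

Lemma off_pole_sqn {R} q (z : plane R) : z <> (q, 0) -> 0 < sqn (z.1 - q, z.2).
Proof.
move=> zq; rewrite lt_neqAle sqn_ge0 andbT eq_sym; apply/eqP => /sqn_eq0 h; apply: zq.
apply: plane_ext => /=; last exact: (congr1 snd h).
by have := congr1 fst h => /= /eqP; rewrite subr_eq0 => /eqP.
Qed.

Lemma kq0_neq0 {R} q (z : plane R) : off_pole q z -> nk (ka0 q) (kb0 q) z != 0.
Proof.
case: q => [q|] /=; last by rewrite /nk /= mul0r sub0r expr2 mulrNN mulr1 mul0r expr0n/= addr0 oner_neq0.
move=> /off_pole_sqn h; rewrite /nk !mul1r; exact: lt0r_neq0.
Qed.

Lemma nk_coord {R} q z (s : R) : off_pole q z ->
 rho (coord q z) s ^+ 2 = nk (ka q s) (kb q s) z / nk (ka0 q) (kb0 q) z.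
Proof.
rewrite rho_sqr; case: q => [q|] /=; last first.
 by move=> _; rewrite /nk /ka /kb /ka0 /kb0 mul0r sub0r mul0r expr0n/= addr0 sqrrN expr1n divr1 !mul1r.
move=> /off_pole_sqn; rewrite /nk /sqn /= !mul1r => h.
by field; rewrite lt0r_neq0.
Qed.

Lemma coord_real {R} q e (t : R) : pole_out q e -> e t -> coord q (t, 0) = (lcoord q t, 0).
Proof.
case: q => [q|] //= eq et; apply: plane_ext => /=; rewrite /sqn/= expr0n/= addr0.
 have tq : t - q != 0 by apply: contra_notN eq; rewrite subr_eq0 => /eqP <-.
 by field.
by rewrite oppr0 mul0r.
Qed.

Lemma coord_notin {R} q e z (s : R) :
 pole_out q e -> off_pole q z -> ~ pline e z -> Kq q e s -> coord q z <> (s, 0).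
Proof.
move=> qe oz ze [t et <-] h; apply: ze; exists t => //; move: oz h; case: q qe => [q|] //=.
move=> eq zq h.
have S0 := off_pole_sqn zq.
have := congr1 snd h; rewrite /= => /eqP; rewrite mulf_eq0 invr_eq0 (gt_eqF S0) orbF oppr_eq0 => /eqP z2.
have := congr1 fst h; rewrite /= /sqn/= z2 expr0n/= addr0.
have zq1 : z.1 - q != 0 by apply: contraTneq S0 => h0; rewrite /sqn/= h0 z2 expr0n/= addr0 ltxx.
rewrite expr2 invfM mulrA divff// mul1r => /invr_inj h1.
by apply: plane_ext => //=; lra.
Qed.

Lemma rho_eq0 {R} z (s : R) : rho z s = 0 -> z = (s, 0).
Proof.
move=> h; have := rho_sqr z s; rewrite h expr0n/= => /esym h1.
have /= := @sqn_eq0 R (z.1 - s, z.2) h1 => h2; apply: plane_ext => /=; last exact: (congr1 snd h2).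
by have := congr1 fst h2 => /= /eqP; rewrite subr_eq0 => /eqP.
Qed.

Lemma kq_neq0 {R} q e z (s : R) :
 pole_out q e -> off_pole q z -> ~ pline e z -> Kq q e s -> nk (ka q s) (kb q s) z != 0.
Proof.
move=> qe oz ze Ks; apply/negP => /eqP h; apply: (coord_notin qe oz ze Ks).
apply: rho_eq0; apply/eqP; rewrite -sqrf_eq0 nk_coord// h mul0r//.
Qed.

Lemma lg_coord {R} q e z (s : R) : pole_out q e -> off_pole q z -> ~ pline e z -> Kq q e s ->
 lg (coord q z) s = lgk (ka q s) (kb q s) z - kc q * lgk (ka0 q) (kb0 q) z.
Proof.
move=> qe oz ze Ks.
have n1 : 0 < nk (ka q s) (kb q s) z.
 by rewrite lt_neqAle nk_ge0 andbT eq_sym; exact: kq_neq0 Ks.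
have n0 : 0 < nk (ka0 q) (kb0 q) z by rewrite lt_neqAle nk_ge0 andbT eq_sym; exact: kq0_neq0.
rewrite lg_rho /lgk.
have -> : ln (rho (coord q z) s) = ln (rho (coord q z) s ^+ 2) / 2.
 have r0 : 0 < rho (coord q z) s.
  rewrite lt_neqAle rho_ge0 andbT eq_sym; apply/eqP => /rho_eq0; exact: coord_notin Ks.
 by rewrite lnXn// mulr2n; lra.
rewrite nk_coord// lnM ?posrE ?invr_gt0// lnV ?posrE//.
case: q qe oz Ks n1 n0 => [q|] /= *; first by rewrite /kc; ring.
by rewrite /kc mul0r subr0 /nk /ka0 /kb0 /= !mul0r sub0r sqrrN expr1n expr0n/= addr0 ln1 subr0.
Qed.

Lemma continuous_coord {R} q (z : plane R) : off_pole q z -> {for z, continuous (coord q)}.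
Proof.
case: q => [q|] /=; last by move=> _; exact: cvg_id.
move=> /off_pole_sqn S0.
have c1 : {for z, continuous (fun z : plane R => z.1 - q)} by apply: cvgB; [exact: cvg_fst|exact: cvg_cst].
have c2 : {for z, continuous (fun z : plane R => z.2)} by exact: cvg_snd.
have cs : {for z, continuous (fun z : plane R => sqn (z.1 - q, z.2))}.
 by apply: cvgD; apply: cvgM; (exact: c1 || exact: c2).
have cV : {for z, continuous (fun z : plane R => (sqn (z.1 - q, z.2))^-1)}.
 by apply: cvgV; [exact: lt0r_neq0|exact: cs].
apply: continuous_for_pair; first by apply: cvgM; [exact: c1|exact: cV].
by apply: cvgM; [apply: cvgN; exact: c2|exact: cV].
Qed.

Lemma lcoord_inj {R} (q : option R) : injective (lcoord q).
Proof. by case: q => [q|] //= x y /invr_inj; lra. Qed.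

Lemma Kq_compact {R} q (e : set R) : compact e -> pole_out q e -> compact (Kq q e).
Proof.
move=> ce qe; apply: continuous_compact => //.
apply/subspace_continuousP => t et.
have ct : {for t, continuous (lcoord q)}.
 case: q qe => [q|] /=; last by move=> _; exact: cvg_id.
 move=> eq; apply: cvgV; last by apply: cvgB; [exact: cvg_id|exact: cvg_cst].
 by apply: contra_notN eq; rewrite subr_eq0 => /eqP <-.
by apply: cvg_trans ct; apply: cvg_app; exact: cvg_within.
Qed.

Lemma Kq_infinite {R} q (e : set R) : infinite_set e -> infinite_set (Kq q e).
Proof.
move=> ie fK; apply: ie.
apply: (@sub_finite_set _ _ ((lcoord q) @^-1` (Kq q e))); first by move=> t et; exists t.
by apply: finite_preimage => // x y _ _; exact: lcoord_inj.
Qed.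

(** * Fekete sums as comparison functions *)

(** The order-four error asked for by [subharmonic_max_principle], in a two-sided form that is
    stable under linear combinations. *)
Definition fp {R} (g : plane R -> R) (z : plane R) : Prop :=
 exists C r : R, [/\ 0 < r, 0 <= C & forall h, sqn h < r ^+ 2 -> `|sum4 g z h - 4 * g z| <= C * sqn h ^+ 2].

Lemma fp_lin {R} f g z (a b c : R) : fp f z -> fp g z -> fp (fun y => a * f y + b * g y + c) z.
Proof.
move=> [C [r [r0 C0 Hf]]] [C' [r' [r'0 C'0 Hg]]].
exists (`|a| * C + `|b| * C'), (Num.min r r'); split; first by rewrite lt_min r0.
 by rewrite addr_ge0// mulr_ge0.
move=> h hr.
have hr1 : sqn h < r ^+ 2.
 by apply: lt_le_trans hr _; rewrite lerXn2r ?nnegrE ?le_min ?(ltW r0) ?(ltW r'0)// ge_min lexx.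
have hr2 : sqn h < r' ^+ 2.
 by apply: lt_le_trans hr _; rewrite lerXn2r ?nnegrE ?le_min ?(ltW r0) ?(ltW r'0)// ge_min lexx orbT.
rewrite (_ : _ - _ = a * (sum4 f z h - 4 * f z) + b * (sum4 g z h - 4 * g z)); last first.
 by rewrite /sum4; ring.
apply: le_trans (ler_normD _ _) _; rewrite !normrM [leRHS]mulrDl -!(mulrA _ _ (sqn h ^+ 2)).
by apply: lerD; apply: ler_wpM2l => //; [exact: Hf|exact: Hg].
Qed.

Lemma fp_cst {R} c (z : plane R) : fp (fun=> c) z.
Proof.
exists 0, 1; split => // h _; rewrite mul0r normr_le0 /sum4 subr_eq0; apply/eqP; ring.
Qed.

Lemma fp_near {R} f g (z : plane R) : (\forall y \near z, f y = g y) -> fp f z -> fp g z.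
Proof.
move=> fg [C [r [r0 C0 H]]]; have [r' r'0 H'] := near_axes fg.
exists C, (Num.min r r'); split => //; first by rewrite lt_min r0.
move=> h hr.
have hr1 : sqn h < r ^+ 2.
 by apply: lt_le_trans hr _; rewrite lerXn2r ?nnegrE ?le_min ?(ltW r0) ?(ltW r'0)// ge_min lexx.
have hr2 : sqn h < r' ^+ 2.
 by apply: lt_le_trans hr _; rewrite lerXn2r ?nnegrE ?le_min ?(ltW r0) ?(ltW r'0)// ge_min lexx orbT.
have := H h hr1; rewrite /sum4 (nbhs_singleton fg) !H' ?sqnN ?sqn_rot//.
Qed.

Lemma fp_sum {R} s (f : R -> plane R -> R) z :
 (forall x, x \in s -> fp (f x) z) -> fp (fun y => \sum_(x <- s) f x y) z.
Proof.
elim: s => [|x s IH] H.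
 by rewrite (_ : (fun y => _) = (fun=> 0)); [exact: fp_cst|apply/funext => y; rewrite big_nil].
rewrite (_ : (fun y => _) = (fun y => 1 * f x y + 1 * (\sum_(x <- s) f x y) + 0)); last first.
 by apply/funext => y; rewrite big_cons !mul1r addr0.
apply: fp_lin; first by apply: H; rewrite mem_head.
by apply: IH => y ys; apply: H; rewrite in_cons ys orbT.
Qed.

Lemma ln_square_bounds {R} (x y : R) : 0 <= y -> y <= 4^-1 ->
 (1 - y) ^+ 2 <= x -> x <= (1 + y) ^+ 2 -> `|ln x / 2| <= 2 * y.
Proof.
move=> y0 y4 h1 h2.
have p1 : 0 < 1 - y by lra.
have p2 : 0 < 1 + y by lra.
have x0 : 0 < x by apply: lt_le_trans h1; rewrite exprn_gt0.
have u : ln x <= 2 * y.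
 have : ln x <= ln ((1 + y) ^+ 2) by rewrite ler_ln ?posrE ?exprn_gt0.
 rewrite lnXn// mulr2n; have := @le_ln1Dx R y; have : -1 < y by lra.
 by move=> hy /(_ hy); lra.
have l : - (4 * y) <= ln x.
 have : ln ((1 - y) ^+ 2) <= ln x by rewrite ler_ln ?posrE ?exprn_gt0.
 rewrite lnXn// mulr2n.
 have e : 1 - y = (1 + y / (1 - y))^-1 by field; rewrite lt0r_neq0//=; lra.
 have q0 : 0 <= y / (1 - y) by rewrite divr_ge0// ltW.
 have := @le_ln1Dx R (y / (1 - y)); have : -1 < y / (1 - y) by lra.
 move=> hy /(_ hy) h3.
 have h4 : y / (1 - y) <= 2 * y by rewrite ler_pdivrMr//; nra.
 have : ln (1 - y) = - ln (1 + y / (1 - y)) by rewrite {1}e lnV// posrE; lra.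
 lra.
by rewrite ler_norml; apply/andP; split; lra.
Qed.

(** The four arguments are |u + h|^2, |u - h|^2, |u + ih|^2 and |u - ih|^2 with |u|^2 = N and |h|^2
    = S. Their product is |u^4 - h^4|^2, which lies between N^4 (1 - y)^2 and N^4 (1 + y)^2 for y =
    (S / N)^2. *)
Lemma four_logs {R} (n1 n2 n3 n4 N S c d : R) :
 n1 = N + S + 2 * c -> n2 = N + S - 2 * c -> n3 = N + S + 2 * d -> n4 = N + S - 2 * d ->
 c ^+ 2 + d ^+ 2 = N * S -> 0 < N -> 0 <= S -> S <= N / 2 -> 0 <= n1 -> 0 <= n2 -> 0 <= n3 -> 0 <= n4 ->
 `|ln n1 / 2 + ln n2 / 2 + ln n3 / 2 + ln n4 / 2 - 4 * (ln N / 2)| <= 2 * (S / N) ^+ 2.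
Proof.
move=> e1 e2 e3 e4 cd N0 S0 SN p1 p2 p3 p4.
have P : n1 * n2 * (n3 * n4) = (N ^+ 2 - S ^+ 2) ^+ 2 + 16 * (c * d) ^+ 2.
 rewrite e1 e2 e3 e4.
 rewrite (_ : _ * _ * _ = ((N + S) ^+ 2) ^+ 2 - 4 * (N + S) ^+ 2 * (c ^+ 2 + d ^+ 2) + 16 * (c * d) ^+ 2).
  by rewrite cd; ring.
 by ring.
have U : 16 * (c * d) ^+ 2 <= 4 * (N * S) ^+ 2.
 rewrite -cd; have := sqr_ge0 (c ^+ 2 - d ^+ 2); nra.
set y := (S / N) ^+ 2.
have y0 : 0 <= y by exact: sqr_ge0.
have SN1 : S / N <= 2^-1 by rewrite ler_pdivrMr// mulrC.
have SN0 : 0 <= S / N by rewrite divr_ge0// ltW.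
have y4 : y <= 4^-1 by rewrite /y expr2; nra.
have Sy : S ^+ 2 = N ^+ 2 * y by rewrite /y; field; rewrite lt0r_neq0.
have N4 : 0 < N ^+ 4 by rewrite exprn_gt0.
pose x := n1 * n2 * (n3 * n4) / N ^+ 4.
have xE : n1 * n2 * (n3 * n4) = x * N ^+ 4 by rewrite divfK// lt0r_neq0.
have h1 : (1 - y) ^+ 2 <= x.
 rewrite ler_pdivlMr// P Sy (_ : (1 - y) ^+ 2 * N ^+ 4 = (N ^+ 2 - N ^+ 2 * y) ^+ 2); last by ring.
 by rewrite lerDl mulr_ge0// sqr_ge0.
have h2 : x <= (1 + y) ^+ 2.
 rewrite ler_pdivrMr// P (_ : (1 + y) ^+ 2 * N ^+ 4 = (N ^+ 2 + N ^+ 2 * y) ^+ 2); last by ring.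
 rewrite -Sy; have : (N ^+ 2 + S ^+ 2) ^+ 2 = (N ^+ 2 - S ^+ 2) ^+ 2 + 4 * (N * S) ^+ 2 by ring.
 lra.
have x0 : 0 < x by apply: lt_le_trans h1; rewrite exprn_gt0//; lra.
have pp : 0 < n1 * n2 * (n3 * n4) by rewrite xE mulr_gt0.
have q1 : 0 < n1 by rewrite lt_neqAle p1 andbT eq_sym; apply: contraTneq pp => ->; rewrite !mul0r ltxx.
have q2 : 0 < n2 by rewrite lt_neqAle p2 andbT eq_sym; apply: contraTneq pp => ->; rewrite mulr0 mul0r ltxx.
have q3 : 0 < n3 by rewrite lt_neqAle p3 andbT eq_sym; apply: contraTneq pp => ->; rewrite mul0r mulr0 ltxx.
have q4 : 0 < n4 by rewrite lt_neqAle p4 andbT eq_sym; apply: contraTneq pp => ->; rewrite !mulr0 ltxx.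
have a1 : ln (n1 * n2) = ln n1 + ln n2 by exact: lnM.
have a2 : ln (n3 * n4) = ln n3 + ln n4 by exact: lnM.
have a3 : ln (n1 * n2 * (n3 * n4)) = ln (n1 * n2) + ln (n3 * n4).
 by apply: lnM; rewrite posrE mulr_gt0.
have a4 : ln (x * N ^+ 4) = ln x + ln (N ^+ 4) by exact: lnM.
have a5 : ln (N ^+ 4) = 4 * ln N by rewrite lnXn// mulr_natl.
rewrite xE a4 a5 a1 a2 in a3.
have := ln_square_bounds y0 y4 h1 h2.
have -> : ln n1 / 2 + ln n2 / 2 + ln n3 / 2 + ln n4 / 2 - 4 * (ln N / 2) = ln x / 2 by lra.
by [].
Qed.

Lemma fp_lgk {R} a b (z : plane R) : nk a b z != 0 -> fp (lgk a b) z.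
Proof.
move=> n0; set N := nk a b z.
have N0 : 0 < N by rewrite lt_neqAle eq_sym n0 nk_ge0.
have a1 : 0 < a ^+ 2 + 1 by rewrite ltr_wpDl ?sqr_ge0.
exists (2 * (a ^+ 2 / N) ^+ 2), (Num.sqrt (N / 2 / (a ^+ 2 + 1))); split.
- by rewrite sqrtr_gt0 !divr_gt0.
- by rewrite mulr_ge0// sqr_ge0.
move=> h; rewrite sqr_sqrtr; last by rewrite ltW// !divr_gt0.
move=> hr; set S := a ^+ 2 * sqn h.
have S0 : 0 <= S by rewrite mulr_ge0 ?sqr_ge0 ?sqn_ge0.
have SN : S <= N / 2.
 move: hr; rewrite ltr_pdivlMr// => /ltW; apply: le_trans.
 by rewrite /S mulrC ler_wpM2l ?sqn_ge0// lerDl.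
rewrite (_ : 2 * (a ^+ 2 / N) ^+ 2 * sqn h ^+ 2 = 2 * (S / N) ^+ 2); last by rewrite /S; ring.
rewrite /sum4 /lgk.
pose p := a * z.1 - b; pose r := a * z.2.
apply: (@four_logs _ _ _ _ _ N S (p * (a * h.1) + r * (a * h.2)) (r * (a * h.1) - p * (a * h.2))) => //;
 try exact: nk_ge0; rewrite /N /S /nk /sqn /p /r /rot /=; ring.
Qed.

(** A discrete Green function with pole q. It is a finite sum of logarithms, hence satisfies [fp]
    off [e] and the pole, and its upper limits on [e] are nonpositive when [s] is a Fekete set of
    [Kq q e]. *)
Definition gs {R} (q : option R) (s : seq R) (z : plane R) : R := delta s + avg s (lg (coord q z)).

Lemma near_off_pole {R} q (z : plane R) : off_pole q z -> \forall y \near z, off_pole q y.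
Proof.
case: q => [q|] /=; last by move=> _; apply: filterS (@filterT _ (nbhs z) _).
move=> /off_pole_sqn h.
have c : {for z, continuous (fun z : plane R => sqn (z.1 - q, z.2))} by exact: continuous_sqn_shift.
have /cvgrPdist_lt/(_ _ h) := c; apply: filterS => y hy ye; move: hy; rewrite ye /sqn/= subrr.
by rewrite expr0n/= addr0 subr0 gtr0_norm// ltxx.
Qed.

Lemma near_notin {R} e (z : plane R) : compact e -> ~ pline e z -> \forall y \near z, ~ pline e y.
Proof.
move=> ce ze.
have cp : compact (pline e).
 apply: continuous_compact => //; apply: continuous_subspaceT => t.
 by apply: continuous_for_pair; [exact: cvg_id|exact: cvg_cst].
have := compact_closed (@norm_hausdorff _ _) cp; rewrite -openC openE => /(_ z ze).
exact.
Qed.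

Lemma gs_near {R} q e s (z : plane R) :
 compact e -> pole_out q e -> off_pole q z -> ~ pline e z -> (0 < size s)%N ->
 (forall x, x \in s -> Kq q e x) ->
 \forall y \near z, gs q s y = (size s)%:R^-1 * (\sum_(x <- s) lgk (ka q x) (kb q x) y) +
   (- kc q) * lgk (ka0 q) (kb0 q) y + delta s.
Proof.
move=> ce qe oz ze s0 sK.
apply: filterS2 (near_off_pole oz) (near_notin ce ze) => y oy ye.
rewrite /gs addrC; congr (_ + _).
rewrite (@eq_avg _ s _ (fun x => lgk (ka q x) (kb q x) y + - (kc q * lgk (ka0 q) (kb0 q) y))).
 by rewrite avg_addc// /avg mulrC mulNr.
by move=> x xs; rewrite (lg_coord qe oy ye (sK _ xs)).
Qed.

Lemma fp_gs {R} q e s (z : plane R) :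
 compact e -> pole_out q e -> off_pole q z -> ~ pline e z -> (0 < size s)%N ->
 (forall x, x \in s -> Kq q e x) -> fp (gs q s) z.
Proof.
move=> ce qe oz ze s0 sK.
have := gs_near ce qe oz ze s0 sK => h; apply: (fp_near (f := _)).
 by apply: filterS h => y ->; reflexivity.
apply: fp_lin; last by apply: fp_lgk; exact: kq0_neq0.
by apply: fp_sum => x xs; apply: fp_lgk; exact: kq_neq0 (sK _ xs).
Qed.

Lemma continuous_for_sum {R} {T : topologicalType} s (f : R -> T -> R) (z : T) :
 (forall x, x \in s -> {for z, continuous (f x)}) -> {for z, continuous (fun y => \sum_(x <- s) f x y)}.
Proof.
elim: s => [|x s IH] H.
 rewrite (_ : (fun y => _) = (fun=> 0)); first exact: cvg_cst.
 by apply/funext => y; rewrite big_nil.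
rewrite (_ : (fun y => _) = (fun y => f x y + (\sum_(x <- s) f x y))); last first.
 by apply/funext => y; rewrite big_cons.
apply: cvgD; first by apply: H; rewrite mem_head.
by apply: IH => y ys; apply: H; rewrite in_cons ys orbT.
Qed.

Lemma continuous_lg {R} z (x : R) : z <> (x, 0) -> {for z, continuous (lg^~ x)}.
Proof.
move=> zx.
have N0 : 0 < (z.1 - x) ^+ 2 + z.2 ^+ 2.
 rewrite -rho_sqr exprn_gt0// lt_neqAle rho_ge0 andbT eq_sym.
 by apply/eqP => /rho_eq0.
apply: cvgM; last exact: cvg_cst.
have cN : {for z, continuous (fun z : plane R => (z.1 - x) ^+ 2 + z.2 ^+ 2)} by exact: continuous_sqn_shift.
exact: (@continuous_comp _ _ _ _ (@ln R) z cN (continuous_ln N0)).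
Qed.

Lemma continuous_avg_lg {R} s (z : plane R) :
 (forall x, x \in s -> z <> (x, 0)) -> {for z, continuous (fun y => avg s (lg y))}.
Proof.
move=> H; apply: cvgM; last exact: cvg_cst.
by apply: (@continuous_for_sum _ _ s (fun x y => lg y x)) => x xs; apply: continuous_lg; exact: H.
Qed.

Lemma continuous_gs {R} q e s (z : plane R) : pole_out q e -> off_pole q z -> ~ pline e z ->
 (forall x, x \in s -> Kq q e x) -> {for z, continuous (gs q s)}.
Proof.
move=> qe oz ze sK; apply: cvgD; first exact: cvg_cst.
apply: (@continuous_comp _ _ _ (coord q) (fun y => avg s (lg y)) z (@continuous_coord _ q z oz)).
by apply: continuous_avg_lg => x xs; exact: (coord_notin qe oz ze (sK _ xs)).
Qed.

(** The estimate is made on the product of the distances, which is continuous even at the Fekete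
    points and bounded on [e] by [fekete_pot]; logarithms are taken only off [e]. *)
Lemma gs_boundary {R} q e s t eps :
 compact e -> pole_out q e -> fekete (Kq q e) s -> (1 < size s)%N -> e t -> 0 < eps ->
 \forall z \near ((t, 0) : plane R), ~ pline e z -> gs q s z < eps.
Proof.
move=> ce qe [us sK smax] s1 et e0.
have ot : off_pole q ((t, 0) : plane R).
 by case: q qe {sK smax} => [q|] //= eq [tq]; apply: eq; rewrite -tq.
pose n := size s; pose k := n.-1.
have k0 : (0 < k)%N by rewrite /k -ltnS prednK// (ltn_trans _ s1).
have vp : 0 < vdm s by exact: vdm_gt0.
pose P (z : plane R) := \prod_(x <- s) rho z x.
have cP : continuous P.
 apply: continuous_prod => x z.
 have cN : {for z, continuous (fun z : plane R => (z.1 - x) ^+ 2 + z.2 ^+ 2)} by exact: continuous_sqn_shift.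
 exact: (@continuous_comp _ _ _ _ Num.sqrt z cN (@sqrt_continuous _ _)).
have cPc : {for ((t, 0) : plane R), continuous (P \o coord q)}.
 apply: continuous_comp; first exact: continuous_coord.
 exact: cP.
have P0 : P (coord q (t, 0)) ^+ k <= vdm s.
 rewrite (coord_real qe et) /P (eq_bigr (fun x => `|lcoord q t - x|)).
  by apply: (fekete_pot us sK smax); exists t.
 by move=> x _; rewrite /rho/= expr0n/= addr0 sqrtr_sqr.
have P00 : 0 <= P (coord q (t, 0)) by apply: prodr_ge0 => x _; exact: rho_ge0.
pose A := expR (n%:R * eps + ln (vdm s) / k%:R).
have kR : (0 : R) < k%:R by rewrite ltr0n.
have nR : (0 : R) < n%:R by rewrite ltr0n (ltn_trans _ s1).
have PA : P (coord q (t, 0)) < A.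
 rewrite -(@ltr_pXn2r _ k) ?nnegrE ?expR_ge0//; apply: le_lt_trans P0 _.
 rewrite -[ltLHS]lnK ?posrE// -expRM_natr ltr_expR mulrDl divfK ?gt_eqF// ltrDr.
 by rewrite !mulr_gt0.
have /cvgrPdist_lt/(_ (A - P (coord q (t, 0)))) := cPc; rewrite subr_gt0 => /(_ PA) nP.
apply: filterS2 (near_off_pole ot) nP => z oz /=; rewrite ltr_norml => /andP[Pz _] ze.
have PzA : P (coord q z) < A by lra.
have rp x : x \in s -> 0 < rho (coord q z) x.
 move=> xs; rewrite lt_neqAle rho_ge0 andbT eq_sym.
 by apply/eqP => /rho_eq0; exact: (coord_notin qe oz ze (sK _ xs)).
have Pp : 0 < P (coord q z) by exact: prods_gt0.
have : ln (P (coord q z)) < ln A by rewrite ltr_ln ?posrE// expR_gt0.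
rewrite /A expRK /P ln_prods// => h.
rewrite /gs /delta /avg -/n (eq_bigr (fun x => ln (rho (coord q z) x))); last by move=> x _; exact: lg_rho.
rewrite natrM -/k.
move: h; set S := \sum_(_ <- _) _ => h.
rewrite (_ : _ + _ = (S - ln (vdm s) / k%:R) / n%:R); last first.
 by field; rewrite !lt0r_neq0.
by rewrite ltr_pdivrMr//; lra.
Qed.

Lemma outer_boundary_line {R} e (t : R) : e t -> outer_boundary (pline e) (t, 0).
Proof.
move=> et; split; first by exists t.
move=> A [[U V] /= [Ut V0] UV].
have [r /= r0 rV] := (nbhs_ballP _ _).1 V0.
exists (t, r / 2); split; first by move=> [t' _ [_ h]]; move: r0; rewrite (_ : r = 0) ?ltxx//; lra.
apply: UV; split; first exact: nbhs_singleton Ut.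
by apply: rV; rewrite /ball/= sub0r normrN gtr0_norm ?divr_gt0// ltr_pdivrMr// mulr2n; lra.
Qed.

(** * Comparison of Perron solutions with Fekete sums *)

(** Only the boundary on [e] is treated here: both u and the Fekete sum have nonpositive upper
    limits there. The term eta w is a penalty available on the rest of the boundary, which is left
    to the last hypothesis. *)
Lemma perron_mp {R} q e s phi u D w (B c eta : R) :
 compact e -> pole_out q e -> fekete (Kq q e) s -> (1 < size s)%N ->
 (forall z, phi z <= 0) -> perron_family (pline e) phi u -> (forall z, D z -> `|z.1| <= B /\ `|z.2| <= B) ->
 (forall z, D z -> \forall y \near z, D y) ->
 (forall z, D z -> off_pole q z) -> (forall z, D z -> ~ pline e z) ->
 (forall z, D z -> {for z, continuous w}) -> (forall z, D z -> fp w z) ->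
 (forall z, D z -> 0 <= w z) -> 0 < c -> 0 <= eta ->
 (forall z0, ~ D z0 -> ~ pline e z0 -> \forall z \near z0, D z ->
   (u (Some z) + (c * gs q s z + (- eta) * w z + 0)%:E <= 0)%E) ->
 forall z, D z -> (u (Some z) + (c * gs q s z + (- eta) * w z + 0)%:E <= 0)%E.
Proof.
move=> ce qe fs s1 ph0 [[us _] ubd] DB Do Dq De wc wf w0 c0 eta0 bd.
have [_ sK _] := fs; have s0 := ltnW s1.
have gc z : D z -> {for z, continuous (fun z => c * gs q s z + (- eta) * w z + 0)}.
 move=> Dz; have h1 := continuous_gs qe (Dq _ Dz) (De _ Dz) sK; have h2 := wc z Dz.
 apply: cvgD; last exact: cvg_cst.
  by apply: cvgD; (apply: cvgM; [exact: cvg_cst|]); [exact: h1|exact: h2].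
apply: (@subharmonic_max_principle R D [set z | sphere_compl (pline e) (Some z)]
 (fun z => u (Some z)) _ B DB Do _ gc _ us).
- by move=> z /De ze [y ye [yz]]; apply: ze; rewrite -yz.
- move=> z Dz.
 have [C [r [r0 C0 H]]] := fp_lin c (- eta) 0 (fp_gs ce qe (Dq _ Dz) (De _ Dz) s0 sK) (wf _ Dz).
 exists C, r; split => // h hr; have := H h hr.
 by rewrite ler_norml => /andP[].
- move=> z0 Dz0 eps e0.
 have [[t et tz]|z0e] := pselect (pline e z0); last first.
  by apply: filterS (bd z0 Dz0 z0e) => z h /h h'; apply: le_lt_trans h' _; rewrite lte_fin.
 subst z0.
 have e2 : 0 < eps / 2 by rewrite divr_gt0.
 have n1 : \forall z \near ((t, 0) : plane R), ~ pline e z -> (u (Some z) < (eps / 2)%:E)%E.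
  by apply: (ubd _ (outer_boundary_line et)); exact: le_lt_trans (ph0 _) e2.
 have n2 := gs_boundary ce qe fs s1 et (divr_gt0 e2 c0).
 apply: filterS2 n1 n2 => z h1 h2 Dz; rewrite lteDfin.
 apply: lt_le_trans (h1 (De _ Dz)) _; rewrite lee_fin.
 have := h2 (De _ Dz); rewrite ltr_pdivlMr// mulrC => h3.
 have := mulr_ge0 eta0 (w0 _ Dz); lra.
Qed.

Lemma gs_upper {R} q s z (M : R) : (0 < size s)%N -> 1 <= M -> (forall x, x \in s -> rho (coord q z) x <= M) ->
 gs q s z <= delta s + ln M.
Proof.
move=> s0 M1 H; rewrite lerD2l -[leRHS](avg_cst (ln M) s0); apply: le_avg => x xs.
rewrite lg_rho; have := rho_ge0 (coord q z) x; rewrite le_eqVlt => /orP[/eqP <-|r0].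
 by rewrite ln0// ln_ge0.
by rewrite ler_ln ?posrE ?H//; exact: lt_le_trans M1.
Qed.

Lemma gs_lower {R} q s z (d : R) : (0 < size s)%N -> 0 < d -> (forall x, x \in s -> d <= rho (coord q z) x) ->
 delta s + ln d <= gs q s z.
Proof.
move=> s0 d0 H; rewrite lerD2l -[leLHS](avg_cst (ln d) s0); apply: le_avg => x xs.
by rewrite lg_rho ler_ln ?posrE ?H//; exact: lt_le_trans (H _ xs).
Qed.

Definition near_pole {R} (q : option R) (r : R) (z : plane R) : Prop :=
 if q is Some q then sqn (z.1 - q, z.2) < r else r^-1 < sqn z.

Lemma sqn_ginv {R} (z : plane R) : 0 < sqn z -> sqn (ginv z) = (sqn z)^-1.
Proof.
move=> S0; rewrite {1}/sqn /ginv /= !exprMn sqrrN -mulrDl -/(sqn z) exprVn.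
by field; rewrite lt0r_neq0.
Qed.

Lemma sphere_inv_ginv {R} (z : plane R) : 0 < sqn z -> sphere_inv (ginv z) = Some z.
Proof.
move=> S0.
have E := sqn_ginv S0.
rewrite /sphere_inv; case: eqP => [h|_].
 by move: E; rewrite h {1}/sqn/= expr0n/= addr0 => /esym/eqP; rewrite invr_eq0 (gt_eqF S0).
have -> : modulus (ginv z) ^+ 2 = (sqn z)^-1 by rewrite sqr_sqrtr ?sqn_ge0// -E.
congr Some; apply: plane_ext; rewrite /ginv /= ?mulNr ?opprK; field; exact: lt0r_neq0.
Qed.

(** Upper semicontinuity at infinity, read in the chart 1/z. *)
Lemma perron_bounded_inf {R} e u : sphere_subharmonic_on (sphere_compl (pline e)) u ->
 exists T R0 : R, 0 < R0 /\ forall z, R0 < sqn z -> ~ pline e z -> (u (Some z) <= T%:E)%E.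
Proof.
move=> [_ [uoo usc _]].
have U0 : [set z | sphere_compl (pline e) (sphere_inv z)] (0 : plane R).
 by rewrite /= /sphere_inv eqxx => -[].
have := uoo _ U0; have := usc _ U0.
move=> H h0.
have [T uT] : exists T : R, (u (sphere_inv (0%R : plane R)) < T%:E)%E.
 move: h0; case: (u _) => [c| |]// _; last by exists 0; exact: ltNyr.
 by exists (c + 1); rewrite lte_fin ltrDl.
have n1 : \forall y \near (0 : plane R), sphere_compl (pline e) (sphere_inv y) ->
  (u (sphere_inv y) < T%:E)%E := H T uT.
have [r r0 H1] := near_axes n1.
exists T, (r ^+ 2)^-1; split; first by rewrite invr_gt0 exprn_gt0.
move=> z zr ze; have r2 : 0 < r ^+ 2 by rewrite exprn_gt0.
have S0 : 0 < sqn z by apply: lt_trans zr; rewrite invr_gt0.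
have E := sqn_ginv S0.
have := H1 (ginv z); rewrite add0r E sphere_inv_ginv// => h; apply: ltW; apply: h.
 by rewrite -[r ^+ 2]invrK ltf_pV2 ?posrE ?invr_gt0.
by move=> [y ye [yz]]; apply: ze; rewrite -yz.
Qed.

Lemma abs_le_sqn {R} z (a : R) : sqn z <= a -> `|z.1| <= a + 1 /\ `|z.2| <= a + 1.
Proof.
move=> h; have := sqr_ge0 z.1; have := sqr_ge0 z.2; rewrite /sqn in h => h2 h1.
have a0 : 0 <= a + 1 by lra.
by split; rewrite -(@ler_pXn2r _ 2) ?nnegrE// real_normK ?num_real//; nra.
Qed.

Lemma rho_le_sqn {R} z (a t : R) : sqn z <= a -> rho z t <= 2 * (a + 1) + `|t|.
Proof.
move=> /abs_le_sqn [h1 h2]; apply: le_trans (rho_le _ _) _.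
have := ler_normB z.1 t; lra.
Qed.

Lemma near_sqn_shift {R} q z0 (a : R) : (sqn (z0.1 - q, z0.2) < a -> \forall z \near z0, sqn (z.1 - q, z.2) < a) /\
 (a < sqn (z0.1 - q, z0.2) -> \forall z \near z0, a < sqn (z.1 - q, z.2)).
Proof.
have c : {for z0, continuous (fun z : plane R => sqn (z.1 - q, z.2))} by exact: continuous_sqn_shift.
split => h.
 have /cvgrPdist_lt/(_ (a - sqn (z0.1 - q, z0.2))) := c; rewrite subr_gt0 => /(_ h).
 by apply: filterS => y; rewrite ltr_norml => /andP[h1 _]; lra.
have /cvgrPdist_lt/(_ (sqn (z0.1 - q, z0.2) - a)) := c; rewrite subr_gt0 => /(_ h).
by apply: filterS => y; rewrite ltr_norml => /andP[_ h1]; lra.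
Qed.

Lemma eta_limit {R} u a W : 0 <= W ->
 (forall eta : R, 0 < eta -> (u + (a + (- eta) * W + 0)%:E <= 0)%E) -> (u <= (- a)%:E)%E.
Proof.
move=> W0 H; apply/lee_addgt0Pr => eps e0.
have W1 : 0 < W + 1 by lra.
have := H _ (divr_gt0 e0 W1); rewrite leeDfin => h; apply: le_trans h _.
rewrite lee_fin; have : eps / (W + 1) * W <= eps.
 by rewrite mulrAC ler_pdivrMr// ler_wpM2l ?(ltW e0)//; lra.
lra.
Qed.

(** Where the domain is cut off near the pole, the Fekete sum is at most delta + A and u is at most
    -c, so u + c / (delta + A) gs is nonpositive there as well as on [e]. [A] does not depend on the
    Fekete set, which allows a later limit. *)
Lemma perron_step {R} q e r :
 compact e -> pole_out q e -> 0 < r -> (forall z, near_pole q r z -> ~ pline e z) ->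
 exists2 A : R, (forall s, fekete (Kq q e) s -> (1 < size s)%N -> 1 <= delta s + A) &
  forall phi u c s, (forall z, phi z <= 0) -> perron_family (pline e) phi u ->
  0 < c -> (forall z, near_pole q r z -> (u (Some z) <= (- c)%:E)%E) -> fekete (Kq q e) s -> (1 < size s)%N ->
  forall z, ~ pline e z -> ~ near_pole q (r / 4) z ->
   (u (Some z) <= (- (c / (delta s + A) * gs q s z))%:E)%E.
Proof.
move=> ce qe r0 Nq.
have cK := Kq_compact ce qe.
have [C KC] := diam_le_exists cK; have [B B0 KB] := compact_bound cK.
(* The term exp(C + 1) gives delta + ln M >= 1, as delta >= -C. The last term bounds the distance
   from coord z to the points of [Kq q e] as long as |coord z|^2 <= 8 / r. *)
pose M := Num.max (Num.max 1 (expR (C + 1))) (2 * (8 / r + 1) + B).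
have M1 : 1 <= M by rewrite !le_max lexx.
have MC : C + 1 <= ln M.
 by rewrite -[leLHS]expRK ler_ln ?posrE ?expR_gt0// ?le_max ?lexx ?orbT//; exact: lt_le_trans M1.
have MB : 2 * (8 / r + 1) + B <= M by rewrite le_max lexx orbT.
have dA s : fekete (Kq q e) s -> (1 < size s)%N -> 1 <= delta s + ln M.
 by move=> [us sK _] s1; have := delta_ge KC s1 us sK; lra.
exists (ln M) => // phi u c s ph0 fu c0 uc fs s1 z ze zq.
have d1 := dA s fs s1; have [us sK _] := fs.
pose c' := c / (delta s + ln M).
have dp : 0 < delta s + ln M by lra.
have c'0 : 0 < c' by rewrite divr_gt0.
have gup y : off_pole q y -> sqn (coord q y) <= 8 / r -> c' * gs q s y <= c.
 move=> oy cy.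
 apply: (@le_trans _ _ (c' * (delta s + ln M))); last by rewrite /c' divfK// lt0r_neq0.
 rewrite ler_wpM2l ?(ltW c'0)//; apply: gs_upper => //; first exact: ltnW.
 move=> x xs; apply: le_trans MB; apply: le_trans (rho_le_sqn _ cy) _.
 by rewrite lerD2l ler_norml; exact: KB (sK _ xs).
have [T [R0 [R00 uT]]] := perron_bounded_inf (fu.1).
case: q qe Nq cK KC KB dA uc fs sK zq gup => [q|] /= qe Nq cK KC KB dA uc fs sK zq gup; last first.
 pose D := [set y : plane R | ~ pline e y /\ sqn y < 8 / r].
 have r8 : r^-1 < 8 / r by rewrite -[ltLHS]mul1r ltr_pM2r ?invr_gt0//; lra.
 have Dz : D z.
  split => //; move/negP: zq; rewrite -leNgt => zq; apply: le_lt_trans zq _.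
  rewrite invf_div; rewrite ltr_pM2r ?invr_gt0//; lra.
 apply: (@eta_limit _ _ _ 0) => // eta eta0.
 apply: (@perron_mp _ None e s phi u D (fun=> 0) (8 / r + 1) c' eta) => //.
 - by move=> y [_ /ltW /abs_le_sqn].
 - move=> y [ye yr]; have := (near_sqn_shift 0 y (8 / r)).1; rewrite subr0 => /(_ yr) h.
  by apply: filterS2 (near_notin ce ye) h => y' h1; rewrite subr0 => h2.
 - by move=> y [].
 - by move=> y _; exact: cvg_cst.
 - by move=> y _; exact: fp_cst.
 - exact: ltW.
 - move=> z0 nD z0e.
  have z0r : r^-1 < sqn z0.
   by apply: lt_le_trans r8 _; rewrite leNgt; apply/negP => h; apply: nD.
  have := (near_sqn_shift 0 z0 (r^-1)).2; rewrite subr0 => /(_ z0r).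
  apply: filterS => y; rewrite subr0 => yr [ye y8].
  rewrite leeDfin; apply: le_trans (uc y yr) _; rewrite lee_fin.
  by have := gup y I (ltW y8); lra.
have S0 : r / 4 <= sqn (z.1 - q, z.2) by move/negP: zq; rewrite -leNgt.
have r4 : 0 < r / 4 by rewrite divr_gt0.
(* For a finite pole the domain is cut off far away, where u is only known to be bounded above. The
   penalty is ln (|y - q| / sqrt(r / 8)), nonnegative outside the small disc around q and unbounded
   at infinity. *)
pose w (y : plane R) := ln (sqn (y.1 - q, y.2)) / 2 + - (ln (r / 8) / 2).
have r8 : 0 < r / 8 by rewrite divr_gt0.
have wpos y : r / 8 < sqn (y.1 - q, y.2) -> 0 <= w y.
 move=> h; rewrite subr_ge0 ler_pM2r ?invr_gt0// ler_ln ?posrE//; first exact: ltW.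
 exact: lt_trans h.
have W0 : 0 <= w z by apply: wpos; apply: lt_le_trans S0; lra.
apply: (@eta_limit _ _ _ (w z)) => // eta eta0.
(* Where |y - q|^2 >= X, the penalty eta w is at least |T| + c, which absorbs both the bound [T] on
   u and the Fekete sum. *)
pose X := expR (ln (r / 8) + 2 * ((`|T| + c) / eta)).
have X0 : 0 < X by exact: expR_gt0.
pose R2 := 2 * (X + 2 * (R0 + q ^+ 2) + sqn (z.1 - q, z.2)) + r.
have q2 := sqr_ge0 q; have Sz := sqn_ge0 (z.1 - q, z.2).
pose D := [set y : plane R | ~ pline e y /\ r / 8 < sqn (y.1 - q, y.2) /\ sqn (y.1 - q, y.2) < R2].
have Dz : D z by split => //; split; rewrite /R2; lra.
have Dq y : D y -> off_pole (Some q) y.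
 by move=> [_ [h _]] /= yq; move: h; rewrite yq /sqn/= subrr expr0n/= addr0 ltNge (ltW r8).
apply: (@perron_mp _ (Some q) e s phi u D w (`|q| + (R2 + 1)) c' eta) => //.
- move=> y [_ [_ /ltW /abs_le_sqn [h1 h2]]]; split; last by apply: le_trans h2 _; rewrite lerDr.
 have := ler_normD q (y.1 - q); rewrite (_ : q + (y.1 - q) = y.1); last by ring.
 by rewrite /= in h1; lra.
- move=> y [ye [h1 h2]].
 have n1 := (near_sqn_shift q y (r / 8)).2 h1; have n2 := (near_sqn_shift q y R2).1 h2.
 by apply: filterS3 (near_notin ce ye) n1 n2 => y' ? ? ?.
- by move=> y [].
- move=> y [_ [h _]].
 have c1 : {for y, continuous (fun y : plane R => sqn (y.1 - q, y.2))} by exact: continuous_sqn_shift.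
 have p : 0 < sqn (y.1 - q, y.2) by exact: lt_trans h.
 apply: cvgD; last exact: cvg_cst.
 apply: cvgM; last exact: cvg_cst.
 exact: (@continuous_comp _ _ _ _ (@ln R) y c1 (continuous_ln p)).
- move=> y [_ [h _]].
 have p : nk 1 q y != 0 by rewrite /nk !mul1r; apply: lt0r_neq0; exact: lt_trans h.
 have := fp_lin 1 0 (- (ln (r / 8) / 2)) (fp_lgk p) (fp_cst 0 y).
 congr fp; apply/funext => y'.
 by rewrite mul1r mul0r addr0 /lgk /nk !mul1r.
- by move=> y [_ [/wpos]].
- exact: ltW.
- move=> z0 nD z0e.
 have gD y : D y -> c' * gs (Some q) s y <= c.
  move=> Dy; apply: gup; first exact: Dq.
  have [_ [h _]] := Dy; rewrite sqn_ginv; last exact: lt_trans h.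
  rewrite -[leRHS]invrK lef_pV2 ?posrE ?invr_gt0 ?divr_gt0//; last exact: lt_trans h.
  by rewrite invf_div ltW.
 have [h|h] := leP (sqn (z0.1 - q, z0.2)) (r / 8).
  have h' : sqn (z0.1 - q, z0.2) < r by lra.
  apply: filterS ((near_sqn_shift q z0 r).1 h') => y yr Dy.
  rewrite leeDfin; apply: le_trans (uc y yr) _; rewrite lee_fin.
  have [_ [/wpos wy _]] := Dy; have := gD y Dy; have := mulr_ge0 (ltW eta0) wy; lra.
 have h2 : R2 <= sqn (z0.1 - q, z0.2).
  by rewrite leNgt; apply/negP => h2; apply: nD.
 have h3 : R2 / 2 < sqn (z0.1 - q, z0.2).
  by apply: lt_le_trans h2; rewrite /R2; lra.
 apply: filterS ((near_sqn_shift q z0 (R2 / 2)).2 h3) => y yr Dy.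
 have yR0 : R0 < sqn y.
  have : sqn (y.1 - q, y.2) <= 2 * sqn y + 2 * q ^+ 2.
   by rewrite /sqn/=; have := sqr_ge0 (y.1 + q); have := sqr_ge0 y.2; nra.
  by rewrite /R2 in yr; lra.
 rewrite leeDfin; apply: le_trans (uT y yR0 Dy.1) _; rewrite lee_fin.
 have := gD y Dy; have := ler_norm T.
 have : `|T| + c <= eta * w y.
  rewrite mulrC -ler_pdivrMr// /w.
  have : ln X <= ln (sqn (y.1 - q, y.2)).
   by rewrite ler_ln ?posrE//; [rewrite /R2 in yr; lra|rewrite /R2 in yr; lra].
  by rewrite /X expRK; lra.
 lra.
Qed.

Lemma dist_pos {R} K z : compact K ->
 (forall t, K t -> z <> (t, 0)) -> exists2 d : R, 0 < d & forall t, K t -> d <= rho z t.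
Proof.
move=> cK zK.
have [[t0 K0]|K0] := pselect (K !=set0); last by exists 1 => // t Kt; case: K0; exists t.
have cr : continuous (rho z).
 by apply: (@lip_continuous _ 1) => // x y; rewrite mul1r; exact: rho_lip.
have [||p Kp pmin] := @compact_usc_max _ R R K (fun t => - rho z t) cK; first by exists t0.
 move=> p q _ _ pq; rewrite ltrN2 in pq.
 have /cvgrPdist_lt/(_ (rho z p - rho z q)) := cr p; rewrite subr_gt0 => /(_ pq).
 by apply: filterS => y; rewrite ltr_norml => /andP[_ h] _; rewrite ltrN2; lra.
exists (rho z p) => [|t /pmin]; last by rewrite lerN2.
by rewrite lt_neqAle rho_ge0 andbT eq_sym; apply/eqP => /rho_eq0; exact: zK.
Qed.

Lemma near_avoid_pole {R} q e r t : 0 < r -> (forall z, near_pole q r z -> ~ pline e z) -> e t ->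
 \forall z \near ((t, 0) : plane R), ~ near_pole q (r / 4) z.
Proof.
move=> r0 Nq et; have nt : ~ near_pole q r (t, 0) by move=> /Nq; apply; exists t.
case: q Nq nt => [q|] /= Nq nt.
 have h : r / 4 < sqn (((t, 0) : plane R).1 - q, ((t, 0) : plane R).2).
  by move/negP: nt; rewrite -leNgt /= => h; lra.
 by apply: filterS ((near_sqn_shift q (t, 0) (r / 4)).2 h) => z /= hz; apply/negP; rewrite -leNgt ltW.
have h : sqn (((t, 0) : plane R).1 - 0, ((t, 0) : plane R).2) < (r / 4)^-1.
 move/negP: nt; rewrite -leNgt /= subr0 => h; apply: le_lt_trans h _.
 by rewrite ltf_pV2 ?posrE ?divr_gt0//; lra.
apply: filterS ((near_sqn_shift 0 (t, 0) ((r / 4)^-1)).1 h) => z; rewrite subr0 => hz.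
by apply/negP; rewrite -leNgt ltW.
Qed.

Lemma perron_solution_le {R} E phi z (a : \bar R) :
 (perron_solution E phi z <= a)%E <-> (forall u, perron_family E phi u -> (u z <= a)%E).
Proof.
split; first by move=> h u fu; apply: le_trans h; apply: ereal_sup_ubound; exists u.
by move=> H; apply/ereal_supP => _ [u fu <-]; exact: H.
Qed.

Lemma near_off_line {R} e t P : (\forall z \near ((t, 0) : plane R), P z) -> exists2 z, P z & ~ pline e z.
Proof.
move=> [[U V] /= [Ut V0] UV].
have [r /= r0 rV] := (nbhs_ballP _ _).1 V0.
exists (t, r / 2); last by move=> [t' _ [_ h]]; move: r0; rewrite (_ : r = 0) ?ltxx//; lra.
apply: UV; split; first exact: nbhs_singleton Ut.
by apply: rV; rewrite /ball/= sub0r normrN gtr0_norm ?divr_gt0// ltr_pdivrMr// mulr2n; lra.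
Qed.

Section regular_step.
Context {R} (q : option R) (e : set R) (r c : R) (phi : plane R -> R) (x0 : R).
Hypotheses (ce : compact e) (qe : pole_out q e) (r0 : 0 < r) (c0 : 0 < c).
Hypothesis Nq : forall z, near_pole q r z -> ~ pline e z.
Hypothesis ph0 : forall z, phi z <= 0.
Hypothesis Hc : forall z, near_pole q r z -> (perron_solution (pline e) phi (Some z) <= (- c)%:E)%E.
Hypothesis ex0 : e x0.
Hypothesis Hx0 : forall eps : R, 0 < eps -> \forall z \near ((x0, 0) : plane R),
 ~ pline e z -> ((- eps)%:E < perron_solution (pline e) phi (Some z))%E.

Lemma perron_gs : exists2 A : R, (forall s, fekete (Kq q e) s -> (1 < size s)%N -> 1 <= delta s + A) &
 forall s, fekete (Kq q e) s -> (1 < size s)%N -> forall z, ~ pline e z -> ~ near_pole q (r / 4) z ->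
   (perron_solution (pline e) phi (Some z) <= (- (c / (delta s + A) * gs q s z))%:E)%E.
Proof.
have [A A1 H] := perron_step ce qe r0 Nq; exists A => // s fs s1 z ze zq.
apply/perron_solution_le => u fu; apply: (H phi u c s) => // y yq.
by have := Hc yq => /perron_solution_le; apply.
Qed.

Lemma not_near_off {z : plane R} : ~ near_pole q (r / 4) z -> off_pole q z.
Proof.
case: q => [q'|] //= h zq; apply: h; rewrite zq /sqn/= subrr expr0n/= addr0.
by rewrite divr_gt0.
Qed.

(** At a point z off [e] and close to x0 the Perron solution exceeds -c / 2, while it is at most -c
    gs / (delta + A) and gs >= delta + ln d. A large delta would push gs / (delta + A) above 1 / 2.
    This is how regularity yields positive capacity. *)
Lemma delta_bounded : exists B : R, forall s, fekete (Kq q e) s -> (1 < size s)%N -> delta s <= B.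
Proof.
have [A A1 H] := perron_gs.
have c2 : 0 < c / 2 by rewrite divr_gt0.
have [z [Hz zq] ze] := near_off_line e (filterI (Hx0 c2) (near_avoid_pole r0 Nq ex0)).
have oz := not_near_off zq.
have [d d0 dz] := @dist_pos _ (Kq q e) (coord q z) (Kq_compact ce qe) (fun s Ks => coord_notin qe oz ze Ks).
exists (A - 2 * ln d) => s fs s1; rewrite leNgt; apply/negP => ds.
have h := H s fs s1 z ze zq; have := lt_le_trans (Hz ze) h; rewrite lte_fin.
have [us sK _] := fs.
have g : delta s + ln d <= gs q s z by apply: gs_lower => //; [exact: ltnW|move=> x /sK; exact: dz].
have D1 := A1 s fs s1.
have D0 : 0 < delta s + A by lra.
rewrite ltrN2 mulrAC ltr_pdivrMr// => k.
have : c * gs q s z < c * ((delta s + A) / 2) by lra.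
rewrite ltr_pM2l//; lra.
Qed.

(** In the limit the Perron solution is at most -c (V + pot) / (V + A); its lower limit at x0 is at
    least 0, so the upper limit of V + pot there is at most 0. *)
Lemma green_limit X (F : set_system nat) mu V :
 ProperFilter F -> pot_ok (Kq q e) mu V -> (forall n, fekete (Kq q e) (X n)) ->
 (forall n, size (X n) = n.+2) -> delta (X n) @[n --> F] --> V ->
 (forall z, (forall t, Kq q e t -> z <> (t, 0)) -> avg (X n) (lg z) @[n --> F] --> pot (Kq q e) mu z) ->
 forall eps : R, 0 < eps -> \forall z \near ((x0, 0) : plane R),
  ~ pline e z -> V + pot (Kq q e) mu (coord q z) < eps.
Proof.
move=> PF pK fX sX dV aX eps eps0.
have [A A1 H] := perron_gs.
have dn n : 1 <= delta (X n) + A by apply: A1 => //; rewrite sX.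
have dA : delta (X n) + A @[n --> F] --> V + A by apply: cvgD => //; exact: cvg_cst.
have VA : 1 <= V + A.
 have h : (fun=> 1) @ F --> (1 : R) by exact: cvg_cst.
 by apply: (ler_cvg_to h dA); exact: nearW.
have VA0 : 0 < V + A by lra.
have e1 : 0 < c / (V + A) * eps by rewrite mulr_gt0// divr_gt0.
apply: filterS2 (Hx0 e1) (near_avoid_pole r0 Nq ex0) => z Hz zq ze.
have oz := not_near_off zq.
have zK t : Kq q e t -> coord q z <> (t, 0) by exact: coord_notin.
have gX : gs q (X n) z @[n --> F] --> V + pot (Kq q e) mu (coord q z).
 by apply: cvgD => //; exact: aX.
have cX : c / (delta (X n) + A) * gs q (X n) z @[n --> F] --> c / (V + A) * (V + pot (Kq q e) mu (coord q z)).
 apply: cvgM => //; apply: cvgM; first exact: cvg_cst.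
 by apply: cvgV => //; exact: lt0r_neq0.
have : c / (V + A) * (V + pot (Kq q e) mu (coord q z)) < c / (V + A) * eps.
 have := Hz ze; case E : (perron_solution _ _ _) => [v| |] //; last first.
  have := H (X 0%N) (fX 0%N); rewrite sX => /(_ isT z ze zq); by rewrite E leye_eq.
 rewrite lte_fin => h1.
 have h2 : v <= - (c / (V + A) * (V + pot (Kq q e) mu (coord q z))).
  have h : (fun=> v) @ F --> v by exact: cvg_cst.
  apply: (ler_cvg_to h (cvgN cX)); apply: nearW => n.
  by have := H (X n) (fX n); rewrite sX => /(_ isT z ze zq); rewrite E lee_fin.
 lra.
by rewrite ltr_pM2l// divr_gt0.
Qed.
End regular_step.

(** * Fekete sequences, and barriers for every pole *)

Lemma fekete_sequence {R} K : compact K -> infinite_set K ->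
 exists X : nat -> seq R, forall n, [/\ fekete K (X n), size (X n) = n.+2 & sorted <=%R (X n)].
Proof.
move=> cK iK.
have H n : exists s : seq R, [/\ fekete K s, size s = n.+2 & sorted <=%R s].
 have [s [sn us sK smax]] := fekete_exists n.+2 cK iK.
 have ps : perm_eq (sort <=%R s) s by rewrite perm_sort.
 exists (sort <=%R s); split; last by apply: sort_sorted => x y; exact: le_total.
  split; first by rewrite sort_uniq.
   by move=> x; rewrite mem_sort; exact: sK.
  by move=> t; rewrite size_sort (vdm_perm ps) sn => tn; exact: smax.
 by rewrite size_sort.
by have [X HX] := choice H; exists X.
Qed.

Lemma fekete_package {R} K : compact K -> infinite_set K ->
 (exists B : R, forall s, fekete K s -> (1 < size s)%N -> delta s <= B) ->
 exists (mu : prob R) (V : R) (X : nat -> seq R) (F : set_system nat),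
  [/\ ProperFilter F, pot_ok K mu V, energy mu = V%:E, robin_constant K = V%:E &
  [/\ forall n, fekete K (X n), forall n, size (X n) = n.+2, delta (X n) @[n --> F] --> V &
  forall z, (forall t, K t -> z <> (t, 0)) -> avg (X n) (lg z) @[n --> F] --> pot K mu z]].
Proof.
move=> cK iK [B HB]; have [X HX] := fekete_sequence cK iK.
have [F [UF ooF]] := ultraFilterLemma (eventually_filter).
have [|||| mu [V [muK EV RV dV aX]]] := @fekete_limit R K X F B UF ooF cK.
- by move=> n; have [] := HX n.
- by move=> n; have [] := HX n.
- by move=> n; have [] := HX n.
- by move=> n; have [fX sX _] := HX n; apply: HB => //; rewrite sX.
have PF := @ultra_proper _ F UF.
exists mu, V, X, F; split => //; first exact: frostman_pot.
split => //; [by move=> n; have [] := HX n|by move=> n; have [] := HX n|].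
move=> z zK; have [d d0 dz] := dist_pos cK zK.
apply: (avg_lg_cvg PF cK muK _ _ aX d0 dz).
 by move=> n; have [] := HX n.
by move=> n x xs; have [[_ h _] _ _] := HX n; exact: h.
Qed.

(** Regularity of x0 in the pole-dependent form that the comparison with Fekete sums of pole q
    consumes. *)
Definition barrier {R} (q : option R) (e : set R) (x0 : R) : Prop :=
 exists (phi : plane R -> R) (r c : R), [/\ 0 < r, 0 < c, forall z, near_pole q r z -> ~ pline e z,
  forall z, phi z <= 0 & (forall z, near_pole q r z ->
   (perron_solution (pline e) phi (Some z) <= (- c)%:E)%E) /\
  (forall eps : R, 0 < eps -> \forall z \near ((x0, 0) : plane R),
   ~ pline e z -> ((- eps)%:E < perron_solution (pline e) phi (Some z))%E)].

(** The data -|z.1 - x0| / |x1 - x0| vanish at x0 and equal -1 at the end x1 of [e] (maximum or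
    minimum, according to [sgn]). Regularity at x1 keeps the Perron solution below -1/2 near (x1,
    0), and the pole is put there, outside [e]. *)
Lemma barrier_real {R} e x0 x1 sgn : sgn = 1 \/ sgn = -1 ->
 regular_set (pline e) -> e x0 -> e x1 -> x0 != x1 -> (forall t, e t -> sgn * t <= sgn * x1) ->
 exists p : R, ~ e p /\ barrier (Some p) e x0.
Proof.
move=> sg reg e0 e1 x01 emax.
have sg2 : sgn * sgn = 1 by case: sg => ->; rewrite ?mulrNN ?mulr1.
have a0 : 0 < `|x1 - x0| by rewrite normr_gt0 subr_eq0 eq_sym.
pose phi (z : plane R) := - (`|z.1 - x0| / `|x1 - x0|).
have cphi : continuous phi.
 move=> z; apply: cvgN; apply: cvgM; last exact: cvg_cst.
 apply: cvg_norm; apply: cvgB; [exact: cvg_fst|exact: cvg_cst].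
have phE0 : phi (x0, 0) = 0 by rewrite /phi/= subrr normr0 mul0r oppr0.
have phE1 : phi (x1, 0) = -1 by rewrite /phi/= divff ?gt_eqF.
have cw : {within outer_boundary (pline e), continuous phi} by exact: continuous_subspaceT.
have h0 := reg _ (outer_boundary_line e0) phi cw.
have h1 := reg _ (outer_boundary_line e1) phi cw.
rewrite phE0 in h0; rewrite phE1 in h1.
have H0 (eps : R) : 0 < eps -> \forall z \near ((x0, 0) : plane R),
   ~ pline e z -> ((- eps)%:E < perron_solution (pline e) phi (Some z))%E.
 move=> eps0; have n0 : nbhs (0%R%:E : \bar R) [set y | ((- eps)%:E < y)%E].
  by apply: (@nbhs_open_ereal_gt _ 0 (fun=> - eps)); rewrite oppr_lt0.
 exact: h0 n0.
have H1 : \forall z \near ((x1, 0) : plane R),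
   ~ pline e z -> (perron_solution (pline e) phi (Some z) < (- 2^-1)%:E)%E.
 have n0 : nbhs ((-1)%:E : \bar R) [set y | (y < (- 2^-1)%:E)%E].
  by apply: (@nbhs_open_ereal_lt _ (-1) (fun=> - 2^-1)); lra.
 exact: h1 n0.
have [r r0 Hr] := near_axes H1.
have r2 : 0 < r / 2 by rewrite divr_gt0.
have sgl (x : R) : sgn * x <= `|x|.
 by case: sg => ->; rewrite ?mul1r ?mulN1r; [exact: ler_norm|rewrite -normrN ler_norm].
have abs (x y : R) : `|x - y| < r / 2 -> sgn * y - r / 2 < sgn * x.
 move=> h; have := sgl (y - x); rewrite mulrBr distrC; lra.
have out z : sqn (z.1 - (x1 + sgn * (r / 2)), z.2) < (r / 2) ^+ 2 -> ~ pline e z.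
 move=> hz [t et zE]; rewrite -zE /sqn/= expr0n/= addr0 in hz.
 have : `|t - (x1 + sgn * (r / 2))| < r / 2.
  by rewrite -(@ltr_pXn2r _ 2) ?nnegrE ?(ltW r2)// real_normK ?num_real.
 by move=> /abs; rewrite mulrDr mulrA sg2 mul1r; have := emax t et; lra.
exists (x1 + sgn * (r / 2)); split.
 move=> ep; apply: (out (x1 + sgn * (r / 2), 0)); last by exists (x1 + sgn * (r / 2)).
 by rewrite /sqn/= subrr expr0n/= addr0 exprn_gt0.
exists phi, ((r / 2) ^+ 2), 2^-1; split => //.
- by rewrite exprn_gt0.
- move=> z; by rewrite oppr_le0 divr_ge0.
- split=> // z hz.
 have := Hr (z - (x1, 0)); rewrite (addrC (_, _)) subrK => h; apply: ltW; apply: h; last exact: out.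
 move: hz; rewrite /near_pole /sqn/= subr0.
 case: sg => ->; rewrite ?mul1r ?mulN1r => hz.
  have : (z.1 - x1) ^+ 2 <= 2 * (z.1 - (x1 + r / 2)) ^+ 2 + 2 * (r / 2) ^+ 2.
   by have := sqr_ge0 (z.1 - (x1 + r / 2) - r / 2); nra.
  by have := sqr_ge0 z.2; have : (r / 2) ^+ 2 = r ^+ 2 / 4 by [field]; lra.
 have : (z.1 - x1) ^+ 2 <= 2 * (z.1 - (x1 - r / 2)) ^+ 2 + 2 * (r / 2) ^+ 2.
  by have := sqr_ge0 (z.1 - (x1 - r / 2) + r / 2); nra.
 by have := sqr_ge0 z.2; have : (r / 2) ^+ 2 = r ^+ 2 / 4 by [field]; lra.
Qed.

Lemma lcoord_neq0 {R} p e (t : R) : ~ e p -> Kq (Some p) e t -> t != 0.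
Proof.
move=> ep [x ex <-]; rewrite /= invr_eq0 subr_eq0; apply: contra_notN ep => /eqP <-; exact: ex.
Qed.

(** Away from p the Perron solution is at most a negative multiple of the Fekete sum with pole p.
    That sum tends to V + pot, which is positive at q by [pot_pos]; so one suitable Fekete set keeps
    it above c1 / 4 around q, and the same data form a barrier for q. *)
Lemma barrier_transfer {R} e x0 p (q : option R) :
 compact e -> infinite_set e -> ~ e p -> pole_out q e -> q <> Some p -> e x0 ->
 barrier (Some p) e x0 -> barrier q e x0.
Proof.
move=> ce ie ep qe qp ex0 [phi [r1 [c [r10 c0 Nq1 ph0 [Hc1 Hx0]]]]].
pose r := if q is Some q' then Num.min r1 ((q' - p) ^+ 2) else r1.
have r0 : 0 < r.
 rewrite /r; case: q qp {qe r} => [q'|] //= qp; rewrite lt_min r10/= exprn_even_gt0//= subr_eq0.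
 by apply/eqP => h; apply: qp; rewrite h.
have rr1 : r <= r1 by rewrite /r; case: q {qp qe r r0} => [q'|] //=; rewrite ge_min lexx.
have Nq z : near_pole (Some p) r z -> ~ pline e z.
 by move=> h; apply: Nq1; exact: lt_le_trans h rr1.
have Hc z : near_pole (Some p) r z -> (perron_solution (pline e) phi (Some z) <= (- c)%:E)%E.
 by move=> h; apply: Hc1; exact: lt_le_trans h rr1.
have pe : pole_out (Some p) e by [].
have cK := Kq_compact ce pe; have iK : infinite_set (Kq (Some p) e) by exact: Kq_infinite.
have dB := delta_bounded ce pe r0 c0 Nq ph0 Hc ex0 Hx0.
have [A A1 HA] := perron_gs ce pe r0 c0 Nq ph0 Hc.
have [mu [V [X [F [PF pK _ _ [fX sX dV aX]]]]]] := fekete_package cK iK dB.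
(* The pole q seen in the coordinate 1 / (z - p); q = oo becomes 0. *)
pose z0 : plane R := if q is Some q' then coord (Some p) (q', 0) else (0, 0).
have oq q' : q = Some q' -> off_pole (Some p) (q', 0).
 by move=> qE /= [h]; apply: qp; rewrite qE h.
have z0K t : Kq (Some p) e t -> z0 <> (t, 0).
 rewrite /z0; case: q qe oq {qp r r0 rr1 Nq Hc dB A A1 HA z0} => [q'|] qe oq Kt.
  apply: (coord_notin pe (oq _ erefl)) => // -[x ex [xq]]; apply: qe; rewrite -xq//.
 by move=> [h]; have := lcoord_neq0 ep Kt; rewrite -h eqxx.
have [d d0 dz] := dist_pos cK z0K.
have [c1 c10 pc] := pot_pos `|z0.1| cK pK d0.
have {}pc : c1 <= V + pot (Kq (Some p) e) mu z0 by apply: pc.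
have [n Hn] : exists n, c1 / 2 < delta (X n) + avg (X n) (lg z0).
 have h : delta (X n) + avg (X n) (lg z0) @[n --> F] --> V + pot (Kq (Some p) e) mu z0.
  by apply: cvgD => //; exact: aX.
 have c12 : 0 < c1 / 2 by rewrite divr_gt0.
 have /cvgrPdist_lt/(_ _ c12)/filter_ex [n] := h; rewrite ltr_norml => /andP[_ hn].
 by exists n; lra.
have s1 : (1 < size (X n))%N by rewrite sX.
have [us sK _] := fX n.
have cg : {for z0, continuous (fun z => delta (X n) + avg (X n) (lg z))}.
 apply: cvgD; first exact: cvg_cst.
 by apply: continuous_avg_lg => x xs; exact: z0K (sK _ xs).
have n0 : \forall z \near z0, c1 / 4 < delta (X n) + avg (X n) (lg z).
 have c14 : 0 < c1 / 4 by rewrite divr_gt0.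
 have /cvgrPdist_lt/(_ _ c14) := cg; apply: filterS => z; rewrite ltr_norml => /andP[_ h]; lra.
have D1 := A1 _ (fX n) s1; have D0 : 0 < delta (X n) + A by lra.
have [r2 r20 Hr2] : exists2 r2, 0 < r2 & forall z, near_pole q r2 z ->
  [/\ ~ pline e z, ~ near_pole (Some p) (r / 4) z &
   c1 / 4 < delta (X n) + avg (X n) (lg (coord (Some p) z))].
 case: q qe oq qp @r r0 rr1 {Nq Hc dB HA} @z0 z0K dz pc Hn cg n0 => [q'|] qe oq qp r r0 rr1 z0 z0K dz pc Hn cg n0.
  have eq : ~ pline e (q', 0) by move=> [t et [tq]]; apply: qe; rewrite -tq.
  have h1 : r / 4 < sqn (((q', 0) : plane R).1 - p, ((q', 0) : plane R).2).
   have : r <= (q' - p) ^+ 2 by rewrite /r ge_min lexx orbT.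
   by rewrite /sqn/= expr0n/= addr0; lra.
  have cc := continuous_coord (oq _ erefl).
  have n1 : \forall z \near ((q', 0) : plane R), c1 / 4 < delta (X n) + avg (X n) (lg (coord (Some p) z)).
   exact: cc n0.
  have n2 := near_notin ce eq.
  have n3 := (near_sqn_shift p (q', 0) (r / 4)).2 h1.
  have [rr rr0 H] := near_axes (filterI n1 (filterI n2 n3)).
  exists (rr ^+ 2); first by rewrite exprn_gt0.
  move=> z hz; have := H (z - (q', 0)); rewrite (addrC (q', 0)) subrK.
  have -> : sqn (z - (q', 0)) = sqn (z.1 - q', z.2) by rewrite /sqn/= subr0.
  move=> /(_ hz) [H1 [H2 H3]]; split => //.
  by rewrite /near_pole => h; have := lt_trans h H3; rewrite ltxx.
 have [rr rr0 H] := near_axes n0.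
 have [B B0 eB] := compact_bound ce.
 have rr2 : 0 < rr ^+ 2 by rewrite exprn_gt0.
 pose S := 2 * ((rr ^+ 2)^-1 + r) + 2 * p ^+ 2 + B ^+ 2.
 have i0 : 0 < (rr ^+ 2)^-1 by rewrite invr_gt0.
 have p20 := sqr_ge0 p; have B20 := sqr_ge0 B.
 have S0 : 0 < S by rewrite /S; lra.
 exists S^-1; first by rewrite invr_gt0.
 move=> z; rewrite /near_pole invrK => Sz.
 have sh : sqn z <= 2 * sqn (z.1 - p, z.2) + 2 * p ^+ 2.
  by rewrite /sqn/=; have := sqr_ge0 (z.1 - p - p); have := sqr_ge0 z.2; nra.
 have h1 : (rr ^+ 2)^-1 + r < sqn (z.1 - p, z.2) by rewrite /S in Sz; lra.
 have h0 : 0 < sqn (z.1 - p, z.2) by lra.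
 split.
 - move=> [t et tz]; move: Sz; rewrite -tz /sqn/= expr0n/= addr0 ltNge => /negP; apply.
  apply: (@le_trans _ _ (B ^+ 2)); last by rewrite /S; lra.
  by rewrite -real_normK ?num_real// lerXn2r ?nnegrE ?(ltW B0)// ler_norml eB.
 - by move=> h; lra.
 - have := H (coord (Some p) z); rewrite add0r; apply.
  rewrite /= sqn_ginv// -[ltRHS]invrK ltf_pV2 ?posrE//; lra.
exists phi, r2, (c / (delta (X n) + A) * (c1 / 4)); split => //.
- by rewrite !mulr_gt0// ?invr_gt0// divr_gt0.
- by move=> z /Hr2 [].
- split=> // z /Hr2 [ze zp zc].
 apply: le_trans (HA _ (fX n) s1 z ze zp) _; rewrite lee_fin lerN2.
 by rewrite ler_pM2l ?divr_gt0// /gs ltW.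
Qed.

(** An infinite [e] has two distinct ends, so one of them differs from x0 and serves in
    [barrier_real]. *)
Lemma barrier_any {R} e x0 (q : option R) :
 compact e -> infinite_set e -> regular_set (pline e) -> pole_out q e -> e x0 -> barrier q e x0.
Proof.
move=> ce ie reg qe ex0.
have en0 : e !=set0 by exists x0.
have [|M eM Mmax] := @compact_usc_max _ R R e id ce en0.
 by move=> a b _ _ ab; apply: filterS (lt_nbhsl ab) => z h _.
have [|m em mmin] := @compact_usc_max _ R R e -%R ce en0.
 move=> a b _ _; rewrite ltrN2 => ab; have := lt_nbhsr ab.
 by apply: filterS => z h _; rewrite ltrN2.
suff [p [ep bp]] : exists p : R, ~ e p /\ barrier (Some p) e x0.
 have [->//|qp] := pselect (q = Some p).
 exact: barrier_transfer bp.
have [x0M|x0M] := eqVneq x0 M; last first.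
 apply: (@barrier_real _ e x0 M 1 _ reg ex0 eM x0M); first by left.
 by move=> t et; rewrite !mul1r; exact: Mmax.
have [x0m|x0m] := eqVneq x0 m.
 exfalso; apply: ie; apply: (@sub_finite_set _ _ [set x0]); last exact: finite_set1.
 move=> t et; apply/eqP; rewrite eq_le; have := Mmax t et; have := mmin t et.
 by rewrite lerN2 /= -x0M -x0m => -> ->.
apply: (@barrier_real _ e x0 m (-1) _ reg ex0 em x0m); first by right.
by move=> t et; rewrite !mulN1r; exact: mmin.
Qed.

Lemma regular_package {R} e q : compact e -> infinite_set e -> regular_set (pline e) -> pole_out q e ->
 exists (mu : prob R) (V : R) (X : nat -> seq R) (F : set_system nat),
  [/\ ProperFilter F, pot_ok (Kq q e) mu V, energy mu = V%:E, robin_constant (Kq q e) = V%:E &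
  [/\ forall n, fekete (Kq q e) (X n), forall n, size (X n) = n.+2, delta (X n) @[n --> F] --> V,
   forall z, (forall t, Kq q e t -> z <> (t, 0)) -> avg (X n) (lg z) @[n --> F] --> pot (Kq q e) mu z &
   forall t, e t -> forall eps : R, 0 < eps -> \forall z \near ((t, 0) : plane R),
    ~ pline e z -> V + pot (Kq q e) mu (coord q z) < eps]].
Proof.
move=> ce ie reg qe.
have [x0 ex0] : e !=set0.
 by apply/set0P; apply/eqP => e0; apply: ie; rewrite e0; exact: finite_set0.
have [phi [r [c [r0 c0 Nq ph0 [Hc Hx0]]]]] := barrier_any ce ie reg qe ex0.
have dB := delta_bounded ce qe r0 c0 Nq ph0 Hc ex0 Hx0.
have [mu [V [X [F [PF pK EV RV [fX sX dV aX]]]]]] := fekete_package (Kq_compact ce qe) (@Kq_infinite _ q e ie) dB.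
exists mu, V, X, F; split => //; split => // t et.
have [phi' [r' [c' [r'0 c'0 Nq' ph'0 [Hc' Hx'0]]]]] := barrier_any ce ie reg qe et.
exact: (green_limit ce qe r'0 c'0 Nq' ph'0 Hc' et Hx'0 PF pK fX sX dV aX).
Qed.

(** * The Green function as a potential *)

Lemma pot_vertical {R} K mu (V x y : R) : compact K -> pot_ok K mu V -> pot K mu (x, 0) <= pot K mu (x, y).
Proof.
move=> cK pK; have [_ _ int _] := pK.
apply: (@pot_lower _ K mu V (lg (x, 0)) (x, y) x cK pK (int _)).
by move=> t Kt tx; apply: (@lg_le_lg0 _ (x, y)); rewrite eq_sym.
Qed.

Definition green_bd {R} (q : option R) (e : set R) (mu : prob R) (V : R) : Prop :=
 forall t, e t -> forall eps : R, 0 < eps -> \forall z \near ((t, 0) : plane R),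
  ~ pline e z -> V + pot (Kq q e) mu (coord q z) < eps.

(** At infinity a finite pole gives 1 / (oo - q) = 0, whence the point (0, 0). The value 0 at the
    pole is the convention of [is_green]. *)
Definition Gq {R} (q : option R) (e : set R) (mu : prob R) (V : R) (z : sphere R) : R := match z with
 | None => if q is Some _ then V + pot (Kq q e) mu (0, 0) else 0
 | Some z => if `[< off_pole q z >] then V + pot (Kq q e) mu (coord q z) else 0 end.

(** The counterparts of [ka], [kb], [ka0], [kb0] in the chart 1/z: |coord q (1/z) - s| = |ka' z -
    kb'| / |ka0' z - kb0'|. *)
Definition ka' {R} (q : option R) (s : R) : R := if q is Some q then 1 + s * q else s.
Definition kb' {R} (q : option R) (s : R) : R := if q is Some _ then s else 1.
Definition ka0' {R} (q : option R) : R := if q is Some q then q else 1.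
Definition kb0' {R} (q : option R) : R := if q is Some _ then 1 else 0.

Lemma near_vertical {R} t P : (\forall z \near ((t, 0) : plane R), P z) -> exists2 y, y != 0 & P (t, y).
Proof.
move=> [[U V] /= [Ut V0] UV].
have [r /= r0 rV] := (nbhs_ballP _ _).1 V0.
exists (r / 2); first by rewrite gt_eqF// divr_gt0.
apply: UV; split; first exact: nbhs_singleton Ut.
by apply: rV; rewrite /ball/= sub0r normrN gtr0_norm ?divr_gt0// ltr_pdivrMr// mulr2n; lra.
Qed.

Lemma ginvK {R} (z : plane R) : 0 < sqn z -> ginv (ginv z) = z.
Proof.
move=> S0; have E := sqn_ginv S0.
by apply: plane_ext; rewrite {1}/ginv E /ginv/= ?mulNr ?opprK; field; exact: lt0r_neq0.
Qed.

(** [green_bd] controls only points off [e]. Were the value at s = lcoord q t positive, some point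
    of the vertical line through s would have a smaller value, whereas the potential cannot decrease
    when the axis is left vertically. *)
Lemma pot_zero {R} q e mu (V t : R) : compact e -> pole_out q e -> pot_ok (Kq q e) mu V -> green_bd q e mu V -> e t ->
 V + pot (Kq q e) mu (lcoord q t, 0) = 0.
Proof.
move=> ce qe pK bd et; have cK := Kq_compact ce qe.
have ge0 : 0 <= V + pot (Kq q e) mu (lcoord q t, 0) by have [_ _ _ /(_ (lcoord q t, 0))] := pK; lra.
apply/eqP; rewrite eq_le ge0 andbT leNgt; apply/negP => gt0.
have H := bd t et _ gt0.
suff [y] : exists y, V + pot (Kq q e) mu (lcoord q t, y) < V + pot (Kq q e) mu (lcoord q t, 0).
 by rewrite ltrD2l ltNge (pot_vertical _ _ cK pK).
case: q qe pK bd cK ge0 gt0 H => [q|] /= qe pK bd cK ge0 gt0 H; last first.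
 have [y y0 Hy] := near_vertical H; exists y; apply: Hy => -[x _ [_ h]].
 by move: y0; rewrite -h eqxx.
have tq : t - q != 0 by apply: contra_notN qe; rewrite subr_eq0 => /eqP <-.
have S0 : 0 < sqn ((t - q, 0) : plane R) by rewrite /sqn/= expr0n/= addr0 exprn_even_gt0.
pose inv (z : plane R) : plane R := (q + (ginv z).1, (ginv z).2).
pose s := (t - q)^-1.
have s0 : s != 0 by rewrite invr_eq0.
have Ss : 0 < sqn ((s, 0) : plane R) by rewrite /sqn/= expr0n/= addr0 exprn_even_gt0.
have cinv : {for ((s, 0) : plane R), continuous inv}.
 have := @continuous_coord R (Some 0) (s, 0).
 move=> /(_ _)/wrap[]; first by move=> [h]; move: s0; rewrite h eqxx.
 rewrite (_ : coord (Some 0) = ginv); last by apply/funext => z; rewrite /= subr0; case: z.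
 move=> cg; apply: continuous_for_pair.
  apply: cvgD; first exact: cvg_cst.
  exact: (@continuous_comp _ _ _ ginv fst (s, 0) cg (@cvg_fst _ _ _ _ _)).
 exact: (@continuous_comp _ _ _ ginv snd (s, 0) cg (@cvg_snd _ _ _ _ _)).
have invE : inv (s, 0) = (t, 0).
 apply: plane_ext; rewrite /inv /= /sqn/= expr0n/= addr0; last by rewrite oppr0 mul0r.
 by rewrite /s; field.
pose P (z : plane R) := ~ pline e z ->
  V + pot (Kq (Some q) e) mu (coord (Some q) z) < V + pot (Kq (Some q) e) mu (s, 0).
have HP : nbhs (inv (s, 0)) P by rewrite invE; exact: H.
have H' : \forall z \near ((s, 0) : plane R), P (inv z) by exact: (cinv P HP).
have [y y0 Hy] := near_vertical H'; exists y.
have Sy : 0 < sqn ((s, y) : plane R).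
 by rewrite /sqn/= ltr_pwDl ?sqr_ge0// exprn_even_gt0.
have E : coord (Some q) (inv (s, y)) = (s, y).
 rewrite /coord (_ : ((inv (s, y)).1 - q, (inv (s, y)).2) = ginv (s, y)) ?ginvK//.
 by apply: plane_ext => //=; rewrite addrC addKr.
move: Hy; rewrite /P E; apply=> -[x _ [_ /esym/eqP]].
by rewrite mulf_eq0 oppr_eq0 invr_eq0 (negbTE y0) (gt_eqF Sy).
Qed.

Lemma continuous_ka {R} (q : option R) : [/\ continuous (ka q), continuous (kb q),
 continuous (ka' q) & continuous (kb' q)].
Proof.
have c (a b : R) : continuous (fun s : R => a + s * b).
 move=> s; apply: cvgD; first exact: cvg_cst.
 by apply: cvgM; [exact: cvg_id|exact: cvg_cst].
by case: q => [q|]; split => s; rewrite /ka /kb /ka' /kb'; (exact: cvg_id || exact: cvg_cst || exact: c).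
Qed.

Lemma pot_kernel {R} q e mu V (z : plane R) :
 compact e -> pole_out q e -> pot_ok (Kq q e) mu V -> off_pole q z -> ~ pline e z ->
 V + pot (Kq q e) mu (coord q z) = \int[mu]_(s in Kq q e)
  (V + lgk (ka q s) (kb q s) z - kc q * lgk (ka0 q) (kb0 q) z).
Proof.
move=> ce qe [muK _ int _] oz ze.
have mK : measurable (Kq q e) by apply: closed_measurable; apply: compact_closed => //; exact: Kq_compact.
rewrite (_ : \int[mu]_(s in Kq q e) _ = \int[mu]_(s in Kq q e) (V + lg (coord q z) s)); last first.
 by apply: eq_Rintegral => s /set_mem Ks; rewrite (lg_coord qe oz ze Ks) addrA.
rewrite RintegralD ?Rint_prob_cst//.
by exact: cst_integrable.
Qed.

Lemma plane_ne {R} (z : plane R) : z <> (0, 0) -> 0 < sqn z.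
Proof. by move=> h; rewrite lt_neqAle sqn_ge0 andbT eq_sym; apply/eqP => /sqn_eq0. Qed.

Lemma sphere_inv0 {R} : @sphere_inv R (0, 0) = None.
Proof. by rewrite /sphere_inv (_ : _ == _ = true)//; exact/eqP. Qed.

Lemma sphere_invE {R} (z : plane R) : 0 < sqn z -> sphere_inv z = Some (ginv z).
Proof.
move=> S0; rewrite -[z in LHS](ginvK S0) sphere_inv_ginv// sqn_ginv//.
by rewrite invr_gt0.
Qed.

Lemma chart_off {R} q e z : pole_out q e ->
 (sphere_compl (pline e) `\ (omap (fun t : R => (t, 0)) q : sphere R)) (sphere_inv z) <->
 (forall t, e t -> nk t 1 z != 0) /\ nk (ka0' q) (kb0' q) z != 0.
Proof.
move=> qe.
have nkP (t : R) : nk t 1 z = 0 <-> sphere_inv z = Some (t, 0).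
 have [->|z0] := pselect (z = (0, 0)).
  rewrite sphere_inv0; split => //; rewrite /nk/= !mulr0 sub0r expr0n/= addr0 sqrrN expr1n.
  by move/eqP; rewrite oner_eq0.
 have S0 := plane_ne z0; rewrite (sphere_invE S0); split.
  move=> h; have := @sqn_eq0 R (t * z.1 - 1, t * z.2) h => h2.
  have h3 := congr1 fst h2; have h4 := congr1 snd h2; rewrite /= in h3 h4.
  have t0 : t != 0 by apply/eqP => t0; move: h3; rewrite t0 mul0r; lra.
  have z2 : z.2 = 0 by move/eqP: h4; rewrite mulf_eq0 (negbTE t0) => /eqP.
  have z1 : z.1 = t^-1 by apply: (mulfI t0); rewrite divff//; lra.
  congr Some; apply: plane_ext; rewrite /ginv /sqn/= z2 ?oppr0 ?mul0r// expr0n/= addr0 z1.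
  by field.
 move=> [h1 h2]; have z2 : z.2 = 0.
  by move/eqP: h2; rewrite mulNr oppr_eq0 mulf_eq0 invr_eq0 (gt_eqF S0) orbF => /eqP.
 move: S0 h1; rewrite /nk /sqn z2 expr0n/= addr0 mulr0 expr0n/= addr0 => S0 h1.
 have z1 : z.1 != 0 by apply: contraTneq S0 => ->; rewrite expr0n/= ltxx.
 have -> : t * z.1 = 1 by rewrite -h1; field.
 by rewrite subrr expr0n.
have pole : sphere_inv z <> (omap (fun t : R => (t, 0)) q : sphere R) <-> nk (ka0' q) (kb0' q) z != 0.
 case: q {qe} => [q|] /=.
  split; first by move=> h; apply/eqP => /nkP.
  by move=> /eqP h /nkP.
 rewrite /nk mul1r subr0 mul1r -/(sqn z); split.
  by move=> h; apply/eqP => /sqn_eq0 z0; apply: h; rewrite z0 sphere_inv0.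
 move=> S0; have S1 : 0 < sqn z by rewrite lt_neqAle eq_sym S0 sqn_ge0.
 by rewrite sphere_invE.
split.
 move=> [ze zp]; split; last exact/pole.
 by move=> t et; apply/eqP => /nkP h; apply: ze; exists (t, 0) => //; exists t.
move=> [ze zp]; split; last by move: zp => /pole.
by move=> [y [t et <-]] /esym/nkP /eqP h; have := ze t et; rewrite h.
Qed.

Lemma chart_kq_neq0 {R} q e z (s : R) : pole_out q e ->
 (forall t, e t -> nk t 1 z != 0) -> Kq q e s -> nk (ka' q s) (kb' q s) z != 0.
Proof.
move=> qe ze [t et <-]; case: q qe => [q|] /= qe; last exact: ze.
have tq : t - q != 0 by apply: contra_notN qe; rewrite subr_eq0 => /eqP <-.
have := ze t et; apply: contraNneq => h.
rewrite (_ : nk t 1 z = (t - q) ^+ 2 * nk (1 + (t - q)^-1 * q) (t - q)^-1 z); first by rewrite h mulr0.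
by rewrite /nk; field.
Qed.

Lemma Gq_chart {R} q e mu V (z : plane R) : compact e -> pole_out q e -> pot_ok (Kq q e) mu V ->
 (forall t, e t -> nk t 1 z != 0) -> nk (ka0' q) (kb0' q) z != 0 ->
 Gq q e mu V (sphere_inv z) = \int[mu]_(s in Kq q e) (V + lgk (ka' q s) (kb' q s) z - 1 * lgk (ka0' q) (kb0' q) z).
Proof.
move=> ce qe pK ze zp; have [muK _ int _] := pK.
have mK : measurable (Kq q e) by apply: closed_measurable; apply: compact_closed => //; exact: Kq_compact.
have key (y : plane R) : (forall s, Kq q e s -> rho y s ^+ 2 = nk (ka' q s) (kb' q s) z / nk (ka0' q) (kb0' q) z) ->
  V + pot (Kq q e) mu y = \int[mu]_(s in Kq q e) (V + lgk (ka' q s) (kb' q s) z - 1 * lgk (ka0' q) (kb0' q) z).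
 move=> H.
 rewrite (_ : \int[mu]_(s in Kq q e) _ = \int[mu]_(s in Kq q e) (V + lg y s)).
  by rewrite RintegralD ?Rint_prob_cst//; exact: cst_integrable.
 apply: eq_Rintegral => s /set_mem Ks; rewrite mul1r -addrA; congr (_ + _).
 have n1 : 0 < nk (ka' q s) (kb' q s) z.
  by rewrite lt_neqAle nk_ge0 andbT eq_sym; exact: chart_kq_neq0 Ks.
 have n0 : 0 < nk (ka0' q) (kb0' q) z by rewrite lt_neqAle nk_ge0 andbT eq_sym.
 have r2 : 0 < rho y s ^+ 2 by rewrite H// divr_gt0.
 have r0 : 0 < rho y s by rewrite lt_neqAle rho_ge0 andbT; apply: contraTneq r2 => <-; rewrite expr0n/= ltxx.
 rewrite lg_rho (_ : ln (rho y s) = ln (rho y s ^+ 2) / 2); last by rewrite lnXn// mulr2n; lra.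
 rewrite H// /lgk ln_div ?posrE//; lra.
have [_ [U1 U2]] := (iffLR (iff_sym (chart_off z qe)) (conj ze zp), (chart_off z qe).2 (conj ze zp)).
have [zE|z0] := pselect (z = (0, 0)).
 move: zp; rewrite zE sphere_inv0 /=; case: q qe pK muK int mK key {U1 U2} ze => [q|] qe pK muK int mK key ze zp.
  rewrite (key (0, 0)) ?zE// => s Ks; rewrite rho_sqr /nk /= !mulr0 !sub0r expr0n/= !addr0 sqrrN.
  by rewrite (_ : (-1) ^+ 2 = 1) ?divr1// sqrrN expr1n.
 by move: zp; rewrite /nk/= !mulr0 subr0 expr0n/= addr0 eqxx.
have S0 := plane_ne z0; rewrite (sphere_invE S0) /=.
have op : off_pole q (ginv z).
 case: q U2 {qe ze pK muK int mK key U1} zp => [q|] //= + _ h; apply.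
 by rewrite /= (sphere_invE S0) h.
rewrite asboolT//; apply: key => s Ks.
rewrite nk_coord//.
case: q qe ze zp pK muK int mK U1 U2 op Ks => [q|] qe ze zp pK muK int mK U1 U2 op Ks.
 have qz : nk q 1 z != 0 by [].
 have : nk 1 q (ginv z) = nk q 1 z / sqn z.
  by rewrite /nk /ginv /sqn /=; move: S0; rewrite /sqn => S0; field; rewrite lt0r_neq0.
 have : nk s (1 + s * q) (ginv z) = nk (1 + s * q) s z / sqn z.
  by rewrite /nk /ginv /sqn /=; move: S0; rewrite /sqn => S0; field; rewrite lt0r_neq0.
 rewrite /ka /kb /ka0 /kb0 /ka' /kb' /ka0' /kb0' => -> ->.
 by field; rewrite qz lt0r_neq0.
rewrite /ka /kb /ka0 /kb0 /ka' /kb' /ka0' /kb0' /nk /ginv /sqn /=.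
move: S0; rewrite /sqn => S0; rewrite !mul1r !subr0 !mul0r sub0r; field.
by rewrite lt0r_neq0.
Qed.

Lemma near_chart {R} e (z : plane R) : compact e ->
 (forall t, e t -> nk t 1 z != 0) -> \forall y \near z, forall t, e t -> nk t 1 y != 0.
Proof.
move=> /compact_near_coveringP ce ze.
apply: (ce (plane R) (nbhs z) (fun y t => nk t 1 y != 0)) => t et.
have c : {for (t, z), continuous (fun p : R * plane R => nk p.1 1 p.2)}.
 have cx : {for (t, z), continuous (fun p : R * plane R => p.1 * p.2.1)}.
  by apply: cvgM; [exact: cvg_fst|apply: continuous_comp; [exact: cvg_snd|exact: cvg_fst]].
 have cy : {for (t, z), continuous (fun p : R * plane R => p.1 * p.2.2)}.
  by apply: cvgM; [exact: cvg_fst|apply: continuous_comp; [exact: cvg_snd|exact: cvg_snd]].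
 have cx1 : {for (t, z), continuous (fun p : R * plane R => p.1 * p.2.1 - 1)}.
  by apply: cvgB; [exact: cx|exact: cvg_cst].
 by apply: cvgD; apply: cvgM; (exact: cx1 || exact: cy).
have p : 0 < nk t 1 z by rewrite lt_neqAle eq_sym ze// nk_ge0.
have /cvgrPdist_lt/(_ _ p) := c; apply: filterS => -[s y] /= h.
apply/eqP => h0; move: h; rewrite h0 subr0 gtr0_norm// ltxx//.
Qed.

Lemma kernel_part_bounded {R} (mu : prob R) K a b (z : plane R) :
 compact K -> mu K = 1%E -> continuous a -> continuous b ->
 (\forall y \near z, forall s, K s -> nk (a s) (b s) y != 0) ->
 exists M : R, \forall y \near z, `|\int[mu]_(s in K) lgk (a s) (b s) y| <= M /\
   intR mu K (fun s => lgk (a s) (b s) y).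
Proof.
move=> cK muK ca cb H.
have jc : \forall y \near z, jcont K (fun y s => lgk (a s) (b s) y) y.
 by apply: filterS H => y Hy s Ks; exact: (lgk_jcont (@ca s) (@cb s) (Hy s Ks)).
have c := jcont_integral cK muK jc.
exists (`|\int[mu]_(s in K) lgk (a s) (b s) z| + 1).
have lt1 : `|\int[mu]_(s in K) lgk (a s) (b s) z| < `|\int[mu]_(s in K) lgk (a s) (b s) z| + 1 by rewrite ltrDl.
apply: filterS2 jc (near_norm_lt c lt1) => y jy h; split; first exact: ltW.
exact: (continuous_on_integrable mu cK (jcont_section jy)).
Qed.

Lemma kq_neq0_pole {R} q e z (s : R) : pole_out q e -> ~ pline e z -> Kq q e s -> nk (ka q s) (kb q s) z != 0.
Proof.
move=> qe ze Ks; have [oz|oz] := pselect (off_pole q z); first exact: kq_neq0 oz ze Ks.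
case: q qe Ks oz => [q|] //= qe Ks; move=> /contrapT ->.
rewrite /nk /= mulr0 expr0n/= addr0 opprD addrCA subrr addr0.
by rewrite sqrrN expr1n oner_neq0.
Qed.

Lemma Rint_kernel_split {R} (mu : prob R) K f V c : measurable K -> mu K = 1%E -> intR mu K f ->
 \int[mu]_(s in K) (V + f s - c) = V + \int[mu]_(s in K) f s - c.
Proof.
move=> mK muK fi.
have ci (x : R) : intR mu K (fun=> x) by exact: cst_integrable.
have i1 := integrableD mK (ci V) fi.
by rewrite RintegralB// ?Rint_prob_cst// RintegralD// Rint_prob_cst.
Qed.

Lemma ln_modulus {R} (z : plane R) : ln (modulus z) = ln (sqn z) / 2.
Proof.
rewrite /modulus -/(sqn z); have := sqn_ge0 z; rewrite le_eqVlt => /orP[/eqP <-|S0].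
 by rewrite sqrtr0 ln0// mul0r.
rewrite -[in RHS](sqr_sqrtr (sqn_ge0 z)) lnXn ?sqrtr_gt0// mulr2n; lra.
Qed.

Lemma Gq_ge0 {R} q e mu V (z : sphere R) : pot_ok (Kq q e) mu V -> 0 <= Gq q e mu V z.
Proof.
move=> [_ _ _ ge]; case: z => [z|] /=.
 by case: asboolP => // _; have := ge (coord q z); lra.
by case: q ge => [q|] ge //=; have := ge (0, 0); lra.
Qed.

Lemma Gq_pole {R} q e mu V : Gq q e mu V (omap (fun t : R => (t, 0)) q : sphere R) = 0.
Proof. by case: q => [q|] //=; rewrite asboolF//; apply. Qed.

Section Gq_green.
Context {R} (q : option R) (e : set R) (mu : prob R) (V : R).
Hypotheses (ce : compact e) (qe : pole_out q e) (pK : pot_ok (Kq q e) mu V).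
Let E := pline e.
Let z0 : sphere R := omap (fun t : R => (t, 0)) q.
Let G := Gq q e mu V.
Let cK : compact (Kq q e) := Kq_compact ce qe.
Let mK : measurable (Kq q e). Proof. by exact: compact_measurable. Qed.
Let muK : mu (Kq q e) = 1%E. Proof. by case: pK. Qed.

Lemma chart1P z : (sphere_compl E `\ z0) (Some z) <-> (~ E z /\ off_pole q z).
Proof.
split=> [[h1 h2]|[h1 h2]]; split.
- by move=> Ez; apply: h1; exists z.
- by move: h2; rewrite /z0; case: (q) => [q'|] //= h zE; apply: h; rewrite zE.
- by move=> [y Ey [yz]]; apply: h1; rewrite -yz.
- by move: h2; rewrite /z0; case: (q) => [q'|] //= h [].
Qed.

Lemma Gq_harmonic1 : harmonic_on [set z | (sphere_compl E `\ z0) (Some z)] (fun z => G (Some z)).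
Proof.
have [ca cb _ _] := continuous_ka q.
apply: (@kernel_harmonic R mu (Kq q e) (ka q) (kb q) V (kc q) (ka0 q) (kb0 q)) => //.
- move=> z /chart1P [ze zq].
 by apply: filterS2 (near_notin ce ze) (near_off_pole zq) => y ye yq; apply/chart1P.
- by move=> z t /chart1P [ze zq] Kt; exact: kq_neq0 Kt.
- by move=> z /chart1P [ze zq]; exact: kq0_neq0.
- by move=> z /chart1P [ze zq]; rewrite /G/= asboolT// pot_kernel.
Qed.

Lemma near_chart2 z : (sphere_compl E `\ z0) (sphere_inv z) ->
 \forall y \near z, (sphere_compl E `\ z0) (sphere_inv y).
Proof.
move=> /(chart_off z qe) [ze zp].
have c0 : {for z, continuous (nk (ka0' q) (kb0' q))}.
 have c1 : {for z, continuous (fun z : plane R => ka0' q * z.1 - kb0' q)}.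
  by apply: cvgB; [apply: cvgM; [exact: cvg_cst|exact: cvg_fst]|exact: cvg_cst].
 have c2 : {for z, continuous (fun z : plane R => ka0' q * z.2)}.
  by apply: cvgM; [exact: cvg_cst|exact: cvg_snd].
 by apply: cvgD; apply: cvgM; (exact: c1 || exact: c2).
have n0 : \forall y \near z, nk (ka0' q) (kb0' q) y != 0.
 have p : 0 < nk (ka0' q) (kb0' q) z by rewrite lt_neqAle eq_sym zp nk_ge0.
 have /cvgrPdist_lt/(_ _ p) := c0; apply: filterS => y h.
 by apply/eqP => h0; move: h; rewrite h0 subr0 gtr0_norm// ltxx.
by apply: filterS2 (near_chart ce ze) n0 => y ye yp; apply/(chart_off y qe).
Qed.

Lemma Gq_harmonic2 : harmonic_on [set z | (sphere_compl E `\ z0) (sphere_inv z)] (fun z => G (sphere_inv z)).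
Proof.
have [_ _ ca cb] := continuous_ka q.
apply: (@kernel_harmonic R mu (Kq q e) (ka' q) (kb' q) V 1 (ka0' q) (kb0' q)) => //.
- exact: near_chart2.
- by move=> z t /(chart_off z qe) [ze zq] Kt; exact: chart_kq_neq0 Kt.
- by move=> z /(chart_off z qe) [].
- by move=> z /(chart_off z qe) [ze zq]; rewrite /G Gq_chart.
Qed.

(** Near the pole the integral of the logarithms of the numerators is continuous, hence bounded; the
    denominator alone produces the singularity. *)
Lemma Gq_log_pole : log_pole z0 G.
Proof.
have [ca cb ca' cb'] := continuous_ka q.
rewrite /log_pole /z0; case Eq : q => [q'|] /=.
 have ze : ~ E (q', 0) by move=> [t et [tq]]; move: qe; rewrite Eq /= -tq.
 have [M HM] := @kernel_part_bounded R mu (Kq q e) (ka q) (kb q) (q', 0) cK muK ca cb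
  (filterS (fun y ye s Ks => kq_neq0_pole qe ye Ks) (near_notin ce ze)).
 exists (`|V| + M).
 apply: filterS2 HM (near_notin ce ze) => z [HM fi] zE zq.
 have oz : off_pole q z by rewrite Eq /= => h; move/eqP: zq; rewrite h.
 rewrite /G/= asboolT// pot_kernel// Rint_kernel_split//.
 rewrite ln_modulus Eq /kc mul1r /lgk /nk /ka0 /kb0 !mul1r /sqn/= subr0 subrK.
 by apply: le_trans (ler_normD _ _) _; rewrite lerD2l; rewrite Eq in HM.
have n0 : forall t, e t -> nk t 1 ((0, 0) : plane R) != 0.
 by move=> t _; rewrite /nk/= !mulr0 sub0r expr0n/= addr0 sqrrN expr1n oner_neq0.
have [M HM] := @kernel_part_bounded R mu (Kq q e) (ka' q) (kb' q) (0, 0) cK muK ca' cb'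
  (filterS (fun y ye s Ks => chart_kq_neq0 qe ye Ks) (near_chart ce n0)).
exists (`|V| + M).
apply: filterS2 HM (near_chart ce n0) => z [HM fi] ze zq.
have zp : nk (ka0' q) (kb0' q) z != 0.
 rewrite Eq /nk/= mul1r subr0 mul1r; apply/eqP => /sqn_eq0 h.
 by move/eqP: zq; rewrite h.
rewrite /G Gq_chart// Rint_kernel_split//.
rewrite ln_modulus Eq mul1r /lgk /nk /ka0' /kb0' !mul1r subr0 /sqn subrK.
by apply: le_trans (ler_normD _ _) _; rewrite lerD2l; rewrite Eq in HM.
Qed.

Hypothesis bd : green_bd q e mu V.

Lemma Gq_zero z : E z -> G (Some z) = 0.
Proof.
move=> [t et <-]; rewrite /G/=; case: asboolP => // oz.
by rewrite (coord_real qe et); exact: pot_zero et.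
Qed.

Lemma Gq_boundary zeta : outer_boundary E zeta ->
 (fun z : plane R => G (Some z)) @ within (~` E) (nbhs zeta) --> (0 : R).
Proof.
move=> [[t et <-] _]; apply/cvgrPdist_lt => eps e0.
apply: filterS (bd et e0) => z h ze; rewrite sub0r normrN ger0_norm; last exact: Gq_ge0.
by rewrite /G/=; case: asboolP => // oz; exact: h.
Qed.

Lemma Gq_is_green : is_green E z0 G.
Proof.
split; [split; [exact: Gq_harmonic1|exact: Gq_harmonic2]|exact: Gq_log_pole|exact: Gq_boundary
 |exact: Gq_zero|exact: Gq_pole].
Qed.
End Gq_green.

(** * Uniqueness of the Green function *)

(** A Phragmen-Lindelof argument: h is only bounded above near the pole and near infinity, but h -
    eps Phi, with Phi tending to +oo at both, falls under the maximum principle. It stands in for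
    the removal of singularities. *)
Lemma zero_principle {R} e q h Phi (M R0 : R) : compact e -> pole_out q e ->
 (forall z, ~ pline e z -> off_pole q z ->
  [/\ {for z, continuous h}, har4 h z, {for z, continuous Phi}, har4 Phi z & 0 <= Phi z]) ->
 (forall z, ~ pline e z -> off_pole q z -> R0 < sqn z -> h z <= M) ->
 (forall z0, ~ off_pole q z0 -> \forall z \near z0, off_pole q z -> h z <= M) ->
 (forall L : R, exists R1 : R, forall z, ~ pline e z -> off_pole q z -> R1 < sqn z -> L <= Phi z) ->
 (forall (L : R) z0, ~ off_pole q z0 -> \forall z \near z0, off_pole q z -> L <= Phi z) ->
 (forall t, e t -> forall eps : R, 0 < eps -> \forall z \near ((t, 0) : plane R),
   ~ pline e z -> h z < eps) -> forall z, ~ pline e z -> off_pole q z -> h z <= 0.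
Proof.
move=> ce qe reg hM hp Pinf Pp bd z ze zq.
have [_ _ _ _ Pz0] := reg z ze zq.
suff H eps : 0 < eps -> h z <= eps * Phi z.
 apply/ler_addgt0Pr => d d0; rewrite add0r.
 have P1 : 0 < Phi z + 1 by lra.
 apply: le_trans (H _ (divr_gt0 d0 P1)) _.
 by rewrite mulrAC ler_pdivrMr// ler_wpM2l ?(ltW d0)//; lra.
move=> eps0.
pose L := (`|M| + 1) / eps.
have ML : M - eps * L < 0 by rewrite /L mulrC divfK ?gt_eqF//; have := ler_norm M; lra.
have [R1 HR1] := Pinf L.
pose S := Num.max (Num.max R0 R1) (sqn z) + 1.
have [S0 S1 S2] : [/\ R0 + 1 <= S, R1 + 1 <= S & sqn z + 1 <= S].
 by rewrite /S !lerD2r !le_max !lexx !orbT.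
pose D := [set y : plane R | [/\ ~ pline e y, off_pole q y & sqn y < S]].
have Dz : D z by split => //; lra.
pose f (y : plane R) := 1 * h y + (- eps) * Phi y + 0.
have := @max_principle R D f (S + 1) _ _ _ _ _ z Dz.
rewrite /f mul1r addr0 mulNr subr_le0; apply.
- by move=> y [_ _ /ltW /abs_le_sqn].
- move=> y [ye yq yS]; have := (near_sqn_shift 0 y S).1; rewrite subr0 => /(_ yS) n.
 by apply: filterS3 (near_notin ce ye) (near_off_pole yq) n => y' h1 h2; rewrite subr0.
- move=> y [ye yq _]; have [ch _ cP _ _] := reg y ye yq.
 apply: cvgD; last exact: cvg_cst.
  by apply: cvgD; (apply: cvgM; [exact: cvg_cst|]); [exact: ch|exact: cP].
- move=> y [ye yq _]; have [_ hh _ hP _] := reg y ye yq.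
 by apply: har4_sub4; exact: har4_lin.
- move=> z0 nD d d0.
 have [[t et tz]|z0e] := pselect (pline e z0).
  subst z0; apply: filterS (bd t et d d0) => y hy [ye yq _].
  have [_ _ _ _ P0] := reg y ye yq; have := hy ye; have := mulr_ge0 (ltW eps0) P0; lra.
 have [z0q|z0q] := pselect (off_pole q z0); last first.
  apply: filterS2 (hp z0 z0q) (Pp L z0 z0q) => y h1 h2 [ye yq _].
  have := h1 yq; have := ler_wpM2l (ltW eps0) (h2 yq); lra.
 have z0S : S - 2^-1 < sqn z0.
  have : S <= sqn z0 by rewrite leNgt; apply/negP => hS; apply: nD.
  lra.
 have := (near_sqn_shift 0 z0 (S - 2^-1)).2; rewrite subr0 => /(_ z0S).
 apply: filterS => y; rewrite subr0 => yS [ye yq _].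
 have h1 : h y <= M by apply: hM => //; lra.
 have h2 : L <= Phi y by apply: HR1 => //; lra.
 have := ler_wpM2l (ltW eps0) h2; lra.
Qed.

Lemma ln_lt_near0 {R} L : exists2 r : R, 0 < r & forall x, x < r -> 0 < x -> L <= - (ln x / 2).
Proof.
exists (expR (- (2 * L))) => [|x xr x0]; first exact: expR_gt0.
have : ln x < - (2 * L) by rewrite -(expRK (- (2 * L))) ltr_ln ?posrE ?expR_gt0.
lra.
Qed.

Lemma log_pole_growth {R} q g L : log_pole (omap (fun t : R => (t, 0)) q : sphere R) g -> match q with
 | Some q' => \forall z \near ((q', 0) : plane R), z <> (q', 0) -> L <= g (Some z)
 | None => exists R1 : R, forall z, R1 < sqn z -> L <= g (Some z) end.
Proof.
case: q => [q'|] /= [M HM]; have [r r0 Hr] := ln_lt_near0 (L + M).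
 have h : sqn (((q', 0) : plane R).1 - q', ((q', 0) : plane R).2) < r.
  by rewrite /sqn/= subrr expr0n/= addr0.
 have HM' : \forall z \near ((q', 0) : plane R), z != (q', 0) ->
  `|g (Some z) + ln (modulus (z - (q', 0)))| <= M by exact: HM.
 apply: filterS2 HM' ((near_sqn_shift q' (q', 0) r).1 h) => z h1 h2 zq.
 have /eqP zq' := zq; have := h1 zq'; rewrite ln_modulus.
 rewrite (_ : z - (q', 0) = (z.1 - q', z.2)); last by apply: plane_ext; rewrite //= subr0.
 have := Hr _ h2 (off_pole_sqn zq); rewrite ler_norml => ? /andP[? ?]; lra.
have HM' : \forall z \near (0 : plane R), z != 0 -> `|g (sphere_inv z) + ln (modulus z)| <= M by exact: HM.
have [s s0 Hs] := near_axes HM'.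
have s2 : 0 < s ^+ 2 by rewrite exprn_gt0.
exists (r^-1 + (s ^+ 2)^-1) => z hz.
have [ri si] : 0 < r^-1 /\ 0 < (s ^+ 2)^-1 by rewrite !invr_gt0.
have S0 : 0 < sqn z by lra.
have E := sqn_ginv S0.
have i1 : (sqn z)^-1 < s ^+ 2 by rewrite -[ltRHS]invrK ltf_pV2 ?posrE//; lra.
have i2 : (sqn z)^-1 < r by rewrite -[ltRHS]invrK ltf_pV2 ?posrE//; lra.
have i0 : 0 < (sqn z)^-1 by rewrite invr_gt0.
have := Hs (ginv z); rewrite add0r E sphere_inv_ginv// => /(_ i1).
have gn : ginv z != 0.
 by apply/eqP => h; move: i0; rewrite -E h /sqn/= expr0n/= addr0 ltxx.
move=> /(_ gn); rewrite ln_modulus E.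
have := Hr _ i2 i0; rewrite ler_norml => ? /andP[? ?]; lra.
Qed.

Lemma green_continuous1 {R} e q g z : compact e -> pole_out q e ->
 harmonic_on [set z | (sphere_compl (pline e) `\ (omap (fun t : R => (t, 0)) q : sphere R)) (Some z)]
  (fun z => g (Some z)) -> ~ pline e z -> off_pole q z ->
 {for z, continuous (fun z => g (Some z))} /\ har4 (fun z => g (Some z)) z.
Proof.
move=> ce qe H ze zq.
have n : \forall y \near z, [set z | (sphere_compl (pline e) `\ (omap (fun t : R => (t, 0)) q : sphere R)) (Some z)] y.
 by apply: filterS2 (near_notin ce ze) (near_off_pole zq) => y ye yq; apply/chart1P.
split; first exact: C2_continuous n H.1.
exact: harmonic_har4 n H.
Qed.

Section green_unique.
Context {R} (e : set R) (q : option R) (mu mu0 : prob R) (V V0 : R).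
Hypotheses (ce : compact e) (qe : pole_out q e).
Hypotheses (pK : pot_ok (Kq q e) mu V) (bd : green_bd q e mu V).
Hypotheses (pK0 : pot_ok (Kq None e) mu0 V0) (bd0 : green_bd None e mu0 V0).
Let E := pline e.
Let z0 : sphere R := omap (fun t : R => (t, 0)) q.

(** The boundary hypotheses are one-sided: [g2] may be a function known only to be nonnegative,
    which is how the equilibrium measure is reached later. *)
Lemma green_diff_le g1 g2 : sphere_harmonic_on (sphere_compl E `\ z0) g1 -> log_pole z0 g1 ->
 (forall t, e t -> forall eps : R, 0 < eps -> \forall y \near ((t, 0) : plane R), ~ E y -> g1 (Some y) < eps) ->
 sphere_harmonic_on (sphere_compl E `\ z0) g2 -> log_pole z0 g2 ->
 (forall t, e t -> forall eps : R, 0 < eps -> \forall y \near ((t, 0) : plane R), ~ E y -> - eps < g2 (Some y)) ->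
 forall z, ~ E z -> off_pole q z -> g1 (Some z) - g2 (Some z) <= 0.
Proof.
move=> [h1 h1'] lp1 b1 [h2 h2'] lp2 b2.
have [[hG hG'] lpG bG _ _] := Gq_is_green ce qe pK bd.
have [[hI hI'] lpI bI _ _] := @Gq_is_green _ None e mu0 V0 ce I pK0 bd0.
(* The sum of the Green functions with poles q and oo tends to +oo at both exceptional points. *)
pose Phi (z : plane R) := 1 * Gq q e mu V (Some z) + 1 * Gq None e mu0 V0 (Some z) + 0.
pose h (z : plane R) := 1 * g1 (Some z) + (- 1) * g2 (Some z) + 0.
have reg z : ~ E z -> off_pole q z -> [/\ {for z, continuous h}, har4 h z,
  {for z, continuous Phi}, har4 Phi z & 0 <= Phi z].
 move=> ze zq.
 have [c1 a1] := green_continuous1 ce qe h1 ze zq; have [c2 a2] := green_continuous1 ce qe h2 ze zq.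
 have [cG aG] := green_continuous1 ce qe hG ze zq.
 have [cI aI] := @green_continuous1 _ e None _ z ce I hI ze I.
 split; try exact: har4_lin.
 - apply: cvgD; last exact: cvg_cst.
  by apply: cvgD; (apply: cvgM; [exact: cvg_cst|]); [exact: c1|exact: c2].
 - apply: cvgD; last exact: cvg_cst.
  by apply: cvgD; (apply: cvgM; [exact: cvg_cst|]); [exact: cG|exact: cI].
 - by rewrite /Phi !mul1r addr0 addr_ge0//; exact: Gq_ge0.
have [Mi [Ri Hi]] : exists Mi Ri : R, forall z, ~ E z -> off_pole q z -> Ri < sqn z -> h z <= Mi.
 have [Mi [r r0 Hr]] : exists Mi : R, exists2 r : R, 0 < r & forall y, sqn y < r ^+ 2 -> y <> (0, 0) ->
   g1 (sphere_inv y) - g2 (sphere_inv y) <= Mi.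
  move: h1' h2' lp1 lp2; rewrite /z0; case Eq : q => [q'|] h1' h2' lp1 lp2; last first.
   have [M1 H1] := lp1; have [M2 H2] := lp2.
   have H1' : \forall z \near (0 : plane R), z != 0 -> `|g1 (sphere_inv z) + ln (modulus z)| <= M1 by exact: H1.
   have H2' : \forall z \near (0 : plane R), z != 0 -> `|g2 (sphere_inv z) + ln (modulus z)| <= M2 by exact: H2.
   have [r r0 H] := near_axes (filterI H1' H2').
   exists (M1 + M2), r => // y yr y0; have [] := H y yr; rewrite add0r.
   have y0' : y != 0 by apply/eqP.
   by move=> /(_ y0') + /(_ y0'); rewrite !ler_norml => /andP[? ?] /andP[? ?]; lra.
  have U0 : (sphere_compl E `\ z0) (@sphere_inv R (0, 0)).
   rewrite sphere_inv0 /z0 Eq; split; first by move=> [].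
   by [].
  have n := near_chart2 ce qe U0; rewrite /z0 Eq in n.
  have c1 := C2_continuous n h1'.1; have c2 := C2_continuous n h2'.1.
  have [l1 l2] : `|g1 (sphere_inv (0, 0))| < `|g1 (sphere_inv (0, 0))| + 1 /\
    `|g2 (sphere_inv (0, 0))| < `|g2 (sphere_inv (0, 0))| + 1 by rewrite !ltrDl.
  have [r r0 H] := near_axes (filterI (near_norm_lt c1 l1) (near_norm_lt c2 l2)).
  exists (`|g1 (sphere_inv (0, 0))| + 1 + (`|g2 (sphere_inv (0, 0))| + 1)), r => // y yr _.
  have [] := H y yr; rewrite (_ : (0, 0) + y = y); last by apply: plane_ext; rewrite /= add0r.
  rewrite !ltr_norml => /andP[? ?] /andP[? ?]; lra.
 exists Mi, (r ^+ 2)^-1 => z ze zq zr.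
 have r2 : 0 < r ^+ 2 by rewrite exprn_gt0.
 have S0 : 0 < sqn z by apply: lt_trans zr; rewrite invr_gt0.
 have Eg := sqn_ginv S0.
 have := Hr (ginv z); rewrite Eg sphere_inv_ginv// => k.
 rewrite /h mul1r mulN1r addr0; apply: k; first by rewrite -[ltRHS]invrK ltf_pV2 ?posrE ?invr_gt0.
 by move=> g0; move: Eg; rewrite g0 /sqn/= expr0n/= addr0 => /esym/eqP; rewrite invr_eq0 (gt_eqF S0).
have [Mp Hp] : exists Mp : R, forall z0, ~ off_pole q z0 -> \forall z \near z0, off_pole q z -> h z <= Mp.
 move: lp1 lp2; rewrite /z0; case: (q) => [q'|]; last by exists 0 => z1 [].
 move=> [M1 H1] [M2 H2].
 have H1' : \forall z \near ((q', 0) : plane R), z != (q', 0) ->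
   `|g1 (Some z) + ln (modulus (z - (q', 0)))| <= M1 by exact: H1.
 have H2' : \forall z \near ((q', 0) : plane R), z != (q', 0) ->
   `|g2 (Some z) + ln (modulus (z - (q', 0)))| <= M2 by exact: H2.
 exists (M1 + M2) => z1 /= /contrapT ->.
 apply: filterS2 H1' H2' => z k1 k2 /eqP zq; have := k1 zq; have := k2 zq.
 by rewrite /h mul1r mulN1r addr0 !ler_norml => /andP[? ?] /andP[? ?]; lra.
have main := @zero_principle R e q h Phi (Num.max Mi Mp) Ri ce qe reg.
move=> z ze zq; have := main _ _ _ _ _ z ze zq; rewrite /h mul1r mulN1r addr0; apply.
- by move=> y ye yq yR; rewrite le_max Hi.
- by move=> z1 zq1; apply: filterS (Hp z1 zq1) => y hy /hy; rewrite le_max => ->; rewrite orbT.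
- move=> L; have [R1 H1] := @log_pole_growth _ None _ L lpI.
 exists R1 => y ye yq /H1; rewrite /Phi !mul1r addr0 => h3.
 by apply: le_trans h3 _; rewrite lerDr; exact: Gq_ge0 pK.
- move=> L z1; have := @log_pole_growth _ q _ L lpG.
 rewrite /Phi; case: (q) (@Gq_ge0 _ None e mu0 V0) => [q'|] G0 k /=; last by move=> [].
 move=> /contrapT ->; apply: filterS k => y k' yq; have {}k := k' yq.
 by rewrite !mul1r addr0; apply: le_trans k _; rewrite lerDl; exact: (G0 (Some y) pK0).
- move=> t et eps eps0.
 have e2 : 0 < eps / 2 by rewrite divr_gt0.
 apply: filterS2 (b1 t et _ e2) (b2 t et _ e2) => y k1 k2 ye; have := k1 ye; have := k2 ye.
 by rewrite mul1r mulN1r addr0 => ? ?; lra.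
Qed.

Lemma green_near0 g t : is_green E z0 g -> e t -> forall eps : R, 0 < eps ->
 \forall y \near ((t, 0) : plane R), ~ E y -> - eps < g (Some y) < eps.
Proof.
move=> [_ _ b _ _] et eps e0.
have /cvgrPdist_lt/(_ _ e0) n := b _ (outer_boundary_line et).
have n' : \forall y \near ((t, 0) : plane R), ~ E y -> `|0 - g (Some y)| < eps by exact: n.
by apply: filterS n' => y k ye; have := k ye; rewrite sub0r normrN ltr_norml.
Qed.

Lemma green_diff_le0 g1 g2 : is_green E z0 g1 -> is_green E z0 g2 ->
 forall z, ~ E z -> off_pole q z -> g1 (Some z) - g2 (Some z) <= 0.
Proof.
move=> G1 G2; have [h1 l1 _ _ _] := G1; have [h2 l2 _ _ _] := G2.
apply: green_diff_le => // t et eps e0.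
 by apply: filterS (green_near0 G1 et e0) => y k ye; have /andP[] := k ye.
by apply: filterS (green_near0 G2 et e0) => y k ye; have /andP[] := k ye.
Qed.

Lemma green_unique : green E z0 = Gq q e mu V.
Proof.
have GG := Gq_is_green ce qe pK bd.
apply: xget_unique => // g gg; apply/funext => z.
have eqp y : ~ E y -> off_pole q y -> g (Some y) = Gq q e mu V (Some y).
 move=> ye yq; apply/eqP; rewrite eq_le.
 by have := green_diff_le0 gg GG ye yq; have := green_diff_le0 GG gg ye yq; rewrite !subr_le0 => -> ->.
case: z => [z|].
 have [ze|ze] := pselect (E z).
  by have [_ _ _ h _] := gg; have [_ _ _ h' _] := GG; rewrite h// h'.
 have [zq|zq] := pselect (off_pole q z); first exact: eqp.
 have [_ _ _ _ h] := gg; have [_ _ _ _ h'] := GG.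
 have zE : z0 = Some z by rewrite /z0; case: (q) zq => [q'|] //= /contrapT ->.
 by rewrite -zE h h'.
case Eq : q => [q'|]; last first.
 have [_ _ _ _ h] := gg; have [_ _ _ _ h'] := GG.
 have zE : z0 = None by rewrite /z0 Eq.
 by rewrite -Eq -zE h h'.
(* For a finite pole, the value at infinity follows by continuity in the chart 1/z along the points
   (0, y). *)
have U0 : (sphere_compl E `\ z0) (@sphere_inv R (0, 0)).
 by rewrite sphere_inv0 /z0 Eq; split => // -[].
have n := near_chart2 ce qe U0.
have [[_ gh2] _ _ _ _] := gg; have [[_ Gh2] _ _ _ _] := GG.
have c1 := C2_continuous n gh2.1; have c2 := C2_continuous n Gh2.1.
have cd : {for ((0, 0) : plane R), continuous (fun y => g (sphere_inv y) - Gq q e mu V (sphere_inv y))}.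
 by apply: cvgB; [exact: c1|exact: c2].
rewrite -Eq; apply/eqP; rewrite -subr_eq0; apply/negPn/negP => ne.
have p : 0 < `|g None - Gq q e mu V None| by rewrite normr_gt0.
have := cd; move=> /cvgrPdist_lt; rewrite sphere_inv0 => /(_ _ p) nn.
have [y y0 [H1 H2]] := near_vertical (filterI nn n).
have Sy : 0 < sqn ((0, y) : plane R) by rewrite /sqn/= expr0n/= add0r exprn_even_gt0.
move: H1; rewrite sphere_invE// eqp ?subrr ?subr0 ?ltxx//.
- by move: H2; rewrite sphere_invE// => -[k _] Eg; apply: k; exists (ginv (0, y)).
- by move: H2; rewrite sphere_invE// => -[_ k]; move: k; rewrite /z0; case: (q) => [q2|] //= k h; apply: k; rewrite h.
Qed.
End green_unique.

(** * Sums over N-th roots in place of circle integrals *)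

Section nodes.
Context {R}.
Implicit Types (c s w a : R[i]) (z : plane R).
Local Notation normc := (@ComplexField.Normc.normc R).

Definition toC z : R[i] := (z.1 +i* z.2)%C.
Definition ofC c : plane R := (complex.Re c, complex.Im c).

Lemma normc_sqn z : normc (toC z) = Num.sqrt (sqn z). Proof. by []. Qed.

Lemma normc_ge0 c : 0 <= normc c. Proof. by case: c => a b; exact: sqrtr_ge0. Qed.

Lemma normc_gt0 c : (0 < normc c) = (c != 0).
Proof.
rewrite lt_neqAle normc_ge0 andbT eq_sym; congr negb; apply/eqP/eqP => [|->].
 exact: ComplexField.Normc.eq0_normc.
exact: ComplexField.Normc.normc0.
Qed.

Lemma normcX c n : normc (c ^+ n) = normc c ^+ n.
Proof.
elim: n => [|n IH]; first by rewrite !expr0 ComplexField.Normc.normc1.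
by rewrite !exprS ComplexField.Normc.normcM IH.
Qed.

Lemma normc_prod r (F : R[i] -> R[i]) : normc (\prod_(w <- r) F w) = \prod_(w <- r) normc (F w).
Proof.
elim: r => [|w r IH]; first by rewrite !big_nil ComplexField.Normc.normc1.
by rewrite !big_cons ComplexField.Normc.normcM IH.
Qed.

Lemma normcN' c : normc (- c) = normc c.
Proof. by case: c => a b /=; rewrite !sqrrN. Qed.

Lemma normcD_le a c : normc (a + c) <= normc a + normc c.
Proof. exact: (@ler_normD R (Rcomplex R) a c). Qed.

Lemma nodes_exist c (N : nat) : (0 < N)%N -> exists r : seq R[i], [/\
 forall s, \prod_(w <- r) normc (w - s) = normc (s ^+ N - c),
 forall w, w \in r -> w ^+ N = c, forall a, a ^+ N = c -> a \in r & size r = N].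
Proof.
move=> N0; have [r] := closed_field_poly_normal ('X^N - c%:P : {poly R[i]}).
rewrite lead_coefDl ?size_polyXn ?size_polyN ?lead_coefXn ?scale1r; last first.
 by rewrite ltnS (leq_trans (size_polyC_leq1 _)).
move=> pE; exists r.
have ev s : s ^+ N - c = \prod_(w <- r) (s - w).
 have := congr1 (fun p => p.[s]) pE; rewrite !hornerE => ->.
 by rewrite horner_prod; apply: eq_bigr => w _; rewrite !hornerE.
split.
- move=> s; rewrite ev normc_prod; apply: eq_bigr => w _.
 by rewrite -normcN' opprB.
- move=> w wr; apply/eqP; rewrite -subr_eq0 ev; apply/eqP.
 by rewrite (big_rem w)//= subrr mul0r.
- move=> a aE; have := ev a; rewrite aE subrr => /esym/eqP; rewrite prodf_seq_eq0.
 by move=> /hasP[w wr]; rewrite /= subr_eq0 => /eqP ->.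
- by apply: succn_inj; rewrite -(size_XnsubC c N0) pE size_prod_XsubC.
Qed.

Lemma rho_normc z w t : rho (z + ofC w) t = normc (w - toC (t - z.1, - z.2)).
Proof.
by case: w => a b; rewrite /rho /=; congr (Num.sqrt (_ ^+ 2 + _ ^+ 2)); ring.
Qed.

(** For the nodes z + w with w^N = c, the product of the distances to t is |(t - z)^N - c|; the
    complex number t - z is [toC (t - z.1, - z.2)]. *)
Lemma lg_nodes r c (N : nat) z t : (forall s, \prod_(w <- r) normc (w - s) = normc (s ^+ N - c)) ->
 toC (t - z.1, - z.2) ^+ N != c -> \sum_(w <- r) lg (z + ofC w) t = ln (normc (toC (t - z.1, - z.2) ^+ N - c)).
Proof.
move=> rE; set s := toC _ => sc; rewrite -rE.
have pos w : w \in r -> 0 < normc (w - s).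
 move=> wr; rewrite normc_gt0; apply: contra sc => /eqP ws.
 have := rE s; rewrite (big_rem w)//= ws ComplexField.Normc.normc0 mul0r => /esym h.
 by rewrite -subr_eq0; apply/eqP; exact: ComplexField.Normc.eq0_normc.
rewrite (eq_bigr (fun w => ln (normc (w - s)))); last by move=> w _; rewrite lg_rho rho_normc.
elim: r pos {rE} => [|w r IH] pos; first by rewrite !big_nil ln1.
rewrite !big_cons lnM ?posrE ?pos ?mem_head ?IH//.
 by move=> x xr; apply: pos; rewrite in_cons xr orbT.
by rewrite big_seq; apply: prodr_gt0 => x xr; apply: pos; rewrite in_cons xr orbT.
Qed.

Lemma Rint_sum {I : Type} (mu : prob R) K (r : seq I) f : measurable K -> (forall i, intR mu K (f i)) ->
 intR mu K (fun t => \sum_(i <- r) f i t) /\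
 \sum_(i <- r) \int[mu]_(t in K) f i t = \int[mu]_(t in K) \sum_(i <- r) f i t.
Proof.
move=> mK fi; elim: r => [|i r [IHi IH]].
 rewrite big_nil (_ : (fun t => _) = (fun=> 0)); last by apply/funext => t; rewrite big_nil.
 split; last by rewrite (_ : \int[mu]_(t in K) 0 = 0)// Rintegral_cst// mul0r.
 by apply: (bounded_integrable 0) => // t _; rewrite normr0.
rewrite big_cons (_ : (fun t => _) = (fun t => f i t + \sum_(i <- r) f i t)); last first.
 by apply/funext => t; rewrite big_cons.
split; first exact: (integrableD mK (fi i) IHi).
by rewrite RintegralD// IH.
Qed.

Lemma ln_perturb a c u : a != 0 -> normc c <= u * normc a -> u <= 2^-1 ->
 a - c != 0 /\ `|ln (normc (a - c)) - ln (normc a)| <= 2 * u.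
Proof.
move=> a0 ca u2; have na : 0 < normc a by rewrite normc_gt0.
have u0 : 0 <= u by rewrite -(pmulr_lge0 _ na); exact: le_trans (normc_ge0 c) ca.
have up : normc (a - c) <= (1 + u) * normc a.
 by apply: le_trans (normcD_le _ _) _; rewrite normcN'; lra.
have lo : (1 - u) * normc a <= normc (a - c).
 have := normcD_le (a - c) c; rewrite subrK; lra.
have p : 0 < normc (a - c) by apply: lt_le_trans lo; rewrite mulr_gt0//; lra.
split; first by rewrite -normc_gt0.
have q1 : 0 < 1 - u by lra.
have q2 : 0 < 1 + u by lra.
have l1 : ln (normc (a - c)) <= ln (1 + u) + ln (normc a).
 by rewrite -lnM ?posrE// ler_ln ?posrE ?mulr_gt0.
have l2 : ln (1 - u) + ln (normc a) <= ln (normc (a - c)).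
 by rewrite -lnM ?posrE// ler_ln ?posrE ?mulr_gt0.
have l3 := @le_ln1Dx R u; have : -1 < u by lra.
move=> /l3 {}l3.
have q0 : 0 <= u / (1 - u) by rewrite divr_ge0// ltW.
have : ln (1 - u) = - ln (1 + u / (1 - u)).
 rewrite (_ : 1 + u / (1 - u) = (1 - u)^-1); last by field; rewrite lt0r_neq0.
 by rewrite lnV ?posrE// opprK.
have := @le_ln1Dx R (u / (1 - u)); have : -1 < u / (1 - u) by lra.
move=> hy /(_ hy) h3.
have h4 : u / (1 - u) <= 2 * u by rewrite ler_pdivrMr//; nra.
by rewrite ler_norml => h5; apply/andP; split; lra.
Qed.

(** In (t - z)^N - c one of the two terms, up to sign [A], dominates the other by the factor u, so
    the sum of the potential over the nodes is the integral of ln |A| up to 2 u. This is a mean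
    value formula; u will be the N-th power of a number below 1. *)
Lemma pot_nodes K mu V z r c (N : nat) A L u : compact K -> pot_ok K mu V ->
 (forall s, \prod_(w <- r) normc (w - s) = normc (s ^+ N - c)) -> u <= 2^-1 -> intR mu K L ->
 (forall t, K t -> [/\ A t != 0, ln (normc (A t)) = L t & exists2 d, normc d <= u * normc (A t) &
   toC (t - z.1, - z.2) ^+ N - c = A t - d \/ toC (t - z.1, - z.2) ^+ N - c = - (A t - d)]) ->
 `|\sum_(w <- r) pot K mu (z + ofC w) - \int[mu]_(t in K) L t| <= 2 * u.
Proof.
move=> cK pK rE u2 Li H; have [muK _ int _] := pK.
have mK := compact_measurable cK.
have [si sE] := @Rint_sum _ mu K r (fun w t => lg (z + ofC w) t) mK (fun w => int _).
rewrite /pot sE -RintegralB//.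
apply: Rint_diff_le => //; first exact: (integrableB mK si Li).
move=> t Kt; have [A0 AL [d dA e]] := H t Kt.
have [n0 l0] := ln_perturb A0 dA u2.
have E : normc (toC (t - z.1, - z.2) ^+ N - c) = normc (A t - d).
 by case: e => ->; rewrite ?normcN'.
rewrite (lg_nodes rE) ?E -?AL//.
by rewrite -subr_eq0 -normc_gt0 E normc_gt0.
Qed.

Lemma small_power (q eps : R) : 0 <= q -> q < 1 -> 0 < eps -> exists2 N : nat, (0 < N)%N & q ^+ N <= eps.
Proof.
move=> q0 q1 e0.
have c : q ^+ n @[n --> \oo] --> (0 : R) by apply: cvg_expr; rewrite ger0_norm.
have /cvgrPdist_lt/(_ _ e0) := c => -[n _ Hn]; exists n.+1 => //.
have := Hn n.+1; rewrite /= leqnSn sub0r normrN ger0_norm ?exprn_ge0// => h.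
by apply: ltW; exact: h.
Qed.
End nodes.

(** * The potential of the equilibrium measure *)

Section equilibrium.
Context {R}.
Implicit Types (z : plane R) (a c w : R[i]).
Local Notation normc := (@ComplexField.Normc.normc R).

(** The difference of the potentials is nonnegative at every node, so its value at the single node a
    is at most its sum over all nodes, which [pot_nodes] evaluates for both laws. *)
Lemma node_le K nu mu V W z a (N : nat) A L u :
 compact K -> pot_ok K nu V -> pot_ok K mu W -> (0 < N)%N -> u <= 2^-1 -> intR nu K L -> intR mu K L ->
 (forall t, K t -> [/\ A t != 0, ln (normc (A t)) = L t & exists2 d, normc d <= u * normc (A t) &
   toC (t - z.1, - z.2) ^+ N - a ^+ N = A t - d \/ toC (t - z.1, - z.2) ^+ N - a ^+ N = - (A t - d)]) ->
 (forall w, w ^+ N = a ^+ N -> pot K mu (z + ofC w) <= pot K nu (z + ofC w)) ->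
 pot K nu (z + ofC a) - pot K mu (z + ofC a) <= \int[nu]_(t in K) L t - \int[mu]_(t in K) L t + 4 * u.
Proof.
move=> cK pn pm N0 u2 Ln Lm H Dge.
have [r [rE rP ra _]] := nodes_exist (a ^+ N) N0.
have := pot_nodes cK pn rE u2 Ln H; have := pot_nodes cK pm rE u2 Lm H.
have : pot K nu (z + ofC a) - pot K mu (z + ofC a) <=
  \sum_(w <- r) pot K nu (z + ofC w) - \sum_(w <- r) pot K mu (z + ofC w).
 rewrite -sumrB (big_rem a)/=; last exact: ra.
 rewrite lerDl big_seq; apply: sumr_ge0 => w wr; rewrite subr_ge0; apply: Dge; apply: rP.
 exact: mem_rem wr.
by rewrite !ler_norml => h1 /andP[h2 h3] /andP[h4 h5]; lra.
Qed.

Lemma pot_conj K mu z : pot K mu (z.1, - z.2) = pot K mu z.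
Proof. by rewrite /pot; congr Rintegral; apply/funext => t; rewrite /lg/= sqrrN. Qed.

Lemma off_line z e : z.2 != 0 -> ~ pline e z.
Proof. by move=> z2 [t _ tz]; move: z2; rewrite -tz eqxx. Qed.

Section domination.
Context (K : set R) (nu mu : prob R) (V : R).
Hypotheses (cK : compact K) (pn : pot_ok K nu V) (pm : pot_ok K mu V).
Hypothesis Dge : forall z, ~ pline K z -> pot K mu z <= pot K nu z.

(** The nodes lie on the circle of radius |z| about 0, which encloses [K]; the dominant term is the
    constant a^N, whose logarithm has the same integral for both laws. *)
Lemma domination_far B z : 0 < B -> (forall t, K t -> - B <= t <= B) -> B ^+ 2 < sqn z -> pot K nu z = pot K mu z.
Proof.
move=> B0 KB zB; have [nuK _ nint _] := pn; have [muK _ mint _] := pm.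
have mK : measurable K by exact: compact_measurable.
have S0 : 0 < sqn z by apply: lt_trans zB; rewrite exprn_gt0.
pose a := toC z; have an : normc a ^+ 2 = sqn z by rewrite sqr_sqrtr// sqn_ge0.
have a0 : 0 < normc a by rewrite normc_gt0; apply/eqP => h; move: S0; rewrite -an h ComplexField.Normc.normc0 expr0n/= ltxx.
have Ba : B < normc a by rewrite -(@ltr_pXn2r _ 2) ?nnegrE ?(ltW B0) ?(ltW a0)// an.
have far w : normc w = normc a -> ~ pline K ((0, 0) + ofC w).
 move=> wa [t Kt tE]; have := KB t Kt; rewrite -ler_norml leNgt => /negP; apply.
 have -> : `|t| = normc w; last by rewrite wa.
 move: tE => [t1 t2]; case: w {wa} t1 t2 => x y /=; rewrite !add0r => -> <-.
 by rewrite expr0n/= addr0 sqrtr_sqr.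
apply/eqP; rewrite eq_le Dge ?andbT; last first.
 by have := far a erefl; rewrite (_ : (0, 0) + _ = z)//; apply: plane_ext; rewrite /= add0r.
apply/ler_addgt0Pr => eps e0.
have e4 : 0 < Num.min (eps / 4) 2^-1 by rewrite lt_min; apply/andP; split; lra.
have q1 : B / normc a < 1 by rewrite ltr_pdivrMr// mul1r.
have q0 : 0 <= B / normc a by rewrite divr_ge0 ?ltW.
have [N N0 Ne] := small_power q0 q1 e4.
have [Ne1 Ne2] : (B / normc a) ^+ N <= eps / 4 /\ (B / normc a) ^+ N <= 2^-1.
 by move: Ne; rewrite le_min => /andP.
have ci (m : prob R) : m K = 1%E -> intR m K (fun=> ln (normc (a ^+ N))).
 by move=> _; exact: cst_integrable.
have := @node_le K nu mu V V (0, 0) a N (fun=> a ^+ N) _ _ cK pn pm N0 Ne2 (ci nu nuK) (ci mu muK).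
rewrite (_ : (0, 0) + ofC a = z); last by apply: plane_ext; rewrite /= add0r.
rewrite !Rint_prob_cst// subrr add0r.
move=> H; have := H _ _; rewrite lerBlDl => {}H.
apply: le_trans (H _ _) _; last by rewrite lerD2l; lra.
- move=> t Kt; split=> //; first by rewrite expf_neq0// -normc_gt0.
 exists (toC (t - 0, - 0) ^+ N); last by right; rewrite opprB.
 rewrite !normcX expr_div_n divfK ?gt_eqF ?exprn_gt0//.
 rewrite lerXn2r ?nnegrE ?normc_ge0 ?(ltW B0)//=.
 rewrite (_ : (t - 0) ^+ 2 + (- 0) ^+ 2 = t ^+ 2); last by ring.
 by rewrite sqrtr_sqr ler_norml; exact: KB.
- move=> w wa; apply: Dge; apply: far; apply/eqP.
 by rewrite -(@eqrXn2 _ N) ?normc_ge0// -!normcX wa.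
Qed.

(** A circle through z inside the upper half plane, centred at (0, Y). Now (t - iY)^N dominates, and
    its logarithm integrates to N times the potential at (0, Y), where the laws agree by the far
    case. *)
Lemma domination_upper z : 0 < z.2 -> pot K nu z = pot K mu z.
Proof.
move=> z20; have [nuK _ nint _] := pn; have [muK _ mint _] := pm.
have mK : measurable K by exact: compact_measurable.
have [B B0 KB] := compact_bound cK.
have z2' : z.2 != 0 by rewrite gt_eqF.
(* Y > B puts the centre in the far region, and |z|^2 < 2 z.2 Y means |z - iY| < Y, so the circle
   avoids the real axis. *)
pose Y := B + 1 + sqn z / z.2.
have k0 : 0 <= sqn z / z.2 by rewrite divr_ge0 ?sqn_ge0 ?ltW.
have Y0 : 0 < Y by rewrite /Y; lra.
have YB : B < Y by rewrite /Y; lra.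
pose a := toC (z.1, z.2 - Y).
have aY : normc a < Y.
 rewrite normc_sqn -(@ltr_pXn2r _ 2) ?nnegrE ?sqrtr_ge0 ?(ltW Y0)// sqr_sqrtr ?sqn_ge0//.
 have : sqn z < 2 * (z.2 * Y).
  by rewrite /Y mulrDr [z.2 * (_ / _)]mulrC divfK//; have := sqn_ge0 z; nra.
 by rewrite /sqn/=; nra.
have DY : pot K nu (0, Y) = pot K mu (0, Y).
 by apply: (domination_far B0 KB); rewrite /sqn/= expr0n/= add0r ltr_pXn2r ?nnegrE// ltW.
have zE : (0, Y) + ofC a = z by apply: plane_ext; rewrite /= ?add0r// addrCA subrr addr0.
apply/eqP; rewrite eq_le Dge ?andbT; last exact: off_line.
apply/ler_addgt0Pr => eps e0.
have e4 : 0 < Num.min (eps / 4) 2^-1 by rewrite lt_min; apply/andP; split; lra.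
have q1 : normc a / Y < 1 by rewrite ltr_pdivrMr// mul1r.
have q0 : 0 <= normc a / Y by rewrite divr_ge0 ?normc_ge0 ?ltW.
have [N N0 Ne] := small_power q0 q1 e4.
have [Ne1 Ne2] : (normc a / Y) ^+ N <= eps / 4 /\ (normc a / Y) ^+ N <= 2^-1.
 by move: Ne; rewrite le_min => /andP.
have sY t : Y <= normc (toC (t - 0, - Y)).
 rewrite normc_sqn -(@ler_pXn2r _ 2) ?nnegrE ?sqrtr_ge0 ?(ltW Y0)// sqr_sqrtr ?sqn_ge0//.
 by rewrite /sqn/= sqrrN lerDr sqr_ge0.
have sp t : 0 < normc (toC (t - 0, - Y)) by exact: lt_le_trans (sY t).
have Li (m : prob R) : (forall z, intR m K (lg z)) -> intR m K (fun t => N%:R * lg (0, Y) t).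
 by move=> mi; exact: (integrableZl mK N%:R (mi (0, Y))).
have := @node_le K nu mu V V (0, Y) a N (fun t => toC (t - 0, - Y) ^+ N) _ _ cK pn pm N0 Ne2
 (Li nu nint) (Li mu mint).
rewrite zE !RintegralZl// -/(pot K nu (0, Y)) -/(pot K mu (0, Y)) DY subrr add0r.
move=> H; have := H _ _; rewrite lerBlDl => {}H.
apply: le_trans (H _ _) _; last by rewrite lerD2l; lra.
- move=> t Kt; split.
 + by rewrite expf_neq0// -normc_gt0.
 + rewrite normcX lnXn// lg_rho mulr_natl; congr (ln _ *+ _).
  rewrite normc_sqn /rho /sqn/=; congr (Num.sqrt (_ + _)); first by rewrite sub0r subr0 sqrrN.
  by rewrite sqrrN.
 + exists (a ^+ N); last by left.
  rewrite !normcX expr_div_n mulrAC ler_pdivlMr ?exprn_gt0//.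
  rewrite ler_wpM2l ?exprn_ge0 ?normc_ge0// lerXn2r ?nnegrE ?normc_ge0 ?(ltW Y0)//.
- move=> w wa; apply: Dge; apply: off_line => /=.
 have wa' : normc w = normc a.
  by apply/eqP; rewrite -(@eqrXn2 _ N) ?normc_ge0// -!normcX wa.
 rewrite gt_eqF// -[ltLHS](subrr Y) ltrD2l ltrNl.
 have : - complex.Im w <= normc w.
  case: (w) => x y /=; apply: le_trans (ler_norm _) _; rewrite normrN -sqrtr_sqr.
  by rewrite ler_wsqrtr// lerDr sqr_ge0.
 by rewrite wa'; lra.
Qed.

Lemma domination z : z.2 != 0 -> pot K nu z = pot K mu z.
Proof.
rewrite neq_lt => /orP[z2|/domination_upper//].
by rewrite -(pot_conj K nu) -(pot_conj K mu) domination_upper//= oppr_gt0.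
Qed.
End domination.

Lemma Kq_None (e : set R) : Kq None e = e.
Proof. by rewrite /Kq /=; exact: image_id. Qed.

(** [equilibrium_measure] picks some minimizer nu, for which Frostman's inequality is known but not
    the boundary behaviour. Its V + pot is nonnegative, hence dominates the Green function obtained
    from the limit law; domination forces equality off the real axis, and [green_bd] passes to
    nu. *)
Lemma equilibrium_package (e : set R) : compact e -> infinite_set e ->
 regular_set (pline e) -> exists V, [/\ pot_ok (Kq None e) (equilibrium_measure e) V,
  robin_constant e = V%:E & green_bd None e (equilibrium_measure e) V].
Proof.
move=> ce ie re.
have [mu [V [X [F [_ pm Em Rm [_ _ _ _ bm]]]]]] := @regular_package _ e None ce ie re I.
have bd : green_bd None e mu V := bm.
set nu := equilibrium_measure e.
have [nuP nuE] : probabilities_on e nu /\ energy nu = robin_constant e.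
 apply: (@xgetPex _ (\d_(0 : R) : prob R) [set mu | probabilities_on e mu /\ energy mu = robin_constant e]).
 exists mu; split; first by have [] := pm; rewrite Kq_None.
 by rewrite Em -Rm Kq_None.
have RV : robin_constant e = V%:E by rewrite -Rm Kq_None.
have pn : pot_ok (Kq None e) nu V.
 rewrite Kq_None; apply: frostman_pot => //; first by rewrite nuE.
exists V; split => //.
have Dge z : ~ pline (Kq None e) z -> pot (Kq None e) mu z <= pot (Kq None e) nu z.
 rewrite {1}Kq_None => ze.
 have Gm := @Gq_is_green _ None e mu V ce I pm bd.
 have := @green_diff_le _ e None mu mu V V ce I pm bd pm bd (Gq None e mu V) (Gq None e nu V).
 have [h1 l1 _ _ _] := Gm.
 move=> /(_ h1 l1) H.
 have {}H := H _ _ (Gq_log_pole ce (I : pole_out None e) pn) _ z ze I.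
 have : Gq None e mu V (Some z) - Gq None e nu V (Some z) <= 0.
  apply: H.
  - by move=> t et eps e0; apply: filterS (green_near0 Gm et e0) => y k ye; have /andP[] := k ye.
  - by split; [exact: (Gq_harmonic1 ce (I : pole_out None e) pn)|exact: (Gq_harmonic2 ce (I : pole_out None e) pn)].
  - move=> t et eps e0; apply: filterS (@filterT _ (nbhs ((t, 0) : plane R)) _) => y _ _.
   by have := @Gq_ge0 _ None e nu V (Some y) pn; lra.
 by rewrite /Gq /=; case: asboolP => // _; lra.
have cK0 : compact (Kq None e) by rewrite Kq_None.
have eqD := domination cK0 pn pm Dge.
move=> t et eps e0; have [r r0 Hr] := near_axes (bd t et eps e0).
have r2 : 0 < r ^+ 2 by rewrite exprn_gt0.
have n := (@near_sqn_shift R t (t, 0) (r ^+ 2)).1.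
have {}n : \forall z \near ((t, 0) : plane R), sqn (z.1 - t, z.2) < r ^+ 2.
 by apply: n; rewrite /sqn/= subrr expr0n/= addr0.
apply: filterS n => z zr ze.
have off (y : plane R) : sqn (y.1 - t, y.2) < r ^+ 2 -> y.2 != 0 -> V + pot (Kq None e) nu y < eps.
 move=> yr y2; rewrite eqD//; have := Hr (y.1 - t, y.2) yr.
 rewrite (_ : (t, 0) + _ = y); last by apply: plane_ext; rewrite /= ?add0r// addrCA subrr addr0.
 by apply; exact: off_line.
have [z2|z2] := eqVneq z.2 0; last exact: off.
(* For a real point off [e], the potential is at most its value slightly above, where the two laws
   have the same potential. *)
move: zr; rewrite /sqn/= z2 expr0n/= addr0 => zr.
pose d := r ^+ 2 - (z.1 - t) ^+ 2; have d0 : 0 < d by rewrite /d; lra.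
pose y := Num.min 1 (d / 2).
have y0 : 0 < y by rewrite lt_min ltr01 divr_gt0.
have y1 : y <= 1 by rewrite ge_min lexx.
have yd : y <= d / 2 by rewrite ge_min lexx orbT.
have yy : y ^+ 2 <= d / 2 by rewrite expr2; apply: le_trans yd; rewrite ger_pMl.
have := off (z.1, y); rewrite /sqn/=; rewrite gt_eqF// => /(_ _ isT) h.
have := @pot_vertical _ (Kq None e) nu V z.1 y cK0 pn.
have zE : z = (z.1, 0) by apply: plane_ext.
move=> h1; apply: le_lt_trans (h _); first by rewrite lerD2l {1}zE.
by move: yy d0; rewrite /d; lra.
Qed.
End equilibrium.

(** * Symmetry of the Green function *)

Lemma Rintegral_EFin {d} {T : measurableType d} {R} (mu : measure T R) (K : set T) f : intR mu K f -> measurable K ->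
 (\int[mu]_(t in K) (f t)%:E)%E = (\int[mu]_(t in K) f t)%:E.
Proof. by move=> fi mK; rewrite /Rintegral fineK//; exact: (integrable_fin_num mK fi). Qed.

(** The kernel is bounded above only, so Tonelli's theorem is applied to C - F, cut off outside K x
    L. *)
Lemma swap_Rint {R} (mu nu : prob R) K L (F : R -> R -> R) g h C :
 measurable K -> measurable L -> mu K = 1%E -> nu L = 1%E -> measurable_fun setT (fun z : R * R => F z.1 z.2) ->
 (forall t s, K t -> L s -> F t s <= C) -> (forall t, K t -> intR nu L (F t) /\ \int[nu]_(s in L) F t s = g t) ->
 (forall s, L s -> intR mu K (F^~ s) /\ \int[mu]_(t in K) F t s = h s) -> intR mu K g -> intR nu L h ->
 \int[mu]_(t in K) g t = \int[nu]_(s in L) h s.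
Proof.
move=> mK mL muK nuL mF FC Hg Hh gi hi.
pose f (z : R * R) : \bar R := ((C - F z.1 z.2) * (\1_K z.1 * \1_L z.2))%:E.
have f0 z : (0 <= f z)%E.
 rewrite /f !indicE lee_fin; case: (boolP (z.1 \in K)) => [/set_mem K1|_]; last by rewrite mul0r mulr0.
 case: (boolP (z.2 \in L)) => [/set_mem L2|_]; last by rewrite !mulr0.
 by rewrite !mulr1 subr_ge0 FC.
have mf : measurable_fun setT f.
 apply/measurable_EFinP; apply: measurable_funM; first exact: measurable_funB.
 by apply: measurable_funM; apply: measurableT_comp.
have ci (m : prob R) (A : set R) (c : R) : measurable A -> intR m A (fun=> c) by exact: cst_integrable.
have key (m : prob R) (A : set R) (u : R -> R) : measurable A -> m A = 1%E -> intR m A u ->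
  (\int[m]_s ((C - u s) * \1_A s)%:E)%E = (C - \int[m]_(s in A) u s)%:E.
 move=> mA mA1 ui.
 have -> : (\int[m]_s ((C - u s) * \1_A s)%:E = \int[m]_(s in A) (C - u s)%:E)%E.
  rewrite [RHS]integral_mkcond; apply: eq_integral => s _; rewrite patchE indicE.
  by case: (s \in A); rewrite ?mulr1 ?mulr0.
 rewrite Rintegral_EFin//; last exact: (integrableB mA (ci m A C mA) ui).
 by rewrite RintegralB//; [rewrite Rint_prob_cst|exact: ci].
have := @fubini_tonelli _ _ _ _ _ mu nu f mf f0.
have -> : (\int[mu]_x \int[nu]_y f (x, y) = \int[mu]_x ((C - g x) * \1_K x)%:E)%E.
 apply: eq_integral => t _; rewrite /f/=.
 have [tK|tK] := boolP (t \in K); last first.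
  rewrite !indicE (negbTE tK) mulr0; apply: integral0_eq => s _; by rewrite mul0r mulr0.
 have [i <-] := Hg t (set_mem tK).
 under eq_integral do rewrite indicE tK mul1r.
 by rewrite (key nu L (F t))// indicE tK mulr1.
have -> : (\int[nu]_y \int[mu]_x f (x, y) = \int[nu]_y ((C - h y) * \1_L y)%:E)%E.
 apply: eq_integral => s _; rewrite /f/=.
 have [sL|sL] := boolP (s \in L); last first.
  rewrite !indicE (negbTE sL) mulr0; apply: integral0_eq => t _; by rewrite !mulr0.
 have [i <-] := Hh s (set_mem sL).
 under eq_integral do rewrite [in X in _ * X]indicE [\1_L s]indicE sL mulr1.
 by rewrite (key mu K (F^~ s))// indicE sL mulr1.
by rewrite (key mu K g)// (key nu L h)// => -[]; lra.
Qed.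

Lemma Rint_off_point {R} (mu : prob R) K f g a : measurable K -> mu [set a] = 0%E -> intR mu K g ->
 (forall t, K t -> t != a -> f t = g t) -> intR mu K f /\ \int[mu]_(t in K) f t = \int[mu]_(t in K) g t.
Proof.
move=> mK at0 gi fg.
pose h (t : R) := (f a - g a) * \1_[set a] t.
have mh : measurable_fun setT h.
 by apply: measurable_funM => //; apply: measurable_indic.
have hi : intR mu K h.
 apply: (bounded_integrable `|f a - g a|) => // t _.
 by rewrite /h normrM ler_piMr// indicE; case: (_ \in _); rewrite ?normr1 ?normr0.
have fE t : K t -> f t = g t + h t.
 move=> Kt; rewrite /h indicE; have [->|ta] := eqVneq t a.
  by rewrite mem_set// mulr1 addrC subrK.
 by rewrite memNset ?mulr0 ?addr0 ?fg//; apply/eqP.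
have si : intR mu K (fun t => g t + h t) by exact: (integrableD mK gi hi).
have mKa : measurable (K `\ a) by exact: measurableD.
have m0 : mu (K `\` (K `\ a)) = 0%E.
 apply/eqP; rewrite -measure_le0 -at0; apply: le_measure; rewrite ?inE//; first exact: measurableD.
 by move=> t [Kt] nt; apply: contrapT => ta; apply: nt.
have Ka : K `\ a `<=` K by move=> t [].
split.
 by apply: eq_integrable si => // t /set_mem Kt; rewrite /= fE.
rewrite (_ : \int[mu]_(t in K) f t = \int[mu]_(t in K) (g t + h t)); last first.
 by apply: eq_Rintegral => t /set_mem /fE.
rewrite RintegralD// (_ : \int[mu]_(t in K) h t = 0) ?addr0//.
rewrite (Rint_restrict mK mKa Ka m0 hi).
rewrite (_ : \int[mu]_(t in K `\ a) h t = \int[mu]_(t in K `\ a) 0).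
 by rewrite Rintegral_cst// mul0r.
by apply: eq_Rintegral => t /set_mem [_ ta]; rewrite /h indicE memNset ?mulr0.
Qed.

(** Symmetry of the Green function between q and infinity. Integrate ln |1 - s (t - q)| in both
    orders: as a function of s it is ln |t - q| + ln |s - lcoord t|, as a function of t it is ln |s|
    + ln |t - t0| with s = lcoord t0, and the last terms integrate to -V and -W by [pot_zero]. *)
Lemma pot_sphere0 {R} q e mu nu (V W : R) :
 compact e -> ~ e q -> pot_ok (Kq (Some q) e) mu V -> green_bd (Some q) e mu V ->
 pot_ok (Kq None e) nu W -> green_bd None e nu W ->
 V + pot (Kq (Some q) e) mu (0, 0) = W + pot (Kq None e) nu (q, 0).
Proof.
move=> ce qe pm bm pn bn.
have cK := @Kq_compact R None e ce I; have cL := @Kq_compact R (Some q) e ce qe.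
have mK := closed_measurable (compact_closed (@Rhausdorff R) cK).
have mL := closed_measurable (compact_closed (@Rhausdorff R) cL).
have [nK nat nint _] := pn; have [mL1 mat mint _] := pm.
pose F (t s : R) := ln ((1 - s * (t - q)) ^+ 2) / 2.
have FE t s : F t s = ln `|1 - s * (t - q)|.
 rewrite /F -(@real_normK _ (1 - s * (t - q))) ?num_real//.
 have := normr_ge0 (1 - s * (t - q)); rewrite le_eqVlt => /orP[/eqP <-|p].
  by rewrite expr0n/= ln0// mul0r.
 by rewrite lnXn// mulr2n; lra.
have [B B0 KB] := compact_bound cK; have [B' B'0 LB] := compact_bound cL.
have mF : measurable_fun setT (fun z : R * R => F z.1 z.2).
 apply: measurable_funM => //.
 apply: (measurableT_comp (@measurable_ln R)); apply: measurable_funX; apply: measurable_funB => //; apply: measurable_funM => //.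
 exact: measurable_funB.
have tq t : Kq None e t -> 0 < `|t - q|.
 rewrite Kq_None => et; rewrite normr_gt0 subr_eq0; apply/eqP => h; apply: qe; rewrite -h; exact: et.
have s0 s : Kq (Some q) e s -> 0 < `|s|.
 by move=> [t et <-] /=; rewrite normr_gt0 invr_eq0 -normr_gt0 tq// Kq_None.
have FC t s : Kq None e t -> Kq (Some q) e s -> F t s <= ln (1 + B' * (B + `|q|)).
 move=> Kt Ls; rewrite FE.
 have le1 : `|1 - s * (t - q)| <= 1 + B' * (B + `|q|).
  apply: le_trans (ler_normB _ _) _; rewrite normr1 lerD2l normrM; apply: ler_pM => //.
   by rewrite ler_norml LB.
  by apply: le_trans (ler_normB _ _) _; rewrite lerD2r ler_norml KB.
 have p1 : 1 <= 1 + B' * (B + `|q|) by rewrite lerDl; apply: mulr_ge0; [exact: ltW|apply: addr_ge0 => //; exact: ltW].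
 have := normr_ge0 (1 - s * (t - q)); rewrite le_eqVlt => /orP[/eqP <-|p].
  by rewrite ln0// ln_ge0.
 by rewrite ler_ln// posrE (lt_le_trans ltr01).
have cst (m : prob R) (A : set R) (c : R) : measurable A -> intR m A (fun=> c).
 by exact: cst_integrable.
have := @swap_Rint R nu mu (Kq None e) (Kq (Some q) e) F (fun t => - V + lg (q, 0) t)
 (fun s => - W + lg (0, 0) s) (ln (1 + B' * (B + `|q|))) mK mL nK mL1 mF FC.
move=> H; have {H} : \int[nu]_(t in Kq None e) (- V + lg (q, 0) t) = \int[mu]_(s in Kq (Some q) e) (- W + lg (0, 0) s).
 apply: H.
 - move=> t Kt; have et : e t by rewrite -(Kq_None e).
  have gi : intR mu (Kq (Some q) e) (fun s => lg (lcoord (Some q) t, 0) s + lg (q, 0) t).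
   exact: (integrableD mL (mint _) (cst _ _ _ mL)).
  have [|i ->] := @Rint_off_point R mu (Kq (Some q) e) (F t) _ (lcoord (Some q) t) mL (mat _) gi.
   move=> s Ls st; rewrite FE !lg_real [`|q - t|]distrC -lnM ?posrE ?tq//.
    rewrite -normrM; have tq0 : t - q != 0 by rewrite -normr_gt0 tq.
    by congr (ln `|_|); rewrite /=; field.
   by rewrite normr_gt0 subr_eq0 eq_sym.
  split=> //; rewrite RintegralD// ?Rint_prob_cst//; last exact: cst.
  have := @pot_zero _ (Some q) e mu V t ce qe pm bm et; rewrite /pot => h.
  by congr (_ + _); move: h; set x := Rintegral _ _ _; lra.
 - move=> s [t0 et0 sE]; have Ls : Kq (Some q) e s by exists t0.
  have gi : intR nu (Kq None e) (fun t => lg (t0, 0) t + lg (0, 0) s).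
   exact: (integrableD mK (nint _) (cst _ _ _ mK)).
  have [|i ->] := @Rint_off_point R nu (Kq None e) (F^~ s) _ t0 mK (nat _) gi.
   move=> t Kt tt; rewrite FE !lg_real sub0r normrN -lnM ?posrE ?(s0 s Ls)//.
    have t0q : t0 - q != 0 by rewrite -normr_gt0 tq// Kq_None.
    rewrite -normrM; congr (ln `|_|); rewrite -sE /=; by field.
   by rewrite normr_gt0 subr_eq0 eq_sym.
  split=> //; rewrite RintegralD// ?Rint_prob_cst//; last exact: cst.
  have := @pot_zero _ None e nu W t0 ce I pn bn et0; move=> /= h.
  by congr (_ + _); move: h; rewrite /pot; set x := Rintegral _ _ _; lra.
 - exact: (integrableD mK (cst _ _ _ mK) (nint _)).
 - exact: (integrableD mL (cst _ _ _ mL) (mint _)).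
rewrite !RintegralD// ?Rint_prob_cst//; try exact: cst.
rewrite /pot; set x := Rintegral _ _ _; set y := Rintegral _ _ _; lra.
Qed.

(** * Comparison of the laws of two poles *)

Definition inball {R} (t : R) (p : R * R) : bool := `|t - p.1| < p.2.

Section cover.
Context {R}.
Implicit Types (p : R * R) (X : seq (R * R)).
Local Notation inb := inball.

(** In a finite cover with as few intervals as possible no point lies in three of them: of three
    intervals with a common point, one is covered by the one reaching furthest left and the one
    reaching furthest right. *)
Lemma cover_mult2 e P : compact e -> (forall x, e x -> exists2 s, 0 < s & P x s) ->
 exists X, [/\ forall p, p \in X -> e p.1 /\ P p.1 p.2,
  forall t, e t -> has (inb t) X & forall t, (count (inb t) X <= 2)%N].
Proof.
move=> ce eP.
have /choice [s Hs] : forall x, exists s, e x -> 0 < s /\ P x s.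
 move=> x; have [ex|nex] := pselect (e x); last by exists 0.
 by have [s s0 Ps] := eP x ex; exists s.
pose good X := [/\ uniq X, forall p, p \in X -> e p.1 /\ P p.1 p.2 & forall t, e t -> has (inb t) X].
have [X0 X0g] : exists X, good X.
 have cc := ce; rewrite compact_cover in cc.
 have [||D De cov] := cc R e (fun x => ball x (s x)).
 - by move=> x ex; apply: ball_open; have [] := Hs x ex.
 - by move=> x ex; exists x => //; apply: ballxx; have [] := Hs x ex.
 exists (undup [seq (x, s x) | x <- finmap.enum_fset D]); split; first exact: undup_uniq.
  move=> p; rewrite mem_undup => /mapP[x xD ->] /=.
  by have /set_mem ex := De x xD; split => //; have [] := Hs x ex.
 move=> t /cov [x /= xD xt]; apply/hasP; exists (x, s x).
  by rewrite mem_undup; apply/mapP; exists x.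
 by rewrite /inball /= distrC.
pose Q n := `[< exists2 X, good X & size X = n >].
have exQ : exists n, Q n by exists (size X0); apply/asboolP; exists X0.
case: (ex_minnP exQ) => n /asboolP [X [uX XP Xc] sX] nmin.
exists X; split => // t; rewrite leqNgt; apply/negP => c3.
pose Y := [seq p <- X | inb t p].
have sY : (2 < size Y)%N by rewrite size_filter.
have ext (g : R * R -> R) : exists2 a, a \in Y & forall p, p \in Y -> g a <= g p.
 have : Y != [::] by case: (Y) sY.
 elim: (Y) => [//|y Z IH] _; have [->|Z0] := eqVneq Z [::].
  by exists y; rewrite ?mem_head// => p; rewrite inE => /eqP ->.
 have [a aZ am] := IH Z0; have [ya|ay] := leP (g y) (g a).
  exists y; first by rewrite mem_head.
  by move=> p; rewrite in_cons => /orP[/eqP ->//|/am]; exact: le_trans.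
 exists a; first by rewrite in_cons aZ orbT.
 by move=> p; rewrite in_cons => /orP[/eqP ->|/am//]; exact: ltW.
have [a aY am] := ext (fun p => p.1 - p.2).
have [b bY bm] := ext (fun p => - (p.1 + p.2)).
have uY : uniq Y by exact: filter_uniq.
have [c /andP[ca cb] cY] : exists2 c, (c != a) && (c != b) & c \in Y.
 have : (0 < size [seq p <- Y | predC (mem [:: a; b]) p])%N.
  have := count_predC (mem [:: a; b]) Y; rewrite size_filter.
  have : (count (mem [:: a; b]) Y <= 2)%N.
   rewrite -size_filter; apply: (@uniq_leq_size _ _ [:: a; b]); first exact: filter_uniq.
   by move=> x; rewrite mem_filter => /andP[].
  move=> h1 h2; have h3 : (0 < count (predC (mem [:: a; b])) Y)%N.
   by rewrite lt0n; apply: contraTneq sY => h0; rewrite -leqNgt -h2 h0 addn0.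
  exact: h3.
 case E : [seq p <- Y | predC (mem [:: a; b]) p] => [|c Z] // _; exists c.
  have : c \in [seq p <- Y | predC (mem [:: a; b]) p] by rewrite E mem_head.
  by rewrite mem_filter => /andP[/= + _]; rewrite !inE negb_or.
 have : c \in [seq p <- Y | predC (mem [:: a; b]) p] by rewrite E mem_head.
 by rewrite mem_filter => /andP[].
have YX p : p \in Y -> inb t p /\ p \in X by rewrite mem_filter => /andP.
have [[ta aX] [tb bX] [_ cX]] := And3 (YX _ aY) (YX _ bY) (YX _ cY).
have : (n <= (size X).-1)%N.
 apply: nmin; apply/asboolP; exists (rem c X); last by rewrite size_rem.
 split; first exact: rem_uniq.
  by move=> p /mem_rem; exact: XP.
 move=> u eu; have /hasP[p pX up] := Xc u eu.
 have [pc|pc] := eqVneq p c; last first.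
  by apply/hasP; exists p => //; rewrite mem_rem_uniq// inE pc.
 have := am c cY; have := bm c cY; move: up ta tb; rewrite pc /inball !ltr_norml.
 move=> /andP[? ?] /andP[? ?] /andP[? ?] ? ?.
 have [ut|ut] := leP u t.
  by apply/hasP; exists a; [rewrite mem_rem_uniq// inE eq_sym ca|rewrite ltr_norml; apply/andP; split; lra].
 by apply/hasP; exists b; [rewrite mem_rem_uniq// inE eq_sym cb|rewrite ltr_norml; apply/andP; split; lra].
by rewrite sX; case: (n) sX cX => [/size0nil ->|m _ _] //; rewrite ltnn.
Qed.
End cover.

Section layers.
Context {R}.
Implicit Types (mu : prob R) (K : set R) (phi : R -> R).

(** The mass near x of the image of [mu] under [phi]; [phi] will be [ilcoord q], so that laws living
    on different sets [Kq q e] are compared on [e]. [logp] below is the positive part of ln (r / |x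
    - phi t|). *)
Definition cap mu K phi (x s : R) : R := fine (mu (K `&` [set t | `|x - phi t| < s])).

Definition logp phi (x r t : R) : R := ln (Num.max r `|x - phi t|) - ln `|x - phi t|.

Lemma cap_meas K phi x s : measurable K -> measurable_fun setT phi -> measurable (K `&` [set t | `|x - phi t| < s]).
Proof.
move=> mK mphi; apply: measurableI => //.
have mh : measurable_fun setT (fun t => `|x - phi t|).
 by apply: measurableT_comp => //; exact: measurable_funB.
rewrite (_ : [set t | _] = setT `&` (fun t => `|x - phi t|) @^-1` `]-oo, s[); first exact: mh.
by rewrite setTI; apply/seteqP; split => t /=; rewrite in_itv.
Qed.

(** Layer-cake formula at the levels r exp(-u): the length of the set of u >= 0 with |x - phi t| < r
    exp(-u) is the positive part of ln (r / |x - phi t|). *)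
Lemma layer mu K phi x r : measurable K -> measurable_fun setT phi -> 0 < r -> mu (K `&` [set t | phi t = x]) = 0%E ->
 intR mu K (logp phi x r) -> measurable_fun setT (fun u : R => cap mu K phi x (r * expR (- u))) /\
 (\int[leb]_(u in `[0%R, +oo[) (cap mu K phi x (r * expR (- u)))%:E)%E =
 (\int[mu]_(t in K) logp phi x r t)%:E.
Proof.
move=> mK mphi r0 at0 ji.
pose N := [set t | phi t = x]; pose K' := K `&` ~` N.
have mN : measurable N.
 by rewrite (_ : N = setT `&` phi @^-1` [set x])//; [exact: mphi|rewrite setTI].
have mK' : measurable K' by apply: measurableI => //; exact: measurableC.
pose h (z : R * R) := r * expR (- z.2) - `|x - phi z.1|.
have mh : measurable_fun setT h.
 apply: measurable_funB.
  by apply: measurable_funM => //; apply: measurableT_comp => //; exact: measurableT_comp.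
 by apply: measurableT_comp => //; apply: measurable_funB => //; exact: measurableT_comp.
pose S := (K' `*` `[0%R, +oo[) `&` (setT `&` h @^-1` `]0%R, +oo[).
have mS : measurable S.
 by apply: measurableI; [exact: measurableX|exact: mh].
have SP t u : S (t, u) <-> [/\ K' t, 0 <= u & `|x - phi t| < r * expR (- u)].
 rewrite /S /h /=; split.
  by move=> [[k' +] [_ +]]; rewrite !in_itv/= !andbT subr_gt0 => -> ->.
 by move=> [k' u0 ur]; rewrite !in_itv/= !andbT subr_gt0.
pose f z : \bar R := (\1_S z)%:E.
have mf : measurable_fun setT f by apply/measurable_EFinP; exact: measurable_indic.
have f0 z : (0 <= f z)%E by rewrite lee_fin.
have capE s : cap mu K phi x s = fine (mu (K' `&` [set t | `|x - phi t| < s])).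
 congr fine; rewrite [LHS](_ : _ = mu ((K' `&` [set t | `|x - phi t| < s]) `|`
   ((K `&` N) `&` (K `&` [set t | `|x - phi t| < s])))); last first.
  congr (mu _); apply/seteqP; split => t /=.
   by move=> [Kt ts]; have [tx|tx] := pselect (phi t = x); [right|left].
  by move=> [[[Kt _] ts]|[_ []]].
 rewrite measureU; [|exact: cap_meas| |].
 - rewrite [X in (_ + X)%E](_ : _ = 0%E) ?adde0//.
  have m1 : measurable (K `&` N) by exact: measurableI.
  have m2 : measurable ((K `&` N) `&` (K `&` [set t | `|x - phi t| < s])).
   by apply: measurableI => //; exact: cap_meas.
  apply/eqP; rewrite -measure_le0 -at0; apply: le_measure; rewrite ?inE//.
 - by apply: measurableI; [exact: measurableI|exact: cap_meas].
 - by apply/seteqP; split => // t [[[_ nt] _] [[_ tN] _]].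
have f1 t : (\int[leb]_u f (t, u))%E = ((EFin \o logp phi x r) \_ K') t.
 rewrite patchE; case: ifPn => [/set_mem tK'|tK'].
  have [Kt tN] := tK'; have p : 0 < `|x - phi t|.
   by rewrite normr_gt0 subr_eq0; apply/eqP => xt; apply: tN.
  rewrite (_ : (fun u => f (t, u)) = (fun u => (\1_(`[0%R, ln r - ln `|x - phi t|[%classic) u)%:E)); last first.
   apply/funext => u; rewrite /f !indicE; congr (_%:R%:E); congr nat_of_bool.
   apply/idP/idP => /set_mem h'; apply/mem_set; move: h'.
    move=> /SP[_ u0 ut] /=; rewrite in_itv/= u0 /=.
    have : ln `|x - phi t| < ln r + ln (expR (- u)).
     by rewrite -lnM ?posrE ?expR_gt0// ltr_ln ?posrE ?mulr_gt0 ?expR_gt0.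
    by rewrite expRK; lra.
   rewrite /= in_itv/= => /andP[u0 ul]; apply/SP; split=> //.
   rewrite -ltr_ln ?posrE ?mulr_gt0 ?expR_gt0// lnM ?posrE ?expR_gt0// expRK; lra.
  rewrite integral_indic// setIT.
  rewrite [LHS](@lebesgue_measure_itv R `[0%R, ln r - ln `|x - phi t|[)/= lte_fin.
  rewrite /logp; case: ltP => h1.
   rewrite -EFinB subr0; congr (_ - _)%:E; congr ln; apply/esym/max_idPl.
   by rewrite -ler_ln ?posrE//; lra.
  rewrite (_ : Num.max _ _ = `|x - phi t|) ?subrr//; apply/max_idPr.
  by rewrite -ler_ln ?posrE//; lra.
 apply: integral0_eq => u _; rewrite /f indicE memNset// => /SP[tK _ _].
 by move: tK'; rewrite mem_set.
have f2 u : (\int[mu]_t f (t, u))%E = ((fun u : R => (cap mu K phi x (r * expR (- u)))%:E) \_ `[0%R, +oo[) u.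
 rewrite patchE; case: ifPn => [/set_mem/=|u0].
  rewrite in_itv/= andbT => u0.
  rewrite (_ : (fun t => f (t, u)) = (fun t => (\1_(K' `&` [set t | `|x - phi t| < r * expR (- u)]) t)%:E)); last first.
   apply/funext => t; rewrite /f !indicE; congr (_%:R%:E); congr nat_of_bool.
   apply/idP/idP => /set_mem h'; apply/mem_set.
    by have [k1 k2 k3] := (SP _ _).1 h'; split.
   by apply/(SP t u); move: h' => [k1 k2]; split.
  rewrite integral_indic ?setIT//; last exact: cap_meas.
  by rewrite capE fineK// fin_num_measure//; exact: cap_meas.
 apply: integral0_eq => t _; rewrite /f indicE memNset// => /SP[_ uu _].
 by move: u0; rewrite mem_set//= in_itv/= uu.
have mcap : measurable_fun setT (fun u : R => cap mu K phi x (r * expR (- u))).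
 have mono : {homo (fun s => cap mu K phi x s) : a b / a <= b}.
  move=> a b ab; rewrite /cap fine_le ?fin_num_measure//; try exact: cap_meas.
  apply: le_measure; rewrite ?inE; try exact: cap_meas.
  by move=> t [Kt /= ta]; split => //=; exact: lt_le_trans ab.
 have mc : measurable_fun setT (fun s => cap mu K phi x s).
  by apply: nondecreasing_measurable => //.
 apply: (measurableT_comp mc); apply: measurable_funM => //.
 by apply: measurableT_comp => //; exact: measurableT_comp.
split=> //.
rewrite [LHS]integral_mkcond.
have := @fubini_tonelli _ _ _ _ _ mu (@leb R) f mf f0.
under [in X in X = _ -> _]eq_integral do rewrite f1.
under [in X in _ = X -> _]eq_integral do rewrite f2.
move=> <-; rewrite -integral_mkcond.
have K'K : K' `<=` K by move=> t [].
rewrite Rintegral_EFin//; last exact: (integrableS mK mK' K'K).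
congr (_%:E); apply/esym; apply: Rint_restrict => //.
by apply/eqP; rewrite -measure_le0 -at0; apply: le_measure; rewrite ?inE//;
 [exact: measurableD|exact: measurableI|move=> t [Kt nt]; split => //; apply: contrapT => h'; apply: nt].
Qed.

(** Otherwise the first mass exceeds 2 A times the second at every radius up to r. Integrated over
    the layers, the first integral would be at least 2 A times the second, hence at least twice
    itself, although it is positive. *)
Lemma small_cap mu1 mu2 K1 K2 phi1 phi2 x r A :
 measurable K1 -> measurable K2 -> measurable_fun setT phi1 -> measurable_fun setT phi2 -> 0 < r -> 0 < A ->
 mu1 (K1 `&` [set t | phi1 t = x]) = 0%E -> mu2 (K2 `&` [set t | phi2 t = x]) = 0%E ->
 intR mu1 K1 (logp phi1 x r) -> intR mu2 K2 (logp phi2 x r) ->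
 \int[mu1]_(t in K1) logp phi1 x r t <= A * \int[mu2]_(t in K2) logp phi2 x r t ->
 exists s, [/\ 0 < s, s <= r & cap mu1 K1 phi1 x s <= 2 * A * cap mu2 K2 phi2 x s].
Proof.
move=> mK1 mK2 mp1 mp2 r0 A0 a1 a2 i1 i2 J.
have [m1 e1] := layer mK1 mp1 r0 a1 i1; have [m2 e2] := layer mK2 mp2 r0 a2 i2.
apply: contrapT => H.
have lt s : 0 < s -> s <= r -> 2 * A * cap mu2 K2 phi2 x s < cap mu1 K1 phi1 x s.
 by move=> s0 sr; rewrite ltNge; apply/negP => h; apply: H; exists s.
have c0 mu K phi s : 0 <= cap mu K phi x s by rewrite /cap fine_ge0.
pose b1 u := cap mu1 K1 phi1 x (r * expR (- u)); pose b2 u := cap mu2 K2 phi2 x (r * expR (- u)).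
have ru u : 0 <= u -> 0 < r * expR (- u) <= r.
 by move=> u0; rewrite mulr_gt0 ?expR_gt0//= ger_pMr// -expR0 ler_expR oppr_le0.
have le12 : (\int[leb]_(u in `[0%R, +oo[) ((2 * A)%:E * (b2 u)%:E) <=
  \int[leb]_(u in `[0%R, +oo[) (b1 u)%:E)%E.
 apply: ge0_le_integral => //.
 - by move=> u _; rewrite -EFinM lee_fin mulr_ge0// ?c0//; lra.
 - by apply: measurable_funTS; apply/measurable_EFinP; apply: measurable_funM.
 - by apply: measurable_funTS; apply/measurable_EFinP.
 - move=> u /=; rewrite in_itv/= andbT => u0; have /andP[p q] := ru u u0.
  by rewrite -EFinM lee_fin; apply: ltW; exact: lt.
rewrite ge0_integralZl// in le12; last 3 first.
- by apply: measurable_funTS; apply/measurable_EFinP.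
- by move=> u _; rewrite lee_fin c0.
- by rewrite lee_fin; lra.
rewrite /b1 /b2 e1 e2 -EFinM lee_fin in le12.
have lo : ((b1 1)%:E <= \int[leb]_(u in `[0%R, +oo[) (b1 u)%:E)%E.
 apply: (@le_trans _ _ (\int[leb]_(u in `[0%R, 1%R]) (b1 1)%:E)%E).
  rewrite integral_cst//= lebesgue_measure_itv/= lte_fin ltr01 -EFinB subr0 mule1//.
 apply: (@le_trans _ _ (\int[leb]_(u in `[0%R, 1%R]) (b1 u)%:E)%E).
  apply: ge0_le_integral => //.
  - by move=> u _; rewrite lee_fin c0.
  - by apply: measurable_funTS; apply/measurable_EFinP.
  - move=> u /=; rewrite in_itv/= => /andP[u0 u1]; rewrite lee_fin /b1 /cap fine_le//.
   + by rewrite fin_num_measure//; exact: cap_meas.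
   + by rewrite fin_num_measure//; exact: cap_meas.
   + apply: le_measure; rewrite ?inE; try exact: cap_meas.
    move=> t [Kt /= ta]; split => //=; apply: (lt_le_trans ta).
    by rewrite ler_wpM2l ?(ltW r0)// ler_expR lerN2.
 apply: ge0_subset_integral => //.
 - by apply: measurable_funTS; apply/measurable_EFinP.
 - by move=> u _; rewrite lee_fin c0.
 - by move=> u /=; rewrite !in_itv/= andbT => /andP[].
have b1p : 0 < b1 1.
 have /andP[p q] := ru 1 ler01; apply: le_lt_trans (lt _ p q).
 by rewrite mulr_ge0// ?c0//; lra.
rewrite /b1 e1 lee_fin -/(b1 1) in lo.
have : A * \int[mu2]_(t in K2) logp phi2 x r t <= 2^-1 * \int[mu1]_(t in K1) logp phi1 x r t by lra.
by lra.
Qed.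

(** Cover [e] by intervals whose radii satisfy the mass comparison and on which f oscillates by less
    than eps. The multiplicity two of the cover accounts for the factor 2. *)
Lemma comparison mu1 mu2 K1 K2 phi1 phi2 e r0 A (f : R -> R) :
 compact e -> measurable K1 -> measurable K2 -> measurable_fun setT phi1 -> measurable_fun setT phi2 ->
 mu1 K1 = 1%E -> mu2 K2 = 1%E -> (forall t, K1 t -> e (phi1 t)) -> (forall t, K2 t -> e (phi2 t)) ->
 0 < r0 -> 0 < A -> (forall x r, e x -> 0 < r -> r < r0 -> exists s, [/\ 0 < s, s <= r &
   cap mu1 K1 phi1 x s <= A * cap mu2 K2 phi2 x s]) -> continuous f -> (forall t, 0 <= f t) ->
 intR mu1 K1 (f \o phi1) -> intR mu2 K2 (f \o phi2) ->
 \int[mu1]_(t in K1) f (phi1 t) <= 2 * A * \int[mu2]_(t in K2) f (phi2 t).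
Proof.
move=> ce mK1 mK2 mp1 mp2 mu1K mu2K p1e p2e r00 A0 H fc f0 i1 i2.
apply/ler_addgt0Pr => d d0.
pose eps := d / (4 * A); have eps0 : 0 < eps by rewrite divr_gt0// mulr_gt0.
have dE : d = 4 * A * eps by rewrite /eps mulrC divfK// gt_eqF// mulr_gt0.
pose P x s := cap mu1 K1 phi1 x s <= A * cap mu2 K2 phi2 x s /\ forall t, `|t - x| < s -> `|f x - f t| < eps.
have [X [XP Xc X2]] : exists X : seq (R * R), [/\ forall p, p \in X -> e p.1 /\ P p.1 p.2,
  forall t, e t -> has (inball t) X & forall t, (count (inball t) X <= 2)%N].
 apply: cover_mult2 => // x ex.
 have /cvgrPdist_lt/(_ _ eps0) := fc x => -[r /= r1 Hr].
 pose r2 := Num.min r (r0 / 2); have r20 : 0 < r2 by rewrite lt_min r1 divr_gt0.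
 have r2r0 : r2 < r0 by rewrite gt_min; apply/orP; right; lra.
 have [s [s0 sr sc]] := H x r2 ex r20 r2r0.
 exists s => //; split=> // t ts; apply: Hr; rewrite /= distrC (lt_le_trans ts)//.
 by apply: le_trans sr _; rewrite ge_min lexx.
pose g phi (p : R * R) t := (f p.1 + eps) * \1_(fun t => `|p.1 - phi t| < p.2) t.
have ind0 phi p t : g phi p t = if inball (phi t) p then f p.1 + eps else 0.
 rewrite /g indicE /inball distrC; case: ifPn => h; first by rewrite mem_set// mulr1.
 by rewrite memNset ?mulr0//; apply/negP.
have gi mu K phi p : measurable K -> mu K = 1%E -> measurable_fun setT phi -> intR mu K (g phi p) /\
  \int[mu]_(t in K) g phi p t = (f p.1 + eps) * cap mu K phi p.1 p.2.
 move=> mK muK mp.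
 have mB : measurable [set t | `|p.1 - phi t| < p.2].
  by have := @cap_meas setT phi p.1 p.2 measurableT mp; rewrite setTI.
 have ii : intR mu K (\1_[set t | `|p.1 - phi t| < p.2]).
  by apply: (bounded_integrable 1) => // t _; rewrite ger0_norm// indicE lern1 leq_b1.
 split; first exact: (integrableZl mK (f p.1 + eps) ii).
 rewrite /g RintegralZl//; congr (_ * _); rewrite /Rintegral /cap; congr fine.
 by rewrite integral_indic// setIC.
have [s1i s1E] := @Rint_sum R _ mu1 K1 X (g phi1) mK1 (fun p => (gi mu1 K1 phi1 p mK1 mu1K mp1).1).
have [s2i s2E] := @Rint_sum R _ mu2 K2 X (g phi2) mK2 (fun p => (gi mu2 K2 phi2 p mK2 mu2K mp2).1).
have u1 : \int[mu1]_(t in K1) f (phi1 t) <= \sum_(p <- X) \int[mu1]_(t in K1) g phi1 p t.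
 rewrite s1E; apply: le_Rintegral => // t Kt.
 have /hasP[p pX tp] := Xc _ (p1e t Kt); have [_ [_ osc]] := XP p pX.
 rewrite (big_rem p)//= ind0 tp; have := osc _ tp; rewrite ltr_norml => /andP[h1 h2].
 have : 0 <= \sum_(y <- rem p X) g phi1 y t.
  by apply: sumr_ge0 => y _; rewrite ind0; case: ifP => // _; have := f0 y.1; lra.
 lra.
have u2 : \sum_(p <- X) \int[mu2]_(t in K2) g phi2 p t <= 2 * (\int[mu2]_(t in K2) f (phi2 t) + 2 * eps).
 have ci : intR mu2 K2 (fun=> 2 * eps) by exact: cst_integrable.
 have si : intR mu2 K2 (fun t => f (phi2 t) + 2 * eps) by exact: (integrableD mK2 i2 ci).
 rewrite s2E -(Rint_prob_cst (2 * eps) mK2 mu2K) -RintegralD// -RintegralZl//.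
 apply: le_Rintegral => //; first exact: (integrableZl mK2 2 si).
 move=> t Kt; apply: (@le_trans _ _ (\sum_(p <- X) (if inball (phi2 t) p then f (phi2 t) + 2 * eps else 0))).
  rewrite big_seq [leRHS]big_seq; apply: ler_sum => p pX; rewrite ind0; case: ifP => // tp.
  by have [_ [_ /(_ _ tp)]] := XP p pX; rewrite ltr_norml => /andP[]; lra.
 rewrite -big_mkcond/= big_const_seq iter_addr_0 -(mulr_natl _ (count _ _)) ler_wpM2r//.
  by have := f0 (phi2 t); lra.
 by rewrite ler_nat.
have u12 : \sum_(p <- X) \int[mu1]_(t in K1) g phi1 p t <= A * \sum_(p <- X) \int[mu2]_(t in K2) g phi2 p t.
 rewrite mulr_sumr big_seq [leRHS]big_seq; apply: ler_sum => p pX.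
 rewrite (gi mu1 K1 phi1 p mK1 mu1K mp1).2 (gi mu2 K2 phi2 p mK2 mu2K mp2).2 mulrCA.
 rewrite ler_wpM2l//; first by have := f0 p.1; lra.
 by have [_ []] := XP p pX.
have := ler_wpM2l (ltW A0) u2; rewrite dE; lra.
Qed.
End layers.

Definition ilcoord {R} (q : option R) (s : R) : R := if q is Some p then p + s^-1 else s.

(* [s^-1] is written as a product so that measurability of [ln] and [expR] applies; both sides vanish at 0. *)
Lemma measurable_ilcoord {R} (q : option R) : measurable_fun setT (@ilcoord R q).
Proof.
case: q => [p|]; last exact: measurable_id.
rewrite /ilcoord (_ : (fun s : R => _) = (fun s : R => p + s * expR (- ln (s ^+ 2)))).
 apply: measurable_funD => //; apply: measurable_funM => //.
 apply: (measurableT_comp (@measurable_expR R)); apply: measurableT_comp => //.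
 by apply: (measurableT_comp (@measurable_ln R)); exact: measurable_funX.
apply/funext => s; congr (_ + _); have [->|s0] := eqVneq s 0; first by rewrite invr0 mul0r.
have s2 : 0 < s ^+ 2 by rewrite exprn_even_gt0.
by rewrite -lnV ?posrE// lnK ?posrE ?invr_gt0//; field.
Qed.

Lemma lcoordK {R} q (t : R) : ilcoord q (lcoord q t) = t.
Proof. by case: q => [p|] //=; rewrite invrK addrC subrK. Qed.

Lemma ilcoord_in {R} q e (s : R) : Kq q e s -> e (ilcoord q s).
Proof. by move=> [t et <-]; rewrite lcoordK. Qed.

Lemma ilcoordK {R} q e (s : R) : Kq q e s -> lcoord q (ilcoord q s) = s.
Proof. by move=> [t et <-]; rewrite lcoordK. Qed.

Lemma ilcoord_integrable {R} (mu : prob R) q e f :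
 compact e -> pole_out q e -> continuous f -> intR mu (Kq q e) (f \o ilcoord q).
Proof.
move=> ce qe cf; have mK : measurable (Kq q e).
 by apply: closed_measurable; apply: compact_closed => //; exact: Kq_compact.
have mf : measurable_fun setT f by exact: continuous_measurable_fun.
have cfe : compact (f @` e) by apply: continuous_compact => //; exact: continuous_subspaceT.
have [B B0 HB] := compact_bound cfe.
apply: (bounded_integrable B) => //.
 by apply: measurableT_comp => //; exact: measurable_ilcoord.
by move=> s Ks; rewrite ler_norml; apply: HB; exists (ilcoord q s) => //; exact: ilcoord_in.
Qed.

Lemma rho_tri {R} z y (t : R) : rho z t <= rho y t + (`|z.1 - y.1| + `|z.2 - y.2|).
Proof.
have -> : rho z t = ComplexField.Normc.normc (toC (y.1 - t, y.2) + toC (z.1 - y.1, z.2 - y.2)).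
 rewrite /rho /=; congr (Num.sqrt (_ ^+ 2 + _ ^+ 2)); ring.
apply: le_trans (normcD_le _ _) _; rewrite lerD2l normc_sqn.
have := @rho_le R (z.1 - y.1, z.2 - y.2) 0; rewrite /rho /= subr0; exact.
Qed.

Definition polar {R} (q : option R) (z : plane R) (t : R) : R := if q is Some p then rho z p * `|t - p| else 1.

Lemma polar_gt0 {R} q e z (t : R) : pole_out q e -> off_pole q z -> e t -> 0 < polar q z t.
Proof.
case: q => [p|] //= pe zp et; rewrite mulr_gt0//.
 by rewrite lt_neqAle rho_ge0 andbT eq_sym; apply/eqP => /rho_eq0.
by rewrite normr_gt0 subr_eq0; apply/eqP => tp; apply: pe; rewrite -tp.
Qed.

Lemma rho_coord {R} q e z (t : R) :
 pole_out q e -> off_pole q z -> e t -> rho (coord q z) (lcoord q t) = rho z t / polar q z t.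
Proof.
case: q => [p|] pe zp et; last by rewrite /= divr1.
have pp := polar_gt0 pe zp et.
apply/eqP; rewrite -(@eqrXn2 _ 2) ?rho_ge0//; last by rewrite divr_ge0 ?rho_ge0 ?ltW.
rewrite expr_div_n exprMn real_normK ?num_real// !rho_sqr.
have tp : t - p != 0 by rewrite subr_eq0; apply/eqP => tp; apply: pe; rewrite -tp.
have S := off_pole_sqn zp; move: S; rewrite /= /sqn/= => S.
by apply/eqP; field; rewrite tp (lt0r_neq0 S).
Qed.

Lemma coord_bounds {R} q e : compact e -> pole_out q e ->
 exists delta L : R, [/\ 0 < delta, 1 <= L & forall z t, e t -> rho z t < delta ->
  [/\ off_pole q z, `|(coord q z).1| <= L & forall t', e t' ->
   rho (coord q z) (lcoord q t') <= L /\ rho z t' <= L * rho (coord q z) (lcoord q t')]].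
Proof.
move=> ce qe; have [B B0 KB] := compact_bound ce.
have tri (z : plane R) a b : rho z a <= rho z b + `|a - b|.
 by have := rho_lip z a b; rewrite ler_norml => /andP[]; lra.
have KB2 a b : e a -> e b -> `|a - b| <= 2 * B.
 by move=> /KB/andP[? ?] /KB/andP[? ?]; rewrite ler_norml; apply/andP; split; lra.
case: q qe => [p|] qe; last first.
 exists 1, (2 * B + 2); split => //; first lra.
 move=> z t et zt /=; split => //.
  have := rho_ge_abs z t; have := KB t et; rewrite !ler_norml => /andP[? ?] /andP[? ?].
  by apply/andP; split; lra.
 move=> t' et'; have := tri z t' t; have := KB2 _ _ et' et => h1 h2; split; first lra.
 by have := rho_ge0 z t'; nra.
have [d d0 Hd] : exists2 d : R, 0 < d & forall t, e t -> d <= rho (p, 0) t.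
 by apply: dist_pos => // t et [pt]; apply: qe; rewrite pt.
have {}Hd t : e t -> d <= `|t - p|.
 by move=> /Hd; rewrite /rho/= expr0n/= addr0 sqrtr_sqr distrC.
have d20 : 0 < d / 2 by rewrite divr_gt0.
pose M := d / 2 + B + `|p|; pose L1 := (d / 2 + 2 * B) / (d / 2 * d).
pose L := 1 + d^-1 + L1 + M * (B + `|p|).
have di : 0 < d^-1 by rewrite invr_gt0.
have p0 := normr_ge0 p.
have L10 : 0 < L1 by rewrite divr_gt0 ?mulr_gt0//; lra.
have MB : 0 <= M * (B + `|p|) by rewrite mulr_ge0 /M//; lra.
exists (d / 2), L; split => //; first by rewrite /L; lra.
move=> z t et zt.
have zp0 : d / 2 <= rho z p.
 have := Hd t et; have := rho_ge_abs z t; have := rho_ge_abs z p.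
 have : `|t - p| <= `|z.1 - t| + `|z.1 - p|.
  by rewrite (_ : t - p = (z.1 - p) - (z.1 - t)); [rewrite [leRHS]addrC ler_normB|ring].
 lra.
have zp : off_pole (Some p) z.
 by move=> /= zE; move: zp0; rewrite zE /rho/= subrr expr0n/= addr0 sqrtr0; lra.
have tpB a : e a -> `|a - p| <= B + `|p|.
 move=> ea; apply: le_trans (ler_normB _ _) _; rewrite lerD2r ler_norml; exact: KB.
have zpM : rho z p <= M.
 have := tri z p t; have := tpB t et; rewrite distrC /M; lra.
have up a : e a -> rho (coord (Some p) z) (lcoord (Some p) a) <= L1.
 move=> ea; rewrite (rho_coord qe zp ea) /L1; apply: ler_pM => //.
 - exact: rho_ge0.
 - by rewrite invr_ge0 ltW//; exact: (polar_gt0 qe zp ea).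
 - by have := tri z a t; have := KB2 _ _ ea et; lra.
 - have pg := polar_gt0 qe zp ea; rewrite lef_pV2 ?posrE// ?mulr_gt0//.
  by rewrite /= ler_pM ?(ltW d20) ?(ltW d0)// Hd.
split => //.
 have h1 := up t et; have h2 := rho_ge_abs (coord (Some p) z) (lcoord (Some p) t).
 have h3 : `|lcoord (Some p) t| <= d^-1.
  rewrite /= normfV lef_pV2 ?posrE// ?Hd//; apply: lt_le_trans d0 _; exact: Hd.
 have h4 : `|(coord (Some p) z).1| <= `|(coord (Some p) z).1 - lcoord (Some p) t| + `|lcoord (Some p) t|.
  by rewrite -{1}(subrK (lcoord (Some p) t) (coord (Some p) z).1) ler_normD.
 by rewrite /L; lra.
move=> a ea; split; first by have := up a ea; rewrite /L; lra.
have pp := polar_gt0 qe zp ea.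
rewrite -[leLHS](@divfK _ (polar (Some p) z a)) ?gt_eqF// -(rho_coord qe zp ea) mulrC.
rewrite ler_wpM2r ?rho_ge0//.
have : polar (Some p) z a <= M * (B + `|p|) by rewrite /= ler_pM ?rho_ge0// tpB.
by rewrite /L; lra.
Qed.

Section near_compare.
Context {R} (e : set R) (q1 q2 : option R) (mu1 mu2 : prob R) (V1 V2 : R).
Hypotheses (ce : compact e) (qe1 : pole_out q1 e) (qe2 : pole_out q2 e).
Hypotheses (pK1 : pot_ok (Kq q1 e) mu1 V1) (bd1 : green_bd q1 e mu1 V1).
Hypothesis (pK2 : pot_ok (Kq q2 e) mu2 V2).

(** Maximum principle in a neighbourhood of [e] that avoids both poles: the first Green function
    tends to 0 on [e], and near the rest of the boundary it is at most M while the second is at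
    least c by [pot_pos]. *)
Lemma near_compare : exists delta A : R, [/\ 0 < delta, 0 < A &
 forall z t, e t -> rho z t < delta -> ~ pline e z ->
  V1 + pot (Kq q1 e) mu1 (coord q1 z) <= A * (V2 + pot (Kq q2 e) mu2 (coord q2 z))].
Proof.
have aux (a b u w d : R) : a <= b + (u + w) -> d <= a -> u < d / 4 -> w < d / 4 -> d / 2 <= b by lra.
have [d1 [L1 [d10 L11 H1]]] := coord_bounds ce qe1.
have [d2 [L2 [d20 L21 H2]]] := coord_bounds ce qe2.
have cK2 := Kq_compact ce qe2; have cK1 := Kq_compact ce qe1.
have mK1 : measurable (Kq q1 e) by exact: compact_measurable.
have [B B0 KB] := compact_bound ce.
pose d := Num.min d1 d2; have d0 : 0 < d by rewrite lt_min d10.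
have dd1 : d <= d1 by rewrite ge_min lexx.
have dd2 : d <= d2 by rewrite ge_min lexx orbT.
have L20 : 0 < L2 by lra.
have dL : 0 < d / 2 / L2 by rewrite !divr_gt0.
have [c c0 Hc] := @pot_pos _ _ mu2 V2 (d / 2 / L2) L2 cK2 pK2 dL.
pose M := `|V1| + ln L1; have M0 : 0 <= M by rewrite addr_ge0// ln_ge0.
pose A := (M + 1) / c; have A0 : 0 < A by rewrite divr_gt0//; lra.
have Ac : A * c = M + 1 by rewrite /A divfK// gt_eqF.
exists d, A; split => // z t et zt ze.
pose D := [set y : plane R | ~ pline e y /\ exists2 t, e t & rho y t < d].
have Dz : D z by split => //; exists t.
have Doff y : D y -> off_pole q1 y /\ off_pole q2 y.
 move=> [_ [u eu yu]].
 by have [? _ _] := H1 y u eu (lt_le_trans yu dd1); have [? _ _] := H2 y u eu (lt_le_trans yu dd2).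
have GE y : D y -> Gq q1 e mu1 V1 (Some y) = V1 + pot (Kq q1 e) mu1 (coord q1 y) /\
  Gq q2 e mu2 V2 (Some y) = V2 + pot (Kq q2 e) mu2 (coord q2 y).
 move=> Dy; have [off1 off2] := Doff y Dy.
 by rewrite /Gq /=; case: asboolP => // _; case: asboolP.
pose f (y : plane R) := 1 * Gq q1 e mu1 V1 (Some y) + (- A) * Gq q2 e mu2 V2 (Some y) + 0.
have sqnrho y u : sqn (y.1 - u, y.2) = rho y u ^+ 2 by rewrite rho_sqr.
have := @max_principle R D f (B + d) _ _ _ _ _ z Dz.
rewrite /f mul1r addr0 mulNr subr_le0 (GE z Dz).1 (GE z Dz).2; apply.
- move=> y [_ [u eu yu]]; have := rho_ge_abs y u; have := KB u eu.
 have : `|y.2| <= rho y u.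
  by rewrite -sqrtr_sqr /rho ler_wsqrtr// lerDr sqr_ge0.
 by rewrite !ler_norml => /andP[? ?] /andP[? ?] /andP[? ?]; split; apply/andP; split; lra.
- move=> y [ye [u eu yu]].
 have n := (near_sqn_shift u y (d ^+ 2)).1; rewrite sqnrho ltr_pXn2r ?nnegrE ?rho_ge0 ?(ltW d0)// in n.
 apply: filterS2 (near_notin ce ye) (n yu) => y' ye'; rewrite sqnrho ltr_pXn2r ?nnegrE ?rho_ge0 ?(ltW d0)//.
 by move=> yu'; split => //; exists u.
- move=> y Dy; have [off1 off2] := Doff y Dy; have [ye _] := Dy.
 have [h1 _] := green_continuous1 ce qe1 (Gq_harmonic1 ce qe1 pK1) ye off1.
 have [h2 _] := green_continuous1 ce qe2 (Gq_harmonic1 ce qe2 pK2) ye off2.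
 apply: cvgD; last exact: cvg_cst.
  by apply: cvgD; (apply: cvgM; [exact: cvg_cst|]); [exact: h1|exact: h2].
- move=> y Dy; have [off1 off2] := Doff y Dy; have [ye _] := Dy.
 have [_ h1] := green_continuous1 ce qe1 (Gq_harmonic1 ce qe1 pK1) ye off1.
 have [_ h2] := green_continuous1 ce qe2 (Gq_harmonic1 ce qe2 pK2) ye off2.
 by apply: har4_sub4; exact: har4_lin.
- move=> z0 nD eps eps0.
 have [[u eu uz]|z0e] := pselect (pline e z0).
  subst z0; apply: filterS (bd1 eu eps0) => y hy Dy; have := hy Dy.1.
  rewrite -(GE y Dy).1; have := @Gq_ge0 _ q2 e mu2 V2 (Some y) pK2.
  by move=> g0; have := mulr_ge0 (ltW A0) g0; lra.
 have far u : e u -> d <= rho z0 u.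
  by move=> eu; rewrite leNgt; apply/negP => h; apply: nD; split => //; exists u.
 have d4 : 0 < d / 4 by rewrite divr_gt0.
 have c1 : {for z0, continuous (fun y : plane R => y.1)} by exact: cvg_fst.
 have c2 : {for z0, continuous (fun y : plane R => y.2)} by exact: cvg_snd.
 have /cvgrPdist_lt/(_ _ d4) n1 := c1; have /cvgrPdist_lt/(_ _ d4) n2 := c2.
 apply: filterS2 n1 n2 => y y1 y2 Dy.
 have [_ [u eu yu]] := Dy.
 have [_ _ k1] := H1 y u eu (lt_le_trans yu dd1).
 have [_ b2 k2] := H2 y u eu (lt_le_trans yu dd2).
 have G2 : c <= V2 + pot (Kq q2 e) mu2 (coord q2 y).
  apply: Hc => // s [v ev <-]; have [_ k] := k2 v ev.
  have k' : d / 2 <= L2 * rho (coord q2 y) (lcoord q2 v).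
   by apply: le_trans k; exact: (aux _ _ _ _ _ (rho_tri z0 y v) (far v ev) y1 y2).
  by rewrite ler_pdivrMr// [leRHS]mulrC.
 have G1 : V1 + pot (Kq q1 e) mu1 (coord q1 y) <= M.
  have [mu1K _ int1 _] := pK1.
  apply: lerD; first exact: ler_norm.
  rewrite -(Rint_prob_cst (ln L1) mK1 mu1K); apply: le_Rintegral => //.
   by exact: cst_integrable.
  move=> s [v ev <-]; have [k _] := k1 v ev; rewrite lg_rho.
  have := rho_ge0 (coord q1 y) (lcoord q1 v); rewrite le_eqVlt => /orP[/eqP <-|p].
   by rewrite ln0// ln_ge0.
  by rewrite ler_ln// posrE; lra.
 rewrite (GE y Dy).1 (GE y Dy).2; have := ler_wpM2l (ltW A0) G2; lra.
Qed.
End near_compare.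

Section node_sum.
Context {R}.
Local Notation normc := (@ComplexField.Normc.normc R).

(** The sum of ln (|t - x - w| / |t - x|) over the N nodes w of [even_nodes]; up to ln 2 it is N
    times the positive part of ln (r / |t - x|). *)
Definition logN (x r : R) (N : nat) (t : R) : R := ln ((t - x) ^+ N + r ^+ N) - N%:R * ln `|x - t|.

Definition polec (q : option R) (x t : R) : R := if q is Some p then ln `|x - p| + ln `|t - p| else 0.

Lemma lg_coord_off q e z (t : R) : pole_out q e -> e t ->
 z.2 != 0 -> lg (coord q z) (lcoord q t) = lg z t - if q is Some p then lg z p + ln `|t - p| else 0.
Proof.
move=> qe et z2; case: q qe => [p|] qe; last by rewrite subr0.
have zp : off_pole (Some p) z by move=> /= zE; move: z2; rewrite zE eqxx.
have rp a : 0 < rho z a.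
 by rewrite lt_neqAle rho_ge0 andbT eq_sym; apply/eqP => /rho_eq0 zE; move: z2; rewrite zE eqxx.
have tp : 0 < `|t - p| by rewrite normr_gt0 subr_eq0; apply/eqP => h; apply: qe; rewrite -h.
rewrite !lg_rho (rho_coord qe zp et) ln_div ?posrE// ?(polar_gt0 qe zp et)//.
by rewrite /= lnM ?posrE.
Qed.

Lemma lg_coord_real q e x t : pole_out q e -> e x -> e t -> x != t ->
 lg (lcoord q x, 0) (lcoord q t) = ln `|x - t| - polec q x t.
Proof.
move=> qe ex et xt; rewrite lg_real; case: q qe => [p|] qe; last by rewrite /= subr0.
have ne a : e a -> a - p != 0 by move=> ea; rewrite subr_eq0; apply/eqP => h; apply: qe; rewrite -h.
have xp := ne x ex; have tp := ne t et.
rewrite /= (_ : (x - p)^-1 - (t - p)^-1 = (t - x) / ((x - p) * (t - p))); last by field; rewrite xp tp.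
rewrite normrM normfV normrM ln_div ?posrE ?mulr_gt0 ?normr_gt0//; last by rewrite subr_eq0 eq_sym.
by rewrite lnM ?posrE ?normr_gt0// distrC.
Qed.

Lemma logN_bounds x r (N : nat) t : 0 < r -> (0 < N)%N -> ~~ odd N -> x != t ->
 N%:R * (ln (Num.max r `|x - t|) - ln `|x - t|) <= logN x r N t /\
 logN x r N t <= N%:R * (ln (Num.max r `|x - t|) - ln `|x - t|) + ln 2.
Proof.
move=> r0 N0 evN xt; set tau := `|x - t|.
have tau0 : 0 < tau by rewrite normr_gt0 subr_eq0.
have -> : logN x r N t = ln (tau ^+ N + r ^+ N) - N%:R * ln tau.
 rewrite /logN -/tau; congr (ln (_ + _) - _).
 by rewrite /tau distrC -normrX ger0_norm// exprn_even_ge0.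
set m := Num.max r tau; have m0 : 0 < m by rewrite lt_max r0.
have [rm tm] : r <= m /\ tau <= m by rewrite !le_max !lexx orbT.
have [rN tN] : 0 < r ^+ N /\ 0 < tau ^+ N by rewrite !exprn_gt0.
have up : tau ^+ N + r ^+ N <= 2 * m ^+ N.
 by rewrite mulr_natl mulr2n lerD// lerXn2r ?nnegrE ?(ltW r0) ?(ltW tau0) ?(ltW m0).
have lo : m ^+ N <= tau ^+ N + r ^+ N.
 by rewrite /m; case: (leP r tau) => _; [rewrite lerDl|rewrite lerDr]; exact: ltW.
have mN : 0 < m ^+ N by rewrite exprn_gt0.
have e1 : ln (m ^+ N) = N%:R * ln m by rewrite lnXn// mulr_natl.
have l1 : ln (m ^+ N) <= ln (tau ^+ N + r ^+ N) by rewrite ler_ln ?posrE ?addr_gt0.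
have l2 : ln (tau ^+ N + r ^+ N) <= ln 2 + ln (m ^+ N).
 by rewrite -lnM ?posrE// ler_ln ?posrE ?addr_gt0 ?mulr_gt0.
rewrite e1 in l1 l2; rewrite mulrBr; move: l1 l2.
by set a := N%:R * _; set b := N%:R * _; set c := ln (_ + _) => l1 l2; split; lra.
Qed.

Lemma logN_pole x r (N : nat) p : 0 < r -> (0 < N)%N -> ~~ odd N -> r < `|x - p| -> 0 <= logN x r N p <= 1.
Proof.
move=> r0 N0 evN rp; set tau := `|x - p| in rp *.
have tau0 : 0 < tau by exact: lt_trans rp.
have -> : logN x r N p = ln (1 + (r / tau) ^+ N).
 rewrite /logN -/tau -[(p - x) ^+ N]ger0_norm ?exprn_even_ge0// normrX distrC -/tau.
 rewrite mulr_natl -lnXn// -ln_div ?posrE ?addr_gt0 ?exprn_gt0//; congr ln.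
 by rewrite mulrDl expr_div_n divff// gt_eqF// exprn_gt0.
have q0 : 0 <= (r / tau) ^+ N by rewrite exprn_ge0// divr_ge0 ?ltW.
have q1 : (r / tau) ^+ N <= 1 by rewrite exprn_ile1 ?divr_ge0 ?ltW// ltr_pdivrMr ?mul1r// ltW.
apply/andP; split; first by apply: ln_ge0; lra.
apply: le_trans q1; apply: le_ln1Dx; lra.
Qed.

(** The nodes are the roots of w^N = -r^N with N even: none is real, so the points x + w lie off [e]
    and Green functions can be compared there. *)
Lemma even_nodes r (N : nat) : 0 < r -> (0 < N)%N -> ~~ odd N -> exists W : seq R[i], [/\
 size W = N, forall w, w \in W -> normc w = r /\ complex.Im w != 0 &
 forall x t : R, t != x -> \sum_(w <- W) lg ((x, 0) + ofC w) t = ln ((t - x) ^+ N + r ^+ N)].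
Proof.
move=> r0 N0 evN; pose c := (toC (- r ^+ N, 0)).
have rX (a : R) n : toC (a, 0) ^+ n = toC (a ^+ n, 0).
 elim: n => [|n IH]; first by rewrite !expr0.
 rewrite !exprS IH; apply/eqP; rewrite eq_complex /=.
 by rewrite !mulr0 mul0r subr0 addr0 !eqxx.
have rN : 0 < r ^+ N by rewrite exprn_gt0.
have [W [WE WP _ sW]] := nodes_exist c N0; exists W; split => //.
 move=> w wW; have wc := WP w wW; split.
  apply/eqP; rewrite -(@eqrXn2 _ N) ?normc_ge0 ?ltW//; apply/eqP.
  by rewrite -normcX wc /= expr0n/= addr0 sqrtr_sqr normrN gtr0_norm.
 apply/eqP => w0; have wE : w = toC (complex.Re w, 0) by case: w w0 {wW wc} => a b /= ->.
 move: wc; rewrite wE rX /c => -[] h.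
 have : 0 <= complex.Re w ^+ N by rewrite exprn_even_ge0.
 by rewrite h oppr_ge0 leNgt rN.
move=> x t tx.
have E : toC (t - x, - 0) ^+ N - c = toC ((t - x) ^+ N + r ^+ N, 0).
 by rewrite oppr0 rX; apply/eqP; rewrite eq_complex /= opprK subr0 !eqxx.
have p : 0 < (t - x) ^+ N + r ^+ N by rewrite ltr_wpDl// exprn_even_ge0.
rewrite (@lg_nodes R W c N (x, 0) t WE)/= ?E; first by rewrite /= expr0n/= addr0 sqrtr_sqr gtr0_norm.
rewrite -subr_eq0 E; apply/eqP => -[h]; by move: p; rewrite h ltxx.
Qed.

Section bound.
Context (e : set R) (q : option R) (mu : prob R) (V : R).
Hypotheses (ce : compact e) (qe : pole_out q e) (pK : pot_ok (Kq q e) mu V) (bd : green_bd q e mu V).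
Let K := Kq q e.
Let G z := V + pot K mu (coord q z).

Lemma Kq_measurable : measurable K.
Proof. by apply: closed_measurable; apply: compact_closed => //; exact: Kq_compact. Qed.

Lemma logp_integrable x r : e x -> 0 < r -> intR mu K (logp (ilcoord q) x r).
Proof.
move=> ex r0; have mK := Kq_measurable; have [muK at0 int _] := pK.
pose pc s := if q is Some p then ln `|x - p| - lg (0, 0) s else 0.
have pci : intR mu K pc.
 have ci (c : R) : intR mu K (fun=> c) by exact: cst_integrable.
 rewrite /pc; case: (q) => [p|]; last exact: ci.
 exact: (integrableB mK (ci _) (int _)).
have cm : continuous (fun t : R => ln (Num.max r `|x - t|)).
 move=> t; apply: (@continuous_comp _ _ _ (fun t : R => Num.max r `|x - t|) (@ln R)).
  apply: continuous_max; first exact: cvg_cst.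
  by apply: cvg_norm; apply: cvgB; [exact: cvg_cst|exact: cvg_id].
 by apply: continuous_ln; rewrite lt_max r0.
have mi := ilcoord_integrable mu ce qe cm.
have gi := integrableB mK mi (integrableD mK (int (lcoord q x, 0)) pci).
have [|i _] := @Rint_off_point R mu K (logp (ilcoord q) x r)
 (fun s => ln (Num.max r `|x - ilcoord q s|) - (lg (lcoord q x, 0) s + pc s)) (lcoord q x) mK (at0 _) gi.
 move=> s [t et <-] sx; rewrite /logp lcoordK; congr (_ - _).
 have xt : x != t by apply: contraNneq sx => ->.
 rewrite (lg_coord_real qe ex et xt) /pc /polec; move: qe; case: (q) => [p|] qe'; last by rewrite !addr0 ?subr0.
 have tp : 0 < `|t - p| by rewrite normr_gt0 subr_eq0; apply/eqP => h; apply: qe'; rewrite -h.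
 by rewrite lg_real sub0r normrN /= normfV lnV ?posrE//; ring.
exact: i.
Qed.

(** A discrete Jensen formula: the Green function vanishes at x, so its sum over N nodes on the
    circle of radius r about x is N times the integral of [logp], up to constants independent of N.
    The pole, which lies outside the circle, accounts for the 1. *)
Lemma node_sum x r (N : nat) W : e x -> 0 < r -> (0 < N)%N -> ~~ odd N ->
 (if q is Some p then is_true (r < `|x - p|) else True) ->
 size W = N -> (forall w, w \in W -> normc w = r /\ complex.Im w != 0) ->
 (forall x t : R, t != x -> \sum_(w <- W) lg ((x, 0) + ofC w) t = ln ((t - x) ^+ N + r ^+ N)) ->
 N%:R * (\int[mu]_(s in K) logp (ilcoord q) x r s) - 1 <= \sum_(w <- W) G ((x, 0) + ofC w) /\
 \sum_(w <- W) G ((x, 0) + ofC w) <= N%:R * (\int[mu]_(s in K) logp (ilcoord q) x r s) + ln 2.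
Proof.
move=> ex r0 N0 evN rp sW WP WE.
have mK := Kq_measurable; have [muK at0 int _] := pK.
pose S s := \sum_(w <- W) (lg (coord q ((x, 0) + ofC w)) s - lg (lcoord q x, 0) s).
have Si w : intR mu K (fun s => lg (coord q ((x, 0) + ofC w)) s - lg (lcoord q x, 0) s).
 exact: (integrableB mK (int _) (int _)).
have [SI SE] := @Rint_sum R _ mu K W _ mK Si.
have -> : \sum_(w <- W) G ((x, 0) + ofC w) = \int[mu]_(s in K) S s.
 rewrite -SE; apply: eq_bigr => w _; rewrite RintegralB// /G.
 have := pot_zero ce qe pK bd ex; rewrite /pot; set a := Rintegral _ _ _; set b := Rintegral _ _ _; lra.
have mKa : measurable (K `\ lcoord q x) by exact: measurableD.
have Ka : K `\ lcoord q x `<=` K by move=> t [].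
have m0 : mu (K `\` (K `\ lcoord q x)) = 0%E.
 apply/eqP; rewrite -measure_le0 -(at0 (lcoord q x)); apply: le_measure; rewrite ?inE//.
  exact: measurableD.
 by move=> t [Kt] nt; apply: contrapT => ta; apply: nt.
have li := logp_integrable ex r0.
have Nli : intR mu K (fun s => N%:R * logp (ilcoord q) x r s) by exact: (integrableZl mK N%:R li).
have ci (c : R) : intR mu K (fun=> c) by exact: cst_integrable.
have pt s : (K `\ lcoord q x) s -> N%:R * logp (ilcoord q) x r s - 1 <= S s /\
  S s <= N%:R * logp (ilcoord q) x r s + ln 2.
 move=> [[t et <-] sx]; rewrite /logp lcoordK.
 have xt : x != t by apply: contra_notN sx => /eqP ->.
 have tx : t != x by rewrite eq_sym.
 have [b1 b2] := logN_bounds r0 N0 evN xt.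
 pose cq : R := if q is Some p then logN x r N p else 0.
 have cq01 : 0 <= cq <= 1.
  by rewrite /cq; case: (q) rp => [p|] rp; [exact: logN_pole|rewrite lexx ler01].
 have -> : S (lcoord q t) = logN x r N t - cq.
  rewrite /S big_seq (eq_bigr (fun w => (lg ((x, 0) + ofC w) t - ln `|x - t|) -
    (if q is Some p then lg ((x, 0) + ofC w) p - ln `|x - p| else 0))); last first.
   move=> w /WP [_ w2].
   rewrite (lg_coord_off qe et); last by rewrite /= add0r.
   rewrite (lg_coord_real qe ex et xt) /polec; case: (q) => [p|]; [ring|by rewrite !subr0].
  rewrite -big_seq sumrB sumrB WE// big_const_seq count_predT iter_addr_0 sW.
  rewrite -[ln `|x - t| *+ N]mulr_natl -/(logN x r N t); congr (_ - _).
  rewrite /cq; case: (q) qe => [p|] qe'; last by rewrite big1.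
  rewrite sumrB WE ?big_const_seq ?count_predT ?iter_addr_0 ?sW; first by rewrite -[_ *+ N]mulr_natl.
  by apply/eqP => px; apply: qe'; rewrite px.
 by move/andP: cq01 => [? ?]; split; lra.
split.
- have i1 : intR mu K (fun s => N%:R * logp (ilcoord q) x r s - 1).
  exact: (integrableB mK Nli (ci 1)).
 have := ae_le_Rint mK mKa Ka m0 i1 SI (fun s Ks => (pt s Ks).1).
 by rewrite RintegralB// RintegralZl// Rint_prob_cst.
- have i1 : intR mu K (fun s => N%:R * logp (ilcoord q) x r s + ln 2).
  exact: (integrableD mK Nli (ci _)).
 have := ae_le_Rint mK mKa Ka m0 SI i1 (fun s Ks => (pt s Ks).2).
 by rewrite RintegralD// RintegralZl// Rint_prob_cst.
Qed.
End bound.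
End node_sum.

(** Green functions of different poles are comparable near [e]. Summed over N nodes, this bounds N
    J1 by A N J2 up to a constant, and N tends to infinity; [small_cap] then provides the radii for
    [comparison]. *)
Theorem pole_comparison {R} (e : set R) (q1 q2 : option R) (mu1 mu2 : prob R) (V1 V2 : R) :
 compact e -> pole_out q1 e -> pole_out q2 e ->
 pot_ok (Kq q1 e) mu1 V1 -> green_bd q1 e mu1 V1 -> pot_ok (Kq q2 e) mu2 V2 -> green_bd q2 e mu2 V2 ->
 exists2 C : R, 0 < C & forall f : R -> R, continuous f -> (forall t, 0 <= f t) ->
  \int[mu1]_(s in Kq q1 e) f (ilcoord q1 s) <= C * \int[mu2]_(s in Kq q2 e) f (ilcoord q2 s).
Proof.
move=> ce qe1 qe2 p1 b1 p2 b2.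
have [delta [A [d0 A0 HA]]] := near_compare ce qe1 qe2 p1 b1 p2.
have mK1 := Kq_measurable ce qe1; have mK2 := Kq_measurable ce qe2.
have far (q : option R) : pole_out q e -> exists2 d : R, 0 < d & forall x, e x -> if q is Some p then is_true (d <= `|x - p|) else True.
 case: q => [p|] qe; last by exists 1.
 have [d dp Hd] : exists2 d : R, 0 < d & forall t, e t -> d <= rho (p, 0) t.
  by apply: dist_pos => // t et [pt]; apply: qe; rewrite pt.
 exists d => // x /Hd; by rewrite /rho/= expr0n/= addr0 sqrtr_sqr distrC.
have [da da0 Hda] := far q1 qe1; have [db db0 Hdb] := far q2 qe2.
pose r0 := Num.min delta (Num.min da db).
have r00 : 0 < r0 by rewrite !lt_min d0 da0.
have [rd ra rb] : [/\ r0 <= delta, r0 <= da & r0 <= db] by rewrite /r0 !ge_min !lexx !orbT.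
have [muK1 at1 _ _] := p1; have [muK2 at2 _ _] := p2.
have point q (mu : prob R) x : measurable (Kq q e) -> mu [set lcoord q x] = 0%E ->
  mu (Kq q e `&` [set s | ilcoord q s = x]) = 0%E.
 move=> mK at0; apply/eqP; rewrite -measure_le0 -at0; apply: le_measure; rewrite ?inE//.
  apply: measurableI => //; rewrite (_ : [set s | _] = setT `&` ilcoord q @^-1` [set x]); last by rewrite setTI.
  exact: measurable_ilcoord.
 by move=> s [Ks /= <-]; rewrite (ilcoordK Ks).
exists (2 * (2 * A)); first by rewrite !mulr_gt0.
move=> f cf f0.
apply: (@comparison R mu1 mu2 (Kq q1 e) (Kq q2 e) (ilcoord q1) (ilcoord q2) e r0 (2 * A) f) => //;
 try exact: measurable_ilcoord; try exact: ilcoord_in; try exact: ilcoord_integrable.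
 by rewrite mulr_gt0.
move=> x r ex rp rr0.
apply: small_cap => //; try exact: measurable_ilcoord; try exact: point;
 [exact: (logp_integrable ce qe1 p1)|exact: (logp_integrable ce qe2 p2)|].
set J1 := Rintegral _ _ _; set J2 := Rintegral _ _ _.
have key (m : nat) : (m.+1.*2)%:R * (J1 - A * J2) <= 1 + A * ln 2.
 have N0 : (0 < m.+1.*2)%N by rewrite double_gt0.
 have evN : ~~ odd m.+1.*2 by rewrite odd_double.
 have [W [sW WP WE]] := even_nodes rp N0 evN.
 have [] := @node_sum R e q1 mu1 V1 ce qe1 p1 b1 x r _ W ex rp N0 evN _ sW WP WE.
  by move: (Hda x ex); case: (q1) => // p; lra.
 have [] := @node_sum R e q2 mu2 V2 ce qe2 p2 b2 x r _ W ex rp N0 evN _ sW WP WE.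
  by move: (Hdb x ex); case: (q2) => // p; lra.
 rewrite -/J1 -/J2; set S1 := \sum_(w <- W) _; set S2 := \sum_(w <- W) _ => _ h2 h1 _.
 (* [S2] is the node sum for [mu1] and [S1] the one for [mu2]; the nodes are not real and lie within
    delta of x, where the Green functions are comparable. *)
 have S12 : S2 <= A * S1.
  rewrite /S1 /S2 mulr_sumr big_seq [leRHS]big_seq; apply: ler_sum => w wW.
  have [wr w2] := WP w wW.
  apply: (HA _ x ex); last by apply: off_line; rewrite /= add0r.
  apply: lt_le_trans rd; apply: le_lt_trans rr0; rewrite -wr.
  case: (w) => a b; rewrite /rho /=; rewrite add0r (_ : x + a - x = a)//; ring.
 have := ler_wpM2l (ltW A0) h2; lra.
rewrite leNgt; apply/negP => lt; have D0 : 0 < J1 - A * J2 by rewrite subr_gt0.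
pose m := Num.truncn ((1 + A * ln 2) / (J1 - A * J2)).
have := key m; rewrite leNgt => /negP; apply.
rewrite -ltr_pdivrMr//; apply: lt_le_trans (Num.Theory.truncnS_gt _) _.
by rewrite ler_nat -addnn leq_addl.
Qed.

(** * Weighted extremal polynomials on finite sets *)

Lemma seq_min {R} (T : eqType) (s : seq T) (g : T -> R) : s != [::] ->
 exists2 a, a \in s & forall p, p \in s -> g a <= g p.
Proof.
elim: s => [//|y Z IH] _; have [->|Z0] := eqVneq Z [::].
 by exists y; rewrite ?mem_head// => p; rewrite inE => /eqP ->.
have [a aZ am] := IH Z0; have [ya|ay] := leP (g y) (g a).
 exists y; first by rewrite mem_head.
 by move=> p; rewrite in_cons => /orP[/eqP ->//|/am]; exact: le_trans.
exists a; first by rewrite in_cons aZ orbT.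
by move=> p; rewrite in_cons => /orP[/eqP ->|/am//]; exact: ltW.
Qed.

Lemma fin_min {R} (I : finType) (P : pred I) (g : I -> R) i0 : P i0 -> exists2 i, P i & forall j, P j -> g i <= g j.
Proof.
move=> Pi0; have : enum P != [::].
 by apply/eqP => h; have : i0 \in enum P; [rewrite mem_enum|rewrite h].
move=> /(@seq_min R _ _ g)[a]; rewrite mem_enum => Pa am.
by exists a => // j Pj; apply: am; rewrite mem_enum.
Qed.

Section lagrange.
Context {R} (n : nat).
Implicit Types (x : 'I_n.+1 -> R) (D Q : {poly R}).

(** Divided-difference weights: the coefficient of degree n of Q is the sum of the Q(x j)
    [lcoef x j]. Hence a monic Q of degree n satisfies |Q| >= D / [lsum D x] at some node; [lext] is
    the monic polynomial with equality at all nodes and the signs of the weights. *)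
Definition lcoef x (j : 'I_n.+1) : R := \prod_(i < n.+1 | i != j) (x j - x i)^-1.
Definition lpoly x (j : 'I_n.+1) : {poly R} := \prod_(i < n.+1 | i != j) ('X - (x i)%:P).
Definition lsum D x : R := \sum_j D.[x j] * `|lcoef x j|.
Definition lext D x : {poly R} := \sum_j (Num.sg (lcoef x j) * D.[x j] / lsum D x * lcoef x j) *: lpoly x j.

Lemma lpoly_monic x j : lpoly x j \is monic /\ size (lpoly x j) = n.+1.
Proof.
rewrite /lpoly -big_filter monic_prod_XsubC size_prod_XsubC; split => //; congr S.
by rewrite -sum1_size big_filter sum1_card cardC1 card_ord.
Qed.

Lemma lpoly_horner x j y : (lpoly x j).[y] = \prod_(i < n.+1 | i != j) (y - x i).
Proof. by rewrite horner_prod; apply: eq_bigr => i _; rewrite !hornerE. Qed.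

Lemma lcoef_neq0 x j : injective x -> lcoef x j != 0.
Proof.
move=> ix; rewrite prodf_seq_neq0; apply/allP => i _; apply/implyP => ij.
by rewrite invr_neq0// subr_eq0; apply: contraNneq ij => /ix ->.
Qed.

Lemma lpoly_node x j : injective x -> (lpoly x j).[x j] * lcoef x j = 1.
Proof.
move=> ix; rewrite lpoly_horner /lcoef -big_split big1// => i ij /=.
by rewrite divff// subr_eq0; apply: contraNneq ij => /ix ->.
Qed.

Lemma lpoly_node0 x j k : k != j -> (lpoly x j).[x k] = 0.
Proof. by move=> kj; rewrite lpoly_horner (bigD1 k)//= subrr mul0r. Qed.

Lemma comb_horner x c k : injective x -> (\sum_j (c j * lcoef x j) *: lpoly x j).[x k] = c k.
Proof.
move=> ix; rewrite horner_sum (bigD1 k)//= hornerZ -mulrA [lcoef x k * _]mulrC lpoly_node// mulr1.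
by rewrite big1 ?addr0// => j jk; rewrite hornerZ lpoly_node0 ?mulr0// eq_sym.
Qed.

Lemma lagrange x Q : injective x -> (size Q <= n.+1)%N -> Q = \sum_j (Q.[x j] * lcoef x j) *: lpoly x j.
Proof.
move=> ix sQ; apply/eqP; rewrite -subr_eq0; apply/eqP.
set T := \sum_j _; have sT : (size T <= n.+1)%N.
 apply: (leq_trans (size_sum _ _ _)); apply/bigmax_leqP => j _.
 by apply: (leq_trans (size_scale_leq _ _)); rewrite (lpoly_monic x j).2.
apply: (@roots_geq_poly_eq0 _ _ [seq x j | j <- enum 'I_n.+1]).
- by apply/allP => _ /mapP[k _ ->]; rewrite rootE !hornerE /T comb_horner// subrr.
- by rewrite map_inj_uniq// enum_uniq.
- rewrite size_map size_enum_ord; apply: (leq_trans (size_polyD _ _)).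
 by rewrite size_polyN geq_max sQ.
Qed.

Lemma coefn_comb x c : (\sum_j c j *: lpoly x j)`_n = \sum_j c j.
Proof.
rewrite coef_sum; apply: eq_bigr => j _; rewrite coefZ.
by have [/monicP + s] := lpoly_monic x j; rewrite lead_coefE s /= => ->; rewrite mulr1.
Qed.

Lemma lagrange_lead x Q : injective x -> (size Q <= n.+1)%N -> Q`_n = \sum_j Q.[x j] * lcoef x j.
Proof. by move=> ix sQ; rewrite {1}(lagrange ix sQ) coefn_comb. Qed.

Lemma lsum_gt0 D x : injective x -> (forall j, 0 < D.[x j]) -> 0 < lsum D x.
Proof.
move=> ix Dp; have p j : 0 < D.[x j] * `|lcoef x j| by rewrite mulr_gt0// normr_gt0 lcoef_neq0.
by rewrite /lsum (bigD1 ord0)//= ltr_wpDr// sumr_ge0// => j _; exact: ltW.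
Qed.

Lemma lext_node D x k : injective x -> (lext D x).[x k] = Num.sg (lcoef x k) * D.[x k] / lsum D x.
Proof. exact: comb_horner. Qed.

Lemma lext_monic D x : injective x -> (forall j, 0 < D.[x j]) -> lext D x \is monic /\ size (lext D x) = n.+1.
Proof.
move=> ix Dp; have s0 := lsum_gt0 ix Dp.
have sl : (size (lext D x) <= n.+1)%N.
 apply: (leq_trans (size_sum _ _ _)); apply/bigmax_leqP => j _.
 by apply: (leq_trans (size_scale_leq _ _)); rewrite (lpoly_monic x j).2.
have cn : (lext D x)`_n = 1.
 rewrite /lext coefn_comb (eq_bigr (fun j => D.[x j] * `|lcoef x j| * (lsum D x)^-1)); last first.
  by move=> j _; rewrite [`|lcoef x j|]normrEsg; ring.
 by rewrite -mulr_suml divff// gt_eqF.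
have sE : size (lext D x) = n.+1.
 apply/eqP; rewrite eqn_leq sl /= ltnNge; apply/negP => h.
 by move: cn; rewrite nth_default// => /esym/eqP; rewrite oner_eq0.
by split => //; apply/monicP; rewrite lead_coefE sE.
Qed.

Definition exch x k (y : R) (i : 'I_n.+1) : R := if i == k then y else x i.

Lemma exch_inj x k y : injective x -> (forall j, y != x j) -> injective (exch x k y).
Proof.
move=> ix yx i j; rewrite /exch; case: eqP => [->|_]; case: eqP => [->|_] //.
- by move=> /eqP; rewrite (negbTE (yx j)).
- by move=> /esym/eqP; rewrite (negbTE (yx i)).
- exact: ix.
Qed.

Lemma lcoef_exch x k y j : injective x -> (forall j, y != x j) -> j != k ->
 lcoef (exch x k y) j = lcoef x j * ((x j - x k) / (x j - y)).
Proof.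
move=> ix yx jk; have kj : k != j by rewrite eq_sym.
rewrite /lcoef (bigD1 k)//= [in RHS](bigD1 k)//= /exch eqxx (negbTE jk).
rewrite (eq_bigr (fun i => (x j - x i)^-1)); last by move=> i /andP[_ /negbTE ->].
set T := \prod_(i < _ | _) _.
have n1 : x j - x k != 0 by rewrite subr_eq0; apply: contraNneq jk => /ix ->.
have n2 : x j - y != 0 by rewrite subr_eq0 eq_sym.
by field; rewrite n1 n2.
Qed.

Lemma lcoef_exch0 x k y : lcoef (exch x k y) k = \prod_(i < n.+1 | i != k) (y - x i)^-1.
Proof. by rewrite /lcoef /exch eqxx; apply: eq_bigr => i /negbTE ->. Qed.

(* Simplex exchange: trading the node next to [y], on the side where the interpolant keeps its sign, lowers [lsum]. *)
Lemma lsum_exch D x y : injective x -> (forall j, 0 < D.[x j]) -> (forall j, y != x j) -> 0 < D.[y] ->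
 D.[y] / lsum D x < `|(lext D x).[y]| -> exists k, lsum D (exch x k y) < lsum D x.
Proof.
move=> ix Dp yx Dy big; set P := lext D x in big *; set s := lsum D x in big *.
have s0 : 0 < s by exact: lsum_gt0.
have [Pm sP] := lext_monic ix Dp.
pose a j := D.[x j] / s * `|lcoef x j|.
have a0 j : 0 < a j by rewrite mulr_gt0 ?divr_gt0// normr_gt0 lcoef_neq0.
have Pa j : P.[x j] * lcoef x j = a j.
 by rewrite lext_node// /a -/s [`|lcoef x j|]normrEsg; ring.
have yx0 j : y - x j != 0 by rewrite subr_eq0.
(* Barycentric form: P(y) is the product of all y - x i times [T]. The a j are positive, so the sign
   of [T] tells on which side of y the node to be traded lies. *)
pose T := \sum_j a j / (y - x j).
have PT k : P.[y] * lcoef (exch x k y) k = (y - x k) * T.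
 have LP : P = \sum_j (P.[x j] * lcoef x j) *: lpoly x j := lagrange ix (eq_leq sP).
 rewrite {1}LP horner_sum mulr_suml mulr_sumr; apply: eq_bigr => j _.
 rewrite hornerZ Pa lpoly_horner lcoef_exch0.
 have full l : \prod_(i < n.+1) (y - x i) = (y - x l) * \prod_(i < n.+1 | i != l) (y - x i).
  by rewrite (bigD1 l).
 have iv : \prod_(i < n.+1 | i != k) (y - x i)^-1 = (\prod_(i < n.+1 | i != k) (y - x i))^-1.
  by rewrite prodfV.
 have nk : \prod_(i < n.+1 | i != k) (y - x i) != 0.
  by rewrite prodf_seq_neq0; apply/allP => i _; apply/implyP.
 have := full j; rewrite (full k) iv => E.
 have Ej : \prod_(i < n.+1 | i != j) (y - x i) = (y - x k) * \prod_(i < n.+1 | i != k) (y - x i) / (y - x j).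
  by rewrite E mulrAC divff ?mul1r.
 by rewrite Ej; field; rewrite yx0 nk.
have T0 : T != 0.
 apply/eqP => T0; have := PT ord0; rewrite T0 mulr0 => /eqP; rewrite mulf_eq0.
 rewrite (negbTE (lcoef_neq0 _ (exch_inj ix yx))) orbF => /eqP P0.
 by move: big; rewrite P0 normr0 ltNge ltW// divr_gt0.
have [k [kT kadj]] : exists k, 0 < (y - x k) * T /\ forall j, j != k -> 0 < (x j - x k) / (x j - y).
 have adj k : (forall j, j != k -> 0 < (x j - x k) * (x j - y)) -> forall j, j != k -> 0 < (x j - x k) / (x j - y).
  move=> h j jk; have n2 : x j - y != 0 by rewrite subr_eq0 eq_sym.
  rewrite (_ : _ / _ = (x j - x k) * (x j - y) / (x j - y) ^+ 2); last by field.
  by rewrite divr_gt0 ?h// exprn_even_gt0.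
 have lt0 j : y < x j -> a j / (y - x j) < 0.
  by move=> h; rewrite nmulr_llt0// invr_lt0 subr_lt0.
 have gt0 j : x j < y -> 0 < a j / (y - x j) by move=> h; rewrite divr_gt0// subr_gt0.
 have ijn j k : j != k -> x j != x k by apply: contraNneq => /ix ->.
 move: T0; rewrite neq_lt => /orP[Tn|Tp].
 - have [j0 hj0] : exists j, y < x j.
   apply: contrapT => h; move: Tn; rewrite ltNge sumr_ge0// => j _; apply: ltW; apply: gt0.
   by rewrite lt_neqAle eq_sym yx leNgt; apply/negP => yj; apply: h; exists j.
  have [k hk kmin] := @fin_min R _ (fun j => y < x j) x j0 hj0.
  exists k; split; first by rewrite nmulr_rgt0// subr_lt0.
  apply: adj => j jk; have [yj|jy] := ltP y (x j).
   by rewrite mulr_gt0 ?subr_gt0// lt_neqAle eq_sym ijn//= kmin.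
  have jy' : x j < y by rewrite lt_neqAle eq_sym yx.
  by rewrite nmulr_rgt0 ?subr_lt0// (lt_trans jy').
 - have [j0 hj0] : exists j, x j < y.
   apply: contrapT => h; move: Tp; rewrite ltNge -oppr_ge0 -sumrN sumr_ge0// => j _.
   rewrite oppr_ge0; apply: ltW; apply: lt0; rewrite lt_neqAle yx leNgt; apply/negP => yj.
   by apply: h; exists j.
  have [k hk kmax] := @fin_min R _ (fun j => x j < y) (fun j => - x j) j0 hj0.
  exists k; split; first by rewrite mulr_gt0// subr_gt0.
  apply: adj => j jk; have [jy|yj] := ltP (x j) y.
   by rewrite nmulr_rgt0 ?subr_lt0// lt_neqAle ijn//= -lerN2 kmax.
  have yj' : y < x j by rewrite lt_neqAle yx.
  by rewrite mulr_gt0 ?subr_gt0// (lt_trans hk).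
exists k; have ix' := exch_inj (k := k) ix yx.
have cn : P`_n = 1 by have /monicP := Pm; rewrite lead_coefE sP.
(* The leading coefficient 1 is expanded at the new nodes. By the choice of k all terms are
   positive; each equals the corresponding term of the new [lsum] divided by s, except the one at y,
   which is strictly larger. *)
have := lagrange_lead ix' (eq_leq sP); rewrite -/P cn => E.
rewrite -[ltLHS]mul1r -[in ltLHS](divff (lt0r_neq0 s0)) -mulrA gtr_pMr//.
rewrite E mulrC /lsum mulr_suml [ltLHS](bigD1 k)//= [ltRHS](bigD1 k)//=.
have xk : exch x k y k = y by rewrite /exch eqxx.
apply: ltr_leD.
 rewrite xk -[ltRHS]gtr0_norm; last by rewrite PT.
 rewrite normrM mulrAC ltr_pM2r// normr_gt0 lcoef_neq0//.
apply: ler_sum => j jk; rewrite lcoef_exch//.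
have -> : exch x k y j = x j by rewrite /exch (negbTE jk).
have rp := kadj j jk; rewrite normrM (gtr0_norm rp) [leRHS]mulrA Pa /a.
by rewrite le_eqVlt; apply/orP; left; apply/eqP; ring.
Qed.
End lagrange.

Lemma poly_continuous {R} (p : {poly R}) : continuous (horner p).
Proof.
elim/poly_ind: p => [|p c IH] t.
 rewrite (_ : horner 0 = fun=> 0); first exact: cvg_cst.
 by apply/funext => s; rewrite horner0.
rewrite (_ : horner _ = fun s => p.[s] * s + c); last by apply/funext => s; rewrite !hornerE.
by apply: cvgD; [apply: cvgM; [exact: IH|exact: cvg_id]|exact: cvg_cst].
Qed.

Lemma Rint_off_null {R} (mu : prob R) K N f g : measurable K -> measurable N -> mu N = 0%E -> measurable_fun setT f ->
 intR mu K g -> (forall t, K t -> ~ N t -> f t = g t) ->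
 intR mu K f /\ \int[mu]_(t in K) f t = \int[mu]_(t in K) g t.
Proof.
move=> mK mN N0 mf gi fg.
have mKN : measurable (K `\` N) by exact: measurableD.
have KN : K `\` N `<=` K by move=> t [].
have m0 : mu (K `\` (K `\` N)) = 0%E.
 apply/eqP; rewrite -measure_le0 -N0; apply: le_measure; rewrite ?inE//; first exact: measurableD.
 by move=> t [Kt] nt; apply: contrapT => ta; apply: nt.
have gi' : intR mu (K `\` N) g by exact: integrableS gi.
have fi : intR mu K f.
 apply/(negligible_integrable mN mK _ N0); first by apply: measurable_funTS; apply/measurable_EFinP.
 by apply: eq_integrable gi' => // t /set_mem [Kt Nt]; rewrite /= fg.
split=> //; rewrite (Rint_restrict mK mKN KN m0 fi) (Rint_restrict mK mKN KN m0 gi).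
by apply: eq_Rintegral => t /set_mem [Kt Nt]; rewrite fg.
Qed.

Lemma swap_le {R} (mu nu : prob R) K L (F : R -> R -> R) h A C :
 measurable K -> measurable L -> mu K = 1%E -> nu L = 1%E -> measurable_fun setT (fun z : R * R => F z.1 z.2) ->
 (forall t s, K t -> L s -> F t s <= C) -> (forall t, K t -> intR nu L (F t) /\ \int[nu]_(s in L) F t s <= A) ->
 (forall s, L s -> intR mu K (F^~ s) /\ h s <= \int[mu]_(t in K) F t s) -> intR nu L h -> \int[nu]_(s in L) h s <= A.
Proof.
move=> mK mL muK nuL mF FC Hg Hh hi.
pose f (z : R * R) : \bar R := ((C - F z.1 z.2) * (\1_K z.1 * \1_L z.2))%:E.
have f0 z : (0 <= f z)%E.
 rewrite /f !indicE lee_fin; case: (boolP (z.1 \in K)) => [/set_mem K1|_]; last by rewrite mul0r mulr0.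
 case: (boolP (z.2 \in L)) => [/set_mem L2|_]; last by rewrite !mulr0.
 by rewrite !mulr1 subr_ge0 FC.
have mf : measurable_fun setT f.
 apply/measurable_EFinP; apply: measurable_funM; first exact: measurable_funB.
 by apply: measurable_funM; apply: measurableT_comp.
have ci (m : prob R) (B : set R) (c : R) : measurable B -> intR m B (fun=> c) by exact: cst_integrable.
have key (m : prob R) (B : set R) (u : R -> R) : measurable B -> m B = 1%E -> intR m B u ->
  (\int[m]_s ((C - u s) * \1_B s)%:E)%E = (C - \int[m]_(s in B) u s)%:E.
 move=> mB mB1 ui.
 have -> : (\int[m]_s ((C - u s) * \1_B s)%:E = \int[m]_(s in B) (C - u s)%:E)%E.
  rewrite [RHS]integral_mkcond; apply: eq_integral => s _; rewrite patchE indicE.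
  by case: (s \in B); rewrite ?mulr1 ?mulr0.
 rewrite Rintegral_EFin//; last exact: (integrableB mB (ci m B C mB) ui).
 by rewrite RintegralB//; [rewrite Rint_prob_cst|exact: ci].
have H1 : (\int[mu]_x ((C - A) * \1_K x)%:E <= \int[mu]_x \int[nu]_y f (x, y))%E.
 apply: le_integral_pointwise => t _; rewrite /f/=.
 have [tK|tK] := boolP (t \in K); last first.
  by rewrite !indicE (negbTE tK) mulr0; apply: integral_ge0 => s _; rewrite mul0r mulr0.
 have [i iA] := Hg t (set_mem tK).
 under eq_integral do rewrite indicE tK mul1r.
 by rewrite (key nu L (F t))// indicE tK mulr1 lee_fin lerD2l lerN2.
have H2 : (\int[nu]_y \int[mu]_x f (x, y) <= \int[nu]_y ((C - h y) * \1_L y)%:E)%E.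
 apply: le_integral_pointwise => s _; rewrite /f/=.
 have [sL|sL] := boolP (s \in L); last first.
  rewrite indicE (negbTE sL) mulr0 (_ : (\int[mu]_x _)%E = 0%E)//.
  by apply: integral0_eq => t _; rewrite !mulr0.
 have [i hF] := Hh s (set_mem sL).
 under eq_integral do rewrite [\1_L s]indicE sL mulr1.
 by rewrite (key mu K (F^~ s))// indicE sL mulr1 lee_fin lerD2l lerN2.
rewrite (@fubini_tonelli _ _ _ _ _ mu nu f mf f0) in H1.
have := le_trans H1 H2; rewrite (key mu K (fun=> A))// ?Rint_prob_cst//; last exact: ci.
by rewrite (key nu L h)// lee_fin lerD2l lerN2.
Qed.

Lemma null_seq {R} (mu : prob R) (r : seq R) : (forall t, mu [set t] = 0%E) ->
 measurable [set t | t \in r] /\ mu [set t | t \in r] = 0%E.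
Proof.
move=> at0; elim: r => [|a r [mr r0]].
 by rewrite (_ : [set t | _] = set0) ?measure0//; apply/seteqP; split.
rewrite (_ : [set t | t \in a :: r] = [set a] `|` [set t | t \in r]); last first.
 apply/seteqP; split => t /=; rewrite in_cons; first by case/orP => [/eqP ->|]; [left|right].
 by case=> [->|->]; rewrite ?eqxx// orbT.
split; first exact: measurableU.
have h : (mu ([set a] `|` [set t | t \in r]) <= mu [set a] + mu [set t | t \in r])%E by apply: measureU2.
by apply/eqP; rewrite -measure_le0; apply: le_trans h _; rewrite at0 r0 adde0.
Qed.

Section extremal.
Context {R} (n : nat).
Implicit Types (x : 'I_n.+1 -> R) (D Q : {poly R}).

(** Choose n + 1 nodes of Y with the least [lsum]; if the bound failed at some y, an exchange would
    lower it. *)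
Lemma finite_extremal D (Y : seq R) x0 : injective x0 -> (forall j, x0 j \in Y) -> (forall y, y \in Y -> 0 < D.[y]) ->
 exists x, [/\ injective x, forall j, x j \in Y & forall y, y \in Y -> `|(lext D x).[y]| <= D.[y] / lsum D x].
Proof.
move=> ix0 x0Y DY.
pose xf (f : {ffun 'I_n.+1 -> 'I_(size Y)}) (i : 'I_n.+1) := nth 0 Y (f i).
have xY f j : xf f j \in Y by rewrite mem_nth.
have idx y : y \in Y -> exists i : 'I_(size Y), nth 0 Y i = y.
 by rewrite -index_mem => iy; exists (Ordinal iy); rewrite nth_index// -index_mem.
have lift x : (forall j, x j \in Y) -> exists f, xf f =1 x.
 move=> xj; have /choice [k kP] : forall j, exists i : 'I_(size Y), nth 0 Y i = x j by move=> j; exact: idx.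
 by exists [ffun j => k j] => j; rewrite /xf ffunE.
have [f0 f0E] := lift x0 x0Y.
have inj f : reflect (injective (xf f)) (injectiveb (xf f)) by exact: injectiveP.
have Pf0 : injectiveb (xf f0).
 by apply/inj => i j; rewrite !f0E; exact: ix0.
have [f /inj fi fmin] := @fin_min R _ (fun f => injectiveb (xf f)) (fun f => lsum D (xf f)) f0 Pf0.
have Dp j : 0 < D.[xf f j] by exact: DY.
exists (xf f); split => // y yY; rewrite leNgt; apply/negP => big.
have [[j jy]|nj] := pselect (exists j, y = xf f j).
 move: big; rewrite jy lext_node// !normrM normfV normr_sg lcoef_neq0// mul1r.
 by rewrite !gtr0_norm ?ltxx// lsum_gt0.
have yx j : y != xf f j by apply: contra_notN nj => /eqP; exists j.
have [k kl] := lsum_exch fi Dp yx (DY y yY) big.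
have [f' f'E] : exists f', xf f' =1 exch (xf f) k y.
 by apply: lift => j; rewrite /exch; case: ifP.
have f'i : injectiveb (xf f').
 by apply/inj => i j; rewrite !f'E; exact: (exch_inj fi yx).
have := fmin f' f'i; rewrite leNgt (_ : lsum D (xf f') = lsum D (exch (xf f) k y)) ?kl//.
by congr lsum; apply/funext.
Qed.

(** For |c| < 1 the difference has at every node the sign of the weight, and these signs alternate
    along the sorted nodes. This gives n roots, hence all of them, since D has smaller degree. The
    free parameter c is what will be averaged. *)
Lemma interlace D x c : injective x -> (forall j, 0 < D.[x j]) -> (size D <= n)%N -> `|c| < 1 ->
 exists z y : nat -> R, [/\ forall i, (i <= n)%N -> exists j, z i = x j, forall i, (i < n)%N -> z i < y i < z i.+1 &
  lext D x - (c / lsum D x) *: D = \prod_(t <- [seq y i | i <- iota 0 n]) ('X - t%:P)].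
Proof.
move=> ix Dp sD c1; have s0 := lsum_gt0 ix Dp.
pose s := sort <=%R [seq x j | j <- enum 'I_n.+1].
have ss : size s = n.+1 by rewrite size_sort size_map size_enum_ord.
have us : sorted <%R s by rewrite sort_lt_sorted map_inj_uniq// enum_uniq.
pose z i := nth 0 s i.
have zlt i j : (i < j)%N -> (j <= n)%N -> z i < z j.
 move=> ij jn; apply: (sorted_ltn_nth lt_trans 0 us) => //; rewrite inE ss ltnS//.
 by apply: leq_trans (ltnW ij) jn.
have zx i : (i <= n)%N -> exists j, z i = x j.
 move=> iN; have : z i \in s by rewrite mem_nth// ss ltnS.
 by rewrite mem_sort => /mapP[j _ ->]; exists j.
have xz l : exists2 m, (m <= n)%N & x l = z m.
 have xs : x l \in s by rewrite mem_sort; apply/mapP; exists l; rewrite ?mem_enum.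
 exists (seq.index (x l) s); last by rewrite /z nth_index.
 by rewrite -ltnS -ss index_mem.
pose Q := lext D x - (c / lsum D x) *: D.
have [Pm sP] := lext_monic ix Dp.
have sQ : size Q = n.+1.
 rewrite size_polyDl sP// size_polyN; apply: (leq_ltn_trans (size_scale_leq _ _)).
 by rewrite ltnS.
have Qm : Q \is monic.
 apply/monicP; rewrite lead_coefDl ?(monicP Pm)// size_polyN sP.
 by apply: (leq_ltn_trans (size_scale_leq _ _)); rewrite ltnS.
have Qx j : Q.[x j] = D.[x j] / lsum D x * (Num.sg (lcoef x j) - c).
 by rewrite !hornerE lext_node//; ring.
have Qs j : 0 < Num.sg (lcoef x j) * Q.[x j].
 rewrite Qx mulrCA mulr_gt0 ?divr_gt0// mulrBr -expr2 sqr_sg lcoef_neq0//= subr_gt0.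
 apply: le_lt_trans c1; apply: le_trans (ler_norm _) _.
 by rewrite normrM normr_sg lcoef_neq0// mul1r.
have alt a b : x a < x b -> (forall l, l != a -> l != b -> 0 < (x a - x l) * (x b - x l)) ->
  lcoef x a * lcoef x b < 0.
 move=> ab h; have nab : b != a by apply: contraTneq ab => ->; rewrite ltxx.
 have nab' : a != b by rewrite eq_sym.
 rewrite /lcoef (bigD1 b)//= [X in _ * X](bigD1 a)//= mulrACA.
 rewrite [X in _ * (_ * X)](eq_bigl (fun i => (i != a) && (i != b))); last by move=> i; rewrite andbC.
 rewrite -big_split/= pmulr_llt0.
  by rewrite pmulr_llt0 ?invr_gt0 ?subr_gt0// invr_lt0 subr_lt0.
 by apply: prodr_gt0 => i /andP[ia ib]; rewrite -invfM invr_gt0 h.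
have rootQ i : (i < n)%N -> exists t, z i < t < z i.+1 /\ root Q t.
 move=> iN; have zz : z i < z i.+1 by exact: zlt.
 have [a za] := zx i (ltnW iN); have [b zb] := zx i.+1 iN.
 have ll : lcoef x a * lcoef x b < 0.
  apply: alt; first by rewrite -za -zb.
  move=> l la lb; have [m mn lm] := xz l; rewrite -za -zb lm.
  have [mi|im|mi] := ltngtP m i.
  - have h1 := zlt m i mi (ltnW iN); have h2 := zlt m i.+1 (ltnW mi) iN.
   by rewrite mulr_gt0// subr_gt0.
  - have [im1|im1|im1] := ltngtP m i.+1.
   + by move: im im1; rewrite ltnS => /leq_trans h /h; rewrite ltnn.
   + have h1 := zlt i m im mn; have h2 := zlt i.+1 m im1 mn.
    by rewrite nmulr_rgt0 subr_lt0.
   + by move: lb; rewrite -(inj_eq ix) lm im1 zb eqxx.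
  - by move: la; rewrite -(inj_eq ix) lm mi za eqxx.
 have QQ : Q.[z i] * Q.[z i.+1] < 0.
  have := mulr_gt0 (Qs a) (Qs b); rewrite mulrACA -sgrM ltr0_sg// mulN1r oppr_gt0.
  by rewrite za zb.
 have [t + rt] := polyrcf.poly_ivtoo (ltW zz) QQ.
 by rewrite in_itv => ti; exists t.
have /choice [y Hy] : forall i, exists t, (i < n)%N -> z i < t < z i.+1 /\ root Q t.
 by move=> i; have [/rootQ [t Ht]|_] := ltnP i n; [exists t|exists 0].
exists z, y; split => //; first by move=> i /Hy [].
have ylt i j : (i < j)%N -> (j < n)%N -> y i < y j.
 move=> ij jn; have /andP[_ h1] := (Hy i (ltn_trans ij jn)).1; have /andP[h2 _] := (Hy j jn).1.
 apply: lt_trans h2; apply: lt_le_trans h1 _; move: ij; rewrite leq_eqVlt => /orP[/eqP ->//|h].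
 by apply: ltW; apply: zlt => //; exact: ltnW.
have uy : uniq [seq y i | i <- iota 0 n].
 rewrite map_inj_in_uniq ?iota_uniq// => i j; rewrite !mem_iota !add0n /= => iN jN yij.
 apply/eqP; rewrite eqn_leq; apply/andP; split; rewrite leqNgt; apply/negP => h.
  by have := ylt j i h iN; rewrite yij ltxx.
 by have := ylt i j h jN; rewrite yij ltxx.
have := @all_roots_prod_XsubC R Q [seq y i | i <- iota 0 n].
rewrite size_map size_iota uniq_rootsE (monicP Qm) scale1r; apply => //.
by apply/allP => _ /mapP[i iN ->]; have [] := Hy i; rewrite // ; move: iN; rewrite mem_iota.
Qed.
End extremal.

(** * From finite sets to [K]: the bound on the extremal norm *)

Section extremal_bound.
Context {R} (n : nat) (K : set R) (mu : prob R) (V M S : R) (D : {poly R}).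
Hypotheses (cK : compact K) (pK : pot_ok K mu V).
Hypothesis KM : forall t, K t -> `|t| < M.
Hypotheses (D0 : forall t, K t -> 0 < D.[t]) (sD : (size D <= n)%N).
Hypothesis HS : forall z y : nat -> R, (forall i, (i <= n)%N -> K (z i)) ->
 (forall i, (i < n)%N -> z i < y i < z i.+1) -> \sum_(i < n) (V + pot K mu (y i, 0)) <= S.

Lemma ln_poly_continuous t : K t -> {for t, continuous (fun s => ln D.[s])}.
Proof.
move=> Kt; apply: (@continuous_comp _ _ _ (horner D) (@ln R)); first exact: poly_continuous.
by apply: continuous_ln; exact: D0.
Qed.

(** Put c = t / M in [interlace]. For fixed t the integral over u of ln |P(u) - c D(u) / s| is the
    sum of the potential at the interlacing points, at most S - n V. For fixed u the same expression
    is, in t, ln D(u) - ln s - ln M plus a logarithmic kernel whose integral is at least -V.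
    Averaging t by [mu] as well and exchanging the integrals bounds -ln s. *)
Lemma lext_bound (x : 'I_n.+1 -> R) : injective x -> (forall j, K (x j)) ->
 (lsum D x)^-1 <= expR (S - n%:R * V + V + ln M - \int[mu]_(s in K) ln D.[s]).
Proof.
move=> ix xK; have [muK at0 int ge] := pK.
have mK : measurable K by exact: compact_measurable.
have Dp j : 0 < D.[x j] by exact: D0.
have s0 := lsum_gt0 ix Dp; set s := lsum D x in s0 *.
have M0 : 0 < M by apply: le_lt_trans (KM (xK ord0)).
have sM : 0 < s * M by rewrite mulr_gt0.
have lDi : intR mu K (fun t => ln D.[t]).
 by apply: continuous_on_integrable => // t Kt; exact: ln_poly_continuous.
have ci (c : R) : intR mu K (fun=> c) by exact: cst_integrable.
pose P := lext D x.
have [B1 B10 HB1] : exists2 B, 0 < B & forall t, K t -> `|P.[t]| <= B.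
 have [B B0 HB] := compact_bound (continuous_compact (continuous_subspaceT (@poly_continuous _ P)) cK).
 by exists B => // t Kt; rewrite ler_norml; apply: HB; exists t.
have [B2 B20 HB2] : exists2 B, 0 < B & forall t, K t -> `|D.[t]| <= B.
 have [B B0 HB] := compact_bound (continuous_compact (continuous_subspaceT (@poly_continuous _ D)) cK).
 by exists B => // t Kt; rewrite ler_norml; apply: HB; exists t.
pose F (t u : R) := ln `|P.[u] - t / (s * M) * D.[u]|.
have mF : measurable_fun setT (fun z : R * R => F z.1 z.2).
 apply: (measurableT_comp (@measurable_ln R)); apply: measurableT_comp => //.
 apply: measurable_funB; first by apply: (measurableT_comp (@measurable_poly R P setT)).
 apply: measurable_funM; first exact: measurable_funM.
 by apply: (measurableT_comp (@measurable_poly R D setT)).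
have FC t u : K t -> K u -> F t u <= ln (1 + B1 + B2 / s).
 move=> Kt Ku; have le1 : `|P.[u] - t / (s * M) * D.[u]| <= 1 + B1 + B2 / s.
  apply: le_trans (ler_normB _ _) _; have := HB1 u Ku; have := HB2 u Ku => h2 h1.
  have : `|t / (s * M) * D.[u]| <= B2 / s.
   have e1 : `|t / (s * M)| <= s^-1.
    by rewrite normrM normfV (gtr0_norm sM) ler_pdivrMr// mulrA mulVf ?gt_eqF// mul1r ltW// KM.
   by rewrite normrM [leLHS]mulrC; apply: ler_pM.
  lra.
 have q0 : 0 <= B2 / s by apply: divr_ge0; exact: ltW.
 have p1 : 1 <= 1 + B1 + B2 / s by lra.
 have := normr_ge0 (P.[u] - t / (s * M) * D.[u]); rewrite /F le_eqVlt => /orP[/eqP <-|p].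
  by rewrite ln0// ln_ge0.
 by rewrite ler_ln// posrE (lt_le_trans ltr01).
have hi : intR mu K (fun u => - (ln s + ln M + V) + ln D.[u]).
 exact: (integrableD mK (ci _) lDi).
have main : \int[mu]_(u in K) (- (ln s + ln M + V) + ln D.[u]) <= S - n%:R * V.
 apply: (@swap_le R mu mu K K F _ (S - n%:R * V) (ln (1 + B1 + B2 / s))) => //.
 - move=> t Kt; have c1 : `|t / M| < 1.
   by rewrite normrM normfV (gtr0_norm M0) ltr_pdivrMr// mul1r KM.
  have [z [y [zx zy E]]] := interlace ix Dp sD c1.
  have [mN N0] := null_seq [seq y i | i <- iota 0 n] at0.
  have si := @Rint_sum R nat mu K (iota 0 n) (fun i u => lg (y i, 0) u) mK (fun i => int _).
  have [||i ->] := @Rint_off_null R mu K [set u | u \in [seq y i | i <- iota 0 n]] (F t)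
   (fun u => \sum_(i <- iota 0 n) lg (y i, 0) u) mK mN N0 _ si.1.
  + apply: (measurableT_comp (@measurable_ln R)); apply: measurableT_comp => //.
   apply: measurable_funB; first exact: measurable_poly.
   by apply: measurable_funM => //; exact: measurable_poly.
  + move=> u Ku uN.
   have ev : P.[u] - t / (s * M) * D.[u] = \prod_(v <- [seq y i | i <- iota 0 n]) (u - v).
    have := congr1 (fun p => p.[u]) E; rewrite horner_prod !hornerE -/s -/P.
    rewrite (eq_bigr (fun v => u - v)); last by move=> v _; rewrite !hornerE.
    by move=> <-; congr (_ - _ * _); rewrite invfM; ring.
   rewrite /F ev normr_prod big_map.
   elim: (iota 0 n) (uN : ~ (u \in [seq y i | i <- iota 0 n])) => [|j r IH] nr; first by rewrite !big_nil ln1.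
   move: nr; rewrite /= in_cons => /negP; rewrite negb_or => /andP[uj ur].
   have p (r' : seq nat) : u \notin [seq y i | i <- r'] -> 0 < \prod_(i <- r') `|u - y i|.
    move=> h; rewrite big_seq; apply: prodr_gt0 => i ir; rewrite normr_gt0 subr_eq0.
    by apply: contraNneq h => ->; apply/mapP; exists i.
   rewrite !big_cons lnM ?posrE ?p//; last by rewrite normr_gt0 subr_eq0.
   by rewrite IH; [rewrite lg_real distrC|exact/negP].
  split => //; rewrite -si.2.
  have zK k : (k <= n)%N -> K (z k) by move=> kN; have [j ->] := zx k kN; exact: xK.
  have := HS zK zy; rewrite big_split/= sumr_const card_ord.
  rewrite -[V *+ n]mulr_natl -(big_mkord xpredT (fun i => pot K mu (y i, 0))) /index_iota subn0 /pot.
  by rewrite addrC -lerBrDr.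
 - move=> u Ku; have Du := D0 Ku; pose a := P.[u] * (s * M) / D.[u].
  have gi : intR mu K (fun t => - (ln s + ln M) + ln D.[u] + lg (a, 0) t).
   exact: (integrableD mK (ci _) (int _)).
  have [|i ->] := @Rint_off_point R mu K (F^~ u) _ a mK (at0 a) gi.
   move=> t Kt ta; rewrite /F lg_real.
   have -> : P.[u] - t / (s * M) * D.[u] = D.[u] / (s * M) * (a - t).
    by rewrite /a; field; rewrite !gt_eqF.
   rewrite normrM (gtr0_norm (divr_gt0 Du sM)) lnM ?posrE ?divr_gt0//; last by rewrite normr_gt0 subr_eq0 eq_sym.
   by rewrite ln_div ?posrE// lnM ?posrE//; ring.
  split => //; rewrite RintegralD// ?Rint_prob_cst//.
  by have := ge (a, 0); rewrite /pot; set I := Rintegral _ _ _; lra.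
rewrite RintegralD// ?Rint_prob_cst// in main.
rewrite -ler_ln ?posrE ?invr_gt0 ?expR_gt0// expRK lnV ?posrE//.
by move: main; set I := Rintegral _ _ _; lra.
Qed.

(** Passage from a finite net to [K] at the cost of a factor 2. Between net points P is controlled
    through its expansion at the fixed nodes x0, where it obeys the same bound: the oscillation of
    the finitely many [lpoly x0 j] is fixed before P is known. *)
Lemma extremal_poly : infinite_set K -> exists P : {poly R}, [/\ P \is monic, size P = n.+1 &
 forall t, K t -> `|P.[t]| <= 2 * expR (S - n%:R * V + V + ln M - \int[mu]_(s in K) ln D.[s]) * D.[t]].
Proof.
move=> iK; set M0 := expR _; have M00 : 0 < M0 by exact: expR_gt0.
have [x0 [ix0 x0K]] : exists x0 : 'I_n.+1 -> R, injective x0 /\ forall j, K (x0 j).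
 have [r [sr ur rK]] := infinite_uniq_seq n.+1 iK.
 exists (fun j : 'I_n.+1 => nth 0 r j); split; last by move=> j; apply: rK; rewrite mem_nth// sr.
 by move=> i j /eqP; rewrite nth_uniq ?sr// => /eqP /val_inj.
have [t0 Kt0 tmin] : exists2 t0, K t0 & forall t, K t -> D.[t0] <= D.[t].
 have [x Kx] : K !=set0 by exists (x0 ord0).
 have [t0 /set_mem Kt0 tm] := compact_EVT_min (ex_intro _ x Kx) cK (continuous_subspaceT (@poly_continuous _ D)).
 by exists t0 => // t Kt; apply: tm; exact: mem_set.
set d := D.[t0] in tmin; have d0 : 0 < d by exact: D0.
have Dp j : 0 < D.[x0 j] by exact: D0.
pose L := lsum D x0; have L0 : 0 < L by exact: lsum_gt0.
(* Gives L eta + eta = d, the minimum of D on [K]: the oscillations of P and of D together cost at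
   most one more M0 D(t). *)
pose eta := d / (L + 1); have e0 : 0 < eta by rewrite divr_gt0// addr_gt0.
have eL : L * eta + eta = d.
 by rewrite -{2}[eta]mul1r -mulrDl /eta mulrC divfK// gt_eqF// addr_gt0.
have [X [XP Xc _]] : exists X : seq (R * R), [/\ forall p, p \in X -> K p.1 /\
  (forall y, `|y - p.1| < p.2 -> `|D.[p.1] - D.[y]| <= eta /\
    forall j, `|(lpoly x0 j).[p.1] - (lpoly x0 j).[y]| <= eta),
  forall t, K t -> has (inball t) X & forall t, (count (inball t) X <= 2)%N].
 apply: (@cover_mult2 R K (fun a r => forall y, `|y - a| < r -> `|D.[a] - D.[y]| <= eta /\
    forall j, `|(lpoly x0 j).[a] - (lpoly x0 j).[y]| <= eta)) => // a _.
 have nD : \forall y \near a, `|D.[a] - D.[y]| <= eta by exact: ((cvgrPdist_le _ _).1 (@poly_continuous R D a) _ e0).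
 have nL : \forall y \near a, forall j, `|(lpoly x0 j).[a] - (lpoly x0 j).[y]| <= eta.
  by apply: (@filter_forall _ _ _ (nbhs a)) => j; exact: ((cvgrPdist_le _ _).1 (@poly_continuous R (lpoly x0 j) a) _ e0).
 have [r /= r0 Hr] := (nbhs_ballP _ _).1 (filterI nD nL).
 by exists r => // y yr; apply: Hr; rewrite /ball/= distrC.
pose Y := [seq x0 j | j <- enum 'I_n.+1] ++ [seq p.1 | p <- X].
have YK y : y \in Y -> K y.
 rewrite mem_cat => /orP[/mapP[j _ ->]|/mapP[p pX ->]]; first exact: x0K.
 by have [] := XP p pX.
have x0Y j : x0 j \in Y by rewrite mem_cat; apply/orP; left; apply/mapP; exists j; rewrite ?mem_enum.
have [x [ix xY Hx]] := finite_extremal ix0 x0Y (fun y yY => D0 (YK y yY)).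
have Dx j : 0 < D.[x j] by apply: D0; exact: YK.
have [Pm sP] := lext_monic ix Dx; set P := lext D x in Pm sP Hx.
exists P; split => // t Kt.
have PY y : y \in Y -> `|P.[y]| <= M0 * D.[y].
 move=> yY; apply: le_trans (Hx y yY) _; rewrite mulrC; apply: ler_wpM2r; first by apply: ltW; apply: D0; exact: YK.
 exact: (lext_bound ix (fun j => YK _ (xY j))).
have /hasP[p pX tp] := Xc t Kt; have [Kp /(_ t tp) [oD oL]] := XP p pX.
have pY : p.1 \in Y by rewrite mem_cat; apply/orP; right; apply/mapP; exists p.
have PE u : P.[u] = \sum_j P.[x0 j] * lcoef x0 j * (lpoly x0 j).[u].
 by rewrite {1}(lagrange ix0 (eq_leq sP)) horner_sum; apply: eq_bigr => j _; rewrite hornerZ.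
have dP : `|P.[t] - P.[p.1]| <= M0 * L * eta.
 rewrite (PE t) (PE p.1) -sumrB; apply: le_trans (ler_norm_sum _ _ _) _.
 rewrite /L /lsum mulr_sumr mulr_suml; apply: ler_sum => j _.
 rewrite -mulrBr normrM normrM [M0 * _]mulrA; apply: ler_pM => //.
  by rewrite ler_wpM2r// PY.
 by rewrite distrC.
have h1 := PY p.1 pY.
have h2 : `|P.[t]| <= `|P.[t] - P.[p.1]| + `|P.[p.1]| by rewrite -{1}(subrK P.[p.1] P.[t]) ler_normD.
have h3 : D.[p.1] <= D.[t] + eta by move: oD; rewrite ler_norml => /andP[_]; lra.
have h4 := tmin t Kt.
have h5 : M0 * D.[p.1] <= M0 * (D.[t] + eta) by rewrite ler_pM2l.
have h6 : M0 * d <= M0 * D.[t] by rewrite ler_pM2l.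
have h7 : M0 * d = M0 * L * eta + M0 * eta by rewrite -eL; ring.
by move: h1 h2 dP h5 h6 h7; rewrite mulrDr -!mulrA; lra.
Qed.
End extremal_bound.

(** * Bernstein polynomials *)

Section bernstein.
Context {R}.
Implicit Types (phi psi : nat -> R) (x : R).

(** Bernstein polynomial of the values phi 0, ..., phi n by de Casteljau's recursion; monotonicity,
    linearity and the variance follow by induction without binomial coefficients. *)
Fixpoint bern n phi : {poly R} :=
 if n is m.+1 then 'X * bern m (fun k => phi k.+1) + (1 - 'X) * bern m phi else (phi 0)%:P.

Lemma bernS n phi x : (bern n.+1 phi).[x] = x * (bern n (fun k => phi k.+1)).[x] + (1 - x) * (bern n phi).[x].
Proof. by rewrite /= !hornerE. Qed.

Lemma bern_le n phi psi x : 0 <= x <= 1 -> (forall k, (k <= n)%N -> phi k <= psi k) ->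
 (bern n phi).[x] <= (bern n psi).[x].
Proof.
move=> /andP[x0 x1]; elim: n phi psi => [|n IH] phi psi h; first by rewrite /= !hornerE; exact: h.
rewrite !bernS; apply: lerD; apply: ler_wpM2l => //; rewrite ?subr_ge0//.
 by apply: IH => k kn; exact: h.
by apply: IH => k kn; apply: h; exact: leqW.
Qed.

Lemma bern_lin n phi psi a b x :
 (bern n (fun k => a * phi k + b * psi k)).[x] = a * (bern n phi).[x] + b * (bern n psi).[x].
Proof.
elim: n phi psi => [|n IH] phi psi; first by rewrite /= !hornerE.
by rewrite !bernS !IH; ring.
Qed.

Lemma bern_cst n c x : (bern n (fun=> c)).[x] = c.
Proof. by elim: n => [|n IH]; [rewrite /= !hornerE|rewrite bernS !IH; ring]. Qed.

Lemma bern_variance n a x : (bern n (fun k => (k%:R - a) ^+ 2)).[x] = n%:R * x * (1 - x) + (n%:R * x - a) ^+ 2.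
Proof.
elim: n a => [|n IH] a; first by rewrite /= !hornerE; ring.
rewrite bernS (_ : (fun k => (k.+1%:R - a) ^+ 2) = (fun k => (k%:R - (a - 1)) ^+ 2)); last first.
 by apply/funext => k; rewrite -natr1; congr (_ ^+ 2); ring.
by rewrite !IH -natr1; ring.
Qed.

(** The inequality |u| <= eta + u^2 / eta reduces the mean deviation to the variance n x (1 - x). *)
Lemma bern_lip n L eta f x : (0 < n)%N -> 0 <= L -> lip L f -> 0 < eta -> 0 <= x <= 1 ->
 `|(bern n (fun k => f (k%:R / n%:R))).[x] - f x| <= L * (eta + (n%:R * eta)^-1).
Proof.
move=> n0 L0 fl e0 x01; have n0' : 0 < n%:R :> R by rewrite ltr0n.
have osc k : `|f (k%:R / n%:R) - f x| <= L * eta + L / (n%:R ^+ 2 * eta) * (k%:R - n%:R * x) ^+ 2.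
 apply: le_trans (fl _ _) _; set u := k%:R / n%:R - x.
 have -> : L / (n%:R ^+ 2 * eta) * (k%:R - n%:R * x) ^+ 2 = L * (u ^+ 2 / eta).
  by rewrite /u; field; rewrite !gt_eqF.
 rewrite -mulrDr ler_wpM2l//.
 have uu : u ^+ 2 = `|u| ^+ 2 by rewrite real_normK ?num_real.
 rewrite uu; have := normr_ge0 u; set v := `|u| => v0.
 rewrite -(ler_pM2r e0) mulrDl divfK ?gt_eqF//; nra.
pose b k := L * eta * 1 + L / (n%:R ^+ 2 * eta) * (k%:R - n%:R * x) ^+ 2.
have bE : (bern n b).[x] <= L * (eta + (n%:R * eta)^-1).
 rewrite /b (bern_lin n (fun=> 1) (fun k => (k%:R - n%:R * x) ^+ 2)) bern_cst bern_variance.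
 have /andP[x0 x1] := x01.
 have -> : L * eta * 1 + L / (n%:R ^+ 2 * eta) * (n%:R * x * (1 - x) + (n%:R * x - n%:R * x) ^+ 2) =
   L * (eta + (n%:R * eta)^-1 * (x * (1 - x))) by field; rewrite !gt_eqF.
 rewrite ler_wpM2l// lerD2l ler_piMr ?invr_ge0 ?mulr_ge0 ?(ltW n0') ?(ltW e0)//; nra.
have up : (bern n (fun k => 1 * f (k%:R / n%:R) + (- 1) * f x)).[x] <= (bern n b).[x].
 apply: bern_le => // k _; have := osc k; rewrite ler_norml /b => /andP[_]; lra.
have lo : (bern n (fun k => (- 1) * f (k%:R / n%:R) + 1 * f x)).[x] <= (bern n b).[x].
 apply: bern_le => // k _; have := osc k; rewrite ler_norml /b => /andP[+ _]; lra.
move: up lo; rewrite (bern_lin n _ (fun=> f x)) (bern_lin n _ (fun=> f x)) bern_cst.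
by rewrite ler_norml => up lo; apply/andP; split; lra.
Qed.

Lemma weierstrass_lip f L B eps : 0 <= L -> lip L f -> 0 < B -> 0 < eps ->
 exists p : {poly R}, forall t, - B <= t <= B -> `|p.[t] - f t| <= eps.
Proof.
move=> L0 fl B0 e0; pose g x := f (2 * B * x - B); pose L' := L * (2 * B).
have L'0 : 0 <= L' by rewrite mulr_ge0//; lra.
have gl : lip L' g.
 move=> x y; apply: le_trans (fl (2 * B * x - B) (2 * B * y - B)) _.
 rewrite /L' -[L * (2 * B) * _]mulrA ler_wpM2l//.
 rewrite (_ : 2 * B * x - B - (2 * B * y - B) = 2 * B * (x - y)); last by ring.
 by rewrite normrM gtr0_norm// mulr_gt0.
pose eta := eps / (2 * (L' + 1)); have L1 : 0 < L' + 1 by lra.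
have eta0 : 0 < eta by rewrite divr_gt0// mulr_gt0.
have etaE : (L' + 1) * (eta + eta) = eps by rewrite /eta; field; rewrite gt_eqF.
clearbody eta.
pose n := (Num.truncn ((eta ^+ 2)^-1)).+1.
have n0 : (0 < n)%N by [].
have nn : (n%:R * eta)^-1 <= eta.
 have h : (eta ^+ 2)^-1 < n%:R by exact: Num.Theory.truncnS_gt.
 rewrite -[leRHS]invrK lef_pV2 ?posrE ?invr_gt0 ?mulr_gt0//.
 rewrite -(ler_pM2r (x := eta^-1)) ?invr_gt0// mulfK ?gt_eqF// -invfM -expr2.
 exact: ltW.
clearbody n.
exists ((bern n (fun k => g (k%:R / n%:R))) \Po ((2 * B)^-1 *: ('X + B%:P))) => t /andP[t0 t1].
rewrite horner_comp !hornerE; set x := _ * (t + B).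
have x01 : 0 <= x <= 1.
 by rewrite /x mulr_ge0 ?invr_ge0 /=; [rewrite mulrC ler_pdivrMr|lra|lra]; lra.
have -> : f t = g x by rewrite /g /x; congr f; field; rewrite gt_eqF.
apply: le_trans (bern_lip n0 L'0 gl eta0 x01) _.
have : L' * (eta + (n%:R * eta)^-1) <= L' * (eta + eta) by rewrite ler_wpM2l// lerD2l.
move: etaE; rewrite mulrDl mul1r => etaE h; apply: le_trans h _; lra.
Qed.
End bernstein.

(** * Approximation of the weight from above *)

Section supconv.
Context {R} (e : set R) (w : R -> R) (B : R).
Hypotheses (e0 : e !=set0) (wB : forall x, e x -> 0 <= w x <= B).
Hypothesis wu : upper_semicontinuous_on e (EFin \o w).

(** Sup-convolution of w: Lipschitz of constant k, at least w on [e], and decreasing to w there by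
    upper semicontinuity. [wk] adds a cut at 0 and 1 / (k + 1) to be positive on the whole line. *)
Definition supc (k : nat) (t : R) : R := sup [set w x - k%:R * `|x - t| | x in e].
Definition wk (k : nat) (t : R) : R := Num.max 0 (supc k t) + k.+1%:R^-1.

Lemma supc_ub k t x : e x -> w x - k%:R * `|x - t| <= supc k t.
Proof.
move=> ex; apply: ub_le_sup; last by exists x.
exists B => _ [y ey <-]; have /andP[_ yB] := wB ey.
have : 0 <= k%:R * `|y - t| by rewrite mulr_ge0.
lra.
Qed.

Lemma supc_le k t b : (forall x, e x -> w x - k%:R * `|x - t| <= b) -> supc k t <= b.
Proof.
move=> h; apply: ge_sup; first by have [x ex] := e0; exists (w x - k%:R * `|x - t|); exists x.
by move=> _ [x ex <-]; exact: h.
Qed.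

Lemma B_ge0 : 0 <= B.
Proof. by have [x /wB/andP[h1 h2]] := e0; exact: le_trans h2. Qed.

Lemma wk_gt0 k t : 0 < wk k t.
Proof. by rewrite ltr_wpDl ?invr_gt0// le_max lexx. Qed.

Lemma wk_ub k t : wk k t <= B + 1.
Proof.
apply: lerD; last by rewrite invf_le1// ler1n.
rewrite ge_max B_ge0/=; apply: supc_le => x ex; have /andP[_ xB] := wB ex.
have : 0 <= k%:R * `|x - t| by rewrite mulr_ge0.
lra.
Qed.

Lemma wk_ge k t : e t -> w t <= wk k t.
Proof.
move=> et; have := supc_ub k t et; rewrite subrr normr0 mulr0 subr0 => h.
apply: le_trans h _; apply: (@le_trans _ _ (Num.max 0 (supc k t))); first by rewrite le_max lexx orbT.
by rewrite lerDl invr_ge0.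
Qed.

Lemma wk_lip k : lip k%:R (wk k).
Proof.
have one s t : Num.max 0 (supc k s) <= Num.max 0 (supc k t) + k%:R * `|s - t|.
 have h : supc k s <= supc k t + k%:R * `|s - t|.
  apply: supc_le => x ex; have h1 := supc_ub k t ex.
  have : k%:R * `|x - t| <= k%:R * (`|x - s| + `|s - t|).
   by rewrite ler_wpM2l//; apply: le_trans (ler_normD _ _); rewrite addrA subrK.
  by rewrite mulrDr; lra.
 rewrite ge_max; apply/andP; split; first by rewrite addr_ge0// le_max lexx.
 by apply: le_trans h _; rewrite lerD2r le_max lexx orbT.
move=> s t; rewrite /wk (_ : forall a b c : R, a + c - (b + c) = a - b) ?ler_norml; last by move=> *; ring.
have := one s t; have := one t s; rewrite [`|t - s|]distrC => h1 h2.
by apply/andP; split; lra.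
Qed.

Lemma wk_decr k t : wk k.+1 t <= wk k t.
Proof.
apply: lerD; last by rewrite lef_pV2 ?posrE ?ltr0n// ler_nat.
rewrite ge_max le_max lexx/= le_max; apply/orP; right.
apply: supc_le => x ex; apply: le_trans (supc_ub k t ex).
by rewrite lerB// ler_wpM2r// ler_nat.
Qed.

Lemma wk_lim t eps : e t -> 0 < eps -> exists k, wk k t < w t + eps.
Proof.
move=> et ep; have e2 : 0 < eps / 2 by rewrite divr_gt0.
have : ((EFin \o w) t < (w t + eps / 2)%:E)%E by rewrite /= lte_fin ltrDl.
move=> /(wu et); rewrite near_withinE => H.
have [r /= r0 Hr] := (nbhs_ballP _ _).1 H.
pose k := (Num.truncn (B / r + (eps / 2)^-1)).+1; exists k.
have kk : B / r + (eps / 2)^-1 < k%:R by exact: Num.Theory.truncnS_gt.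
have Br : 0 <= B / r by rewrite divr_ge0 ?B_ge0 ?ltW.
have ei : 0 < (eps / 2)^-1 by rewrite invr_gt0.
have kr : B <= k%:R * r by rewrite -ler_pdivrMr// ltW//; lra.
have ke : k.+1%:R^-1 < eps / 2.
 rewrite -[ltRHS]invrK ltf_pV2 ?posrE//; apply: (@lt_le_trans _ _ k%:R); first lra.
 by rewrite ler_nat.
have w0 : 0 <= w t by have /andP[] := wB et.
have : Num.max 0 (supc k t) <= w t + eps / 2.
 rewrite ge_max; apply/andP; split; first lra.
 apply: supc_le => x ex; have [xt|xt] := ltP `|t - x| r.
  have := Hr x xt ex; rewrite /= lte_fin => h.
  have : 0 <= k%:R * `|x - t| by rewrite mulr_ge0.
lra.
 have /andP[_ xB] := wB ex.
 have : k%:R * r <= k%:R * `|x - t| by rewrite ler_wpM2l// distrC.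
 lra.
by move=> h; rewrite /wk [eps in ltRHS]splitr addrA; exact: ler_ltD.
Qed.

(** -ln w shifted by ln (B + 1): on [e] it is nonnegative, and +oo where w vanishes. Condition (b)
    becomes finiteness of its integral, and the continuous functions [fk] increase to it. *)
Definition flog (t : R) : \bar R := ((ln (B + 1))%:E - lne (w t)%:E)%E.
Definition fk k t : R := ln (B + 1) - ln (wk k t).

Lemma fk_ge0 k t : 0 <= fk k t.
Proof. by rewrite subr_ge0 ler_ln ?posrE ?wk_gt0 ?wk_ub// (lt_le_trans (wk_gt0 k t))// wk_ub. Qed.

Lemma fk_continuous k : continuous (fk k).
Proof.
move=> t; apply: cvgB; first exact: cvg_cst.
apply: (@continuous_comp _ _ _ (wk k) (@ln R)); last by apply: continuous_ln; exact: wk_gt0.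
exact: (lip_continuous (ler0n R k) (@wk_lip k)).
Qed.

Lemma fk_nd t : {homo fk^~ t : a b / (a <= b)%N >-> a <= b}.
Proof.
apply: homo_leq => //; first by move=> ? ? ?; exact: le_trans.
by move=> k; rewrite lerD2l lerN2 ler_ln ?posrE ?wk_gt0// wk_decr.
Qed.

Lemma fk_cvg t : e t -> (fk k t)%:E @[k --> \oo] --> flog t.
Proof.
move=> et.
have nd : nondecreasing_seq (fun k => (fk k t)%:E).
 by move=> a b ab; rewrite lee_fin; exact: fk_nd.
have := ereal_nondecreasing_cvgn nd; suff -> : ereal_sup (range (fun k => (fk k t)%:E)) = flog t by [].
apply/eqP; rewrite eq_le; apply/andP; split.
 apply: ge_ereal_sup => _ [k _ <-]; rewrite /fk /flog EFinB leeB//.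
 rewrite -lne_EFin ?wk_gt0//; have [w0|w0] := leP (w t) 0; first by rewrite le0_lneNy ?leNye// lee_fin.
 by rewrite !lne_EFin ?wk_gt0// lee_fin ler_ln ?posrE ?wk_gt0 ?wk_ge.
have key (r : R) : (r%:E < flog t)%E -> exists k, r < fk k t.
 move=> rf; have lt : w t < expR (ln (B + 1) - r).
  have [w0|w0] := leP (w t) 0; first exact: le_lt_trans w0 (expR_gt0 _).
  move: rf; rewrite /flog lne_EFin// -EFinB lte_fin => h.
  by rewrite -[ltLHS]lnK ?posrE// ltr_expR; lra.
 have d0 : 0 < expR (ln (B + 1) - r) - w t by rewrite subr_gt0.
 have [k] := wk_lim et d0; rewrite addrC subrK => kl; exists k.
 have : ln (wk k t) < ln (B + 1) - r by rewrite -[ltRHS]expRK ltr_ln ?posrE ?wk_gt0 ?expR_gt0.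
 by rewrite /fk; lra.
rewrite leNgt; apply/negP => lt.
have [r /andP[r1 r2]] : exists r : R, ((ereal_sup (range (fun k => (fk k t)%:E)) < r%:E) && (r%:E < flog t))%E.
 have := lt; move: (ereal_sup _) (flog t) => [a| |] [b| |] //= h.
 - by move: h; rewrite lte_fin => h; exists ((a + b) / 2); rewrite !lte_fin; apply/andP; split; lra.
 - by exists (a + 1); rewrite lte_fin ltrDl ltr01 ltry.
 - by exists (b - 1); rewrite lte_fin ltrBlDr ltrDl ltr01 ltNyr.
 - by exists 0; rewrite ltNyr ltry.
have [k rk] := key r r2.
have : ((fk k t)%:E <= ereal_sup (range (fun k => (fk k t)%:E)))%E by apply: ereal_sup_ubound; exists k.
by move=> /le_lt_trans/(_ r1); rewrite lte_fin => h; move: (lt_trans h rk); rewrite ltxx.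
Qed.

Lemma flog_ge0 t : e t -> (0 <= flog t)%E.
Proof.
move=> et; have /andP[w0 w1] := wB et; rewrite /flog.
have [w0'|w0'] := leP (w t) 0; first by rewrite le0_lneNy ?leey// lee_fin.
rewrite lne_EFin// -EFinB lee_fin subr_ge0 ler_ln ?posrE//; lra.
Qed.

Section integral.
Context (mu : prob R) (K : set R) (phi : R -> R).
Hypotheses (mK : measurable K) (mp : measurable_fun setT phi) (Ke : forall s, K s -> e (phi s)).
Hypothesis (muK : mu K = 1%E).

Lemma fk_measurable k : measurable_fun setT (fun s => fk k (phi s)).
Proof. by apply: (measurableT_comp _ mp); apply: continuous_measurable_fun; exact: fk_continuous. Qed.

Lemma flog_measurable : measurable_fun K (fun s => flog (phi s)).
Proof.
apply: (emeasurable_fun_cvg (fun k s => (fk k (phi s))%:E)).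
 by move=> k; apply: measurable_funTS; apply/measurable_EFinP; exact: fk_measurable.
by move=> s Ks; apply: fk_cvg; exact: Ke.
Qed.

Lemma fk_integral_cvg : (\int[mu]_(s in K) (fk k (phi s))%:E)%E @[k --> \oo] --> (\int[mu]_(s in K) flog (phi s))%E.
Proof.
have -> : (\int[mu]_(s in K) flog (phi s) = \int[mu]_(s in K) (limn (fun k => (fk k (phi s))%:E)))%E.
 by apply: eq_integral => s /set_mem Ks; apply/esym/cvg_lim => //; apply: fk_cvg; exact: Ke.
apply: (@cvg_monotone_convergence _ _ _ mu K mK (fun k s => (fk k (phi s))%:E)).
- by move=> k; apply: measurable_funTS; apply/measurable_EFinP; exact: fk_measurable.
- by move=> k s _; rewrite lee_fin fk_ge0.
- by move=> s _ a b ab; rewrite lee_fin fk_nd.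
Qed.

Lemma fk_integral_le k : (\int[mu]_(s in K) (fk k (phi s))%:E <= \int[mu]_(s in K) flog (phi s))%E.
Proof.
apply: le_integral_pointwise => s Ks.
have nd : nondecreasing_seq (fun k => (fk k (phi s))%:E) by move=> a b ab; rewrite lee_fin; exact: fk_nd.
have c := fk_cvg (Ke Ks); have c' := ereal_nondecreasing_cvgn nd.
by rewrite (cvg_unique _ c c')//; apply: ereal_sup_ubound; exists k.
Qed.

Lemma lne_flog : (-oo < \int[mu]_(s in K) lne (w (phi s))%:E)%E <-> (\int[mu]_(s in K) flog (phi s) < +oo)%E.
Proof.
have B1 := B_ge0; have lB : 0 <= ln (B + 1) by apply: ln_ge0; lra.
pose u s := lne (w (phi s))%:E.
have uB s : K s -> (u s <= (ln (B + 1))%:E)%E.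
 move=> /Ke et; have /andP[w0 w1] := wB et; rewrite /u.
 have [w0'|w0'] := leP (w (phi s)) 0; first by rewrite le0_lneNy ?leNye ?lee_fin.
 by rewrite lne_EFin// lee_fin ler_ln ?posrE//; lra.
have np s : K s -> (u^\- s = maxe (flog (phi s) - (ln (B + 1))%:E) 0)%E.
 move=> _; rewrite funenegE /flog -/(u s); congr maxe.
 by case: (u s) => [r| |] //=; rewrite -?EFinN -?EFinD; congr (_%:E); ring.
have mneg : measurable_fun K (fun s => maxe (flog (phi s) - (ln (B + 1))%:E) 0)%E.
 by apply: measurable_maxe => //; apply: emeasurable_funB => //; exact: flog_measurable.
have cint : (\int[mu]_(s in K) (ln (B + 1))%:E = (ln (B + 1))%:E)%E.
 rewrite Rintegral_EFin ?Rint_prob_cst//.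
 by exact: cst_integrable.
have posf : (\int[mu]_(s in K) u^\+ s < +oo)%E.
 apply: (@le_lt_trans _ _ (\int[mu]_(s in K) (ln (B + 1))%:E)%E).
  apply: le_integral_pointwise => s Ks; rewrite funeposE ge_max uB//= lee_fin//.
 by rewrite cint ltry.
have pos0 : (0 <= \int[mu]_(s in K) u^\+ s)%E by apply: integral_ge0 => s _; exact: funepos_ge0.
have neg0 : (0 <= \int[mu]_(s in K) u^\- s)%E by apply: integral_ge0 => s _; exact: funeneg_ge0.
rewrite -/(u _) integralE.
have -> : (-oo < \int[mu]_(s in K) u^\+ s - \int[mu]_(s in K) u^\- s)%E <-> (\int[mu]_(s in K) u^\- s < +oo)%E.
 move: posf pos0 neg0; case: (\int[mu]_(s in K) u^\+ s)%E => [p| |] //.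
 by case: (\int[mu]_(s in K) u^\- s)%E => [m| |] // _ _ _; split => // _; rewrite -?EFinB ?ltNyr ?ltry.
split=> fin.
- apply: (@le_lt_trans _ _ (\int[mu]_(s in K) (u^\- s + (ln (B + 1))%:E))%E).
  apply: le_integral_pointwise => s Ks; rewrite np// /flog.
  apply: (@le_trans _ _ ((flog (phi s) - (ln (B + 1))%:E) + (ln (B + 1))%:E)%E); last first.
   by rewrite leeD2r// le_max lexx.
  by rewrite /flog -/(u s); case: (u s) => [r| |] //=; rewrite -?EFinN -?EFinD// lee_fin; lra.
 rewrite ge0_integralD//.
 + by rewrite cint; move: fin neg0; case: (\int[mu]_(s in K) u^\- s)%E => [m| |] // _ _; rewrite -EFinD ltry.
 + by apply: eq_measurable_fun mneg => s /set_mem Ks; rewrite np.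
- apply: le_lt_trans fin; apply: le_integral_pointwise => s Ks; rewrite np// ge_max flog_ge0 ?andbT; last exact: Ke.
 rewrite leeBlDr// leeDl// lee_fin//.
Qed.

Hypothesis ce : compact e.
Hypothesis fi : forall f : R -> R, continuous f -> intR mu K (f \o phi).

Lemma weight_poly T : (\int[mu]_(s in K) flog (phi s) = +oo)%E ->
 exists E : {poly R}, [/\ forall t, e t -> 0 < E.[t], forall t, e t -> w t * E.[t] <= 1 &
  forall f, (forall s, K s -> f s = ln E.[phi s]) -> intR mu K f -> T <= \int[mu]_(s in K) f s].
Proof.
move=> inf; have c := fk_integral_cvg; rewrite inf in c.
(* The losses to be covered: ln (B + 1) from the shift in [fk], and ln 2 from the bound E >= 1 / (2
   wk). *)
have /cvgeyPge/(_ (T + ln (B + 1) + ln 2)) [k _ /(_ k (leqnn k))] := c.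
rewrite /= Rintegral_EFin//; last exact: (fi (@fk_continuous k)).
rewrite lee_fin => kT.
have [Be Be0 eB] := compact_bound ce.
have B1 := B_ge0; pose c0 := (B + 1)^-1; have c00 : 0 < c0 by rewrite invr_gt0; lra.
have kinv t : c0 <= (wk k t)^-1 by rewrite lef_pV2 ?posrE ?wk_gt0 ?wk_ub//; lra.
(* E will approximate 3 / (4 wk) within 1 / (4 (B + 1)), which is at most 1 / (4 wk); hence 1 / (2
   wk) <= E <= 1 / wk, and w E <= 1 on [e]. *)
have il : lip (k%:R * k.+1%:R ^+ 2) (fun t => 3 / 4 * (wk k t)^-1).
 have lo t : k.+1%:R^-1 <= wk k t by rewrite lerDr le_max lexx.
 have inv t : (wk k t)^-1 <= k.+1%:R by rewrite -[leRHS]invrK lef_pV2 ?posrE ?wk_gt0// invr_gt0.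
 move=> s t; have [p1 p2] := (wk_gt0 k s, wk_gt0 k t).
 have -> : 3 / 4 * (wk k s)^-1 - 3 / 4 * (wk k t)^-1 =
   3 / 4 * ((wk k t - wk k s) * ((wk k s)^-1 * (wk k t)^-1)) by field; rewrite !gt_eqF.
 have q34 : 0 < 3 / 4 :> R by lra.
 rewrite normrM (gtr0_norm q34).
 rewrite normrM [`|_ * (wk k t)^-1|]gtr0_norm ?mulr_gt0 ?invr_gt0// distrC.
 have h1 := @wk_lip k s t.
 have h2 : (wk k s)^-1 * (wk k t)^-1 <= k.+1%:R ^+ 2.
  by rewrite expr2; apply: ler_pM => //; rewrite invr_ge0 ltW.
 have h3 : `|wk k s - wk k t| * ((wk k s)^-1 * (wk k t)^-1) <= k%:R * `|s - t| * k.+1%:R ^+ 2.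
  by apply: ler_pM => //; rewrite mulr_ge0 ?invr_ge0 ?ltW.
 rewrite [leRHS]mulrAC; apply: le_trans h3; apply: ler_piMl; last by lra.
 by rewrite !mulr_ge0 ?invr_ge0 ?(ltW p1) ?(ltW p2).
have L0 : 0 <= k%:R * k.+1%:R ^+ 2 :> R by rewrite mulr_ge0// exprn_ge0.
have c4 : 0 < c0 / 4 by rewrite divr_gt0.
have [E HE] := weierstrass_lip L0 il Be0 c4.
have EP t : e t -> 2^-1 * (wk k t)^-1 <= E.[t] /\ E.[t] <= (wk k t)^-1.
 by move=> et; have := HE t (eB t et); have := kinv t; rewrite ler_norml => ? /andP[? ?]; split; lra.
have Ep t : e t -> 0 < E.[t].
 by move=> et; apply: lt_le_trans (EP t et).1; rewrite mulr_gt0 ?invr_gt0 ?wk_gt0.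
exists E; split => //.
- move=> t et; have /andP[w0 _] := wB et.
 apply: (@le_trans _ _ (wk k t * (wk k t)^-1)); last by rewrite divff// gt_eqF// wk_gt0.
 by apply: ler_pM => //; [exact: ltW (Ep t et)|exact: wk_ge|exact: (EP t et).2].
- move=> f fE fint.
 have ci (c1 : R) : intR mu K (fun=> c1) by exact: cst_integrable.
 have gi : intR mu K (fun s => fk k (phi s) - (ln (B + 1) + ln 2)).
  exact: (integrableB mK (fi (@fk_continuous k)) (ci _)).
 apply: (@le_trans _ _ (\int[mu]_(s in K) (fk k (phi s) - (ln (B + 1) + ln 2)))).
  rewrite RintegralB// ?Rint_prob_cst//; last exact: (fi (@fk_continuous k)).
  by move: kT; set I := Rintegral _ _ _; lra.
 apply: le_Rintegral => // s Ks; rewrite fE// /fk; have et := Ke Ks.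
 have := (EP _ et).1; rewrite -ler_ln ?posrE ?mulr_gt0 ?invr_gt0 ?wk_gt0 ?Ep//.
 by rewrite lnM ?posrE ?invr_gt0 ?wk_gt0// !lnV ?posrE ?wk_gt0//; lra.
Qed.
End integral.
End supconv.

(** * The Parreau-Widom sum *)

Lemma coord_line {R} q (t : R) : coord q (t, 0) = (lcoord q t, 0).
Proof.
case: q => [p|] //=; apply: plane_ext; rewrite /= /sqn/= expr0n/= addr0 ?oppr0 ?mul0r//.
have [->|tp] := eqVneq (t - p) 0; first by rewrite mul0r invr0.
by field.
Qed.

Definition upt {R} (q : option R) (y : R) : extline R :=
 if q is Some p then (if y == 0 then None else Some (p + y^-1)) else Some y.

Section PW_sum.
Context {R} (e : set R) (q : option R) (mu : prob R) (V : R).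
Hypotheses (ce : compact e) (qe : pole_out q e) (pK : pot_ok (Kq q e) mu V) (bd : green_bd q e mu V).
Hypothesis hG : green (pline e) (omap (fun t : R => (t, 0)) q : sphere R) = Gq q e mu V.
Let K := Kq q e.
Let G1 (y : R) : R := V + pot K mu (y, 0).
Let cK : compact K := Kq_compact ce qe.

Lemma upt_inj : injective (@upt R q).
Proof.
rewrite /upt; case: (q) => [p|] x y; last by case.
case: eqP => [->|x0]; case: eqP => [->|y0] // [] h.
by apply: invr_inj; apply: (addrI p).
Qed.

Lemma green_line_Some t : off_pole q (t, 0) -> green_line e q (Some t) = G1 (lcoord q t).
Proof.
by move=> tq; rewrite /green_line /sphere_of_extline hG /Gq /= asboolT// coord_line.
Qed.

Lemma green_line_upt y : green_line e q (upt q y) = G1 y.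
Proof.
rewrite /upt; case Eq : q => [p|]; last by rewrite -Eq green_line_Some Eq.
case: eqP => [->|/eqP y0]; first by rewrite -Eq /green_line /sphere_of_extline hG /Gq Eq /G1 /K Eq.
rewrite -Eq green_line_Some Eq /=; first by rewrite addrAC subrr add0r invrK.
by case=> /eqP; rewrite -subr_eq0 addrAC subrr add0r invr_eq0 (negbTE y0).
Qed.

(** V + pot K mu is also [Gq None K mu V], with [K] in the role of [e] and pole at infinity, so the
    smoothness proved for every pole applies in the s-plane. *)
Lemma G1_off_K y : ~ K y -> continuous_at y G1 /\ derivable G1 y 1.
Proof.
move=> nK; pose h z := V + pot K mu z.
have pK' : pot_ok (Kq None K) mu V by rewrite Kq_None.
have hE : (fun z => Gq None K mu V (Some z)) = h.
 by apply/funext => z; rewrite /Gq asboolT// Kq_None.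
have nz : ~ pline K (y, 0) by move=> [t Kt [ty]]; apply: nK; rewrite -ty.
have H := Gq_harmonic1 cK (I : pole_out None K) pK'; rewrite hE in H.
have [hc _] := @green_continuous1 _ K None _ (y, 0) cK I (Gq_harmonic1 cK (I : pole_out None K) pK') nz I.
rewrite hE in hc; split.
 apply: (@continuous_comp _ _ _ (fun t : R => (t, 0) : plane R) h); last exact: hc.
 by apply: continuous_for_pair; [exact: cvg_id|exact: cvg_cst].
have yz : (sphere_compl (pline K) `\ (None : sphere R)) (Some (y, 0)).
 by split=> //; move=> [z0 z0K [zE]]; apply: nz; rewrite -zE.
have [dh _ _] := H.1 (y, 0) yz (1, 0) (1, 0).
have E (t : R) : (0, 0) + t *: (1, 0) = (t, 0) :> plane R.
 by apply: plane_ext; rewrite /= add0r /GRing.scale/= ?mulr1 ?mulr0.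
have := @line_derive R h (0, 0) (1, 0) y; rewrite E => /(_ dh).
rewrite (_ : (fun t : R => h ((0, 0) + t *: (1, 0))) = G1); first by case.
by apply/funext => t; rewrite E.
Qed.

Lemma G1_ge0 y : 0 <= G1 y.
Proof. by have [_ _ _ /(_ (y, 0))] := pK; rewrite /G1 /K; lra. Qed.

Lemma G1_zero y : K y -> G1 y = 0.
Proof. by move=> [t et <-]; exact: pot_zero. Qed.

Lemma ilcoord_continuous y : K y -> {for y, continuous (ilcoord q)}.
Proof.
rewrite /K /ilcoord; case: (q) qe => [p|] qe' Ky; last exact: cvg_id.
apply: cvgD; first exact: cvg_cst.
by apply: cvgV; [exact: (lcoord_neq0 qe' Ky)|exact: cvg_id].
Qed.

Lemma G1_continuous : continuous G1.
Proof.
move=> y; have [Ky|nK] := pselect (K y); last exact: (G1_off_K nK).1.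
apply/cvgrPdist_lt => eps eps0; rewrite (G1_zero Ky).
have [t et ty] := Ky.
have n1 := bd et eps0.
have c : {for y, continuous (fun s => (ilcoord q s, 0) : plane R)}.
 by apply: continuous_for_pair; [exact: ilcoord_continuous|exact: cvg_cst].
have n2 : \forall s \near y, ~ pline e (ilcoord q s, 0) ->
  V + pot (Kq q e) mu (coord q (ilcoord q s, 0)) < eps.
 have c' : (fun s => (ilcoord q s, 0) : plane R) @ y --> ((t, 0) : plane R).
  have iy : ilcoord q y = t by rewrite -ty lcoordK.
  by have := c; rewrite /prop_for /continuous_at iy.
 exact: (c' _ n1).
have n3 : \forall s \near y, s != 0 \/ q = None.
 case Eq : q => [p|]; last by apply: filterS (@filterT _ (nbhs y) _) => s _; right.
 have y0 : y != 0 by move: Ky qe; rewrite /K Eq => Ky qe'; exact: (lcoord_neq0 qe' Ky).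
 have py : 0 < `|y| by rewrite normr_gt0.
 have /cvgrPdist_lt/(_ _ py) := (@cvg_id _ (nbhs y)); apply: filterS => s; rewrite -/(is_true _) => h.
 by left; apply: contraTneq h => ->; rewrite subr0 ltxx.
apply: filterS2 n2 n3 => s h s0; rewrite sub0r normrN ger0_norm ?G1_ge0//.
have [Ks|nKs] := pselect (K s); first by rewrite G1_zero.
have sE : lcoord q (ilcoord q s) = s.
 by move: s0; rewrite /lcoord /ilcoord; case: (q) => [p|] // _; rewrite addrAC subrr add0r invrK.
have := h _; rewrite coord_line sE; apply.
by move=> [u eu [us]]; apply: nKs; rewrite -sE; exists u => //; rewrite us.
Qed.

(** The maximum is taken over all of [a, b], not over the gap of y: it is positive, hence off [K]
    and critical, and critical points from successive intervals are distinct without any description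
    of the gaps. *)
Lemma gap_max a y b : K a -> K b -> a < y < b -> 0 < G1 y ->
 exists c, [/\ a < c < b, G1 y <= G1 c, ~ K c & is_derive c 1 G1 0].
Proof.
move=> Ka Kb /andP[ay yb] Gy; have ab : a <= b by apply: ltW; exact: lt_trans yb.
have [c cab cmax] := EVT_max ab (continuous_subspaceT G1_continuous).
have yc : G1 y <= G1 c by apply: cmax; rewrite in_itv/= !ltW.
have nKc : ~ K c by move=> Kc; move: yc; rewrite (G1_zero Kc) leNgt Gy.
have [ac cb] : a < c /\ c < b.
 move: cab; rewrite in_itv/= !le_eqVlt => /andP[/orP[/eqP ac|ac] /orP[/eqP cb|cb]] //.
 - by case: nKc; rewrite -ac.
 - by case: nKc; rewrite -ac.
 - by case: nKc; rewrite cb.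
exists c; split => //; first by rewrite ac.
have oK : open (~` K) by apply: closed_openC; exact: compact_closed.
have [r /= r0 Hr] := (nbhs_ballP _ _).1 (open_nbhs_nbhs (conj oK nKc)).
pose d := Num.min r (Num.min (c - a) (b - c)).
have d0 : 0 < d by rewrite !lt_min r0 !subr_gt0 ac.
have [dr da db] : [/\ d <= r, d <= c - a & d <= b - c] by rewrite /d !ge_min !lexx !orbT.
apply: (@derive1_at_max R G1 (c - d) (c + d) c).
- by lra.
- move=> t; rewrite in_itv/= => /andP[t1 t2]; apply: (G1_off_K _).2; apply: Hr.
 by rewrite /ball/= ltr_norml; apply/andP; split; lra.
- by rewrite in_itv/=; apply/andP; split; lra.
- by move=> t; rewrite in_itv/= => /andP[t1 t2]; apply: cmax; rewrite in_itv/=; apply/andP; split; lra.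
Qed.

Lemma derive0_small : is_derive (0 : R) 1 G1 0 -> forall eps : R, 0 < eps -> exists2 d : R, 0 < d &
 forall h, `|h| < d -> `|G1 h - G1 0| <= eps * `|h|.
Proof.
move=> [dG vG] eps e0.
have c : (fun h : R => h^-1 *: (G1 (h *: 1 + 0) - G1 0)) @ (0 : R)^' --> (0 : R).
 by rewrite -[X in _ --> X]vG; exact: dG.
have /cvgrPdist_le/(_ _ e0) := c; rewrite near_withinE => H.
have [d /= d0 Hd] := (nbhs_ballP _ _).1 H.
exists d => // h hd; have [->|h0] := eqVneq h 0; first by rewrite subrr !normr0 mulr0.
have := Hd h; rewrite /ball/= !sub0r !normrN => /(_ hd h0).
rewrite /GRing.scale/= mulr1 addr0 normrM normfV.
by rewrite mulrC ler_pdivrMr// normr_gt0.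
Qed.

(** Away from s = 0 this is the chain rule. The point s = 0 is t = oo, where t (g(t) - g(oo))
    behaves like the difference quotient of [G1] at 0, since s = 1 / (t - p). *)
Lemma upt_critical c : ~ K c -> is_derive c 1 G1 0 -> critical_point e q (upt q c).
Proof.
move=> nKc dc; rewrite /upt; case Eq : q => [p|] /=; last first.
 rewrite -Eq (_ : (fun t => _) = G1)//; apply/funext => t.
 by rewrite green_line_Some Eq.
have pt t : t != p -> green_line e q (Some t) = G1 ((t - p)^-1).
 by move=> tp; rewrite green_line_Some Eq//= => -[/eqP]; rewrite (negbTE tp).
case: eqP => [c0|/eqP c0] /=; last first.
 have z0 : p + c^-1 - p != 0 by rewrite addrAC subrr add0r invr_eq0.
 rewrite -Eq; apply: (@near_eq_is_derive _ _ _ (G1 \o (fun t => (t - p)^-1))).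
  have cs : {for p + c^-1, continuous (fun t : R => t - p)} by apply: cvgB; [exact: cvg_id|exact: cvg_cst].
  have pz : 0 < `|p + c^-1 - p| by rewrite normr_gt0.
  have /cvgrPdist_lt/(_ _ pz) := cs; apply: filterS => t h.
  rewrite /= pt//; apply: contraTneq h => ->; by rewrite subrr subr0 ltxx.
 have d1 : is_derive (p + c^-1) 1 (fun t : R => t - p) (1 - 0).
  exact: is_deriveB.
 have d2 := @is_deriveV R (fun t : R => t - p) (p + c^-1) (1 - 0) 1 z0 d1.
 have gE : (p + c^-1 - p)^-1 = c by rewrite addrAC subrr add0r invrK.
 have d3 : is_derive ((fun t : R => (t - p)^-1) (p + c^-1)) 1 G1 0 by rewrite gE.
 by have := @is_derive1_comp R G1 (fun t : R => (t - p)^-1) (p + c^-1) 0 _ d3 d2; rewrite mul0r.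
rewrite c0 in dc; have small := derive0_small dc.
have g0 : green_line e (Some p) None = G1 0.
 by rewrite -(green_line_upt 0) /upt Eq eqxx.
have key (eps : R) : 0 < eps -> exists2 M : R, 0 < M & forall t, M < `|t| ->
  `|t * (green_line e (Some p) (Some t) - green_line e (Some p) None)| <= eps.
 move=> e0; have e2 : 0 < eps / 2 by rewrite divr_gt0.
 have [d d0 Hd] := small _ e2; have di : 0 < d^-1 by rewrite invr_gt0.
 exists (2 * `|p| + d^-1 + 1); first by have := normr_ge0 p; lra.
 move=> t tM; have p0 := normr_ge0 p.
 have tp1 : `|t| <= `|t - p| + `|p| by rewrite -{1}(subrK p t) ler_normD.
 have tp0 : 0 < `|t - p| by lra.
 have tp : t != p by rewrite -subr_eq0 -normr_gt0.
 have := pt t tp; rewrite Eq => ->; rewrite g0.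
 have sd : `|(t - p)^-1| < d by rewrite normfV -[ltRHS]invrK ltf_pV2 ?posrE//; lra.
 rewrite normrM; apply: le_trans (ler_wpM2l (normr_ge0 t) (Hd _ sd)) _.
 rewrite normfV mulrA ler_pdivrMr//.
 have : `|t| <= 2 * `|t - p| by lra.
 by move=> h; have := ler_wpM2l (ltW e2) h; lra.
split; apply/cvgrPdist_le => eps e0; have [M M0 HM] := key eps e0.
- have n : \forall t \near +oo, M < t by apply: nbhs_pinfty_gt; exact: num_real.
 apply: filterS n => t Mt; rewrite sub0r normrN; apply: HM.
 by apply: lt_le_trans Mt _; exact: ler_norm.
- have n : \forall t \near -oo, t < - M by apply: nbhs_ninfty_lt; exact: num_real.
 apply: filterS n => t Mt; rewrite sub0r normrN; apply: HM.
 by rewrite -normrN; apply: lt_le_trans (ler_norm _); lra.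
Qed.

(** Indices with G1 (y i) = 0 contribute nothing; the others yield distinct critical points with at
    least the same value, so the total is at most a finite subsum of [PW]. *)
Lemma PW_bound (n : nat) z y : (PW e q < +oo)%E ->
 (forall i, (i <= n)%N -> K (z i)) -> (forall i, (i < n)%N -> z i < y i < z i.+1) ->
 \sum_(i < n) (V + pot K mu (y i, 0)) <= fine (PW e q).
Proof.
move=> PWf zK zy.
have PW0 : (0 <= PW e q)%E.
 apply: esum_ge0 => x _; rewrite lee_fin /green_line hG; exact: Gq_ge0.
rewrite -lee_fin fineK; last by rewrite ge0_fin_numE.
have /choice [c Hc] : forall i, exists c, (i < n)%N -> 0 < G1 (y i) ->
  [/\ z i < c < z i.+1, G1 (y i) <= G1 c, ~ K c & is_derive c 1 G1 0].
 move=> i; have [iN|iN] := ltnP i n; last by exists 0.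
 have [Gp|Gp] := ltP 0 (G1 (y i)); last by exists 0.
 by have [c Pc] := gap_max (zK i (ltnW iN)) (zK i.+1 iN) (zy i iN) Gp; exists c.
pose s := [seq i <- iota 0 n | 0 < G1 (y i)].
have sP i : i \in s -> [/\ (i < n)%N, z i < c i < z i.+1, G1 (y i) <= G1 (c i), ~ K (c i) & is_derive (c i) 1 G1 0].
 rewrite mem_filter mem_iota add0n => /andP[Gp /= iN].
 by have [] := Hc i iN Gp.
have zle i j : (i <= j)%N -> (j <= n)%N -> z i <= z j.
 elim: j => [|j IH]; first by rewrite leqn0 => /eqP ->.
 rewrite leq_eqVlt => /orP[/eqP ->//|ij] jn.
 apply: (le_trans (IH ij (ltnW jn))); have /andP[h1 h2] := zy j jn; exact: ltW (lt_trans h1 h2).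
have clt i j : i \in s -> j \in s -> (i < j)%N -> c i < c j.
 move=> /sP [iN /andP[_ h1] _ _ _] /sP [jN /andP[h2 _] _ _ _] ij.
 by apply: lt_le_trans h1 _; apply: le_trans (zle _ _ ij (ltnW jN)) (ltW h2).
pose r : seq (extline R) := [seq upt q (c i) | i <- s].
have ur : uniq r.
 rewrite map_inj_in_uniq ?filter_uniq ?iota_uniq// => i j si sj /upt_inj cij.
 apply/eqP; rewrite eqn_leq; apply/andP; split; rewrite leqNgt; apply/negP => h.
  by have := clt j i sj si h; rewrite cij ltxx.
 by have := clt i j si sj h; rewrite cij ltxx.
have le1 : ((\sum_(i < n) (V + pot K mu (y i, 0)))%:E <= \sum_(x <- r) (green_line e q x)%:E)%E.
 rewrite sumEFin lee_fin big_map (eq_bigr (fun i => G1 (c i))); last by move=> i _; rewrite green_line_upt.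
 rewrite -(big_mkord xpredT (fun i => V + pot K mu (y i, 0))) /index_iota subn0.
 rewrite (bigID (fun i => 0 < G1 (y i)))/= [X in _ + X]big1 ?addr0; last first.
  by move=> i; rewrite -leNgt => h; apply/eqP; rewrite eq_le h G1_ge0.
 rewrite -big_filter -/s big_seq [leRHS]big_seq; apply: ler_sum => i /sP[]//.
apply: le_trans le1 _; have E := @fsbig_seq _ _ _ (extline R) r (fun x => (green_line e q x)%:E) ur.
rewrite E; apply: ereal_sup_ubound.
exists [set` r] => //; split; first exact: finite_seq.
move=> x /= /mapP[i /sP [iN _ _ nK dc] ->]; split; last split.
- exists (connected_component (extline_compl e) (upt q (c i))); last first.
  apply: connected_component_refl.
  move=> [t et]; rewrite /upt; move: nK; rewrite /K; case: (q) => [p|] nK.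
   case: eqP => // _ [tE]; apply: nK; exists t => //=; rewrite tE addrAC subrr add0r invrK//.
  by move=> [tE]; apply: nK; exists t.
 exists (upt q (c i)) => //.
 move=> [t et]; rewrite /upt; move: nK; rewrite /K; case: (q) => [p|] nK.
  case: eqP => // _ [tE]; apply: nK; exists t => //=; rewrite tE addrAC subrr add0r invrK//.
 by move=> [tE]; apply: nK; exists t.
- rewrite /upt; case: (q) => [p|] //; case: eqP => // /eqP c0 [/eqP].
 by rewrite -subr_eq0 addrAC subrr add0r invr_eq0 (negbTE c0).
- exact: upt_critical.
Qed.
End PW_sum.

(** * The lower bound *)

(** The exponential rate of the Widom factors: for q = oo it is V, exp(-V) being the capacity; for
    finite q it is the Green function with pole q at infinity, equal to g(q, oo) by
    [pot_sphere0]. *)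
Definition gpole {R} (q : option R) (K : set R) (mu : prob R) (V : R) : R :=
 if q is Some _ then V + pot K mu (0, 0) else V.

Definition nrm {R} (q : option R) (z : plane R) : R := if q is Some p then rho z p else 1.

Section bounds.
Context {R} (e : set R) (q : option R) (mu : prob R) (V : R).
Hypotheses (ce : compact e) (qe : pole_out q e) (pK : pot_ok (Kq q e) mu V).
Let K := Kq q e.
Let mK : measurable K := Kq_measurable ce qe.

(** Off the zeros, the logarithm of the normalized linear factor |z - x| / |z - p| (or |z - x| when
    q = oo) in the coordinate s = lcoord q x. *)
Definition lfac (z : plane R) (s : R) : R := lg (coord q z) s - if q is Some _ then lg (0, 0) s else 0.

Lemma lfac_integral z : intR mu K (lfac z) /\ - gpole q K mu V <= \int[mu]_(s in K) lfac z s.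
Proof.
have [muK _ int ge] := pK.
have ci : intR mu K (fun s => if q is Some _ then lg (0, 0) s else 0).
 case: (q) => [p|]; first exact: int.
 by apply: (bounded_integrable 0) => // t _; rewrite normr0.
split; first exact: (integrableB mK (int _) ci).
have z0 : \int[mu]_(s in Kq q e) (0 : R) = 0 by rewrite (Rint_prob_cst 0 mK muK).
rewrite RintegralB// /gpole; have := ge (coord q z); rewrite /pot /K.
case: (q) z0 => [p|] z0; last by rewrite z0 subr0.
by set I := Rintegral _ _ _; set J := Rintegral _ _ _; lra.
Qed.

Lemma lfac_ln z x : off_pole q z -> e x -> z <> (x, 0) -> expR (lfac z (lcoord q x)) = rho z x / nrm q z.
Proof.
move=> zq ex zx.
have rp t : z <> (t, 0) -> 0 < rho z t.
 by move=> h; rewrite lt_neqAle rho_ge0 andbT eq_sym; apply/eqP => /rho_eq0.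
have rx := rp x zx; have pg := polar_gt0 qe zq ex.
rewrite /lfac lg_rho (rho_coord qe zq ex) ln_div ?posrE//.
case: q qe zq pg => [p|] qe' zq pg /=; last by rewrite ln1 !subr0 lnK ?posrE// divr1.
have xp : 0 < `|x - p| by rewrite normr_gt0 subr_eq0; apply/eqP => h; apply: qe'; rewrite -h.
have rpp := rp p zq.
rewrite lnM ?posrE// lg_real sub0r normrN normfV lnV ?posrE//.
by rewrite (_ : _ - _ - _ = ln (rho z x) - ln (rho z p)); [rewrite -ln_div ?posrE// lnK ?posrE ?divr_gt0|ring].
Qed.

(** The product is the exponential of a sum of [lfac] except at the finitely many s where a factor
    vanishes; these form a null set and are removed. Each [lfac] integrates to at least -[gpole]. *)
Lemma lower_bound w B N r : e !=set0 -> (forall x, e x -> 0 <= w x <= B) -> upper_semicontinuous_on e (EFin \o w) ->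
 (\int[mu]_(s in K) flog w B (ilcoord q s) < +oo)%E -> 0 < N -> (forall z, z \in r -> off_pole q z) ->
 (forall x, e x -> w x * \prod_(z <- r) (rho z x / nrm q z) <= N) ->
 ln (B + 1) - fine (\int[mu]_(s in K) flog w B (ilcoord q s)) - (size r)%:R * gpole q K mu V <= ln N.
Proof.
move=> ne wB wu fin N0 rq rN; have [muK at0 _ _] := pK.
have Ke s : K s -> e (ilcoord q s) by exact: ilcoord_in.
have [Ti TE] := @Rint_sum R (plane R) mu K r lfac mK (fun z => (lfac_integral z).1).
pose T s := \sum_(z <- r) lfac z s.
have [mN N00] := null_seq [seq lcoord q z.1 | z <- r] at0; set Nz := [set t | _] in mN N00.
have mKN : measurable (K `\` Nz) by exact: measurableD.
have KN : K `\` Nz `<=` K by move=> t [].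
have m0 : mu (K `\` (K `\` Nz)) = 0%E.
 apply/eqP; rewrite -measure_le0 -N00; apply: le_measure; rewrite ?inE//; first exact: measurableD.
 by move=> t [Kt] nt; apply: contrapT => ta; apply: nt.
pose c := ln N - ln (B + 1).
have ci (c1 : R) : intR mu K (fun=> c1) by exact: cst_integrable.
have Tci : intR mu K (fun s => T s - c) by exact: (integrableB mK Ti (ci c)).
have I0 : (0 <= \int[mu]_(s in K) flog w B (ilcoord q s))%E.
 by apply: integral_ge0 => s /Ke; exact: (flog_ge0 wB).
have le1 : ((\int[mu]_(s in K) (T s - c))%:E <= \int[mu]_(s in K) flog w B (ilcoord q s))%E.
 rewrite (Rint_restrict mK mKN KN m0 Tci) -Rintegral_EFin//; last exact: (integrableS mK mKN KN Tci).
 apply: (@le_trans _ _ (\int[mu]_(s in K `\` Nz) flog w B (ilcoord q s))%E); last first.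
  apply: ge0_subset_integral => //.
   by apply: (@flog_measurable R e w B) => //; exact: measurable_ilcoord.
  by move=> s /Ke; exact: (flog_ge0 wB).
 apply: le_integral_pointwise => s [Ks sN]; have ex := Ke s Ks.
 have sE := ilcoordK Ks; set x := ilcoord q s in ex sE *.
 have TP : expR (T s) = \prod_(z <- r) (rho z x / nrm q z).
  rewrite /T expR_sum big_seq [RHS]big_seq; apply: eq_bigr => z zr.
  rewrite -sE lfac_ln//; first exact: rq.
  by move=> zx; apply: sN; apply/mapP; exists z => //; rewrite zx /= sE.
 have := rN x ex; rewrite -TP => wN; rewrite /flog /c.
 have /andP[w0 _] := wB x ex.
 have [w0'|w0'] := leP (w x) 0; first by rewrite le0_lneNy ?leey// lee_fin.
 rewrite lne_EFin// -EFinB lee_fin.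
 have : ln (w x * expR (T s)) <= ln N by rewrite ler_ln ?posrE// mulr_gt0// expR_gt0.
 by rewrite lnM ?posrE ?expR_gt0// expRK; lra.
have le2 : \int[mu]_(s in K) (T s - c) <= fine (\int[mu]_(s in K) flog w B (ilcoord q s)).
 have ff : (\int[mu]_(s in K) flog w B (ilcoord q s))%E \is a fin_num by rewrite ge0_fin_numE.
 by rewrite -lee_fin (fineK ff); exact: le1.
rewrite RintegralB// Rint_prob_cst// -TE in le2.
have le3 : - ((size r)%:R * gpole q K mu V) <= \sum_(z <- r) \int[mu]_(s in K) lfac z s.
 rewrite -mulrN mulr_natl -(count_predT r) -iter_addr_0 -big_const_seq.
 by apply: ler_sum => z _; exact: (lfac_integral z).2.
by move: le2; rewrite /c; lra.
Qed.
End bounds.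

(** * The upper bound *)

Section homogenization.
Context {R}.
Implicit Types (E a b : {poly R}).

(** Translates polynomials between t and s: b^n E(a / b) where b is nonzero and E has degree at most
    n, and the coefficient of degree n times a^n where b vanishes. *)
Definition hom (n : nat) E a b : {poly R} := \sum_(i < n.+1) E`_i *: (a ^+ i * b ^+ (n - i)).

Lemma hom_size n E a b : (size a <= 2)%N -> (size b <= 2)%N -> (size (hom n E a b) <= n.+1)%N.
Proof.
move=> sa sb; apply: (leq_trans (size_sum _ _ _)); apply/bigmax_leqP => i _.
apply: (leq_trans (size_scale_leq _ _)); apply: (leq_trans (size_mul_leq _ _)).
have pw (p : {poly R}) k : (size p <= 2)%N -> (size (p ^+ k) <= k.+1)%N.
 move=> sp; apply: (leq_trans (size_exp_leq _ _)); rewrite ltnS -[leqRHS]mul1n leq_mul2r.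
 by case: (size p) sp => [|[|[|]]] //=; rewrite orbT.
have h1 := pw a i sa; have h2 := pw b (n - i)%N sb; have iN : (i <= n)%N by rewrite -ltnS.
by move: h1 h2 iN; set u := size _; set v := size _; lia.
Qed.

Lemma hom_horner n E a b y : (size E <= n.+1)%N -> b.[y] != 0 -> (hom n E a b).[y] = b.[y] ^+ n * E.[a.[y] / b.[y]].
Proof.
move=> sE b0; rewrite (horner_coef_wide _ sE) mulr_sumr horner_sum; apply: eq_bigr => i _.
have iN : (i <= n)%N by rewrite -ltnS.
rewrite hornerZ hornerM !horner_exp expr_div_n.
have -> : b.[y] ^+ n = b.[y] ^+ (n - i) * b.[y] ^+ i by rewrite -exprD subnK.
by field; rewrite expf_neq0.
Qed.

Lemma hom_horner0 n E a b y : b.[y] = 0 -> (hom n E a b).[y] = E`_n * a.[y] ^+ n.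
Proof.
move=> b0; rewrite horner_sum big_ord_recr /= big1 ?add0r.
 by rewrite subnn expr0 mulr1 hornerZ horner_exp.
move=> i _; rewrite hornerZ hornerM !horner_exp b0 expr0n subn_eq0 leqNgt ltn_ord /=.
by rewrite mulr0 mulr0.
Qed.
End homogenization.

Section upper.
Context {R} (e : set R) (q : option R) (mu : prob R) (V : R) (w : R -> R).
Hypotheses (ce : compact e) (ie : infinite_set e) (qe : pole_out q e).
Hypotheses (pK : pot_ok (Kq q e) mu V) (bd : green_bd q e mu V).
Hypothesis hG : green (pline e) (omap (fun t : R => (t, 0)) q : sphere R) = Gq q e mu V.
Hypothesis hPW : (PW e q < +oo)%E.
Hypothesis w0 : forall x, e x -> 0 <= w x.
Let K := Kq q e.
Let cK : compact K := Kq_compact ce qe.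
Let mK : measurable K := Kq_measurable ce qe.

(** For a finite pole p an extremal Q of degree n in s is turned into (x - p)^n Q(1 / (x - p)),
    whose value at p is the leading coefficient 1 of Q. The minorant E of 1 / w must become a
    polynomial in s as well and stay positive although s may take both signs on [K], whence the
    parity of n. *)
Lemma upper_bound : exists C0 : R, forall E : {poly R}, (forall t, e t -> 0 < E.[t]) ->
 (forall t, e t -> w t * E.[t] <= 1) -> intR mu K (fun s => ln E.[ilcoord q s]) ->
 forall n, (if q is Some _ then (size E < n)%N && ~~ odd n else (size E <= n)%N) -> exists P : {poly R},
  (if q is Some p then (size P <= n.+1)%N /\ P.[p] = 1 else P \is monic /\ size P = n.+1) /\
  forall x, e x -> w x * `|P.[x]| <= expR (C0 - n%:R * gpole q K mu V - \int[mu]_(s in K) ln E.[ilcoord q s]).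
Proof.
have [B0 B00 KB] := compact_bound cK.
pose M := B0 + 1; have KM t : K t -> `|t| < M.
 by move=> /KB; rewrite -ler_norml /M; lra.
have iK : infinite_set K by exact: Kq_infinite.
have [muK at0 int ge] := pK.
pose S0 := fine (PW e q).
have HS n (z y : nat -> R) : (forall i, (i <= n)%N -> K (z i)) ->
  (forall i, (i < n)%N -> z i < y i < z i.+1) -> \sum_(i < n) (V + pot K mu (y i, 0)) <= S0.
 by move=> zK zy; apply: (PW_bound ce qe pK bd hG hPW zK zy).
have ep (c : R) : 2 * expR c = expR (ln 2 + c) by rewrite expRD lnK ?posrE.
case Eq : q => [p|]; last first.
 exists (ln 2 + S0 + V + ln M) => E Ep wE Ei n sE.
 have KE t : Kq None e t -> e t by rewrite Kq_None.
 have qK : K = Kq None e by rewrite /K Eq.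
 have D0 t : K t -> 0 < E.[t] by rewrite qK => /KE; exact: Ep.
 have [P [Pm sP PK]] := extremal_poly cK pK KM D0 sE (@HS n) iK.
 exists P; split => // x ex; have Kx : K x by rewrite qK Kq_None.
 have wx := w0 ex; have := ler_wpM2l wx (PK x Kx); rewrite mulrCA => h; apply: le_trans h _.
 rewrite ep -[leRHS]mulr1; rewrite /gpole qK /=.
 set I := \int[mu]_(s in _) _; apply: ler_pM.
 - exact: expR_ge0.
 - by rewrite mulr_ge0// ltW// Ep.
 - by rewrite ler_expR; lra.
 - exact: wE.
have pe : ~ e p by move: qe; rewrite Eq.
pose lam := pot K mu (0, 0).
have [Be Be0 eB] := compact_bound ce.
pose Bq := Be + `|p| + 1; have Bq0 : 0 < Bq by rewrite /Bq; have := normr_ge0 p; lra.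
have xpB x : e x -> (x - p) ^+ 2 <= Bq ^+ 2.
 move=> ex; rewrite -[leLHS]real_normK ?num_real// lerXn2r ?nnegrE ?(ltW Bq0)//.
 by apply: le_trans (ler_normB _ _) _; rewrite /Bq; have := eB x ex; rewrite -ler_norml; lra.
(* The last two terms come from D below: its factor Bq^-2 costs 2 ln Bq, and the exponent m = n - 2
   in place of n leaves 2 lam. *)
exists (ln 2 + S0 + V + ln M + 2 * ln Bq + 2 * lam) => E Ep wE Ei n /= /andP[sE evn].
rewrite -Eq in Ei *.
have sE0 : (0 < size E)%N.
 have [x Kx] : K !=set0 by apply/set0P; apply/eqP => K0; apply: iK; rewrite K0; exact: finite_set0.
 have ex : e (ilcoord q x) by exact: ilcoord_in.
 by rewrite lt0n size_poly_eq0; apply: contraTneq (Ep _ ex) => ->; rewrite horner0 ltxx.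
have n2 : (2 <= n)%N by apply: leq_trans sE; rewrite ltnS.
have n2' : (n - 2).+2 = n by rewrite -addn2 subnK.
pose m := (n - 2)%N; have evm : ~~ odd m by move: evn; rewrite -n2' /= negbK.
(* D(s) = s^m E(p + 1/s) / Bq^2. The exponent m = n - 2 is even with n and leaves D of degree below
   n; the factor (x - p)^2 that remains in (x - p)^n s^m is at most Bq^2. *)
pose D := (Bq ^- 2) *: hom m E (p *: 'X + 1) 'X.
have sD : (size D <= n)%N.
 apply: (leq_trans (size_scale_leq _ _)); apply: (@leq_trans m.+1); last by rewrite -n2'.
 apply: hom_size; last by rewrite size_polyX.
 apply: (leq_trans (size_polyD _ _)); rewrite geq_max size_poly1 andbT.
 by apply: (leq_trans (size_scale_leq _ _)); rewrite size_polyX.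
have sEm : (size E <= m.+1)%N by rewrite -(leq_add2r 1) !addn1 n2'.
have s0 s : K s -> s != 0 by move=> Ks; apply: (@lcoord_neq0 _ p e) => //; rewrite -Eq.
have DE s : K s -> D.[s] = Bq ^- 2 * s ^+ m * E.[ilcoord q s].
 move=> Ks; have sn := s0 s Ks; rewrite hornerZ hom_horner ?hornerX// -mulrA; congr (_ * (_ * E.[_])).
 by rewrite !hornerE Eq /=; field.
have D0 s : K s -> 0 < D.[s].
 move=> Ks; rewrite DE// mulr_gt0//; last by apply: Ep; exact: ilcoord_in.
 rewrite mulr_gt0//; first by rewrite invr_gt0 exprn_gt0.
 by rewrite exprn_even_gt0// s0 ?orbT.
have [Q [Qm sQ QK]] := extremal_poly cK pK KM D0 sD (@HS n) iK.
have ci (c : R) : intR mu K (fun=> c) by exact: cst_integrable.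
have ID : \int[mu]_(s in K) ln D.[s] = - (2 * ln Bq) + m%:R * lam + \int[mu]_(s in K) ln E.[ilcoord q s].
 have i1 : intR mu K (fun s => m%:R * lg (0, 0) s) by exact: (integrableZl mK m%:R (int _)).
 have i2 : intR mu K (fun s => - (2 * ln Bq) + m%:R * lg (0, 0) s).
  exact: (integrableD mK (ci _) i1).
 transitivity (\int[mu]_(s in K) ((- (2 * ln Bq) + m%:R * lg (0, 0) s) + ln E.[ilcoord q s])); last first.
  have -> := RintegralD mK i2 Ei; have -> := RintegralD mK (ci (- (2 * ln Bq))) i1.
  by rewrite RintegralZl// Rint_prob_cst.
 apply: eq_Rintegral => s /set_mem Ks; have sn := s0 s Ks.
 have sp : 0 < `|s| by rewrite normr_gt0.
 rewrite DE// (_ : s ^+ m = `|s| ^+ m); last by rewrite -normrX ger0_norm// exprn_even_ge0.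
 rewrite lnM ?posrE ?mulr_gt0 ?invr_gt0 ?exprn_gt0//; last by apply: Ep; exact: ilcoord_in.
 rewrite lnM ?posrE ?invr_gt0 ?exprn_gt0// lnV ?posrE ?exprn_gt0// !lnXn// lg_real sub0r normrN.
 by rewrite -!(mulr_natl (ln _)).
exists (hom n Q 1 ('X - p%:P)); split.
 split; first by apply: hom_size; rewrite ?size_XsubC// size_poly1.
 rewrite hom_horner0; last by rewrite !hornerE subrr.
 by rewrite hornerC expr1n mulr1 -(monicP Qm) lead_coefE sQ.
move=> x ex; have xp : x - p != 0 by rewrite subr_eq0; apply/eqP => h; apply: pe; rewrite -h.
pose s := lcoord q x; have Ks : K s by exists x.
have sE' : s = (x - p)^-1 by rewrite /s Eq.
rewrite hom_horner ?sQ//; last by rewrite !hornerE.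
have -> : ((1 : {poly R}).[x] / ('X - p%:P).[x]) = s by rewrite hornerC hornerXsubC sE' mul1r.
rewrite hornerXsubC normrM.
have Es : E.[ilcoord q s] = E.[x] by rewrite /s lcoordK.
have q1 := QK s Ks; rewrite ep DE// Es in q1.
set X0 := expR _ in q1; set Y0 := expR _.
have XY : X0 = Y0.
 rewrite /X0 /Y0 ID /gpole -/lam; congr expR; rewrite -n2' -/m -!natr1 /K Eq /=.
 by ring.
apply: (@le_trans _ _ (w x * (`|(x - p) ^+ n| * (X0 * (Bq ^- 2 * s ^+ m * E.[x]))))).
 by rewrite ler_wpM2l ?w0// ler_wpM2l.
have -> : w x * (`|(x - p) ^+ n| * (X0 * (Bq ^- 2 * s ^+ m * E.[x]))) =
  X0 * ((w x * E.[x]) * ((x - p) ^+ 2 / Bq ^+ 2)).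
 rewrite -n2' -/m ger0_norm; last by rewrite exprn_even_ge0//= negbK.
 rewrite -addn2 exprD sE' exprVn; field.
 by rewrite expf_neq0// gt_eqF.
rewrite XY -[leRHS]mulr1 ler_wpM2l ?expR_ge0//; apply: mulr_ile1.
- by rewrite mulr_ge0 ?w0// ltW// Ep.
- by rewrite divr_ge0 ?sqr_ge0.
- exact: wE.
- by rewrite ler_pdivrMr ?exprn_gt0// mul1r xpB.
Qed.
End upper.

(** * Complex polynomials and the Widom factors *)

Section weighted_norms.
Context {R}.
Implicit Types (e : set R) (w : R -> R) (P : {poly R[i]}).

Lemma cmodulus_map p x : cmodulus (map_poly (real_complex R) p).[(x%:C)%C] = `|p.[x]|.
Proof. by rewrite horner_map /cmodulus /= expr0n/= addr0 sqrtr_sqr. Qed.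

Lemma cmodulus_bounded e P : compact e -> exists C, forall x, e x -> cmodulus P.[(x%:C)%C] <= C.
Proof.
move=> ce; have [M M0 eM] := compact_bound ce.
elim/poly_ind: P => [|P c [C HC]].
 by exists 0 => x _; rewrite horner0 /cmodulus ComplexField.Normc.normc0.
exists (`|C| * M + cmodulus c) => x ex; rewrite !hornerE; apply: le_trans (normcD_le _ _) _.
rewrite lerD2r /cmodulus ComplexField.Normc.normcM; apply: ler_pM; rewrite ?normc_ge0//.
 by apply: le_trans (HC x ex) (ler_norm _).
by rewrite /= expr0n/= addr0 sqrtr_sqr ler_norml eM.
Qed.

Lemma poly_factor P : P != 0 -> exists r : seq (plane R), size r = (size P).-1 /\
 forall x, cmodulus P.[(x%:C)%C] = cmodulus (lead_coef P) * \prod_(z <- r) rho z x.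
Proof.
move=> P0; have [r rE] := closed_field_poly_normal P.
exists [seq ofC z | z <- r]; split.
 by rewrite size_map rE size_scale ?lead_coef_eq0// size_prod_XsubC.
move=> x; rewrite {1}rE hornerZ /cmodulus ComplexField.Normc.normcM horner_prod normc_prod big_map.
congr (_ * _); apply: eq_bigr => z _; rewrite !hornerE -normcN' opprB.
by case: z => a b; rewrite /rho /= subr0.
Qed.

Lemma weighted_norm_ge e w P B x : compact e -> (forall x, e x -> 0 <= w x <= B) -> e x ->
 w x * cmodulus P.[(x%:C)%C] <= weighted_norm e w P.
Proof.
move=> ce wB ex; have [C HC] := cmodulus_bounded P ce.
apply: ub_le_sup; last by exists x.
exists (B * C) => _ [y ey <-]; have /andP[y0 yB] := wB y ey.
by apply: ler_pM => //; [exact: normc_ge0|exact: HC].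
Qed.

Lemma weighted_norm_le e w P b : e !=set0 ->
 (forall x, e x -> w x * cmodulus P.[(x%:C)%C] <= b) -> weighted_norm e w P <= b.
Proof.
move=> [x ex] h; apply: ge_sup; first by exists (w x * cmodulus P.[(x%:C)%C]); exists x.
by move=> _ [y ey <-]; exact: h.
Qed.

Definition admissible (q : option R) (n : nat) : set {poly R[i]} := match q with
 | Some x => [set P : {poly R[i]} | (size P <= n.+1)%N /\ P.[x%:C%C] = 1]
 | None => [set P : {poly R[i]} | P \is monic /\ size P = n.+1] end.

Lemma admissible_nonempty q n : admissible q n !=set0.
Proof.
case: q => [p|]; first by exists 1; rewrite /= size_poly1 hornerC.
by exists ('X^n); rewrite /= monicXn size_polyXn.
Qed.

(* In both cases [P] is a product of the normalized linear factors [rho z x / nrm q z]. *)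
Lemma admissible_factor q n P : admissible q n P -> exists r : seq (plane R),
 [/\ (size r <= n)%N, q = None -> size r = n, forall z, z \in r -> off_pole q z &
 forall x, cmodulus P.[(x%:C)%C] = \prod_(z <- r) (rho z x / nrm q z)].
Proof.
case: q => [p|] /=.
 move=> [sP Pp]; have P0 : P != 0.
  by apply/eqP => h; move: Pp; rewrite h horner0 => /eqP; rewrite eq_sym oner_eq0.
 have [r [sr rE]] := poly_factor P0; exists r.
 have := rE p; rewrite Pp /cmodulus ComplexField.Normc.normc1 => E1.
 have nz z : z \in r -> rho z p != 0.
  move=> zr; apply/eqP => h; move: E1; rewrite (big_rem z)//= h mul0r mulr0 => /eqP.
  by rewrite oner_eq0.
 split => //; first by rewrite sr; move: sP; case: (size P).
  by move=> z /nz; apply: contra_neq_not => ->; rewrite /rho /= subrr expr0n/= addr0 sqrtr0.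
 move=> x; rewrite -[LHS]/(cmodulus P.[(x%:C)%C]) (rE x) big_split/=.
 have -> : \prod_(z <- r) (rho z p)^-1 = ComplexField.Normc.normc (lead_coef P).
  rewrite prodfV; set X := \prod_(z <- r) _ in E1 *.
  have X0 : X != 0 by apply/eqP => h; move: E1; rewrite h mulr0 => /eqP; rewrite oner_eq0.
  by apply: (mulIf X0); rewrite -E1 mulVf.
 exact: mulrC.
move=> [Pm sP]; have P0 := monic_neq0 Pm; have [r [sr rE]] := poly_factor P0; exists r.
split=> //; try by rewrite sr sP.
move=> x; rewrite -[LHS]/(cmodulus P.[(x%:C)%C]) (rE x) (monicP Pm) /cmodulus ComplexField.Normc.normc1 mul1r.
by apply: eq_bigr => z _; rewrite divr1.
Qed.
End weighted_norms.

(** [pole_comparison] concerns continuous nonnegative functions; it is applied to the [fk], which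
    increase to [flog]. *)
Lemma logint_compare {R} e w B q1 q2 mu1 mu2 (V1 V2 : R) : e !=set0 ->
 (forall x, e x -> 0 <= w x <= B) -> upper_semicontinuous_on e (EFin \o w) ->
 compact e -> pole_out q1 e -> pole_out q2 e ->
 pot_ok (Kq q1 e) mu1 V1 -> green_bd q1 e mu1 V1 -> pot_ok (Kq q2 e) mu2 V2 -> green_bd q2 e mu2 V2 ->
 (\int[mu2]_(s in Kq q2 e) flog w B (ilcoord q2 s) < +oo)%E ->
 (\int[mu1]_(s in Kq q1 e) flog w B (ilcoord q1 s) < +oo)%E.
Proof.
move=> ne wB wu ce qe1 qe2 p1 b1 p2 b2 fin.
have [C C0 HC] := pole_comparison ce qe1 qe2 p1 b1 p2 b2.
have mK1 := Kq_measurable ce qe1; have mK2 := Kq_measurable ce qe2.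
have in1 s : Kq q1 e s -> e (ilcoord q1 s) by exact: ilcoord_in.
have in2 s : Kq q2 e s -> e (ilcoord q2 s) by exact: ilcoord_in.
have c1 := @fk_integral_cvg R e w B ne wB wu mu1 _ _ mK1 (measurable_ilcoord q1) in1.
have I20 : (0 <= \int[mu2]_(s in Kq q2 e) flog w B (ilcoord q2 s))%E.
 by apply: integral_ge0 => s /in2; exact: (flog_ge0 wB).
have I2f : (\int[mu2]_(s in Kq q2 e) flog w B (ilcoord q2 s))%E \is a fin_num by rewrite ge0_fin_numE.
set I2 := (\int[mu2]_(s in Kq q2 e) flog w B (ilcoord q2 s))%E in I2f I20 *.
apply: (@le_lt_trans _ _ (C * fine I2)%:E); last by rewrite ltry.
rewrite -(cvg_lim _ c1)//; apply: lime_le; first by apply/cvg_ex; eexists; exact: c1.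
apply: nearW => k.
have fc : continuous (fk e w B k) by exact: (fk_continuous ne wB).
have i1 := ilcoord_integrable mu1 ce qe1 fc; have i2 := ilcoord_integrable mu2 ce qe2 fc.
rewrite Rintegral_EFin// lee_fin; apply: le_trans (HC _ fc (fk_ge0 ne wB k)) _.
have h : (\int[mu2]_(s in Kq q2 e) (fk e w B k (ilcoord q2 s))%:E <= I2)%E.
 exact: (fk_integral_le ne wB wu mu2 in2 k).
have E2 : (\int[mu2]_(s in Kq q2 e) (fk e w B k (ilcoord q2 s))%:E)%E =
  (\int[mu2]_(s in Kq q2 e) fk e w B k (ilcoord q2 s))%:E by exact: (Rintegral_EFin i2 mK2).
by rewrite E2 -(fineK I2f) lee_fin in h; rewrite ler_pM2l.
Qed.

Theorem theorem3p3 (R : realType) (e : set R) (xs : extline R) (w : R -> R)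
    (he : parreau_widom e xs) (hxs : extline_compl e xs) (hw : weight e w) :
  let W : set (\bar R) :=
    [set (widom_factor e w xs n)%:E | n in [set n : nat | (1 <= n)%N]] in
  let a : Prop := (0 < ereal_inf W)%E in
  let b : Prop :=
    (-oo < \int[equilibrium_measure e]_(x in e) lne (w x)%:E)%E in
  (a <-> b) /\ (a \/ b -> (ereal_sup W < +oo)%E).
Proof.
move=> W a b; have [ce re hPW] := he; have [wu w0 wi] := hw.
have ie : infinite_set e by move=> h; apply: wi; apply: (sub_finite_set _ h) => x [].
have ne : e !=set0.
 by apply/set0P; apply/eqP => e0; apply: ie; rewrite e0; exact: finite_set0.
have [B wB] : exists B, forall x, e x -> 0 <= w x <= B.
 have [|pm epm wmax] := @compact_usc_max _ R R e w ce ne.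
  move=> p p' ep ep' lt; have lt' : ((EFin \o w) p < (w p')%:E)%E by rewrite /= lte_fin.
  have := wu p ep (w p') lt'; rewrite near_withinE => H.
  by apply: filterS H => z hz ez; have := hz ez; rewrite /= lte_fin.
 by exists (w pm) => x ex; rewrite w0//= wmax.
have B0 : 0 <= B by exact: (B_ge0 ne wB).
have qe : pole_out xs e by move: hxs; case: (xs) => [p|] //= h ep; apply: h; exists p.
have [V0 [p0 RV bd0]] := equilibrium_package ce ie re.
set rho0 := equilibrium_measure e in p0 bd0.
(* For xs = oo the equilibrium measure and V0 themselves are taken, so that V is the Robin constant
   in [capacity]. *)
have [mu [V [pq bdq eqq]]] : exists (mu : prob R) (V : R), [/\ pot_ok (Kq xs e) mu V,
  green_bd xs e mu V & xs = None -> mu = rho0 /\ V = V0].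
 case: (xs) qe => [p|] qe'; last by exists rho0, V0.
 have [mu [V [X [F [_ pm _ _ [_ _ _ _ bm]]]]]] := @regular_package _ e (Some p) ce ie re qe'.
 by exists mu, V.
have hG : green (pline e) (omap (fun t : R => (t, 0)) xs : sphere R) = Gq xs e mu V.
 exact: (green_unique ce qe pq bdq p0 bd0).
have hG0 := @green_unique _ e None rho0 rho0 V0 V0 ce I p0 bd0 p0 bd0.
pose gp := gpole xs (Kq xs e) mu V.
pose A n := [set weighted_norm e w P | P in admissible xs n].
(* Both definitions of the Widom factor take one form: for xs = oo, capacity^-n is exp(n V); for
   finite xs, g(xs, oo) is replaced by the Green function with pole xs at infinity, by symmetry. *)
have WE n : widom_factor e w xs n = expR (n%:R * gp) * inf (A n).
 rewrite /widom_factor /A /gp /gpole.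
 case Ex : xs => [p|] /=; last first.
  congr (_ * _); have [_ ->] := eqq Ex.
  by rewrite /capacity RV -EFinN /= expRM_natl -exprVn -expRN opprK.
 congr (expR (_ * _) * _); rewrite /green_line /sphere_of_extline /= hG0 /Gq asboolT//=.
 have pe : ~ e p by move: qe; rewrite Ex.
 have pq' := pq; have bdq' := bdq; rewrite Ex in pq' bdq'.
 by rewrite (pot_sphere0 ce pe pq' bdq' p0 bd0).
have wn0 P : 0 <= weighted_norm e w P.
 have [x ex] := ne; apply: le_trans (weighted_norm_ge P ce wB ex).
 by rewrite mulr_ge0 ?w0// normc_ge0.
have An n : A n !=set0 by have [P HP] := admissible_nonempty xs n; exists (weighted_norm e w P), P.
have Alb n : has_lbound (A n) by exists 0 => _ [P _ <-].
have Ale n P : admissible xs n P -> inf (A n) <= weighted_norm e w P.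
 by move=> HP; apply: ge_inf => //; exists P.
have Kin s : Kq xs e s -> e (ilcoord xs s) by exact: ilcoord_in.
have lnEi (E : {poly R}) : (forall t, e t -> 0 < E.[t]) -> intR mu (Kq xs e) (fun s => ln E.[ilcoord xs s]).
 move=> Ep; apply: continuous_on_integrable; first exact: Kq_compact.
 move=> s Ks; apply: (@continuous_comp _ _ _ (ilcoord xs) (fun t => ln E.[t])).
  exact: (ilcoord_continuous qe Ks).
 apply: (@continuous_comp _ _ _ (horner E) (@ln R)); first exact: poly_continuous.
 by apply: continuous_ln; apply: Ep; exact: Kin.
have [C0 HC] := upper_bound ce ie qe pq bdq hG hPW w0.
have U (E : {poly R}) n : (forall t, e t -> 0 < E.[t]) -> (forall t, e t -> w t * E.[t] <= 1) ->
  (if xs is Some _ then (size E < n)%N && ~~ odd n else (size E <= n)%N) ->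
  widom_factor e w xs n <= expR (C0 - \int[mu]_(s in Kq xs e) ln E.[ilcoord xs s]).
 move=> Ep wE cn; have [P [HP PE]] := HC E Ep wE (lnEi E Ep) n cn.
 have adm : admissible xs n (map_poly (real_complex R) P).
  move: HP; rewrite /admissible; case: (xs) => [p|] /= [h1 h2].
   by rewrite size_map_poly horner_map h2.
  by rewrite map_monic size_map_poly.
 have h : weighted_norm e w (map_poly (real_complex R) P) <=
   expR (C0 - n%:R * gp - \int[mu]_(s in Kq xs e) ln E.[ilcoord xs s]).
  by apply: weighted_norm_le => // x ex; rewrite cmodulus_map; exact: PE.
 rewrite WE; apply: le_trans (ler_wpM2l (expR_ge0 _) (le_trans (Ale n _ adm) h)) _.
 by rewrite -expRD ler_expR; lra.
have L n : (\int[mu]_(s in Kq xs e) flog w B (ilcoord xs s) < +oo)%E ->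
  expR (ln (B + 1) - fine (\int[mu]_(s in Kq xs e) flog w B (ilcoord xs s))) <= widom_factor e w xs n.
 move=> fin; set I := fine _; rewrite WE -ler_pdivrMl ?expR_gt0// -expRN -expRD.
 apply: lb_le_inf => // _ [P HP <-].
 have [r [sr srn rq rP]] := admissible_factor HP.
 (* The added eps keeps the norm positive, since its logarithm is about to be taken. *)
 apply/ler_addgt0Pr => eps eps0; have N0 : 0 < weighted_norm e w P + eps by have := wn0 P; lra.
 have := @lower_bound R e xs mu V ce qe pq w B (weighted_norm e w P + eps) r ne wB wu fin N0 rq.
 move=> H; rewrite -[leRHS]lnK ?posrE// ler_expR.
 apply: (@le_trans _ _ (ln (B + 1) - I - (size r)%:R * gp)).
  (* For a finite pole P may have degree below n, and gp >= 0; for xs = oo the sign of gp is not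
     known, but there the degree is exactly n. *)
  suff : (size r)%:R * gp <= n%:R * gp by lra.
  have [Ex|Ex] := eqVneq xs None; first by rewrite (srn Ex).
  have gp0 : 0 <= gp.
   rewrite /gp /gpole; case: (xs) Ex pq => [p|] // _ [_ _ _ /(_ (0, 0))]; lra.
  by rewrite ler_wpM2r// ler_nat.
 apply: H => x ex; rewrite -rP; apply: le_trans (weighted_norm_ge P ce wB ex) _.
 by rewrite lerDl ltW.
have bE : b <-> (\int[mu]_(s in Kq xs e) flog w B (ilcoord xs s) < +oo)%E.
 have mK0 : measurable (Kq None e) by exact: (Kq_measurable ce (I : pole_out None e)).
 have in0 s : Kq None e s -> e (ilcoord None s) by exact: ilcoord_in.
 have [m0 _ _ _] := p0.
 have lf := lne_flog ne wB wu mK0 (measurable_ilcoord None) in0 m0.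
 have bE0 : b <-> (\int[rho0]_(s in Kq None e) flog w B (ilcoord None s) < +oo)%E.
  by rewrite -lf Kq_None.
 rewrite bE0; split=> fin.
  exact: (logint_compare ne wB wu ce qe (I : pole_out None e) pq bdq p0 bd0 fin).
 exact: (logint_compare ne wB wu ce (I : pole_out None e) qe p0 bd0 pq bdq fin).
split; last first.
 move=> _.
 (* A constant minorant of 1 / w: the resulting bound does not depend on n. *)
 pose E : {poly R} := ((B + 1)^-1)%:P.
 have Bp : 0 < B + 1 by lra.
 have Ep t : e t -> 0 < E.[t] by rewrite hornerC invr_gt0.
 have wE t : e t -> w t * E.[t] <= 1.
  by move=> et; rewrite hornerC ler_pdivrMr// mul1r; have /andP[_] := wB t et; lra.
 have sE : size E = 1%N by rewrite size_polyC invr_neq0// gt_eqF.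
 set C1 := expR (C0 - \int[mu]_(s in Kq xs e) ln E.[ilcoord xs s]).
 have C10 : 0 <= C1 by exact: expR_ge0.
 have UC n : (if xs is Some _ then (1 < n)%N && ~~ odd n else (1 <= n)%N) -> widom_factor e w xs n <= C1.
  by rewrite -sE; exact: U.
 have g0 : 0 < expR gp by exact: expR_gt0.
 have bnd n : (1 <= n)%N -> widom_factor e w xs n <= C1 + expR gp * (C1 + B).
  move=> n1; have q0 : 0 <= expR gp * (C1 + B) by rewrite mulr_ge0 ?addr_ge0 ?(ltW g0).
  case Ex : xs => [p|]; last first.
   rewrite -Ex; apply: (@le_trans _ _ C1); last by rewrite lerDl.
   by apply: UC; rewrite Ex.
  (* For a finite pole [U] covers even n only. The admissible polynomials increase with n, so an odd
     n = m + 1 costs one factor exp(gp); m = 0 is handled by the constant polynomial 1. *)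
  rewrite -Ex; have [on|en] := boolP (odd n); last first.
   apply: (@le_trans _ _ C1); last by rewrite lerDl.
   by apply: UC; rewrite Ex en andbT; case: n n1 en => [|[|n]].
  case: n on n1 => // m om _.
  have sub : inf (A m.+1) <= inf (A m).
   apply: lb_le_inf => // _ [P HP <-]; apply: Ale.
   by move: HP; rewrite /admissible Ex /= => -[h1 h2]; split => //; exact: leqW.
  have step : widom_factor e w xs m.+1 <= expR gp * widom_factor e w xs m.
   rewrite !WE -natr1 mulrDl mul1r expRD [expR _ * expR _]mulrC -mulrA.
   by rewrite !ler_wpM2l ?expR_ge0.
  apply: le_trans step _; apply: ler_wpDl => //; rewrite ler_pM2l//.
  have [m0|m0] := posnP m.
   rewrite m0 WE mul0r expR0 mul1r; apply: ler_wpDl => //.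
   have ad1 : admissible xs 0 1 by rewrite /admissible Ex /= size_poly1 hornerC.
   apply: le_trans (Ale 0%N 1 ad1) _; apply: weighted_norm_le => // x ex.
   by rewrite hornerC /cmodulus ComplexField.Normc.normc1 mulr1; have /andP[] := wB x ex.
  apply: ler_wpDr => //; apply: UC; rewrite Ex; move: om m0 => /= om m0.
  by rewrite om andbT; case: m om m0 {sub} => [|[|m]].
 apply: (@le_lt_trans _ _ (C1 + expR gp * (C1 + B))%:E); last by rewrite ltry.
 by apply: ge_ereal_sup => _ [n /= n1 <-]; rewrite lee_fin; exact: bnd.
split=> [ha|/bE fin]; last first.
 apply: (@lt_le_trans _ _ (expR (ln (B + 1) - fine (\int[mu]_(s in Kq xs e) flog w B (ilcoord xs s))))%:E).
  by rewrite lte_fin expR_gt0.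
 by apply: le_ereal_inf_tmp => _ [n _ <-]; rewrite lee_fin; exact: L.
apply/bE; rewrite ltey; apply/eqP => inf.
have lbW n : (1 <= n)%N -> (ereal_inf W <= (widom_factor e w xs n)%:E)%E.
 by move=> n1; apply: ereal_inf_lbound; exists n.
have [d d0 Hd] : exists2 d : R, 0 < d & forall n, (1 <= n)%N -> d <= widom_factor e w xs n.
 move: ha lbW; rewrite /a; case: (ereal_inf W) => [d| |] //.
  by rewrite lte_fin => d0 h; exists d => // n /h; rewrite lee_fin.
 by move=> _ /(_ 1%N erefl); rewrite leye_eq.
have [m1 _ _ _] := pq.
have fi (f : R -> R) : continuous f -> intR mu (Kq xs e) (f \o ilcoord xs).
 exact: (ilcoord_integrable mu ce qe).
have mK : measurable (Kq xs e) by exact: Kq_measurable.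
(* With the integral of ln E at least C0 - ln (d / 2), [U] makes some Widom factor at most d / 2,
   below their lower bound d. *)
have [E [Ep wE ET]] := weight_poly ne wB wu mK (measurable_ilcoord xs) Kin m1 ce fi (C0 - ln (d / 2)) inf.
have TI := ET (fun s => ln E.[ilcoord xs s]) (fun s _ => erefl) (lnEi E Ep).
(* Even and larger than [size E], as [U] requires for a finite pole. *)
pose n := (size E).*2.+2.
have cn : is_true (if xs is Some _ then (size E < n)%N && ~~ odd n else (size E <= n)%N).
 have h1 : (size E < n)%N by rewrite /n ltnS (leq_trans (leq_addr (size E) _))// addnn leqW.
 by case: (xs) => [p|]; [rewrite h1 /n /= negbK odd_double|exact: ltnW].
have := le_trans (Hd n isT) (U E n Ep wE cn); rewrite leNgt => /negP; apply.
apply: (@le_lt_trans _ _ (expR (ln (d / 2)))); first by rewrite ler_expR; lra.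
by rewrite lnK ?posrE; lra.
Qed.
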